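(* Let $\Omega\subset\mathbb{R}^N$ be a smooth bounded domain, $s_1,s_2\in(0,1)$, $1<p_i<N/s_i$ and $p_i^*=\frac{Np_i}{N-s_ip_i}$ for $i=1,2$. Let $\mathbb{R}^+=[0,\infty)$, and let $f_i:\Omega\times\mathbb{R}^+\times\mathbb{R}^+\to\mathbb{R}^+$ and $g_i:\Omega\times\mathbb{R}^+\to\mathbb{R}^+$ ($i=1,2$) be Carathéodory functions satisfying the following conditions. (A1) There exists $F\in C^1(\Omega\times\mathbb{R}^+\times\mathbb{R}^+,\mathbb{R})$ such that $\frac{\partial F}{\partial u}(x,u,v)=f_1(x,u,v)$ and $\frac{\partial F}{\partial v}(x,u,v)=f_2(x,u,v)$ for all $(x,u,v)\in\Omega\times\mathbb{R}^+\times\mathbb{R}^+$. (A2) For $i=1,2$, $g_i\in C(\overline{\Omega}\times\mathbb{R}^+,\mathbb{R}^+)$ and there exist constants $q_i\in(p_i,p_i^* )$ and $C_i>0$ such that $|g_i(x,u)|\le C_i(|u|^{p_i-1}+|u|^{q_i-1})$ for all $(x,u)\in\Omega\times\mathbb{R}^+$. (A3) For $i=1,2$ there exists a constant $\alpha_i>\max\{p_1,p_2\}$ such that $0<\alpha_iG_i(x,u)\le u\,g_i(x,u)$ for all $(x,u)\in\Omega\times(\mathbb{R}^+\setminus\{0\})$, where $G_i(x,u)=\int_0^ug_i(x,\tau)\,d\tau$. (A4) For $i=1,2$, $\limsup_{u\to0}\frac{g_i(x,u)}{|u|^{p_i-2}u}<\lambda_{1,p_i}$ uniformly with respect to $x\in\Omega$.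 (A5) For $i=1,2$, $\frac{g_i(x,u)}{u^{p_i-1}}$ is an increasing function of $u\in\mathbb{R}^+\setminus\{0\}$. (A6) There exist constants $q\in(1,\min\{p_1^*,p_2^*\})$ and $C_3>0$ such that $|f_1(x,u,v)|+|f_2(x,u,v)|\le C_3(|u|^{q-1}+|v|^{q-1}+1)$. (A7) There exist $\beta_i\in(1,\min\{\alpha_1,\alpha_2\})$ for $i=1,2$, $C_4>0$ and $R>0$ such that $uf_1(x,u,v)+vf_2(x,u,v)\le C_4(|u|^{\beta_1}+|v|^{\beta_2})$ whenever $|u|+|v|\ge R$. Assume moreover that, for $i=1,2$, $f_i(x,u,0)=f_i(x,0,v)=0$ for a.e. $x\in\Omega$ and all $u,v\in\mathbb{R}^+$. Then there exists $\Lambda>0$ such that for every $\lambda\in(0,\Lambda)$ the system $$(\mathcal P)\quad\begin{cases} (-\Delta)^{s_1}_{p_1}u=\lambda f_1(x,u,v)+g_1(x,u)&\text{in }\Omega, \\ (-\Delta)^{s_2}_{p_2}v=\lambda f_2(x,u,v)+g_2(x,v)&\text{in }\Omega, \\ u=v=0&\text{in }\mathbb{R}^N\setminus\Omega \end{cases}$$ has at least three non-negative (weak) solutions. Moreover, if for both $i=1$ and $i=2$ the problem $$(\mathcal P')\quad (-\Delta)^{s_i}_{p_i}u=g_i(x,u)\ \text{in }\Omega,\qquad u=0\ \text{in }\mathbb{R}^N\setminus\Omega$$ has a unique positive solution, then for every $\lambda\in(0,\Lambda)$ the system $(\mathcal P)$ has at least three non-negative solutions, one of which is a nontrivial positiv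e solution.
   Context: For $s\in(0,1)$, $p>1$, $N>sp$, let $Q=\mathbb{R}^{2N}\setminus(\Omega^c\times\Omega^c)$ with $\Omega^c=\mathbb{R}^N\setminus\Omega$, and let $X_{0,s,p}(\Omega)$ be the space of measurable $u:\mathbb{R}^N\to\mathbb{R}$ with $u|_\Omega\in L^p(\Omega)$, $u=0$ a.e. in $\mathbb{R}^N\setminus\Omega$ and finite norm $\|u\|_{0,s,p}=\left(\int_Q\frac{|u(x)-u(y)|^p}{|x-y|^{N+sp}}\,dx\,dy\right)^{1/p}$ (the integral may equivalently be taken over $\mathbb{R}^{2N}$). Put $X=X_{0,s_1,p_1}(\Omega)\times X_{0,s_2,p_2}(\Omega)$ with norm $\|(u,v)\|=\|u\|_{0,s_1,p_1}+\|v\|_{0,s_2,p_2}$. $\lambda_{1,p_i}=\inf_{u\in X_{0,s_i,p_i}(\Omega)\setminus\{0\}}\|u\|_{0,s_i,p_i}^{p_i}/|u|_{p_i}^{p_i}$, where $|u|_r$ is the $L^r(\Omega)$ norm. The fractional $p$-Laplacian $(-\Delta)^{s}_{p}$ is understood weakly: for $u,w\in X_{0,s,p}(\Omega)$, $$\langle(-\Delta)^s_pu,w\rangle=\int_{\mathbb{R}^{2N}}\frac{|u(x)-u(y)|^{p-2}(u(x)-u(y))(w(x)-w(y))}{|x-y|^{N+sp}}\,dx\,dy.$$ A non-negative weak solution of $(\mathcal P)$ is $(u,v)\in X$ with $u,v\ge0$ a.e. such that for all $(w,z)\in X$ $$\langle(-\Delta)^{s_1}_{p_1}u,w\rangle+\langle(-\Delta)^{s_2}_{p_2}v,z\rangle=\int_\Omega\big(\lambda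 f_1(x,u,v)+g_1(x,u)\big)w\,dx+\int_\Omega\big(\lambda f_2(x,u,v)+g_2(x,v)\big)z\,dx.$$ Similarly, a weak solution of $(\mathcal P')$ is $u\in X_{0,s_i,p_i}(\Omega)$, $u\ge 0$ a.e., with $\langle(-\Delta)^{s_i}_{p_i}u,w\rangle=\int_\Omega g_i(x,u)w\,dx$ for all $w\in X_{0,s_i,p_i}(\Omega)$. Positive means strictly positive a.e. in $\Omega$ (in both components, for the system). *)

(* Defs.v *)
From HB Require Import structures.
From mathcomp Require Import all_boot all_order all_algebra.
From mathcomp Require Import all_classical all_reals all_analysis.

Set Implicit Arguments.
Unset Strict Implicit.
Unset Printing Implicit Defensive.

Import Order.TTheory GRing.Theory Num.Theory.
Import numFieldNormedType.Exports.

Local Open Scope classical_set_scope.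
Local Open Scope ring_scope.

(* R^n is 'rV[R]_n with the sigma-algebra generated by the coordinates (the
   Borel one, as for n.-tuple R in the library).  Pitfall: the library norm
   `|x| on 'rV[R]_n is the sup norm; enorm below is the Euclidean norm. *)

Definition measure_row_display : measure_display.
Proof. exact: default_measure_display. Qed.

Section measurable_row.
Context {R : realType} (n : nat).

Definition row_coord (i : 'I_n) (x : 'rV[R]_n) : R := x ord0 i.

Let row_set0 : g_sigma_preimage row_coord set0.
Proof. exact: sigma_algebra0. Qed.

Let row_setC A : g_sigma_preimage row_coord A ->
  g_sigma_preimage row_coord (~` A).
Proof. exact: sigma_algebraC. Qed.

Let row_bigcup (F : _^nat) : (forall i, g_sigma_preimage row_coord (F i)) ->
  g_sigma_preimage row_coord (\bigcup_i (F i)).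
Proof. exact: sigma_algebra_bigcup. Qed.

HB.instance Definition _ := @isMeasurable.Build measure_row_display
  'rV[R]_n (g_sigma_preimage row_coord) row_set0 row_setC row_bigcup.

Lemma measurable_row_coord (i : 'I_n) :
  measurable_fun [set: 'rV[R]_n] (row_coord i).
Proof.
move=> _ Y mY; rewrite setTI; apply: sub_sigma_algebra => /=.
rewrite -bigcup_seq/=; exists i => /=; first by rewrite mem_index_enum.
by exists Y => //; rewrite setTI.
Qed.

End measurable_row.

Lemma measurable_fun_row d (T : measurableType d) (R : realType) n
    (f : T -> 'rV[R]_n) :
  (forall i, measurable_fun [set: T] (fun t => f t ord0 i)) ->
  measurable_fun [set: T] f.
Proof.
move=> mf _ Y mY; rewrite setTI.
suff: <<s \big[setU/set0]_(i < n)
    preimage_set_system setT (row_coord i) measurable >>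
    `<=` [set A | measurable (f @^-1` A)] by exact.
apply: smallest_sub.
  split => /=.
  - by rewrite preimage_set0; exact: measurable0.
  - by move=> A mA; rewrite setTD preimage_setC; exact: measurableC.
  - by move=> F mF; rewrite preimage_bigcup; exact: bigcup_measurable.
move=> A; rewrite -bigcup_seq => -[i _ [B mB <-]] /=.
by rewrite setTI -comp_preimage -[_ @^-1` _]setTI; exact: mf.
Qed.

Section lebesgue_step.
Context {R : realType} (n : nat).

Definition row_cons (z : measurableTypeR R * 'rV[R]_n) : 'rV[R]_n.+1 :=
  row_mx (z.1%:M : 'rV[R]_1) z.2.

Lemma measurable_row_cons :
  measurable_fun [set: measurableTypeR R * 'rV[R]_n] row_cons.
Proof.
apply: measurable_fun_row => i.
rewrite /row_cons; case: (@split_ordP 1 n i) => j ->.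
  under eq_fun do rewrite (row_mxEl (_ : 'rV_1)) (ord1 j) mxE eqxx mulr1n.
  exact: measurable_fst.
under eq_fun do rewrite (row_mxEr (_ : 'rV_1)).
by apply: (measurableT_comp (measurable_row_coord j)); exact: measurable_snd.
Qed.

End lebesgue_step.

Section lebesgue_pushforward.
Context {R : realType} (n : nat).
Variable m : {sigma_finite_measure set 'rV[R]_n -> \bar R}.

Definition lebesgue_cons : set 'rV[R]_n.+1 -> \bar R :=
  pushforward (@lebesgue_measure R \x m)%E (@row_cons R n).

Let lebesgue_cons0 : lebesgue_cons set0 = 0%E.
Proof. by rewrite /lebesgue_cons /pushforward preimage_set0 measure0. Qed.

Let lebesgue_cons_ge0 A : (0 <= lebesgue_cons A)%E.
Proof. by rewrite /lebesgue_cons /pushforward; exact: measure_ge0. Qed.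

Let lebesgue_cons_sigma_additive : semi_sigma_additive lebesgue_cons.
Proof.
move=> F mF tF mUF; rewrite /lebesgue_cons /pushforward preimage_bigcup.
apply: measure_semi_sigma_additive.
- by move=> k; rewrite -[X in measurable X]setTI; exact: measurable_row_cons.
- apply/trivIsetP => /= i j _ _ ij; rewrite -preimage_setI.
  by move/trivIsetP : tF => /(_ _ _ _ _ ij) ->//; rewrite preimage_set0.
- rewrite -preimage_bigcup -[X in measurable X]setTI.
  exact: measurable_row_cons.
Qed.

HB.instance Definition _ := isMeasure.Build _ _ _ lebesgue_cons
  lebesgue_cons0 lebesgue_cons_ge0 lebesgue_cons_sigma_additive.

Let lebesgue_cons_sigma_finite : sigma_finite setT lebesgue_cons.
Proof.
have /sigma_finiteP[F [TF ndF Foo]] := sigma_finiteT (@lebesgue_measure R).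
have /sigma_finiteP[G [TG ndG Goo]] := sigma_finiteT m.
pose hd (x : 'rV[R]_n.+1) : measurableTypeR R := x ord0 ord0.
pose tl (x : 'rV[R]_n.+1) : 'rV[R]_n := col' ord0 x.
have mhd : measurable_fun setT hd by exact: measurable_row_coord.
have mtl : measurable_fun setT tl.
  apply: measurable_fun_row => i; rewrite /tl.
  under eq_fun do rewrite mxE.
  exact: measurable_row_coord.
have hdE z : hd (row_cons z) = z.1.
  rewrite /hd /row_cons mxE; case: splitP => [j _|j /= jE]; last by [].
  by rewrite (ord1 j) mxE eqxx mulr1n.
have tlE z : tl (row_cons z) = z.2.
  rewrite /tl /row_cons; apply/rowP => j; rewrite mxE mxE.
  case: splitP => k /= jk; first by move: jk; rewrite (ord1 k).
  by congr (z.2 _ _); apply/val_inj; move: jk; rewrite /bump /= !add1n => -[].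
exists (fun k => (hd @^-1` F k) `&` (tl @^-1` G k)).
  rewrite predeqE => x; split=> // _.
  have : setT (hd x) by []. rewrite TF => -[i _ Fi].
  have : setT (tl x) by []. rewrite TG => -[j _ Gj].
  exists (maxn i j) => //; split => /=.
  - by move: Fi; exact/subsetPset/ndF/leq_maxl.
  - by move: Gj; exact/subsetPset/ndG/leq_maxr.
move=> k; have [mF Fk] := Foo k; have [mG Gk] := Goo k; split.
  apply: measurableI.
  - by rewrite -[X in measurable X]setTI; exact: mhd.
  - by rewrite -[X in measurable X]setTI; exact: mtl.
rewrite /lebesgue_cons /pushforward (_ : _ @^-1` _ = F k `*` G k); last first.
  by apply/seteqP; split => z /=; rewrite hdE tlE.
by rewrite product_measure1E// lte_mul_pinfty// ge0_fin_numE.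
Qed.

HB.instance Definition _ :=
  @Measure_isSigmaFinite.Build _ _ _ lebesgue_cons lebesgue_cons_sigma_finite.

End lebesgue_pushforward.

(* Lebesgue measure on R^n: iterated product of the one on R, moved to row
   vectors by row_cons; see lebesgue_rV_box for the volume of boxes. *)
Fixpoint lebesgue_rV (R : realType) (n : nat) :
    {sigma_finite_measure set 'rV[R]_n -> \bar R} :=
  match n with
  | 0 => dirac (0 : 'rV[R]_0)
  | n'.+1 => lebesgue_cons (lebesgue_rV R n')
  end.

Lemma measurable_rV_box (R : realType) n (a b : 'rV[R]_n) :
  measurable [set x : 'rV[R]_n | forall i, a ord0 i <= x ord0 i <= b ord0 i].
Proof.
rewrite (_ : [set _ | _] =
    \bigcap_(i in [set: 'I_n]) (row_coord i @^-1` `[a ord0 i, b ord0 i]%classic));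
  last first.
  by apply/seteqP; split=> x /= H i => [_|]; [|have := H i I];
    rewrite /= in_itv/=; [exact: H|].
apply: fin_bigcap_measurable => // i _; rewrite -[X in measurable X]setTI.
by apply: measurable_row_coord => //; exact: measurable_itv.
Qed.

Lemma lebesgue_rV_box (R : realType) n (a b : 'rV[R]_n) :
  (forall i, a ord0 i <= b ord0 i) ->
  lebesgue_rV R n [set x | forall i, a ord0 i <= x ord0 i <= b ord0 i] =
  (\prod_(i < n) (b ord0 i - a ord0 i))%:E.
Proof.
elim: n a b => [|n IHn] a b ab.
  by rewrite big_ord0 /= /dirac/= indicE mem_set// => -[].
rewrite big_ord_recl EFinM [LHS]/= /lebesgue_cons /pushforward.
pose B := [set x : 'rV[R]_n | forall i,
  (col' ord0 a) ord0 i <= x ord0 i <= (col' ord0 b) ord0 i].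
rewrite (_ : _ @^-1` _ = `[a ord0 ord0, b ord0 ord0]%classic `*` B); last first.
  apply/seteqP; split=> -[t x] /=; rewrite in_itv/=.
    move=> H; split.
      have := H ord0; rewrite /row_cons mxE; case: splitP => [j _|//].
      by rewrite (ord1 j) mxE eqxx mulr1n.
    move=> i; have := H (lift ord0 i); rewrite /row_cons !mxE.
    case: splitP => k /= ik; first by move: ik; rewrite (ord1 k).
    rewrite (_ : k = i)//.
    by apply/val_inj; move: ik; rewrite /bump /= !add1n => -[].
  move=> [Ht Hx] i; rewrite /row_cons mxE; case: splitP => k /= ik.
    rewrite (ord1 k) mxE eqxx mulr1n (_ : i = ord0)//.
    by apply/val_inj; rewrite /= ik (ord1 k).
  have -> : i = lift ord0 k by apply/val_inj; rewrite /= ik.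
  by have := Hx k; rewrite !mxE.
rewrite product_measure1E//; last exact: measurable_rV_box.
have := @lebesgue_measure_itv R `[a ord0 ord0, b ord0 ord0]; rewrite /= => ->.
rewrite lte_fin IHn; last by move=> i; rewrite !mxE.
congr (_ * _)%E.
  case: ltP => // ba; have/eqP -> : a ord0 ord0 == b ord0 ord0.
    by rewrite eq_le ab ba.
  by rewrite subrr.
by congr EFin; apply: eq_bigr => i _; rewrite !mxE.
Qed.

Section smooth_domain.
Context {R : realType}.

Definition enorm n (x : 'rV[R]_n) : R := Num.sqrt (\sum_i x ord0 i ^+ 2).

Fixpoint Ck (k : nat) n (h : 'rV[R]_n -> R) : Prop :=
  continuous h /\
  match k with
  | 0 => True
  | k'.+1 => forall i : 'I_n,
      (forall x, derivable h x (delta_mx ord0 i)) /\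
      Ck k' ('D_(delta_mx ord0 i) h)
  end.

Definition smooth n (h : 'rV[R]_n -> R) : Prop := forall k, Ck k h.

(* Near each boundary point the domain is one side of the graph of a C^oo
   function gamma of the other coordinates, after choosing which coordinate i
   is "vertical" and its orientation b. *)
Definition smooth_boundary n (Omega : set 'rV[R]_n) : Prop :=
  forall x0, (closure Omega `\` interior Omega) x0 ->
  exists (i : 'I_n) (b : bool) (gamma : 'rV[R]_n.-1 -> R),
    smooth gamma /\
    \forall x \near x0,
      Omega x <-> 0 < (-1) ^+ b * (x ord0 i - gamma (col' i x)).

Definition smooth_bounded_domain n (Omega : set 'rV[R]_n) : Prop :=
  [/\ Omega !=set0, open Omega, connected Omega, bounded_set Omega &
      smooth_boundary Omega].

End smooth_domain.

Section fractional_sobolev.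
Context {R : realType} {N : nat}.
Implicit Types (Omega : set 'rV[R]_N) (s p : R) (u w : 'rV[R]_N -> R).

Local Notation mu := (lebesgue_rV R N).
Local Notation mu2 := (mu \x mu)%E.

(* ||u||_{0,s,p}^p, as an extended real. *)
Definition gagliardo Omega s p u : \bar R :=
  (\int[mu2]_(z in ~` ((~` Omega) `*` (~` Omega)))
     (`|u z.1 - u z.2| `^ p / enorm (z.1 - z.2) `^ (N%:R + s * p))%:E)%E.

(* Functions are representatives of their a.e.-class; Borel measurability is
   no restriction since every class has a Borel representative. *)
Definition X0 Omega s p : set ('rV[R]_N -> R) := [set u : 'rV[R]_N -> R |
  [/\ measurable_fun setT u,
      mu.-integrable Omega (fun x => (`|u x| `^ p)%:E),
      {ae mu, forall x, ~ Omega x -> u x = 0} &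
      (gagliardo Omega s p u < +oo)%E]].

Definition X0norm Omega s p u : R := fine (gagliardo Omega s p u) `^ p^-1.

Definition Lpnorm Omega r u : R := (\int[mu]_(x in Omega) `|u x| `^ r) `^ r^-1.

Definition lambda1 Omega s p : \bar R :=
  ereal_inf [set (X0norm Omega s p u `^ p / Lpnorm Omega p u `^ p)%:E |
             u in X0 Omega s p `\` [set u | u = cst 0 %[ae mu]]].

Definition sobolev_exponent s p : R := N%:R * p / (N%:R - s * p).

(* Since 0 `^ a = 0 for a != 0, the factor |t|^{p-2} t vanishes at t = 0, also
   for p < 2.  By Hoelder the integrand is integrable for u, w in X0. *)
Definition frac_plap s p u w : R :=
  \int[mu2]_z
    (`|u z.1 - u z.2| `^ (p - 2) * (u z.1 - u z.2) * (w z.1 - w z.2) /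
     enorm (z.1 - z.2) `^ (N%:R + s * p)).

Definition nonneg_ae u : Prop := {ae mu, forall x, 0 <= u x}.

Definition positive_ae Omega u : Prop := {ae mu, forall x, Omega x -> 0 < u x}.

Definition scalar_solution Omega s p (g : 'rV[R]_N -> R -> R) u : Prop :=
  [/\ X0 Omega s p u, nonneg_ae u &
      forall w, X0 Omega s p w ->
        frac_plap s p u w = \int[mu]_(x in Omega) (g x (u x) * w x)].

Definition unique_positive_solution Omega s p (g : 'rV[R]_N -> R -> R) : Prop :=
  exists u, [/\ scalar_solution Omega s p g u, positive_ae Omega u &
    forall u', scalar_solution Omega s p g u' -> positive_ae Omega u' ->
      u' = u %[ae mu]].

Definition system_solution Omega s1 s2 p1 p2 (lam : R)
    (f1 f2 : 'rV[R]_N -> R -> R -> R) (g1 g2 : 'rV[R]_N -> R -> R)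
    (uv : ('rV[R]_N -> R) * ('rV[R]_N -> R)) : Prop :=
  let: (u, v) := uv in
  [/\ X0 Omega s1 p1 u, X0 Omega s2 p2 v, nonneg_ae u, nonneg_ae v &
      forall w z, X0 Omega s1 p1 w -> X0 Omega s2 p2 z ->
        frac_plap s1 p1 u w + frac_plap s2 p2 v z =
        \int[mu]_(x in Omega) ((lam * f1 x (u x) (v x) + g1 x (u x)) * w x) +
        \int[mu]_(x in Omega) ((lam * f2 x (u x) (v x) + g2 x (v x)) * z x)].

Definition eq_ae2 (uv uv' : ('rV[R]_N -> R) * ('rV[R]_N -> R)) : Prop :=
  uv.1 = uv'.1 %[ae mu] /\ uv.2 = uv'.2 %[ae mu].

(* Solutions are a.e.-classes: distinct means not a.e. equal. *)
Definition pairwise_distinct3 (a b c : ('rV[R]_N -> R) * ('rV[R]_N -> R)) :=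
  [/\ ~ eq_ae2 a b, ~ eq_ae2 a c & ~ eq_ae2 b c].

End fractional_sobolev.

Section nonlinearities.
Context {R : realType} {N : nat}.
Variable Omega : set 'rV[R]_N.
Implicit Types (f F : 'rV[R]_N -> R -> R -> R) (g : 'rV[R]_N -> R -> R).

Local Notation mu := (lebesgue_rV R N).
Local Notation Rplus := [set t : R | 0 <= t].

Definition caratheodory1 g : Prop :=
  (forall t, 0 <= t -> measurable_fun Omega (fun x => g x t)) /\
  {ae mu, forall x, Omega x -> {within Rplus, continuous (g x)}}.

Definition caratheodory2 f : Prop :=
  (forall t r, 0 <= t -> 0 <= r -> measurable_fun Omega (fun x => f x t r)) /\
  {ae mu, forall x, Omega x ->
     {within Rplus `*` Rplus, continuous (fun z : R * R => f x z.1 z.2)}}.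

(* h'(t) = l for h defined on [0, +oo[; one-sided at t = 0. *)
Definition deriv_Rplus (h : R -> R) (t l : R) : Prop :=
  k^-1 * (h (t + k) - h t) @[k --> within [set k | 0 <= t + k] 0^'] --> l.

Definition continuous3 F : Prop :=
  {within (Omega `*` Rplus) `*` Rplus,
    continuous (fun z : 'rV[R]_N * R * R => F z.1.1 z.1.2 z.2)}.

(* F is in C^1(Omega x R^+ x R^+), where the derivatives in the last two
   variables are one-sided at 0. *)
Definition C1_regular F : Prop :=
  continuous3 F /\
  exists (Fx : 'I_N -> 'rV[R]_N -> R -> R -> R) (Fu Fv : 'rV[R]_N -> R -> R -> R),
    [/\ forall i, continuous3 (Fx i), continuous3 Fu, continuous3 Fv &
      forall x t r, Omega x -> 0 <= t -> 0 <= r ->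
        [/\ forall i, is_derive x (delta_mx ord0 i : 'rV[R]_N)
                        (fun y => F y t r) (Fx i x t r),
            deriv_Rplus (fun t' => F x t' r) t (Fu x t r) &
            deriv_Rplus (F x t) r (Fv x t r)]].

Definition primitive g (x : 'rV[R]_N) (t : R) : R :=
  \int[lebesgue_measure]_(tau in `[0, t]) g x tau.

(* limsup_{t -> 0+} sup_{x in Omega} g(x,t) / (|t|^{p-2} t), i.e. the limsup
   uniform in x. *)
Definition limsup0 g (p : R) : \bar R :=
  limf_esup (fun t : R =>
    ereal_sup [set (g x t / (`|t| `^ (p - 2) * t))%:E | x in Omega]) 0^'+.

End nonlinearities.

(* Main.v *)
Require Import Defs.
From HB Require Import structures.
From mathcomp Require Import all_boot all_order all_algebra.
From mathcomp Require Import all_classical all_reals all_analysis.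
From mathcomp Require Import measurable_realfun hoelder ring lra.

Set Implicit Arguments.
Unset Strict Implicit.
Unset Printing Implicit Defensive.

Import Order.TTheory GRing.Theory Num.Theory.
Import numFieldNormedType.Exports.

Local Open Scope classical_set_scope.
Local Open Scope ring_scope.

(* Each scalar energy J_i u = [u]^p_i / p_i - int G_i(x, u^+) is minimised on its
   Nehari set by a nontrivial critical point w_i (the compact embedding gives
   existence, monotonicity of g_i(x, u) / u^(p_i - 1) makes w_i the strict maximum
   of J_i on its ray).  As f_1, f_2 vanish on the axes, (0, 0), (w_1, 0) and
   (0, w_2) solve the system for every lambda.
   If the positive solutions of the scalar problems are unique, the strong maximum
   principle makes w_1, w_2 isolated critical points.  For small lambda there is then
   a critical point of the coupled energy I near (w_1, w_2): otherwise the square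
   (s w_1, t w_2) could be deformed below the level J_1 w_1 + J_2 w_2, keeping its
   boundary fixed, while by the Poincare-Miranda theorem the deformed square meets
   the product of the Nehari sets, where I >= J_1 w_1 + J_2 w_2 - O(lambda).  Being
   near (w_1, w_2), both components are nontrivial, hence positive.
   Functionals act on representatives and compactness is used only through weakly
   convergent, dominated subsequences, so that no Banach space is needed. *)

(** * Powers *)

Section power_functions.
Context {R : realType}.
Implicit Types (p r : R) (a b t : R).

(** The sources are merely continuous, so there is no second derivative: neither an implicit
    function argument nor a Lagrange multiplier on the Nehari set is available, and smallness of
    lambda must be exploited through energy levels alone. What matters is the order of the
    constants. Isolation of w_1, w_2 gives, on an annulus around (w_1, w_2), a rate of descent
    [eta0] valid for all small lambda; closer to the centre the absence of critical points gives
    only a rate [eta] that depends on lambda and may be tiny. The level drop [kap] is fixed before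
    lambda, from [eta0] and from the fall of J_i at the ends of the rays. A point crossing the
    annulus pays [eta0 / 2] of energy per unit of length, which confines the deformation to the ball
    however small [eta] is. Estimates that are uniform on balls are obtained by contradiction: a
    violating sequence has a dominated subsequence along which both sides converge. The Sobolev
    inequality comes from averages on dyadic boxes, so it holds for representatives without density
    of smooth functions. *)

Definition signed_pow p t : R := `|t| `^ (p - 2) * t.

Lemma signed_pow0 p : signed_pow p 0 = 0.
Proof. by rewrite /signed_pow mulr0. Qed.

Lemma signed_powN p t : signed_pow p (- t) = - signed_pow p t.
Proof. by rewrite /signed_pow normrN mulrN. Qed.

Lemma norm_signed_pow p t : 1 < p -> `|signed_pow p t| = `|t| `^ (p - 1).
Proof.
move=> p1; rewrite /signed_pow normrM (ger0_norm (powR_ge0 _ _)).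
have [->|t0] := eqVneq t 0.
  by rewrite normr0 mulr0 powR0// subr_eq0 gt_eqF.
rewrite -[X in _ * X]powRr1// -powRD ?normr_eq0 ?t0 ?implybT//.
by congr (_ `^ _); ring.
Qed.

Lemma signed_powM p t : 1 < p -> signed_pow p t * t = `|t| `^ p.
Proof.
move=> p1; rewrite /signed_pow -mulrA -expr2 -[t ^+ 2]real_normK ?num_real//.
have [->|t0] := eqVneq t 0.
  by rewrite normr0 expr2 !mulr0 powR0// gt_eqF// (lt_trans _ p1).
rewrite -powR_mulrn// -powRD ?normr_eq0 ?t0 ?implybT//.
by congr (_ `^ _); ring.
Qed.

Lemma signed_powZ p a t : 1 < p -> 0 <= a ->
  signed_pow p (a * t) = a `^ (p - 1) * signed_pow p t.
Proof.
move=> p1 a0; rewrite /signed_pow normrM (ger0_norm a0) powRM//.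
have [->|an0] := eqVneq a 0.
  by rewrite !(mul0r, mulr0) [in RHS]powR0 ?mul0r// subr_eq0 gt_eqF.
have -> : a `^ (p - 1) = a `^ (p - 2) * a.
  rewrite -[X in _ * X]powRr1// -powRD ?an0 ?implybT//.
  by congr (_ `^ _); ring.
by rewrite mulrACA.
Qed.

Lemma signed_pow_ge0 p t : 1 < p -> 0 <= t -> signed_pow p t = t `^ (p - 1).
Proof.
move=> p1 t0; rewrite -[LHS]ger0_norm ?norm_signed_pow ?ger0_norm//.
by rewrite /signed_pow mulr_ge0// powR_ge0.
Qed.

Lemma ler_powR_base r a b : 0 <= r -> 0 <= a -> a <= b -> a `^ r <= b `^ r.
Proof.
move=> r0 a0 ab; apply: ge0_ler_powR => //; rewrite nnegrE//.
exact: le_trans ab.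
Qed.

(* Young's inequality gives p J(a) b <= (p-1)|a|^p + |b|^p. *)
Lemma powR_convex p a b : 1 < p ->
  `|a| `^ p + p * signed_pow p a * (b - a) <= `|b| `^ p.
Proof.
move=> p1; have p0 : 0 < p by rewrite (lt_trans _ p1).
rewrite -mulrA mulrBr signed_powM//.
have q0 : 0 < p / (p - 1) by rewrite divr_gt0// subr_gt0.
have pn0 : p != 0 by rewrite gt_eqF.
have p1n0 : p - 1 != 0 by rewrite subr_eq0 gt_eqF.
have E : (p / (p - 1))^-1 + p^-1 = 1 by field; rewrite pn0.
have := @conjugate_powR R (`|a| `^ (p - 1)) `|b| (p / (p - 1)) p
  (powR_ge0 _ _) (normr_ge0 _) q0 p0 E.
rewrite -powRrM mulrCA divff// mulr1 => Y.
have : signed_pow p a * b <= `|a| `^ (p - 1) * `|b|.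
  by rewrite -norm_signed_pow// -normrM ler_norm.
move=> /le_trans/(_ Y); rewrite -(ler_pM2l p0) mulrDr.
rewrite (_ : p * (`|a| `^ p / _) = (p - 1) * `|a| `^ p); last first.
  by rewrite invf_div; field.
rewrite (_ : p * (`|b| `^ p / p) = `|b| `^ p); last by field.
by move=> H; lra.
Qed.

(** The parameter [t] makes the coefficient of b^p as small as desired; [Lp_dual_unif] uses it where
    the energy of one factor is merely bounded and that of the other is small. *)
Lemma powR_young p a b t : 1 < p -> 0 <= a -> 0 <= b -> 0 < t ->
  a `^ (p - 1) * b <= t `^ (p - 1) * b `^ p + t^-1 * a `^ p.
Proof.
move=> p1 a0 b0 t0; have p10 : 0 <= p - 1 by rewrite subr_ge0 ltW.
have [atb|tba] := leP a (t * b).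
  apply: (@le_trans _ _ (t `^ (p - 1) * b `^ p)); last first.
    by rewrite lerDl mulr_ge0 ?invr_ge0 ?powR_ge0// ltW.
  rewrite -(@mulr_powRB1 _ b p)// ?(lt_trans _ p1)// mulrCA mulrC.
  rewrite ler_wpM2l// -powRM//; last exact: ltW.
  exact: ler_powR_base.
apply: (@le_trans _ _ (t^-1 * a `^ p)); last first.
  by rewrite lerDr mulr_ge0 ?powR_ge0.
rewrite -(@mulr_powRB1 _ a p)// ?(lt_trans _ p1)// mulrA mulrC.
by rewrite ler_wpM2r ?powR_ge0// ler_pdivlMl// ltW.
Qed.

Lemma powR_mul_le r a b : 1 <= r -> 0 <= a -> 0 <= b ->
  a `^ (r - 1) * b <= a `^ r + b `^ r.
Proof.
move=> r1 a0 b0; have r10 : 0 <= r - 1 by rewrite subr_ge0.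
have r0 : 0 < r by rewrite (lt_le_trans _ r1).
have [ab|/ltW ba] := leP a b.
  apply: (@le_trans _ _ (b `^ r)); last by rewrite lerDr powR_ge0.
  rewrite -(@mulr_powRB1 _ b r)// mulrC ler_wpM2l//.
  exact: ler_powR_base.
apply: (@le_trans _ _ (a `^ r)); last by rewrite lerDl powR_ge0.
by rewrite -(@mulr_powRB1 _ a r)// mulrC ler_wpM2r// powR_ge0.
Qed.

Lemma powRD_le r a b : 0 <= r -> 0 <= a -> 0 <= b ->
  (a + b) `^ r <= 2 `^ r * (a `^ r + b `^ r).
Proof.
move=> r0 a0 b0; wlog ab : a b a0 b0 / a <= b.
  move=> W; have [|/ltW] := leP a b; first exact: W.
  by move=> ba; rewrite addrC [X in _ * X]addrC; exact: W.
apply: (@le_trans _ _ ((2 * b) `^ r)); first by apply: ler_powR_base; lra.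
by rewrite powRM// ler_wpM2l ?powR_ge0// lerDr powR_ge0.
Qed.

Lemma powRB_le r a b : 0 <= r -> `|a - b| `^ r <= 2 `^ r * (`|a| `^ r + `|b| `^ r).
Proof.
move=> r0; apply: le_trans (powRD_le r0 (normr_ge0 a) (normr_ge0 b)).
by apply: ler_powR_base => //; rewrite ler_normB.
Qed.

Lemma powR_le_mixed p r a : 0 <= p -> p <= r -> 0 <= a -> a `^ p <= 1 + a `^ r.
Proof.
move=> p0 pr a0; have [a1|/ltW a1] := leP a 1.
  apply: (@le_trans _ _ 1); last by rewrite lerDl powR_ge0.
  by have := ler_powR_base p0 a0 a1; rewrite powR1.
apply: (@le_trans _ _ (a `^ r)); last by rewrite lerDr.
exact: ler_powR.
Qed.

Lemma continuous_powR_base r a : 0 < a -> {for a, continuous (@powR R ^~ r)}.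
Proof.
move=> a0; apply: differentiable_continuous; apply/derivable1_diffP.
by apply: derivable_powR; rewrite in_itv/= andbT.
Qed.

(** Both error terms are homogeneous of degree p - 1, so one estimate serves for p < 2 and for p >=
    2. If a - b is small relative to a, scaling reduces the claim to continuity of the power at 1;
    otherwise |a| and |b| are both controlled by a multiple of |a - b|. *)
Lemma signed_pow_unif p (e : R) : 1 < p -> 0 < e -> exists2 C : R, 0 <= C &
  forall a b, `|signed_pow p a - signed_pow p b| <=
    e * `|a| `^ (p - 1) + C * `|a - b| `^ (p - 1).
Proof.
move=> p1 e0; have p10 : 0 <= p - 1 by rewrite subr_ge0 ltW.
have : \forall t \near (1 : R), `|1 `^ (p - 1) - t `^ (p - 1)| < e.
  have := @continuous_powR_base (p - 1) 1 ltr01.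
  by move/cvgrPdist_lt; apply.
rewrite powR1 => /nbhs_ballP[d /= d0 dH].
(* Half of [d] turns a weak inequality into a strict one, and [d' < 1] makes b / a nonnegative, as
   [signed_powZ] requires. *)
pose d' := Num.min (d / 2) (1/2).
have d'0 : 0 < d' by rewrite /d' lt_min !divr_gt0.
have d'd : d' < d by rewrite gt_min ltr_pdivrMr// mulr_natr mulr2n ltrDl d0.
have d'1 : d' < 1 by rewrite gt_min; apply/orP; right; lra.
exists (2 * (1 + d'^-1) `^ (p - 1)).
  by rewrite mulr_ge0// powR_ge0.
move=> a b; have [ab|ab] := leP `|a - b| (d' * `|a|).
  apply: (@le_trans _ _ (e * `|a| `^ (p - 1))); last first.
    by rewrite lerDl !mulr_ge0// powR_ge0.
  have [a0|a0] := eqVneq a 0.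
    move: ab; rewrite a0 normr0 mulr0 sub0r normrN normr_le0 => /eqP ->.
    by rewrite subrr normr0 mulr_ge0 ?powR_ge0// ltW.
  have na0 : 0 < `|a| by rewrite normr_gt0.
  have -> : b = (b / a) * a by rewrite divfK.
  have t1 : `|1 - b / a| <= d'.
    rewrite -[1](divff a0) -mulrBl normrM normfV ler_pdivrMr//.
  have t0 : 0 <= b / a by move: t1; rewrite ler_norml; lra.
  rewrite signed_powZ// -[X in X - _]mul1r -mulrBl normrM norm_signed_pow//.
  rewrite ler_wpM2r ?powR_ge0// ltW// dH//=.
  by rewrite /ball/= (le_lt_trans t1).
apply: (@le_trans _ _ (2 * (1 + d'^-1) `^ (p - 1) * `|a - b| `^ (p - 1))); last first.
  by rewrite lerDr mulr_ge0 ?powR_ge0// ltW.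
apply: le_trans (ler_normB _ _) _; rewrite !norm_signed_pow//.
rewrite -mulrA -powRM//; last by rewrite addr_ge0// invr_ge0 ltW.
have aab : `|a| <= d'^-1 * `|a - b| by rewrite ler_pdivlMl// ltW.
have bab : `|b| <= `|a - b| + `|a|.
  by rewrite -[X in `|X| <= _](subKr a b) (le_trans (ler_normB _ _))// addrC.
rewrite [2 * _]mulr_natl mulr2n lerD//; apply: ler_powR_base => //.
  rewrite mulrDl mul1r; apply: le_trans aab _; rewrite lerDr//.
by rewrite mulrDl mul1r (le_trans bab)// lerD2l.
Qed.

End power_functions.

(** * L^p energies *)

Lemma cvg_norm_powR (R : realType) (p b : R) (b_ : nat -> R) : 0 < p ->
  b_ n @[n --> \oo] --> b -> `|b_ n| `^ p @[n --> \oo] --> `|b| `^ p.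
Proof.
move=> p0 bc; have [b0|b0] := eqVneq b 0; last first.
  apply: (@cvg_comp _ _ _ _ (@powR R ^~ p)); first exact: (cvg_norm bc).
  by apply: continuous_powR_base; rewrite normr_gt0.
rewrite b0 normr0 powR0 ?gt_eqF//; apply/cvgrPdist_le => e' e'0.
move: bc; rewrite b0 => /cvgrPdist_le /(_ (e' `^ p^-1) (powR_gt0 _ e'0)).
apply: filterS => n; rewrite !sub0r !normrN => bn.
rewrite ger0_norm ?powR_ge0//.
apply: (@le_trans _ _ ((e' `^ p^-1) `^ p)).
  by apply: ler_powR_base => //; exact: ltW.
by rewrite -powRrM mulVf ?gt_eqF// powRr1// ltW.
Qed.

Section real_integrals.
Context d (T : measurableType d) (R : realType).
Variables (m : {measure set T -> \bar R}) (D : set T).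
Hypothesis mD : measurable D.
Implicit Types (f g : T -> R).

Lemma integrable_dom f g : measurable_fun D f ->
  (forall x, D x -> `|f x| <= g x) -> m.-integrable D (EFin \o g) ->
  m.-integrable D (EFin \o f).
Proof.
move=> mf fg; apply: le_integrable => //; first exact/measurable_EFinP.
by move=> x Dx /=; rewrite lee_fin (le_trans (fg _ Dx))// ler_norm.
Qed.

Lemma integrable_RZ c f : m.-integrable D (EFin \o f) ->
  m.-integrable D (EFin \o (fun x => c * f x)).
Proof. by move=> i; exact: (@integrableZl _ _ _ m D mD c _ i). Qed.

Lemma integrable_RD f g : m.-integrable D (EFin \o f) ->
  m.-integrable D (EFin \o g) -> m.-integrable D (EFin \o (fun x => f x + g x)).
Proof. by move=> i j; exact: (@integrableD _ _ _ m D mD _ _ i j). Qed.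

Lemma integrable_RB f g : m.-integrable D (EFin \o f) ->
  m.-integrable D (EFin \o g) -> m.-integrable D (EFin \o (fun x => f x - g x)).
Proof. by move=> i j; exact: (@integrableB _ _ _ m D mD _ _ i j). Qed.

Lemma Rintegral_dominated (f_ : (T -> R)^nat) f g :
  (forall n, measurable_fun D (f_ n)) -> measurable_fun D f ->
  {ae m, forall x, D x -> f_ ^~ x @ \oo --> f x} ->
  m.-integrable D (EFin \o g) ->
  {ae m, forall x, D x -> forall n, `|f_ n x| <= g x} ->
  m.-integrable D (EFin \o f) /\
  (fun n => \int[m]_(x in D) f_ n x) @ \oo --> \int[m]_(x in D) f x.
Proof.
move=> mf_ mf f_f ig fg.
have [] := @dominated_convergence _ _ _ m D mD (fun n => EFin \o f_ n)
  (EFin \o f) (EFin \o g).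
- by move=> n; exact/measurable_EFinP.
- exact/measurable_EFinP.
- apply: filterS f_f => x H Dx; apply/fine_cvgP; split; last exact: H.
  by near=> n.
- exact: ig.
- by apply: filterS fg => x H n Dx; rewrite /= lee_fin; exact: H.
move=> intf _ c; split => //.
by apply: fine_cvg; rewrite fineK//; exact: integrable_fin_num.
Unshelve. all: by end_near. Qed.

(** The common bound [M] makes the limit integrable: this is how finiteness of energies passes to
    almost everywhere limits. *)
Lemma Rintegral_fatou (f_ : (T -> R)^nat) f (M : R) :
  (forall n, m.-integrable D (EFin \o f_ n)) ->
  (forall n x, D x -> 0 <= f_ n x) -> measurable_fun D f ->
  {ae m, forall x, D x -> f_ ^~ x @ \oo --> f x} ->
  (forall n, \int[m]_(x in D) f_ n x <= M) ->
  [/\ m.-integrable D (EFin \o f), {ae m, forall x, D x -> 0 <= f x} &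
      \int[m]_(x in D) f x <= M].
Proof.
move=> if_ f0 mf f_f fM.
have fge0 : {ae m, forall x, D x -> 0 <= f x}.
  apply: filterS f_f => x H Dx; have /cvg_lim <- := H Dx => //.
  apply: limr_ge; first by apply/cvg_ex; exists (f x); exact: H.
  by near=> n; exact: f0.
have mef_ n : measurable_fun D (EFin \o f_ n : T -> \bar R).
  exact: measurable_int (if_ n).
have main : (\int[m]_(x in D) `|(f x)%:E| <= M%:E)%E.
  have fE x : (f_ ^~ x @ \oo --> f x) ->
      limn_einf (fun n => (f_ n x)%:E) = (f x)%:E.
    move=> H; apply: (cvg_limn_einf_sup (l := (f x)%:E) _).1.
    by apply/fine_cvgP; split; [near=> n|exact: H].
  rewrite (ae_eq_integral (fun x => limn_einf (fun n => (f_ n x)%:E))) //; last 3 first.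
  - by apply: measurableT_comp => //; exact/measurable_EFinP.
  - under eq_fun do rewrite -[limn_einf _]oppeK -limn_esupN.
    apply: measurableT_comp => //; apply: measurable_fun_limn_esup => n /=.
    by apply/measurable_EFinP/measurableT_comp => //; exact/measurable_EFinP.
  - apply: filterS2 f_f fge0 => x H f0x Dx.
    rewrite fE; last exact: H.
    by rewrite gee0_abs// lee_fin f0x.
  apply: le_trans (fatou m mD mef_ _) _.
    by move=> n x Dx /=; rewrite lee_fin f0.
  rewrite limn_einf_lim; apply: lime_le.
    exact: is_cvg_einfs.
  near=> n; apply: (@le_trans _ _ (\int[m]_(x in D) (f_ n x)%:E)%E).
    by apply: ereal_inf_lbound; exists n => /=.
  by rewrite -(fineK (integrable_fin_num mD (if_ n))) lee_fin; exact: fM.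
have intf : m.-integrable D (EFin \o f).
  apply/integrableP; split; first exact/measurable_EFinP.
  by apply: le_lt_trans main _; rewrite ltry.
split => //.
rewrite -lee_fin fineK; last exact: integrable_fin_num.
apply: le_trans main; apply: le_integral => //.
  exact: integrable_abse.
by move=> x _; rewrite /= lee_fin ler_norm.
Unshelve. all: by end_near. Qed.

Lemma Rintegral_ae_eq f g : measurable_fun D f -> measurable_fun D g ->
  {ae m, forall x, D x -> f x = g x} ->
  \int[m]_(x in D) f x = \int[m]_(x in D) g x.
Proof.
move=> mf mg fg; congr fine; apply: ae_eq_integral => //.
- exact/measurable_EFinP.
- exact/measurable_EFinP.
- by apply: filterS fg => x H Dx; rewrite /= H.
Qed.

Lemma le_Rintegral_norm f g : measurable_fun D f ->
  m.-integrable D (EFin \o g) -> (forall x, D x -> `|f x| <= g x) ->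
  `|\int[m]_(x in D) f x| <= \int[m]_(x in D) g x.
Proof.
move=> mf ig fg; have if_ := integrable_dom mf fg ig.
apply: le_trans (le_normr_Rintegral mD if_) _; apply: le_Rintegral => //.
exact: integrable_norm.
Qed.

End real_integrals.

Section lp_energy.
Context d (T : measurableType d) (R : realType).
Variables (m : {measure set T -> \bar R}) (p : R).
Hypothesis p1 : 1 < p.
Implicit Types (a b h : T -> R).

Definition Lp a := measurable_fun setT a /\
  m.-integrable setT (EFin \o (fun x => `|a x| `^ p)).

Definition Lp_energy a := \int[m]_x (`|a x| `^ p).

(** Up to the factor p, the derivative of [Lp_energy] at a in the direction h. *)
Definition Lp_dual a h := \int[m]_x (signed_pow p (a x) * h x).

Let p0 : 0 < p. Proof. by rewrite (lt_trans _ p1). Qed.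

Lemma measurable_norm_powR r a : measurable_fun setT a ->
  measurable_fun setT (fun x => `|a x| `^ r).
Proof.
by move=> ma; apply: (measurableT_comp (measurable_powR r)); exact: measurableT_comp.
Qed.

Lemma measurable_signed_pow a : measurable_fun setT a ->
  measurable_fun setT (fun x => signed_pow p (a x)).
Proof.
by move=> ma; apply: measurable_funM => //; exact: measurable_norm_powR.
Qed.

Lemma LpZ k a : Lp a -> Lp (fun x => k * a x).
Proof.
move=> [ma ia]; split; first exact: measurable_funM.
apply: (eq_integrable measurableT (fun x => (`|k| `^ p)%:E * (`|a x| `^ p)%:E)%E).
  by move=> x _ /=; rewrite normrM powRM// EFinM.
exact: integrableZl.
Qed.

Lemma LpD a b : Lp a -> Lp b -> Lp (fun x => a x + b x).
Proof.
move=> [ma ia] [mb ib]; split; first exact: measurable_funD.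
apply: (@integrable_dom _ _ _ m setT measurableT _
   (fun x => 2 `^ p * (`|a x| `^ p + `|b x| `^ p))).
- exact/measurable_norm_powR/measurable_funD.
- move=> x _; rewrite ger0_norm ?powR_ge0//.
  apply: le_trans (powRD_le (ltW p0) (normr_ge0 (a x)) (normr_ge0 (b x))).
  by apply: ler_powR_base; rewrite ?ler_normD// ltW.
- by apply: integrable_RZ => //; exact: integrable_RD.
Qed.

Lemma LpN a : Lp a -> Lp (fun x => - a x).
Proof.
by move=> /(LpZ (-1)); congr (Lp _); apply/funext => x; rewrite mulN1r.
Qed.

Lemma LpB a b : Lp a -> Lp b -> Lp (fun x => a x - b x).
Proof. by move=> La Lb; apply: LpD => //; exact: LpN. Qed.

Lemma Lp_dom a b : measurable_fun setT a -> Lp b ->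
  (forall x, `|a x| <= `|b x|) -> Lp a.
Proof.
move=> ma [mb ib] ab; split => //.
apply: (integrable_dom measurableT _ _ ib); first exact: measurable_norm_powR.
move=> x _; rewrite ger0_norm ?powR_ge0//.
by apply: ler_powR_base => //; exact: ltW.
Qed.

Lemma Lp_dual_integrable a h : Lp a -> Lp h ->
  m.-integrable setT (EFin \o (fun x => signed_pow p (a x) * h x)).
Proof.
move=> [ma ia] [mh ih].
apply: (@integrable_dom _ _ _ m setT measurableT _
   (fun x => `|a x| `^ p + `|h x| `^ p)).
- by apply: measurable_funM => //; exact: measurable_signed_pow.
- by move=> x _; rewrite normrM norm_signed_pow// powR_mul_le// ltW.
- exact: integrable_RD.
Qed.

Lemma Lp_energy_ge0 a : 0 <= Lp_energy a.
Proof. by apply: Rintegral_ge0 => x _; exact: powR_ge0. Qed.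

Lemma Lp_energyZ k a : Lp a -> Lp_energy (fun x => k * a x) = `|k| `^ p * Lp_energy a.
Proof.
move=> [ma ia]; rewrite /Lp_energy -RintegralZl//.
by apply: eq_Rintegral => x _; rewrite normrM powRM.
Qed.

Lemma Lp_dual_self a : Lp_dual a a = Lp_energy a.
Proof. by apply: eq_Rintegral => x _; rewrite signed_powM. Qed.

Lemma Lp_dualD a h k : Lp a -> Lp h -> Lp k ->
  Lp_dual a (fun x => h x + k x) = Lp_dual a h + Lp_dual a k.
Proof.
move=> La Lh Lk; rewrite /Lp_dual -RintegralD//; try exact: Lp_dual_integrable.
by apply: eq_Rintegral => x _; rewrite mulrDr.
Qed.

Lemma Lp_dualZ a c h : Lp a -> Lp h ->
  Lp_dual a (fun x => c * h x) = c * Lp_dual a h.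
Proof.
move=> La Lh; rewrite /Lp_dual -RintegralZl//; last exact: Lp_dual_integrable.
by apply: eq_Rintegral => x _; rewrite mulrCA.
Qed.

Lemma Lp_dualZl a c h : Lp a -> Lp h -> 0 <= c ->
  Lp_dual (fun x => c * a x) h = c `^ (p - 1) * Lp_dual a h.
Proof.
move=> La Lh c0; rewrite /Lp_dual -RintegralZl//; last exact: Lp_dual_integrable.
by apply: eq_Rintegral => x _; rewrite signed_powZ// mulrA.
Qed.

Lemma Lp_energy_convex a b : Lp a -> Lp b ->
  Lp_energy a + p * Lp_dual a (fun x => b x - a x) <= Lp_energy b.
Proof.
move=> La Lb; have Lba := LpB Lb La.
rewrite /Lp_energy /Lp_dual -RintegralZl//; last exact: Lp_dual_integrable.
rewrite -RintegralD//; last 2 first.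
- by case: La.
- by apply: integrable_RZ => //; exact: Lp_dual_integrable.
apply: le_Rintegral => //; last 2 first.
- by case: Lb.
- by move=> x _; rewrite mulrA powR_convex.
apply: integrable_RD => //; first by case: La.
by apply: integrable_RZ => //; exact: Lp_dual_integrable.
Qed.

(** Uniform continuity of the duality map on bounded sets, in the dual norm. [signed_pow_unif] is
    integrated against h: its first term is small because the energies of a and h are bounded, its
    second one by [powR_young], each of the three resulting parts taking e / 3. *)
Lemma Lp_dual_unif (M e : R) : 0 < e -> exists2 del : R, 0 < del &
  forall a b h, Lp a -> Lp b -> Lp h -> Lp_energy a <= M ->
    Lp_energy (fun x => a x - b x) <= del -> Lp_energy h <= 1 ->
    `|Lp_dual a h - Lp_dual b h| <= e.
Proof.
move=> e0; have e3 : e = e / 3 + (e / 3 + e / 3) by field.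
pose M' : R := `|M| + 1.
have M'0 : 0 < M' by rewrite /M' ltr_wpDl.
have e1 : 0 < e / (3 * M') by rewrite divr_gt0// mulr_gt0.
have [C C0 HC] := signed_pow_unif p1 e1.
have C1 : 0 < C + 1 by rewrite ltr_wpDl.
have p10 : 0 < p - 1 by rewrite subr_gt0.
(* Solves t^(p - 1) = e / (3 (C + 1)); the price is a factor 1 / t on the energy of a - b, which the
   choice of the radius below pays for. *)
pose t := (e / (3 * (C + 1))) `^ (p - 1)^-1.
have et0 : 0 < e / (3 * (C + 1)) by rewrite divr_gt0// mulr_gt0.
have t0 : 0 < t by rewrite powR_gt0.
have tE : t `^ (p - 1) = e / (3 * (C + 1)).
  by rewrite /t -powRrM mulVf ?gt_eqF// powRr1// ltW.
exists (e * t / (3 * (C + 1))); first by rewrite divr_gt0 ?mulr_gt0.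
move=> a b h La Lb Lh aM abd h1.
have Lab := LpB La Lb.
rewrite /Lp_dual -RintegralB//; try exact: Lp_dual_integrable.
pose B x := e / (3 * M') * (`|a x| `^ p + `|h x| `^ p) +
  C * (t `^ (p - 1) * `|h x| `^ p + t^-1 * `|a x - b x| `^ p).
have iZ := @integrable_RZ _ _ _ m setT measurableT.
have iD := @integrable_RD _ _ _ m setT measurableT.
have [[_ ia] [_ ih] [_ iab]] := And3 La Lh Lab.
apply: (@le_trans _ _ (\int[m]_x B x)).
  apply: le_Rintegral_norm => //.
  - apply: measurable_funB; apply: measurable_funM; case: Lh => //.
    + by move=> *; apply: measurable_signed_pow; case: La.
    + by move=> *; apply: measurable_signed_pow; case: Lb.
  - by apply: (iD); apply: (iZ); apply: (iD) => //; exact: iZ.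
  - move=> x _; rewrite -mulrBl normrM.
    apply: le_trans (ler_wpM2r (normr_ge0 _) (HC _ _)) _.
    rewrite /B mulrDl -[X in X + _ <= _]mulrA -[X in _ + X <= _]mulrA.
    apply: lerD; rewrite ler_wpM2l//.
    + exact: ltW.
    + by apply: powR_mul_le => //; exact: ltW.
    + exact: powR_young.
rewrite /B RintegralD//; last 2 first.
- by apply: (iZ); exact: iD.
- by apply: (iZ); apply: (iD); exact: iZ.
rewrite !RintegralZl//; last 2 first.
- by apply: (iD); exact: iZ.
- exact: iD.
rewrite !RintegralD//; last 2 first.
- exact: iZ.
- exact: iZ.
rewrite !RintegralZl// -/(Lp_energy a) -/(Lp_energy h) tE.
rewrite -/(Lp_energy (fun x => a x - b x)).
have h0 := Lp_energy_ge0 h; have ab0 := Lp_energy_ge0 (fun x => a x - b x).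
have E1 : e / (3 * M') * (Lp_energy a + Lp_energy h) <= e / 3.
  have aM' : Lp_energy a + Lp_energy h <= M'.
    by rewrite /M' lerD// (le_trans aM)// ler_norm.
  apply: (@le_trans _ _ (e / (3 * M') * M')); first by rewrite ler_wpM2l// ltW.
  by rewrite le_eqVlt; apply/orP; left; apply/eqP; field; rewrite gt_eqF.
have E2 : C * (e / (3 * (C + 1)) * Lp_energy h) <= e / 3.
  apply: (@le_trans _ _ ((C + 1) * (e / (3 * (C + 1)) * 1))).
    apply: ler_pM; [exact: C0|exact: mulr_ge0 (ltW et0) h0|by rewrite lerDl|].
    by apply: ler_wpM2l; [exact: ltW|].
  by rewrite le_eqVlt; apply/orP; left; apply/eqP; field; rewrite gt_eqF.
have E3 : C * (t^-1 * Lp_energy (fun x => a x - b x)) <= e / 3.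
  apply: (@le_trans _ _ ((C + 1) * (t^-1 * (e * t / (3 * (C + 1)))))).
    apply: ler_pM => //; first by rewrite mulr_ge0// invr_ge0 ltW.
      by rewrite lerDl.
    by rewrite ler_wpM2l// invr_ge0 ltW.
  by rewrite le_eqVlt; apply/orP; left; apply/eqP; field; rewrite !gt_eqF.
by rewrite [C * _]mulrDr [leRHS]e3; exact: lerD E1 (lerD E2 E3).
Qed.

(** Convergence almost everywhere without loss of energy is strong convergence: Fatou's lemma is
    applied to 2^p (|a_n|^p + |a|^p) - |a_n - a|^p, which is nonnegative and whose limit carries the
    full integral 2^p (|a|^p + |a|^p). Along a subsequence that stays at energy more than e from a,
    the integrals would fall short of it by e / 2. *)
Lemma Lp_strong_cvg (a_ : (T -> R)^nat) a : (forall n, Lp (a_ n)) -> Lp a ->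
  {ae m, forall x, a_ ^~ x @ \oo --> a x} ->
  (forall e : R, 0 < e -> exists N, forall n, (N <= n)%N ->
    Lp_energy (a_ n) <= Lp_energy a + e) ->
  Lp_energy (fun x => a_ n x - a x) @[n --> \oo] --> 0.
Proof.
have ar (u v w e : R) : e < v -> u <= w + e / 2 -> u + w - v <= w + w - e / 2.
  by move=> *; lra.
have ar2 (w e : R) : 0 < e -> ~~ (w <= w - e / 2).
  by move=> ?; rewrite -ltNge; lra.
move=> La_ La a_a Hs; apply/cvgrPdist_le => e e0; apply: contrapT => nH.
have pp : 0 < 2 `^ p :> R by exact: powR_gt0.
have [N HN] := Hs (e / (2 * 2 `^ p)) (divr_gt0 e0 (mulr_gt0 (ltr0Sn _ 1) pp)).
have /choice [phi Hphi] : forall n, exists k, [/\ (n <= k)%N, (N <= k)%N &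
    e < Lp_energy (fun x => a_ k x - a x)].
  move=> n; apply: contrapT => Hn; apply: nH; exists (maxn n N) => // k /=.
  rewrite geq_max => /andP[nk Nk]; rewrite sub0r normrN ger0_norm ?Lp_energy_ge0//.
  by rewrite leNgt; apply/negP => ek; apply: Hn; exists k.
have phioo : phi n @[n --> \oo] --> \oo.
  apply/cvgnyPge => A; exists A => // n /= An.
  by have [+ _ _] := Hphi n; exact: leq_trans.
pose f n x := 2 `^ p * (`|a_ (phi n) x| `^ p + `|a x| `^ p) -
  `|a_ (phi n) x - a x| `^ p.
have iZ := @integrable_RZ _ _ _ m setT measurableT.
have iD := @integrable_RD _ _ _ m setT measurableT.
have ia_ n := (La_ n).2; have ia := La.2.
have Lb n := LpB (La_ n) La.
have [] := @Rintegral_fatou _ _ _ m setT measurableT f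
    (fun x => 2 `^ p * (`|a x| `^ p + `|a x| `^ p))
    (2 `^ p * (Lp_energy a + Lp_energy a) - e / 2).
- move=> n; apply: integrable_RB => //; last exact: (Lb _).2.
  by apply: (iZ); exact: iD.
- move=> n x _; rewrite subr_ge0; apply: powRB_le; exact: ltW.
- by apply: measurable_funM => //; apply: measurable_funD;
    apply: measurable_norm_powR; case: La.
- apply: filterS a_a => x Hx _.
  have c1 : a_ (phi n) x @[n --> \oo] --> a x by exact: cvg_comp phioo Hx.
  rewrite -[X in _ --> X]subr0; apply: cvgB.
    apply: cvgM; first exact: cvg_cst.
    apply: cvgD; last exact: cvg_cst.
    exact: cvg_norm_powR.
  rewrite -(powR0 (x := p)) ?gt_eqF// -(normr0 R) -(subrr (a x)).
  by apply: cvg_norm_powR => //; apply: cvgB => //; exact: cvg_cst.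
- move=> n; rewrite RintegralB//; last 2 first.
    by apply: (iZ); exact: iD.
    exact: (Lb _).2.
  rewrite RintegralZl//; last exact: iD.
  rewrite RintegralD//.
  have [_ Nk ek] := Hphi n; have := HN _ Nk.
  rewrite -/(Lp_energy a) -/(Lp_energy (a_ (phi n))) => H1.
  rewrite -/(Lp_energy (fun x => a_ (phi n) x - a x)).
  have : 2 `^ p * Lp_energy (a_ (phi n)) <= 2 `^ p * Lp_energy a + e / 2.
    have := ler_wpM2l (ltW pp) H1; rewrite mulrDr.
    by rewrite (_ : 2 `^ p * (e / (2 * 2 `^ p)) = e / 2)//; field; rewrite gt_eqF.
  by rewrite !mulrDr; exact: ar ek.
- move=> _ _; rewrite RintegralZl//; last exact: iD.
  by rewrite RintegralD//; apply/negP/ar2.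
Qed.

Definition Lp_norm a := Lp_energy a `^ p^-1.

Lemma Lp_normE a : Lp a -> Lnorm m p%:E (EFin \o a) = (Lp_norm a)%:E.
Proof.
move=> [ma ia]; rewrite unlock /Lp_norm /Lp_energy -poweR_EFin fineK//.
exact: integrable_fin_num.
Qed.

Lemma Lp_normD a b : Lp a -> Lp b ->
  Lp_norm (fun x => a x + b x) <= Lp_norm a + Lp_norm b.
Proof.
move=> La Lb.
have := @minkowski_EFin _ _ _ m a b p La.1 Lb.1 (ltW p1).
rewrite (Lp_normE La) (Lp_normE Lb) -EFinD.
have E : Lnorm m p%:E (EFin \o (a \+ b)) = (Lp_norm (fun x => a x + b x))%:E.
  exact: (Lp_normE (LpD La Lb)).
by rewrite E lee_fin.
Qed.

Lemma Lp_normZ k a : Lp a -> Lp_norm (fun x => k * a x) = `|k| * Lp_norm a.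
Proof.
move=> La; rewrite /Lp_norm Lp_energyZ// powRM ?powR_ge0// ?Lp_energy_ge0//.
by rewrite -powRrM divff ?gt_eqF// powRr1.
Qed.

Lemma Lp_norm_ge0 a : 0 <= Lp_norm a. Proof. exact: powR_ge0. Qed.

Lemma Lp_norm_powR a : Lp_norm a `^ p = Lp_energy a.
Proof.
by rewrite /Lp_norm -powRrM mulVf ?gt_eqF// powRr1// Lp_energy_ge0.
Qed.

Lemma Lp_energyE a : Lp_energy a = \int[m]_x (`|a x| `^ p).
Proof. by []. Qed.

Lemma Lp_dualE a h : Lp_dual a h = \int[m]_x (signed_pow p (a x) * h x).
Proof. by []. Qed.

Lemma Lp_normEE a : Lp_norm a = Lp_energy a `^ p^-1.
Proof. by []. Qed.

End lp_energy.

Global Opaque Lp_energy Lp_dual Lp_norm.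

(** * Dominated subsequences *)

Lemma cvg_ge_id (psi : nat -> nat) : (forall n, (n <= psi n)%N) ->
  psi n @[n --> \oo] --> \oo.
Proof.
by move=> H; apply/cvgnyPge => A; exists A => // n /= An; exact: leq_trans (H n).
Qed.

(* Extracted subsequences are only required to satisfy [n <= psi n]: this is
   enough for limits and is stable under composition. *)
Lemma diagonal_subseq (R : realType) (a : nat -> nat -> R) :
  (forall m, exists M : R, forall n, `|a m n| <= M) ->
  exists2 phi : nat -> nat, (forall n, (n <= phi n)%N) &
    forall m, cvgn (a m \o phi).
Proof.
move=> ab.
have /choice [st Hst] : forall mf : nat * (nat -> nat), exists psi : nat -> nat,
    (forall n, (n <= psi n)%N) /\ cvgn (a mf.1 \o mf.2 \o psi).
  move=> [m f] /=; have [M HM] := ab m.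
  have /bolzano_weierstrass [psi ipsi cpsi] : bounded_fun (a m \o f).
    exists M; split; first exact: num_real.
    by move=> y My n _ /=; rewrite (le_trans (HM _))// ltW.
  exists psi; split => //; elim=> // n IH.
  have : (psi n < psi n.+1)%O by rewrite (leW_mono ipsi) ltEnat /=.
  by rewrite ltEnat; exact: leq_ltn_trans.
pose phi := fix phi m := match m with
  | 0 => st (0, id)
  | m'.+1 => phi m' \o st (m'.+1, phi m') end.
have phige m n : (n <= phi m n)%N.
  elim: m n => [n|m IH n] /=; first by have [] := Hst (0, id).
  by apply: leq_trans (IH _); have [] := Hst (m.+1, phi m).
have phic m : cvgn (a m \o phi m).
  case: m => [|m]; first by have [_] := Hst (0, id).
  by have [_] := Hst (m.+1, phi m).
have nest m n : exists2 psi, (forall k, (k <= psi k)%N) &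
    phi (m + n)%N = phi m \o psi.
  elim: n => [|n [psi psige IH]]; first by rewrite addn0; exists id.
  rewrite addnS /=; have [H _] := Hst ((m + n).+1, phi (m + n)%N).
  exists (psi \o st ((m + n).+1, phi (m + n)%N)).
    by move=> k; exact: leq_trans (H k) (psige _).
  by rewrite IH.
exists (fun n => phi n n) => // m.
(* From index m on, the diagonal runs along [phi m]: [phi (m + n)] factors through it, with an inner
   index at least n. *)
have /choice [psi Hpsi] : forall n, exists k, (n <= k)%N /\ phi (m + n)%N (m + n)%N = phi m k.
  move=> n; have [psi psige ->] := nest m n; exists (psi (m + n)%N); split => //.
  by apply: leq_trans (psige _); exact: leq_addl.
apply/cvg_ex; have /cvg_ex [l Hl] := phic m; exists l.
rewrite -(cvg_shiftn m).
have -> : (fun n => (a m \o (fun n => phi n n)) (n + m)%N) =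
    (a m \o phi m) \o psi.
  by apply/funext => n /=; have [_ E] := Hpsi n; rewrite addnC E.
by apply: cvg_comp Hl; apply: cvg_ge_id => n; case: (Hpsi n).
Qed.

(** The threshold t solves t^(r - r') = e: above it the r'-th power dominates, below it the p-th
    one. It upgrades the Cauchy property from L^p to L^r when a higher norm stays bounded. *)
Lemma powR_interpolation (R : realType) (p r r' e : R) :
  0 < p -> p <= r -> r < r' -> 0 < e ->
  exists2 C : R, 0 <= C & forall a : R, 0 <= a -> a `^ r <= e * a `^ r' + C * a `^ p.
Proof.
move=> p0 pr rr' e0; have r0 : 0 < r by rewrite (lt_le_trans p0).
have rr'n : r - r' != 0 by rewrite subr_eq0 lt_eqF.
pose t := e `^ (r - r')^-1; have t0 : 0 < t by exact: powR_gt0.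
exists (t `^ (r - p)); first exact: powR_ge0.
move=> a a0; have [->|an0] := eqVneq a 0.
  by rewrite !powR0 ?gt_eqF// ?mulr0 ?addr0// ?(lt_trans _ rr').
have [at_|ta] := leP a t.
  apply: (@le_trans _ _ (t `^ (r - p) * a `^ p)); last first.
    by rewrite lerDr mulr_ge0 ?powR_ge0// ltW.
  have -> : a `^ r = a `^ (r - p) * a `^ p.
    by rewrite -powRD ?subrK// an0 implybT.
  by rewrite ler_wpM2r ?powR_ge0// ler_powR_base// subr_ge0.
apply: (@le_trans _ _ (e * a `^ r')); last first.
  by rewrite lerDl mulr_ge0 ?powR_ge0.
have -> : a `^ r = a `^ (r - r') * a `^ r'.
  by rewrite -powRD ?subrK// an0 implybT.
rewrite ler_wpM2r ?powR_ge0//.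
have <- : t `^ (r - r') = e by rewrite /t -powRrM mulVf// powRr1// ltW.
rewrite -(opprB r' r) !powRN lef_pV2 ?posrE ?powR_gt0//; last first.
  by rewrite lt_neqAle eq_sym an0.
by apply: ler_powR_base; rewrite ?ltW// subr_gt0.
Qed.

Lemma exprn_powR (R : realType) (a r : R) n : 0 <= a ->
  (a ^+ n) `^ r = (a `^ r) ^+ n.
Proof.
by move=> a0; rewrite -(powR_mulrn n a0) powRAC -(powR_mulrn n (powR_ge0 a r)).
Qed.

Lemma geometric_sum_le (R : realType) (q : R) n : 0 <= q < 1 ->
  \sum_(0 <= k < n) q ^+ k <= (1 - q)^-1.
Proof.
move=> /andP[q0 q1]; rewrite -[leRHS]mul1r ler_pdivlMr ?subr_gt0// mulrC big_mkord.
by rewrite -(opprB q) mulNr -subrX1 opprB gerBl exprn_ge0.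
Qed.

Lemma geometric_nneseries_le (R : realType) (q : R) : 0 <= q < 1 ->
  (\sum_(k <oo) (q ^+ k)%:E <= ((1 - q)^-1)%:E)%E.
Proof.
move=> q01; apply: lime_le.
  by apply: is_cvg_nneseries => k _ _; rewrite lee_fin exprn_ge0//; case/andP: q01.
by apply: nearW => n; rewrite sumEFin lee_fin geometric_sum_le.
Qed.

Section extraction.
Context d (T : measurableType d) (R : realType).
Variables (m : {measure set T -> \bar R}) (D : set T).
Hypothesis mD : measurable D.

(** Convexity of the p-th power at the average c: the linear term integrates to zero. *)
Lemma Rintegral_jensen (p : R) (g : T -> R) : 1 < p ->
  (0 < m D)%E -> (m D < +oo)%E -> measurable_fun D g ->
  m.-integrable D (EFin \o (fun x => `|g x| `^ p)) ->
  m.-integrable D (EFin \o g) /\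
  fine (m D) * `|(\int[m]_(x in D) g x) / fine (m D)| `^ p <=
    \int[m]_(x in D) (`|g x| `^ p).
Proof.
move=> p1 mD0 mDoo mg ig.
have icst (k : R) : m.-integrable D (EFin \o cst k).
  apply/integrableP; split; first exact/measurable_EFinP/measurable_cst.
  rewrite (eq_integral (cst `|k|%:E))// integral_cst// lte_mul_pinfty//.
have V0 : 0 < fine (m D) by rewrite fine_gt0// mD0.
have ig1 : m.-integrable D (EFin \o g).
  apply: (integrable_dom mD mg _ (integrable_RD mD (icst 1) ig)).
  move=> x _; rewrite -[leLHS](powRr1 (normr_ge0 _)).
  by apply: powR_le_mixed => //; exact: ltW.
split => //; set c := _ / _.
have H x : `|c| `^ p + p * signed_pow p c * (g x - c) <= `|g x| `^ p.
  exact: powR_convex.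
have i1 := integrable_RB mD ig1 (icst c).
have i2 := integrable_RZ mD (p * signed_pow p c) i1.
have := @le_Rintegral _ _ _ m D _ _ mD (integrable_RD mD (icst (`|c| `^ p)) i2) ig
  (fun x _ => H x).
rewrite RintegralD// RintegralZl// RintegralB// !Rintegral_cst//.
by rewrite /c divfK ?gt_eqF// subrr mulr0 addr0 mulrC.
Qed.

(** The Riesz-Fischer extraction, keeping the majorant. No triangle inequality in L^r is used, hence
    any r > 0 is allowed: the increments are bounded pointwise by a geometric sequence times one
    function whose r-th power is integrable. *)
Lemma Lr_cauchy_dominated (r : R) (f_ : (T -> R)^nat) : 0 < r ->
  (forall n, measurable_fun setT (f_ n)) ->
  (forall n, m.-integrable D (EFin \o (fun x => `|f_ n x| `^ r))) ->
  (forall e : R, 0 < e -> exists N, forall n k, (N <= n)%N -> (N <= k)%N ->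
     (\int[m]_(x in D) (`|f_ n x - f_ k x| `^ r)%:E <= e%:E)%E) ->
  exists (psi : nat -> nat) (f h : T -> R), [/\ forall n, (n <= psi n)%N, measurable_fun setT f,
    measurable_fun D h /\ m.-integrable D (EFin \o (fun x => `|h x| `^ r)),
    {ae m, forall x, D x -> f_ (psi n) x @[n --> \oo] --> f x} &
    {ae m, forall x, D x -> forall n, `|f_ (psi n) x| <= h x}].
Proof.
move=> r0 mf if_ Hc.
have /choice [N HN] : forall k, exists N, forall n l, (N <= n)%N -> (N <= l)%N ->
     (\int[m]_(x in D) (`|f_ n x - f_ l x| `^ r)%:E <= ((4^-1) ^+ k)%:E)%E.
  by move=> k; apply: Hc; rewrite exprn_gt0.
(* Summing the thresholds yields indices that exceed both k and [N k], and whose successor exceeds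
   [N k] as well. *)
pose psi k := (\sum_(i < k.+1) (N i).+1)%N.
have psiS k : psi k.+1 = (psi k + (N k.+1).+1)%N by rewrite /psi big_ord_recr.
have psiN k : (N k <= psi k)%N.
  case: k => [|k]; first by rewrite /psi big_ord_recr big_ord0 /= add0n leqnSn.
  by rewrite psiS (leq_trans (leqnSn _))// leq_addl.
have psige k : (k <= psi k)%N.
  elim: k => // k IH; by rewrite psiS addnS ltnS (leq_trans IH)// leq_addr.
have psiN' k : (N k <= psi k.+1)%N.
  by rewrite (leq_trans (psiN k))// psiS leq_addr.
pose dk k x := f_ (psi k.+1) x - f_ (psi k) x.
have mdk k : measurable_fun setT (dk k) by exact: measurable_funB.
(* The weight 2^k still leaves the summable bound (2 / 4)^k, while a single term of the series then
   gives |dk| <= H^(1/r) q^k with q = 2^(-1/r) < 1. *)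
pose H x : \bar R := (\sum_(k <oo) (2 ^+ k * `|dk k x| `^ r)%:E)%E.
have mt k : measurable_fun D (fun x => (2 ^+ k * `|dk k x| `^ r)%:E).
  apply: measurable_funTS; apply/measurable_EFinP; apply: measurable_funM => //.
  exact: measurable_norm_powR.
have t0 k x : D x -> (0 <= (2 ^+ k * `|dk k x| `^ r)%:E)%E.
  by move=> _; rewrite lee_fin mulr_ge0// ?exprn_ge0 ?powR_ge0.
have mH : measurable_fun D H.
  apply: ge0_emeasurable_sum => [k x|k]; first by move=> Dx _; exact: t0.
  by move=> _; exact: mt.
have HI : (\int[m]_(x in D) H x < +oo)%E.
  rewrite /H integral_nneseries//.
  apply: (@le_lt_trans _ _ (\sum_(k <oo) ((2^-1) ^+ k)%:E)%E).
    apply: lee_nneseries => [k *|k *]; first by apply: integral_ge0 => x; exact: t0.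
    under eq_integral do rewrite EFinM.
    rewrite ge0_integralZl_EFin ?exprn_ge0//; last first.
      by apply: measurable_funTS; apply/measurable_EFinP; exact: measurable_norm_powR.
    apply: (@le_trans _ _ ((2 ^+ k)%:E * ((4^-1) ^+ k)%:E)%E).
      by rewrite lee_wpmul2l ?lee_fin ?exprn_ge0//; exact: HN.
    by rewrite -EFinM lee_fin -exprMn (_ : 2 * 4^-1 = 2^-1 :> R)//; field.
  by apply: le_lt_trans (geometric_nneseries_le _) _; rewrite ?ltry// invf_lt1 ?ltr1n// invr_ge0 ler0n.
have Hfin : {ae m, forall x, D x -> H x \is a fin_num}.
  apply: (integrable_ae mD); apply/integrableP; split => //.
  rewrite (eq_integral H)// => x /set_mem Dx; rewrite gee0_abs//.
  exact: nneseries_ge0.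
pose q : R := (2^-1) `^ r^-1.
have q0 : 0 < q by rewrite powR_gt0.
have q1 : q < 1.
  have := @gt0_ltr_powR R r^-1; rewrite invr_gt0 => /(_ r0 (2^-1) 1).
  by rewrite powR1; apply; rewrite ?nnegrE// invf_lt1// ltr1n.
have Hx0 x : D x -> 0 <= fine (H x).
  by move=> Dx; rewrite fine_ge0// nneseries_ge0// => k _ _; exact: t0.
have dkH x k : D x -> H x \is a fin_num -> `|dk k x| <= fine (H x) `^ r^-1 * q ^+ k.
  move=> Dx Hx.
  have : ((2 ^+ k * `|dk k x| `^ r)%:E <= H x)%E.
    rewrite /H; apply: le_trans (nneseries_lim_ge k.+1 _); last first.
      by move=> i _ _; exact: t0.
    rewrite big_nat_recr//= leeDr// sume_ge0// => i _; exact: t0.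
  move=> H1; have {}H1 : `|dk k x| `^ r <= fine (H x) * (2^-1) ^+ k.
    by rewrite exprVn ler_pdivlMr ?exprn_gt0// mulrC -lee_fin fineK.
  have -> : q ^+ k = ((2^-1) ^+ k) `^ r^-1.
    by rewrite exprn_powR// invr_ge0.
  rewrite -powRM ?exprn_ge0//; last exact: Hx0.
  have -> : `|dk k x| = (`|dk k x| `^ r) `^ r^-1.
    by rewrite -powRrM divff ?gt_eqF// powRr1.
  by apply: ler_powR_base; rewrite ?invr_ge0 ?powR_ge0 ?(ltW r0).
pose h x : R := `|f_ (psi 0) x| + (1 - q)^-1 * fine (H x) `^ r^-1.
have fE n x : f_ (psi n) x = f_ (psi 0) x + series (dk ^~ x) n.
  by rewrite /series/= telescope_sumr// addrC subrK.
(* The upper limit is measurable on the whole space, including where the sequence diverges. *)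
pose f x := fine (limn_esup (fun n => (f_ (psi n) x)%:E)).
have mfH : measurable_fun D (fun x => fine (H x)).
  by apply: (measurableT_comp (fine_measurable _)).
exists psi, f, h; split => //.
- apply: (measurableT_comp (fine_measurable _)) => //.
  apply: measurable_fun_limn_esup => n; exact/measurable_EFinP.
- have mh : measurable_fun D h.
    apply: measurable_funD; first by apply: measurable_funTS; exact: measurableT_comp.
    apply: measurable_funM => //.
    exact: (measurableT_comp (measurable_powR _)).
  split => //.
  have iH : m.-integrable D (EFin \o (fine \o H)).
    apply: (@le_integrable _ _ _ m D mD _ H).
    + exact/measurable_EFinP.
    + by move=> x Dx /=; case: (H x) => [y| |] /=; rewrite ?normr0 ?leey.
    + apply/integrableP; split => //.
      rewrite (eq_integral H)// => x /set_mem Dx; rewrite gee0_abs//.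
      by apply: nneseries_ge0 => *; exact: t0.
  have := integrable_RZ mD (2 `^ r) (integrable_RD mD (if_ (psi 0))
    (integrable_RZ mD ((1 - q)^-1 `^ r) iH)).
  apply: integrable_dom => //.
    by apply: (measurableT_comp (measurable_powR _)); exact: measurableT_comp.
  move=> x Dx; rewrite ger0_norm ?powR_ge0//.
  have K0 : 0 <= (1 - q)^-1 * fine (H x) `^ r^-1.
    by rewrite mulr_ge0 ?powR_ge0// invr_ge0 subr_ge0 ltW.
  rewrite ger0_norm ?addr_ge0//.
  apply: le_trans (powRD_le (ltW r0) (normr_ge0 _) K0) _.
  rewrite powRM ?powR_ge0// ?invr_ge0 ?subr_ge0 ?(ltW q1)//.
  by rewrite -powRrM mulVf ?gt_eqF// powRr1//= Hx0.
- apply: filterS Hfin => x Hx Dx.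
  have /cvg_ex[l Hl] : cvgn (series (dk ^~ x)).
    apply: normed_cvg; apply: (@series_le_cvg _ _ (geometric (fine (H x) `^ r^-1) q)).
    + by move=> n; exact: normr_ge0.
    + by move=> n; rewrite /geometric/= mulr_ge0 ?powR_ge0// exprn_ge0// ltW.
    + by move=> n; apply: dkH => //; exact: Hx.
    + by apply: is_cvg_geometric_series; rewrite gtr0_norm.
  have c : f_ (psi n) x @[n --> \oo] --> f_ (psi 0) x + l.
    under eq_fun do rewrite fE.
    by apply: cvgD => //; exact: cvg_cst.
  rewrite /f (cvg_limn_einf_sup (l := (f_ (psi 0) x + l)%:E) _).2//.
  by apply/fine_cvgP; split; [near=> n|exact: c].
- apply: filterS Hfin => x Hx Dx n; rewrite fE (le_trans (ler_normD _ _))//.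
  rewrite lerD2l (le_trans (ler_norm_sum _ _ _))//.
  apply: (@le_trans _ _ (\sum_(0 <= k < n) (fine (H x) `^ r^-1 * q ^+ k))).
    by apply: ler_sum => k _; apply: dkH => //; exact: Hx.
  rewrite -mulr_sumr mulrC ler_wpM2r ?powR_ge0//.
  by rewrite geometric_sum_le// q1 ltW.
Unshelve. all: by end_near. Qed.

End extraction.

(** * Boxes in Euclidean space *)

Section row_vectors.
Context {R : realType} {N : nat}.
Implicit Types (x y a : 'rV[R]_N) (Omega : set 'rV[R]_N).
Local Notation mu := (lebesgue_rV R N).

Lemma coord_le_enorm x i : `|x ord0 i| <= enorm x.
Proof.
rewrite /enorm -sqrtr_sqr ler_sqrt ?sumr_ge0//; last by move=> ? _; exact: sqr_ge0.
rewrite (bigD1 i)//= lerDl sumr_ge0// => ? _; exact: sqr_ge0.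
Qed.

Lemma enorm_le x (r : R) : 0 <= r -> (forall i, `|x ord0 i| <= r) ->
  enorm x <= N%:R * r.
Proof.
move=> r0 xr; have Nr0 : 0 <= N%:R * r by rewrite mulr_ge0.
rewrite /enorm -[leRHS]ger0_norm// -sqrtr_sqr ler_sqrt ?sqr_ge0//.
apply: (@le_trans _ _ (\sum_(i < N) r ^+ 2)).
  by apply: ler_sum => i _; rewrite -[leLHS]real_normK ?num_real// lerXn2r ?nnegrE.
rewrite sumr_const card_ord -[leLHS]mulr_natl exprMn ler_wpM2r ?sqr_ge0//.
by case: N => [|n]; rewrite ?expr0n//= -natrX ler_nat expnS leq_pmulr// expn_gt0.
Qed.

Lemma enorm_ge0 x : 0 <= enorm x. Proof. exact: sqrtr_ge0. Qed.

Lemma enormN x : enorm (- x) = enorm x.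
Proof. by congr Num.sqrt; apply: eq_bigr => i _; rewrite mxE sqrrN. Qed.

Lemma enormBC x y : enorm (x - y) = enorm (y - x).
Proof. by rewrite -enormN opprB. Qed.

Lemma enorm_eq0 x : enorm x = 0 -> x = 0.
Proof.
move=> x0; apply/rowP => i; apply/eqP; rewrite mxE -normr_le0 -x0.
exact: coord_le_enorm.
Qed.

Lemma measurable_enormB :
  measurable_fun setT (fun z : 'rV[R]_N * 'rV[R]_N => enorm (z.1 - z.2)).
Proof.
have ms : measurable_fun setT (@Num.sqrt R).
  by apply: continuous_measurable_fun; exact: sqrt_continuous.
rewrite /enorm; apply: (measurableT_comp ms).
apply: measurable_sum => i; apply: measurable_funX.
under eq_fun do rewrite !mxE.
by apply: measurable_funB; apply: (measurableT_comp (measurable_row_coord i)).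
Qed.

Definition cbox a (r : R) : set 'rV[R]_N :=
  [set x | forall i, `|x ord0 i - a ord0 i| <= r].

Let cboxE a r : cbox a r = [set x | forall i,
  (\row_j (a ord0 j - r)) ord0 i <= x ord0 i <= (\row_j (a ord0 j + r)) ord0 i].
Proof.
by apply/seteqP; split => x /= H i; have := H i; rewrite !mxE ler_distl.
Qed.

Lemma measurable_cbox a r : measurable (cbox a r).
Proof. by rewrite cboxE; exact: measurable_rV_box. Qed.

Lemma lebesgue_cbox a (r : R) : 0 <= r -> mu (cbox a r) = ((2 * r) ^+ N)%:E.
Proof.
move=> r0; rewrite cboxE lebesgue_rV_box; last first.
  by move=> i; rewrite !mxE lerD2l; lra.
congr EFin; rewrite -[in RHS](card_ord N) -prodr_const.
by apply: eq_bigr => i _; rewrite !mxE; ring.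
Qed.

Lemma mem_cbox a (r : R) : 0 <= r -> cbox a r a.
Proof. by move=> r0 i; rewrite subrr normr0. Qed.

Lemma enorm_cbox a x y (r : R) : 0 <= r -> cbox a r x -> cbox a r y ->
  enorm (x - y) <= N%:R * (2 * r).
Proof.
move=> r0 ax ay; apply: enorm_le; first by rewrite mulr_ge0.
move=> i; rewrite !mxE -(subrKA (a ord0 i)) (le_trans (ler_normD _ _))//.
by rewrite mulr_natl mulr2n lerD// distrC.
Qed.

Lemma open_cbox Omega x : open Omega -> Omega x ->
  exists2 r : R, 0 < r & cbox x r `<=` Omega.
Proof.
move=> oO Ox; have /nbhs_ballP[e /= e0 He] : nbhs x Omega by exact: open_nbhs_nbhs.
exists (e / 2); first by rewrite divr_gt0.
move=> y Hy; apply: He; split => // i j; rewrite (ord1 i) /ball/= distrC.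
by rewrite (le_lt_trans (Hy j))// ltr_pdivrMr// ltr_pMr// ltr1n.
Qed.

(** The sigma-algebra is generated by the coordinates, not by the topology: an open set is recovered
    as the countable union of the boxes with rational centre and half-side 1 / (k + 1) that it
    contains. *)
Lemma open_measurable_rV Omega : open Omega -> measurable Omega.
Proof.
move=> oO.
pose B (qk : 'rV[rat]_N * nat) := cbox (map_mx ratr qk.1 : 'rV[R]_N) (qk.2.+1%:R^-1).
pose F n := if unpickle n is Some qk then
  (if `[< B qk `<=` Omega >] then B qk else set0) else set0.
have -> : Omega = \bigcup_n F n.
  apply/seteqP; split => [x Ox|x [n _]]; last first.
    by rewrite /F; case: unpickle => // qk; case: asboolP => // H /H.
  have [r r0 Hr] := open_cbox oO Ox.
  have [k Hk] : exists k : nat, k.+1%:R^-1 < r / 2.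
    have r20 : 0 < r / 2 by rewrite divr_gt0.
    have [k _ Hk] := near_infty_natSinv_lt (PosNum r20).
    by exists k; exact: Hk (leqnn k).
  have /choice [q Hq] : forall i, exists q : rat, `|x ord0 i - ratr q| <= k.+1%:R^-1.
    move=> i; have [] := @rat_in_itvoo R (x ord0 i) (x ord0 i + k.+1%:R^-1).
      by rewrite ltrDl invr_gt0.
    move=> q; rewrite in_itv/= => /andP[q1 q2]; exists q.
    by rewrite distrC ger0_norm ?subr_ge0 ?(ltW q1)// lerBlDl ltW.
  exists (pickle (\row_i q i, k)) => //; rewrite /F pickleK.
  have Bx : B (\row_i q i, k) x by move=> i; rewrite !mxE.
  case: asboolP => // nB; exfalso; apply: nB => y By; apply: Hr => i.
  have := Bx i; have := By i; rewrite /= !mxE => H1 H2.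
  rewrite -(subrKA (ratr (q i))) (le_trans (ler_normD _ _))//.
  by rewrite [r]splitr lerD//; [|rewrite distrC]; rewrite ltW// (le_lt_trans _ Hk).
apply: bigcupT_measurable => n; rewrite /F; case: unpickle => // qk.
by case: ifP => // _; exact: measurable_cbox.
Qed.

Lemma bounded_set_cbox Omega : bounded_set Omega ->
  exists2 M : R, 0 < M & Omega `<=` cbox 0 M.
Proof.
move=> [M [Mr HM]]; exists (`|M| + 1); first by rewrite ltr_wpDl.
move=> x Ox i; rewrite mxE subr0; apply: le_trans (HM (`|M| + 1) _ _ Ox); last first.
  by rewrite (le_lt_trans (ler_norm _))// ltrDl.
rewrite /Num.norm/= mx_normrE.
exact: (le_bigmax _ (fun ij : 'I_1 * 'I_N => `|x ij.1 ij.2|) (ord0, i)).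
Qed.

Lemma finite_cbox_cover (M e : R) : 0 < M -> 0 < e ->
  exists cs : seq 'rV[R]_N, forall x, cbox 0 M x -> exists2 c, c \in cs & cbox c e x.
Proof.
move=> M0 e0; pose K := (Num.truncn (M / e)).+1.
have MK : M <= K%:R * e.
  by rewrite -ler_pdivrMr// ltW// /K truncnS_gt.
exists [seq \row_i ((f i : nat)%:R * e - K%:R * e) |
  f : {ffun 'I_N -> 'I_(2 * K).+1}] => x xM.
have /choice [f Hf] : forall i, exists j : 'I_(2 * K).+1,
    `|x ord0 i - (j%:R * e - K%:R * e)| <= e.
  move=> i; have := xM i; rewrite mxE subr0 ler_norml => /andP[x1 x2].
  pose t := (x ord0 i + K%:R * e) / e.
  have t0 : 0 <= t by rewrite divr_ge0 ?(ltW e0)//; lra.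
  have tK : (Num.truncn t < (2 * K).+1)%N.
    have /andP[t1 _] := truncn_itv t0.
    rewrite ltnS -(ler_nat R) (le_trans t1)// ler_pdivrMr//.
    by rewrite natrM; lra.
  exists (Ordinal tK) => /=.
  have /andP[t1 t2] := truncn_itv t0.
  have te : t * e = x ord0 i + K%:R * e by rewrite divfK// gt_eqF.
  have : (Num.truncn t)%:R * e <= t * e by rewrite ler_wpM2r// ltW.
  have : t * e <= (Num.truncn t)%:R * e + e.
    by rewrite -[X in _ + X]mul1r -mulrDl ler_wpM2r ?(ltW e0)// natr1 ltW.
  by rewrite te ler_norml; lra.
exists (\row_i ((f i : nat)%:R * e - K%:R * e)).
  apply/mapP; exists [ffun i => f i]; first by rewrite mem_enum.
  by apply/rowP => i; rewrite !mxE ffunE.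
by move=> i; rewrite mxE; exact: Hf.
Qed.

Lemma ae_prod (P : 'rV[R]_N -> Prop) : {ae mu, forall x, P x} ->
  {ae (mu \x mu)%E, forall z : 'rV[R]_N * 'rV[R]_N, P z.1 /\ P z.2}.
Proof.
move=> [A [mA A0 PA]]; exists ((A `*` setT) `|` (setT `*` A)).
have mAT : measurable (A `*` [set: 'rV[R]_N]) by exact: measurableX.
have mTA : measurable ([set: 'rV[R]_N] `*` A) by exact: measurableX.
split; first exact: measurableU.
  transitivity ((mu \x mu)%E (A `*` [set: 'rV[R]_N])).
    apply: measureU0 => //; transitivity (mu setT * mu A)%E.
      exact: product_measure1E.
    by rewrite [X in (_ * X)%E]A0 mule0.
  transitivity (mu A * mu setT)%E; first exact: product_measure1E.
  by rewrite [X in (X * _)%E]A0 mul0e.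
move=> [x y] /= /not_andP[nP|nP]; [left|right]; split => //; exact: PA.
Qed.

End row_vectors.

(** * Fractional differences and the Sobolev inequality *)

Section fractional_space.
Context {R : realType} {N : nat}.
Variables (Omega : set 'rV[R]_N) (s p : R).
Hypotheses (oO : open Omega) (bO : bounded_set Omega).
Hypotheses (s01 : 0 < s < 1) (p1 : 1 < p) (spN : s * p < N%:R).
Local Notation mu := (lebesgue_rV R N).
Local Notation mu2 := (mu \x mu)%E.
Implicit Types (u v w : 'rV[R]_N -> R) (z : 'rV[R]_N * 'rV[R]_N).

Let p0 : 0 < p. Proof. by rewrite (lt_trans _ p1). Qed.
Let s0 : 0 < s. Proof. by case/andP: s01. Qed.
Let Nsp0 : 0 < N%:R + s * p.
Proof. by rewrite ltr_wpDl// mulr_gt0. Qed.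
Let mO : measurable Omega. Proof. exact: open_measurable_rV. Qed.

Definition frac_ker z : R := enorm (z.1 - z.2) `^ (N%:R + s * p).

(* The weight is spread evenly, so that the Gagliardo energy is the L^p energy
   of [frac_diff u] (on the diagonal [0 `^ (- p^-1) = 0]). *)
Definition frac_diff u z : R := (u z.1 - u z.2) * frac_ker z `^ (- p^-1).

Lemma frac_ker_ge0 z : 0 <= frac_ker z. Proof. exact: powR_ge0. Qed.

Let ker_powp z : (frac_ker z `^ (- p^-1)) `^ p = (frac_ker z)^-1.
Proof.
by rewrite -powRrM mulNr mulVf ?gt_eqF// powR_inv1// frac_ker_ge0.
Qed.

Lemma frac_diff_powR u z :
  `|frac_diff u z| `^ p = `|u z.1 - u z.2| `^ p / frac_ker z.
Proof.
by rewrite normrM powRM// (ger0_norm (powR_ge0 _ _)) ker_powp.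
Qed.

Lemma measurable_frac_ker : measurable_fun setT frac_ker.
Proof. exact: (measurableT_comp (measurable_powR _) measurable_enormB). Qed.

Lemma measurable_frac_diff u : measurable_fun setT u ->
  measurable_fun setT (frac_diff u).
Proof.
move=> mu_; apply: measurable_funM.
  apply: measurable_funB; first exact: (measurableT_comp mu_ measurable_fst).
  exact: (measurableT_comp mu_ measurable_snd).
exact: (measurableT_comp (measurable_powR _) measurable_frac_ker).
Qed.

Lemma frac_diffD u v : frac_diff (fun x => u x + v x) =
  fun z => frac_diff u z + frac_diff v z.
Proof. by apply/funext => z; rewrite /frac_diff; ring. Qed.

Lemma frac_diffB u v : frac_diff (fun x => u x - v x) =
  fun z => frac_diff u z - frac_diff v z.
Proof. by apply/funext => z; rewrite /frac_diff; ring. Qed.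

Lemma frac_diffZ k u : frac_diff (fun x => k * u x) =
  fun z => k * frac_diff u z.
Proof. by apply/funext => z; rewrite /frac_diff; ring. Qed.

(** The inverse kernel is the p-th power of the weight in [frac_diff]: p - 1 of these factors enter
    the signed power and the last one goes to the difference of w. *)
Lemma frac_plapE u w :
  frac_plap s p u w = Lp_dual mu2 p (frac_diff u) (frac_diff w).
Proof.
have ar (a b k k' : R) : a * b * (k * k') = k' * a * (b * k) by ring.
rewrite /frac_plap Lp_dualE; apply: eq_Rintegral => z _; rewrite /frac_diff.
rewrite [_ * frac_ker _ `^ _]mulrC signed_powZ ?powR_ge0//.
rewrite -/(signed_pow p (u z.1 - u z.2)) -/(frac_ker z) -ker_powp.
by rewrite -(@mulr_powRB1 _ (frac_ker z `^ (- p^-1)) p) ?powR_ge0//; exact: ar.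
Qed.

Definition zero_outside u : Prop := {ae mu, forall x, ~ Omega x -> u x = 0}.

Let mfd u : measurable_fun setT u ->
  measurable_fun setT (fun z => (`|frac_diff u z| `^ p)%:E).
Proof.
move=> mu_; apply/measurable_EFinP; apply: measurable_norm_powR.
exact: measurable_frac_diff.
Qed.

Lemma gagliardoE u : measurable_fun setT u -> zero_outside u ->
  gagliardo Omega s p u = (\int[mu2]_z (`|frac_diff u z| `^ p)%:E)%E.
Proof.
move=> mu_ u0; have mf := mfd mu_.
have mA : measurable (~` ((~` Omega) `*` (~` Omega))).
  by apply: measurableC; apply: measurableX; exact: measurableC.
rewrite /gagliardo integral_mkcond; apply: ae_eq_integral => //.
  apply/(measurable_restrictT _ _).1 => //.
  apply: measurable_funTS; under eq_fun do rewrite -/(frac_ker _) -frac_diff_powR.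
  exact: mf.
apply: filterS (ae_prod u0) => z [z1 z2] _; rewrite patchE.
case: ifPn => zA; first by rewrite frac_diff_powR.
move: zA; rewrite notin_setE /= => /contrapT [nz1 nz2].
by rewrite frac_diff_powR z1// z2// subrr normr0 powR0 ?gt_eqF// mul0r.
Qed.

Local Notation fLp u := (Lp mu2 p (frac_diff u)).
Local Notation energy u := (Lp_energy mu2 p (frac_diff u)).

Lemma X0_fLp u : X0 Omega s p u -> fLp u.
Proof.
move=> [mu_ iu u0 gu]; split; first exact: measurable_frac_diff.
apply/integrableP; split; first exact: mfd.
under eq_integral do rewrite /= ger0_norm ?powR_ge0//.
by rewrite -gagliardoE.
Qed.

Lemma X0norm_Lp u : X0 Omega s p u -> X0norm Omega s p u = Lp_norm mu2 p (frac_diff u).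
Proof.
by move=> [mu_ iu u0 gu]; rewrite /X0norm gagliardoE// Lp_normEE Lp_energyE.
Qed.

(** Density at x of the Gagliardo energy; by Tonelli it integrates to the energy, so it is finite
    almost everywhere. *)
Definition gam u x : \bar R := (\int[mu]_y (`|frac_diff u (x, y)| `^ p)%:E)%E.

Lemma measurable_gam u : measurable_fun setT u -> measurable_fun setT (gam u).
Proof.
move=> /mfd mu_; apply: (@measurable_fun_fubini_tonelli_F _ _ _ _ _ mu
  (fun z => (`|frac_diff u z| `^ p)%:E)) => //.
Qed.

Lemma gam_ge0 u x : (0 <= gam u x)%E.
Proof. by apply: integral_ge0 => y _; rewrite lee_fin powR_ge0. Qed.

Lemma integral_gam u : measurable_fun setT u -> fLp u ->
  (\int[mu]_x gam u x)%E = (energy u)%:E.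
Proof.
move=> mu_ [_ iu]; rewrite Lp_energyE fineK; last exact: (integrable_fin_num _ iu).
rewrite (@fubini_tonelli1 _ _ _ _ _ mu mu (fun z => (`|frac_diff u z| `^ p)%:E))//.
exact: mfd.
Qed.

Lemma gam_finite u : measurable_fun setT u -> fLp u ->
  {ae mu, forall x, (gam u x < +oo)%E}.
Proof.
move=> mu_ Lu; have : {ae mu, forall x, setT x -> gam u x \is a fin_num}.
  apply: integrable_ae => //; apply/integrableP; split; first exact: measurable_gam.
  under eq_integral do rewrite gee0_abs ?gam_ge0//.
  by rewrite integral_gam// ltry.
by apply: filterS => x /(_ I); rewrite ge0_fin_numE// gam_ge0.
Qed.

(** * Averages on boxes and a Hedberg-type inequality *)

Definition mean u (B : set 'rV[R]_N) : R := (\int[mu]_(y in B) u y) / fine (mu B).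

(** Jensen's inequality for y |-> u x - u y on B, where the kernel is at most rho^(N + sp). It also
    yields the integrability of u on B from one point of finite density. *)
Lemma mean_dist u x (B : set 'rV[R]_N) (rho : R) : measurable_fun setT u ->
  (gam u x < +oo)%E -> measurable B -> (0 < mu B < +oo)%E -> 0 < rho ->
  (forall y, B y -> enorm (x - y) <= rho) ->
  mu.-integrable B (EFin \o u) /\
  fine (mu B) * `|u x - mean u B| `^ p <= rho `^ (N%:R + s * p) * fine (gam u x).
Proof.
move=> mu_ gx mB /andP[B0 Boo] rho0 Br.
have msec : measurable_fun setT (fun y => `|frac_diff u (x, y)| `^ p).
  apply: measurable_norm_powR.
  exact: (measurableT_comp (measurable_frac_diff mu_) (measurable_pair1 x)).
have isec : mu.-integrable setT (EFin \o (fun y => `|frac_diff u (x, y)| `^ p)).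
  apply/integrableP; split; first exact/measurable_EFinP.
  under eq_integral do rewrite /= ger0_norm ?powR_ge0//.
  exact: gx.
have isecB := integrableS measurableT mB (@subsetT _ B) isec.
have gle y : B y -> `|u x - u y| `^ p <=
    rho `^ (N%:R + s * p) * `|frac_diff u (x, y)| `^ p.
  move=> By; rewrite frac_diff_powR /= mulrCA.
  (* A vanishing kernel means x = y: the quotient is then 0 by convention, and so is the left-hand
     side. *)
  have [k0|k0] := eqVneq (frac_ker (x, y)) 0.
    have /enorm_eq0/eqP := powR_eq0_eq0 k0; rewrite subr_eq0 => /eqP /= ->.
    by rewrite subrr normr0 powR0 ?mul0r// gt_eqF.
  rewrite -[leLHS]mulr1 ler_wpM2l ?powR_ge0//.
  rewrite ler_pdivlMr ?mul1r; last by rewrite lt_neqAle eq_sym k0 frac_ker_ge0.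
  by rewrite /frac_ker/= ler_powR_base ?Br ?enorm_ge0// ltW.
have mg : measurable_fun B (fun y => u x - u y).
  by apply: measurable_funB => //; exact: measurable_funTS.
have ig : mu.-integrable B (EFin \o (fun y => `|u x - u y| `^ p)).
  apply: (integrable_dom mB _ _ (integrable_RZ mB (rho `^ (N%:R + s * p)) isecB)).
    by apply: (measurableT_comp (measurable_powR _)); exact: measurableT_comp.
  by move=> y By; rewrite ger0_norm ?powR_ge0//; exact: gle.
have [ig1 J] := Rintegral_jensen mB p1 B0 Boo mg ig.
have V0 : 0 < fine (mu B) by rewrite fine_gt0// B0.
have icst (k : R) : mu.-integrable B (EFin \o cst k).
  apply/integrableP; split; first exact/measurable_EFinP/measurable_cst.
  by rewrite (eq_integral (cst `|k|%:E))// integral_cst// lte_mul_pinfty.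
have iu : mu.-integrable B (EFin \o u).
  have := integrable_RB mB (icst (u x)) ig1; apply: eq_integrable => // y _ /=.
  by rewrite subKr.
split => //.
have E : (\int[mu]_(y in B) (u x - u y)) / fine (mu B) = u x - mean u B.
  rewrite RintegralB//; last exact: icst.
  by rewrite Rintegral_cst// mulrBl mulfK ?gt_eqF.
rewrite -E; apply: le_trans J _.
apply: (@le_trans _ _ (\int[mu]_(y in B)
    (rho `^ (N%:R + s * p) * `|frac_diff u (x, y)| `^ p))).
  by apply: le_Rintegral => //; exact: integrable_RZ.
rewrite RintegralZl// ler_wpM2l ?powR_ge0//.
rewrite -lee_fin fineK; last exact: (integrable_fin_num mB isecB).
rewrite fineK ?ge0_fin_numE ?gam_ge0//.
by apply: ge0_subset_integral => //; exact/measurable_EFinP.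
Qed.

(** Both averages are compared with u x by [mean_dist], and the result is integrated over x in B. *)
Lemma mean_mean u (B B' : set 'rV[R]_N) (rho : R) : measurable_fun setT u -> fLp u ->
  measurable B -> (0 < mu B < +oo)%E -> measurable B' -> (0 < mu B' < +oo)%E ->
  0 < rho -> (forall x y, B x -> B y \/ B' y -> enorm (x - y) <= rho) ->
  fine (mu B) * `|mean u B - mean u B'| `^ p <=
  2 `^ p * rho `^ (N%:R + s * p) * ((fine (mu B))^-1 + (fine (mu B'))^-1) * energy u.
Proof.
move=> mu_ Lu mB B0 mB' B'0 rho0 Brho.
have V0 : 0 < fine (mu B) by apply: fine_gt0.
have V'0 : 0 < fine (mu B') by apply: fine_gt0.
set C := 2 `^ p * _ * _.
have C0 : 0 <= C by rewrite !mulr_ge0 ?powR_ge0// addr_ge0// invr_ge0 ltW.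
have pt : {ae mu, forall x, B x ->
    ((`|mean u B - mean u B'| `^ p)%:E <= C%:E * gam u x)%E}.
  apply: filterS (gam_finite mu_ Lu) => x gx Bx.
  have [_ H1] := mean_dist mu_ gx mB B0 rho0 (fun y By => Brho x y Bx (or_introl By)).
  have [_ H2] := mean_dist mu_ gx mB' B'0 rho0 (fun y By => Brho x y Bx (or_intror By)).
  rewrite -(@fineK _ (gam u x)) ?ge0_fin_numE ?gam_ge0// -EFinM lee_fin.
  apply: (@le_trans _ _ ((`|u x - mean u B| + `|u x - mean u B'|) `^ p)).
    apply: ler_powR_base; first exact: ltW.
      exact: normr_ge0.
    by rewrite (distrC (u x) (mean u B)); exact: ler_distD.
  apply: le_trans (powRD_le (ltW p0) (normr_ge0 _) (normr_ge0 _)) _.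
  rewrite /C -!mulrA ler_wpM2l ?powR_ge0// mulrCA mulrDl lerD//.
    by rewrite ler_pdivlMl// mulrC.
  by rewrite ler_pdivlMl// mulrC.
rewrite -lee_fin !EFinM -integral_gam// fineK; last first.
  by rewrite ge0_fin_numE ?measure_ge0//; case/andP: B0.
rewrite muleC -integral_cst//.
apply: (@le_trans _ _ (\int[mu]_(x in B) (C%:E * gam u x))%E).
  apply: ae_ge0_le_integral => //.
  - by move=> x _; rewrite lee_fin powR_ge0.
  - by move=> x _; rewrite mule_ge0 ?gam_ge0.
  - apply: measurable_funTS; apply: measurable_funeM; exact: measurable_gam.
rewrite ge0_integralZl_EFin//; last 2 first.
- by move=> x _; exact: gam_ge0.
- by apply: measurable_funTS; exact: measurable_gam.
rewrite lee_wpmul2l ?lee_fin//; apply: ge0_subset_integral => //.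
- exact: measurable_gam.
- by move=> x _; exact: gam_ge0.
Qed.

Let N0 : 0 < N%:R :> R.
Proof. by rewrite (lt_trans _ spN)// mulr_gt0. Qed.

Lemma lebesgue_cbox_fin (x : 'rV[R]_N) (r : R) : 0 < r -> (0 < mu (cbox x r) < +oo)%E.
Proof. by move=> r0; rewrite lebesgue_cbox ?ltW// lte_fin exprn_gt0 ?mulr_gt0// ltry. Qed.

Lemma fine_lebesgue_cbox (x : 'rV[R]_N) (r : R) : 0 < r -> fine (mu (cbox x r)) = (2 * r) ^+ N.
Proof. by move=> r0; rewrite lebesgue_cbox// ltW. Qed.

Let pow_root (a b : R) : 0 <= a -> 0 <= b -> a `^ p <= b -> a <= b `^ p^-1.
Proof.
move=> a0 b0 ab; have -> : a = (a `^ p) `^ p^-1.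
  by rewrite -powRrM divff ?gt_eqF// powRr1.
by apply: ler_powR_base; rewrite ?invr_ge0 ?powR_ge0 ?(ltW p0).
Qed.

(* All averages below are compared with the vanishing average on a box outside
   Omega. *)
Let far_mean : exists A0 : R, 0 <= A0 /\
  forall u x, measurable_fun setT u -> zero_outside u -> fLp u -> energy u <= 1 ->
    Omega x -> `|mean u (cbox x 1)| <= A0.
Proof.
have [M M0 OM] := bounded_set_cbox bO.
pose i0 : 'I_N := Ordinal (eq_rect _ is_true N0 _ (ltr0n R N)).
(* All coordinates lie in [2M, 4M] on this box, while Omega lies in [-M, M]^N; hence u vanishes
   almost everywhere on it. The radius [rho] fits a box of half-side 4M + 1 around the origin, which
   contains both boxes. *)
pose F := cbox (\row_(_ < N) (3 * M) : 'rV[R]_N) M.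
pose rho : R := N%:R * (2 * (4 * M + 1)).
have rho0 : 0 < rho by rewrite !mulr_gt0// addr_gt0// mulr_gt0.
pose D := 2 `^ p * rho `^ (N%:R + s * p) *
   (((2 * 1) ^+ N)^-1 + ((2 * M) ^+ N)^-1) * ((2 * 1) ^+ N)^-1.
have D0 : 0 <= D.
  by rewrite !mulr_ge0 ?powR_ge0 ?addr_ge0 ?invr_ge0 ?exprn_ge0// mulr_ge0// ltW.
exists (D `^ p^-1); split; first exact: powR_ge0.
move=> u x mu_ u0 Lu E1 Ox.
have FO y : F y -> ~ Omega y.
  move=> Fy /OM /(_ i0); have := Fy i0; rewrite !mxE subr0 !ler_norml.
  by move=> /andP[H1 _] /andP[_ H2]; move: M0 H1 H2; lra.
have F0 : mean u F = 0.
  rewrite /mean (@Rintegral_ae_eq _ _ _ mu F (measurable_cbox _ _) _ (cst 0)).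
  - by rewrite Rintegral_cst ?mul0r//; exact: measurable_cbox.
  - exact: measurable_funTS.
  - exact: measurable_cst.
  - by apply: filterS u0 => y H /FO; exact: H.
have in4 y : cbox x 1 y \/ F y -> cbox 0 (4 * M + 1) y.
  move=> H i; rewrite mxE subr0; have := OM _ Ox i; rewrite mxE subr0 => xM.
  case: H => /(_ i); rewrite ?mxE => H.
    apply: (@le_trans _ _ (`|y ord0 i - x ord0 i| + `|x ord0 i|)).
      by rewrite -[X in `|X| <= _](subrK (x ord0 i)) ler_normD.
    by move: xM H M0; lra.
  rewrite ler_norml; move: H; rewrite ler_norml => /andP[]; move: M0; lra.
have := mean_mean mu_ Lu (measurable_cbox x 1) (lebesgue_cbox_fin x ltr01)
  (measurable_cbox _ M) (lebesgue_cbox_fin _ M0) rho0.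
move=> /(_ (\row_(_ < N) (3 * M))); rewrite -/F F0 subr0 !fine_lebesgue_cbox// => H.
apply: pow_root => //; rewrite /D ler_pdivlMr ?exprn_gt0// ?mulr_gt0// mulrC.
apply: le_trans (H _) _.
  move=> y z By Hz; apply: (@enorm_cbox _ _ 0) => //.
  - by rewrite addr_ge0// mulr_ge0// ltW.
  - by apply: in4; left.
  - by apply: in4; case: Hz; [left|right].
rewrite -[leRHS]mulr1 ler_wpM2l//.
by rewrite !mulr_ge0 ?powR_ge0 ?addr_ge0 ?invr_ge0 ?exprn_ge0// mulr_ge0// ltW.
Qed.

Let h : R := 2^-1.
Let h01 : 0 < h < 1. Proof. by rewrite /h invr_gt0 ltr0n invf_lt1// ltr1n. Qed.
Let hj0 j : 0 < h ^+ j. Proof. by rewrite exprn_gt0//; case/andP: h01. Qed.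

Lemma scale_frac_ker (t : R) : 0 < t ->
  (N%:R * (2 * t)) `^ (N%:R + s * p) =
  (N%:R * 2) `^ (N%:R + s * p) * (t ^+ N * t `^ (s * p)).
Proof.
move=> t0; rewrite mulrA powRM ?mulr_ge0// ?ltW//; congr (_ * _).
by rewrite powRD ?gt_eqF ?implybT//; congr (_ * _); rewrite powR_mulrn// ltW.
Qed.

(** At scale t the kernel has size t^(N + sp) and two volumes t^N are divided out, leaving t^(sp -
    N), that is t^(s - N/p) after the p-th root. The exponent is negative, so these differences grow
    as the boxes shrink. *)
Let step_mean : exists A1 : R, 0 <= A1 /\
  forall u x j, measurable_fun setT u -> fLp u -> energy u <= 1 ->
    `|mean u (cbox x (h ^+ j.+1)) - mean u (cbox x (h ^+ j))| <=
      A1 * (h `^ (s - N%:R / p)) ^+ j.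
Proof.
pose D : R := 2 `^ p * (N%:R * 2) `^ (N%:R + s * p) * 2.
have D0 : 0 <= D by rewrite !mulr_ge0 ?powR_ge0.
exists (D `^ p^-1); split; first exact: powR_ge0.
move=> u x j mu_ Lu E1; set t := h ^+ j; have t0 : 0 < t by exact: hj0.
have tS : 2 * h ^+ j.+1 = t by rewrite exprS mulrA /h divff ?mul1r.
have V t' : 0 < t' -> 0 < t' ^+ N by move=> ?; rewrite exprn_gt0.
have rho0 : 0 < N%:R * (2 * t) by rewrite !mulr_gt0.
have sub y : cbox x (h ^+ j.+1) y -> cbox x t y.
  move=> H i; apply: le_trans (H i) _; rewrite exprS -[leRHS]mul1r ler_wpM2r//.
    exact: ltW.
  by case/andP: h01 => _ /ltW.
have := mean_mean mu_ Lu (measurable_cbox x (h ^+ j.+1)) (lebesgue_cbox_fin x (hj0 _))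
  (measurable_cbox x t) (lebesgue_cbox_fin x t0) rho0.
rewrite !fine_lebesgue_cbox// tS => H.
have -> : (h `^ (s - N%:R / p)) ^+ j = (t `^ (s * p - N%:R)) `^ p^-1.
  rewrite -exprn_powR; last by case/andP: h01 => /ltW.
  rewrite -powRrM; congr (_ `^ _); field; exact: lt0r_neq0.
rewrite -powRM ?powR_ge0//; apply: pow_root; rewrite ?mulr_ge0 ?powR_ge0//.
have tsp : t `^ (s * p - N%:R) = t `^ (s * p) / t ^+ N.
  by rewrite powRB ?(gt_eqF t0) ?implybT//; congr (_ / _); rewrite powR_mulrn// ltW.
rewrite tsp mulrA ler_pdivlMr ?V// mulrC.
apply: le_trans (H _) _.
  move=> y z By Hz; apply: (@enorm_cbox _ _ x) => //; first exact: ltW.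
    exact: sub.
  by case: Hz => [/sub|].
rewrite scale_frac_ker// /D.
have V2 : ((2 * t) ^+ N)^-1 <= (t ^+ N)^-1.
  by rewrite lef_pV2 ?posrE ?V ?mulr_gt0// lerXn2r ?nnegrE ?ltW ?mulr_gt0//; lra.
set K := (N%:R * 2) `^ _; set P2 := 2 `^ p; set tt := t `^ _.
have PK0 : 0 <= P2 * (K * (t ^+ N * tt)).
  by rewrite mulr_ge0 ?powR_ge0// mulr_ge0 ?powR_ge0// mulr_ge0 ?powR_ge0// ltW// V.
have tN : t ^+ N != 0 by rewrite gt_eqF// V.
apply: (@le_trans _ _ (P2 * (K * (t ^+ N * tt)) * ((t ^+ N)^-1 + (t ^+ N)^-1) * 1)).
  apply: ler_pM => //.
  - rewrite mulr_ge0// addr_ge0// invr_ge0 ltW// V//.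
    by rewrite mulr_gt0.
  - exact: Lp_energy_ge0.
  - by rewrite ler_wpM2l// lerD2l.
rewrite le_eqVlt; apply/orP; left; apply/eqP.
have ar (a b c v : R) : v != 0 -> a * (b * (v * c)) * (v^-1 + v^-1) * 1 = a * b * 2 * c.
  by move=> ?; field.
exact: ar.
Qed.

(** Only one variable is averaged, so one volume is divided out and t^s remains: the error shrinks
    with the box, at the price of the density at x. *)
Let point_mean : exists A2 : R, 0 <= A2 /\
  forall u x j, measurable_fun setT u -> (gam u x < +oo)%E ->
    `|u x - mean u (cbox x (h ^+ j))| <=
      A2 * (h `^ s) ^+ j * fine (gam u x) `^ p^-1.
Proof.
pose D : R := (N%:R * 2) `^ (N%:R + s * p).
have D0 : 0 <= D by rewrite powR_ge0.
exists (D `^ p^-1); split; first exact: powR_ge0.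
move=> u x j mu_ gx; set t := h ^+ j; have t0 : 0 < t by exact: hj0.
have G0 : 0 <= fine (gam u x) by rewrite fine_ge0// gam_ge0.
have rho0 : 0 < N%:R * (2 * t) by rewrite !mulr_gt0.
have [|_] := mean_dist mu_ gx (measurable_cbox x t) (lebesgue_cbox_fin x t0) rho0.
  move=> y Hy; apply: (@enorm_cbox _ _ x) => //; first exact: ltW.
  exact/mem_cbox/ltW.
rewrite fine_lebesgue_cbox// => H.
have -> : (h `^ s) ^+ j = (t `^ (s * p)) `^ p^-1.
  rewrite -exprn_powR; last by case/andP: h01 => /ltW.
  by rewrite -powRrM; congr (_ `^ _); field; exact: lt0r_neq0.
rewrite -!powRM ?mulr_ge0 ?powR_ge0//; apply: pow_root; rewrite ?mulr_ge0 ?powR_ge0//.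
have V1 : 0 < t ^+ N by rewrite exprn_gt0.
rewrite -(ler_pM2l V1); apply: (@le_trans _ _ ((2 * t) ^+ N * `|u x - mean u (cbox x t)| `^ p)).
  rewrite ler_wpM2r ?powR_ge0// lerXn2r ?nnegrE ?(ltW t0)// ?mulr_ge0 ?(ltW t0)//; lra.
apply: le_trans H _; rewrite scale_frac_ker// /D le_eqVlt; apply/orP; left; apply/eqP.
have ar (a b c v : R) : a * (b * v) * c = b * (a * v * c) by ring.
exact: ar.
Qed.

(** |u x| is split into its distance to the average at scale h^j and that average, which is
    telescoped from scale 1. The first part decreases in j and the second increases; j stays free so
    that the two can be balanced. *)
Lemma hedberg : exists2 A : R, 0 <= A &
  forall u, measurable_fun setT u -> zero_outside u -> fLp u -> energy u <= 1 ->
  forall x j, Omega x -> (gam u x < +oo)%E ->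
    `|u x| <= A * ((h `^ s) ^+ j * fine (gam u x) `^ p^-1 + (h `^ (s - N%:R / p)) ^+ j).
Proof.
have [A0 [A00 H0]] := far_mean; have [A1 [A10 H1]] := step_mean.
have [A2 [A20 H2]] := point_mean.
set b := h `^ (s - N%:R / p).
have b1 : 1 < b.
  have [h0 h1] := andP h01.
  rewrite /b -opprB powRN invf_gt1 ?powR_gt0//.
  have a0 : 0 < N%:R / p - s by rewrite subr_gt0 ltr_pdivlMr.
  by have := gt0_ltr_powR a0 (ltW h0 : h \in Num.nneg) (ler01 : 1 \in Num.nneg) h1; rewrite powR1.
have b10 : 0 < b - 1 by rewrite subr_gt0.
(* Chosen so that A1 + A <= A b: then the bound A b^j on the averages propagates by induction. *)
pose A := A0 + A1 / (b - 1).
have A_ge0 : 0 <= A by rewrite addr_ge0// divr_ge0// ltW.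
exists (A2 + A); first by rewrite addr_ge0.
move=> u mu_ u0 Lu E1 x j Ox gx.
have mj : `|mean u (cbox x (h ^+ j))| <= A * b ^+ j.
  elim: j => [|j IH].
    rewrite !expr0 mulr1; apply: le_trans (H0 _ _ mu_ u0 Lu E1 Ox) _.
    by rewrite lerDl divr_ge0// ltW.
  rewrite -[X in `|X| <= _](subrK (mean u (cbox x (h ^+ j)))).
  apply: le_trans (ler_normD _ _) _.
  apply: (@le_trans _ _ (A1 * b ^+ j + A * b ^+ j)).
    by apply: lerD => //; exact: H1.
  rewrite -mulrDl exprS mulrA ler_wpM2r ?exprn_ge0 ?(ltW (lt_trans ltr01 b1))//.
  rewrite -lerBrDr -[X in _ <= _ - X]mulr1 -mulrBr /A mulrDl divfK ?gt_eqF//.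
  by rewrite lerDr mulr_ge0// ltW.
rewrite -[X in `|X| <= _](subrK (mean u (cbox x (h ^+ j)))).
apply: le_trans (ler_normD _ _) _.
have P0 : 0 <= (h `^ s) ^+ j * fine (gam u x) `^ p^-1.
  by rewrite mulr_ge0 ?powR_ge0// exprn_ge0// powR_ge0.
have b0 : 0 <= b ^+ j by rewrite exprn_ge0// ltW// (lt_trans ltr01).
apply: le_trans (lerD (H2 u x j mu_ gx) mj) _.
rewrite -mulrA [leRHS]mulrDl.
have ar (a c y t : R) : 0 <= a -> 0 <= c -> 0 <= y -> 0 <= t ->
    a * y + c * t <= a * (y + t) + c * (y + t).
  move=> a0' c0' y0 t0; rewrite !mulrDr.
  by have := mulr_ge0 a0' t0; have := mulr_ge0 c0' y0; lra.
exact: ar.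
Qed.

(** The ratio of p to the critical Sobolev exponent. *)
Let thet : R := 1 - s * p / N%:R.

(** With c = h^(-N/p), both terms of [hedberg] become of order G^thet once c^j is comparable to G,
    the p-th root of the density. Since thet r <= p, the r-th power of |u x| is bounded by the
    density itself. *)
Lemma sobolev_pointwise (r : R) : 0 < r -> r <= sobolev_exponent (N := N) s p ->
  exists2 C : R, 0 <= C &
  forall u, measurable_fun setT u -> zero_outside u -> fLp u -> energy u <= 1 ->
  {ae mu, forall x, Omega x -> ((`|u x| `^ r)%:E <= C%:E * (1 + gam u x))%E}.
Proof.
move=> r0 rp; have [A A0 HA] := hedberg.
have [h0 h1] := andP h01.
pose c : R := h `^ (- (N%:R / p)).
have Np0 : 0 < N%:R / p by rewrite divr_gt0.
have c1 : 1 < c.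
  rewrite /c powRN invf_gt1 ?powR_gt0//.
  by have := gt0_ltr_powR Np0 (ltW h0 : h \in Num.nneg) (ler01 : 1 \in Num.nneg) h1; rewrite powR1.
have c0 : 0 < c by rewrite (lt_trans _ c1).
have th0 : 0 < thet by rewrite /thet subr_gt0 ltr_pdivrMr// mul1r.
pose K := A * (1 + c `^ thet).
have K0 : 0 <= K by rewrite mulr_ge0// addr_ge0// powR_ge0.
exists (K `^ r); first exact: powR_ge0.
move=> u mu_ u0 Lu E1; apply: filterS (gam_finite mu_ Lu) => x gx Ox.
have Hx := HA u mu_ u0 Lu E1 x ^~ Ox.
set g := fine (gam u x) `^ p^-1 in Hx.
have g0 : 0 <= g by exact: powR_ge0.
have gp : g `^ p = fine (gam u x).
  by rewrite /g -powRrM mulVf ?gt_eqF// powRr1// fine_ge0// gam_ge0.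
(* Scales are h^j with j a natural number, so densities below 1 are treated as 1; this is the
   summand 1 of the conclusion. *)
pose G := Num.max 1 g.
have G1 : 1 <= G by rewrite le_max lexx.
have G0 : 0 < G by rewrite (lt_le_trans _ G1).
have exj : exists n, G <= c ^+ n.
  have bern n : 1 + n%:R * (c - 1) <= c ^+ n.
    elim: n => [|n IH]; first by rewrite mul0r addr0 expr0.
    rewrite exprS; apply: (@le_trans _ _ (c * (1 + n%:R * (c - 1)))).
      rewrite -natr1; have : 0 <= n%:R * (c - 1) * (c - 1) by rewrite !mulr_ge0// subr_ge0 ltW.
      by move: (n%:R : R) => y; lra.
    by rewrite ler_wpM2l// ltW.
  exists (Num.truncn (G / (c - 1))).+1.
  apply: le_trans (bern _); apply: (@le_trans _ _ (G / (c - 1) * (c - 1))).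
    by rewrite divfK// gt_eqF// subr_gt0.
  apply: (@le_trans _ _ ((Num.truncn (G / (c - 1))).+1%:R * (c - 1))).
    by rewrite ler_wpM2r ?subr_ge0 ?(ltW c1)// ltW// truncnS_gt.
  by rewrite lerDr.
(* Minimality of j gives the reverse comparison c^j <= c G. *)
have [j Gj jmin] := ex_minnP exj.
have cj0 : 0 < c ^+ j by rewrite exprn_gt0.
have cjG : c ^+ j <= c * G.
  case: j Gj jmin cj0 => [|j] Gj jmin _.
    by rewrite expr0 (le_trans (ltW c1))// ler_peMr// ltW.
  rewrite exprS ler_wpM2l ?(ltW c0)// ltW// ltNge.
  by apply/negP => /jmin; rewrite ltnn.
have e1 : (h `^ s) ^+ j = (c ^+ j) `^ (- (s * p / N%:R)).
  rewrite exprn_powR ?(ltW c0)// /c -powRrM; congr ((_ `^ _) ^+ _).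
  by field; rewrite !lt0r_neq0.
have e2 : (h `^ (s - N%:R / p)) ^+ j = (c ^+ j) `^ thet.
  rewrite exprn_powR ?(ltW c0)// /c -powRrM /thet; congr ((_ `^ _) ^+ _).
  by field; rewrite !lt0r_neq0.
have sN0 : 0 < s * p / N%:R by rewrite divr_gt0 ?mulr_gt0.
have b1 : (h `^ s) ^+ j * g <= G `^ thet.
  have -> : G `^ thet = G `^ (- (s * p / N%:R)) * G.
    by rewrite /thet addrC powRD ?(gt_eqF G0) ?implybT// powRr1// ltW.
  apply: ler_pM => //; first by rewrite exprn_ge0// powR_ge0.
    rewrite e1 !powRN lef_pV2 ?posrE ?powR_gt0//.
    by apply: ler_powR_base => //; exact: ltW.
  by rewrite le_max lexx orbT.
have b2 : (h `^ (s - N%:R / p)) ^+ j <= c `^ thet * G `^ thet.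
  rewrite e2 -powRM ?(ltW c0) ?(ltW G0)//; apply: ler_powR_base => //; exact: ltW.
have uK : `|u x| <= K * G `^ thet.
  apply: le_trans (Hx j gx) _; rewrite /K -mulrA ler_wpM2l// mulrDl mul1r.
  exact: lerD.
rewrite -(@fineK _ (gam u x)) ?ge0_fin_numE ?gam_ge0// -EFinD -EFinM lee_fin.
apply: (@le_trans _ _ ((K * G `^ thet) `^ r)).
  by apply: ler_powR_base => //; exact: ltW.
rewrite powRM ?powR_ge0// ler_wpM2l ?powR_ge0// -powRrM.
apply: (@le_trans _ _ (G `^ p)).
  apply: ler_powR => //.
  rewrite /thet (_ : 1 - _ = (N%:R - s * p) / N%:R); last by field; rewrite lt0r_neq0.
  rewrite mulrAC ler_pdivrMr// mulrC -ler_pdivlMr ?subr_gt0//.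
  by move: rp; rewrite /sobolev_exponent [p * _]mulrC.
rewrite /G; case: (leP 1 g) => g1.
  by rewrite -gp lerDr.
by rewrite powR1 lerDl fine_ge0// gam_ge0.
Qed.

Lemma zero_outside_integral u (r : R) : measurable_fun setT u -> zero_outside u -> 0 < r ->
  (\int[mu]_(x in Omega) (`|u x| `^ r)%:E = \int[mu]_x (`|u x| `^ r)%:E)%E.
Proof.
move=> mu_ u0 r0; rewrite integral_mkcond; apply: ae_eq_integral => //.
- apply/(measurable_restrictT _ _).1 => //; apply: measurable_funTS.
  exact/measurable_EFinP/measurable_norm_powR.
- exact/measurable_EFinP/measurable_norm_powR.
- apply: filterS u0 => x Hx _; rewrite patchE; case: ifPn => //.
  by rewrite notin_setE => /Hx ->; rewrite normr0 powR0// gt_eqF.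
Qed.

Lemma lebesgue_bounded_lty : (mu Omega < +oo)%E.
Proof.
have [M M0 OM] := bounded_set_cbox bO.
apply: (@le_lt_trans _ _ (mu (cbox 0 M))).
  by apply: le_measure; rewrite ?inE//; exact: measurable_cbox.
by case/andP: (lebesgue_cbox_fin 0 M0).
Qed.

(** The pointwise bound is integrated for u / t, Omega having finite measure. Any t > 0 above the
    norm is allowed, so functions of norm 0 need no separate treatment and [fnorm_eq0] can let t
    tend to 0. *)
Lemma sobolev (r : R) : 0 < r -> r <= sobolev_exponent (N := N) s p ->
  exists2 C : R, 0 <= C &
  forall u (t : R), measurable_fun setT u -> zero_outside u -> fLp u -> 0 < t ->
  Lp_norm mu2 p (frac_diff u) <= t ->
  mu.-integrable Omega (EFin \o (fun x => `|u x| `^ r)) /\ \int[mu]_(x in Omega) (`|u x| `^ r) <= C * t `^ r.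
Proof.
move=> r0 rp; have [C C0 HC] := sobolev_pointwise r0 rp.
exists (C * (fine (mu Omega) + 1)); first by rewrite mulr_ge0// addr_ge0// fine_ge0.
move=> u t mu_ u0 Lu t0 ut.
pose v x := t^-1 * u x.
have vE : frac_diff v = fun z => t^-1 * frac_diff u z by exact: frac_diffZ.
have Lv : fLp v by rewrite vE; exact: LpZ.
have mv : measurable_fun setT v by exact: measurable_funM.
have v0 : zero_outside v by apply: filterS u0 => x H Ox; rewrite /v H// mulr0.
have Ev : energy v <= 1.
  rewrite -Lp_norm_powR// vE Lp_normZ// gtr0_norm ?invr_gt0//.
  have H1 : t^-1 * Lp_norm mu2 p (frac_diff u) <= 1.
    by rewrite mulrC ler_pdivrMr// mul1r.
  have H0 : 0 <= t^-1 * Lp_norm mu2 p (frac_diff u).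
    by rewrite mulr_ge0 ?Lp_norm_ge0// invr_ge0 ltW.
  by have := ler_powR_base (ltW p0) H0 H1; rewrite powR1.
have mvr : measurable_fun Omega (EFin \o (fun x => `|v x| `^ r)).
  by apply: measurable_funTS; exact/measurable_EFinP/measurable_norm_powR.
have main : (\int[mu]_(x in Omega) (`|v x| `^ r)%:E <= (C * (fine (mu Omega) + 1))%:E)%E.
  apply: (@le_trans _ _ (\int[mu]_(x in Omega) (C%:E * (1 + gam v x)))%E).
    apply: ae_ge0_le_integral => //.
    - by move=> x _; rewrite mule_ge0// adde_ge0// gam_ge0.
    - apply: measurable_funTS; apply: measurable_funeM.
      by apply: emeasurable_funD => //; exact: measurable_gam.
    - exact: HC.
  have mg : measurable_fun Omega (gam v) by apply: measurable_funTS; exact: measurable_gam.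
  rewrite ge0_integralZl_EFin//; last 2 first.
  - by move=> x _; rewrite adde_ge0// gam_ge0.
  - by apply: emeasurable_funD.
  rewrite EFinM lee_wpmul2l ?lee_fin//.
  rewrite ge0_integralD//; last by move=> x _; exact: gam_ge0.
  rewrite integral_cst// mul1e EFinD fineK ?ge0_fin_numE ?lebesgue_bounded_lty//.
  rewrite leeD2l// (@le_trans _ _ (\int[mu]_x gam v x)%E)//.
    apply: ge0_subset_integral => //; first exact: measurable_gam.
    by move=> x _; exact: gam_ge0.
  by rewrite integral_gam// lee_fin.
have iv : mu.-integrable Omega (EFin \o (fun x => `|v x| `^ r)).
  apply/integrableP; split => //.
  under eq_integral do rewrite /= ger0_norm ?powR_ge0//.
  by rewrite (le_lt_trans main)// ltry.
have uv : (fun x => `|u x| `^ r) = (fun x => t `^ r * `|v x| `^ r).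
  apply/funext => x; rewrite /v normrM gtr0_norm ?invr_gt0// powRM ?invr_ge0 ?(ltW t0)//.
  by rewrite mulrA -powRM ?invr_ge0 ?(ltW t0)// divff ?gt_eqF// powR1 mul1r.
rewrite uv; split; first exact: integrable_RZ.
rewrite RintegralZl// mulrC ler_wpM2r ?powR_ge0//.
by rewrite -lee_fin fineK//; exact: (integrable_fin_num mO iv).
Qed.

End fractional_space.

(** * The spaces X0 and their compact embedding *)

Lemma sum_powR_cauchy (I : eqType) (R : realType) (p : R) (a : I -> nat -> R) (cs : seq I) :
  0 < p -> (forall c, c \in cs -> cvgn (a c)) -> forall e : R, 0 < e ->
  exists N, forall n k, (N <= n)%N -> (N <= k)%N ->
    \sum_(c <- cs) `|a c n - a c k| `^ p <= e.
Proof.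
move=> p0; elim: cs => [_ e e0|c cs IH ac e e0].
  by exists 0%N => n k _ _; rewrite big_nil ltW.
have e2 : 0 < e / 2 by rewrite divr_gt0.
have [|N1 H1] := IH _ _ e2; first by move=> c' c'cs; apply: ac; rewrite inE c'cs orbT.
have /cvg_ex[l /cvgrPdist_le Hl] := ac c (mem_head _ _).
have d0 : 0 < (e / 2) `^ p^-1 / 2 by rewrite divr_gt0 ?powR_gt0.
have [N2 _ H2] := Hl _ d0.
exists (maxn N1 N2) => n k; rewrite !geq_max => /andP[n1 n2] /andP[k1 k2].
rewrite big_cons [e]splitr lerD ?H1//.
apply: (@le_trans _ _ (((e / 2) `^ p^-1) `^ p)); last first.
  by rewrite -powRrM mulVf ?gt_eqF// powRr1// ltW.
apply: ler_powR_base => //; first exact: ltW.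
rewrite [leRHS]splitr (le_trans (ler_distD l _ _))// lerD//; last exact: H2.
by rewrite distrC; exact: H2.
Qed.

Section fractional_compactness.
Context {R : realType} {N : nat}.
Variables (Omega : set 'rV[R]_N) (s p : R).
Hypotheses (oO : open Omega) (bO : bounded_set Omega).
Hypotheses (s01 : 0 < s < 1) (p1 : 1 < p) (spN : s * p < N%:R).
Local Notation mu := (lebesgue_rV R N).
Local Notation mu2 := (mu \x mu)%E.
Implicit Types (u v w : 'rV[R]_N -> R).
Local Notation fLp u := (Lp mu2 p (frac_diff s p u)).
Local Notation energy u := (Lp_energy mu2 p (frac_diff s p u)).
Local Notation X := (X0 Omega s p).

Let p0 : 0 < p. Proof. by rewrite (lt_trans _ p1). Qed.
Let s0 : 0 < s. Proof. by case/andP: s01. Qed.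
Let sp0 : 0 < s * p. Proof. exact: mulr_gt0. Qed.
Let mO : measurable Omega. Proof. exact: open_measurable_rV. Qed.
Let muO := lebesgue_bounded_lty oO bO.
Let N0 : 0 < N%:R :> R. Proof. exact: lt_trans spN. Qed.

Let LuX u (Xu : X u) : fLp u := X0_fLp oO p1 Xu.

Definition fnorm u : R := Lp_norm mu2 p (frac_diff s p u).

Lemma lt_sobolev_exponent : p < sobolev_exponent (N := N) s p.
Proof.
rewrite /sobolev_exponent ltr_pdivlMr ?subr_gt0// mulrC ltr_pM2r//.
by rewrite gtrBl.
Qed.

Lemma X0_measurable u : X u -> measurable_fun setT u. Proof. by case. Qed.
Lemma X0_zero u : X u -> zero_outside Omega u. Proof. by case. Qed.

(** The L^p condition is a consequence of finite energy, by the Sobolev inequality at exponent p. *)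
Lemma X0_intro u : measurable_fun setT u -> zero_outside Omega u -> fLp u -> X u.
Proof.
move=> mu_ u0 Lu; split => //.
  have [C C0 HC] := sobolev oO bO s01 p1 spN p0 (ltW lt_sobolev_exponent).
  have t0 : 0 < fnorm u + 1 by rewrite ltr_wpDl// Lp_norm_ge0.
  by have [] := HC u _ mu_ u0 Lu t0; rewrite ?lerDl.
rewrite gagliardoE//; case: Lu => _ iu; rewrite -ge0_fin_numE; last first.
  by apply: integral_ge0 => z _; rewrite lee_fin powR_ge0.
exact: (integrable_fin_num measurableT iu).
Qed.

Lemma X0D u v : X u -> X v -> X (fun x => u x + v x).
Proof.
move=> Xu Xv; apply: X0_intro.
- exact: measurable_funD (X0_measurable Xu) (X0_measurable Xv).
- by apply: filterS2 (X0_zero Xu) (X0_zero Xv) => x Hu Hv nO; rewrite Hu// Hv// addr0.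
- by rewrite frac_diffD; exact: (LpD p1 (LuX Xu) (LuX Xv)).
Qed.

Lemma X0Z k u : X u -> X (fun x => k * u x).
Proof.
move=> Xu; apply: X0_intro.
- exact: measurable_funM (measurable_cst _) (X0_measurable Xu).
- by apply: filterS (X0_zero Xu) => x Hu nO; rewrite Hu// mulr0.
- by rewrite frac_diffZ; exact: (LpZ _ (LuX Xu)).
Qed.

Lemma X0B u v : X u -> X v -> X (fun x => u x - v x).
Proof.
move=> Xu /(X0Z (-1)) Xv; have := X0D Xu Xv; congr (X _).
by apply/funext => x; rewrite mulN1r.
Qed.

Lemma X00 : X (cst 0).
Proof.
apply: X0_intro; first exact: measurable_cst.
  by apply: aeW.
have -> : frac_diff s p (cst 0) = fun z : 'rV[R]_N * 'rV[R]_N => 0 * frac_diff s p (cst 0) z.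
  by apply/funext => -[x y]; rewrite mul0r /frac_diff subrr mul0r.
split; first by apply: measurable_funM => //; exact: measurable_frac_diff.
apply: (eq_integrable measurableT (cst 0)); last exact: integrable0.
by move=> z _ /=; rewrite mul0r normr0 powR0 ?gt_eqF.
Qed.

Lemma fnorm_ge0 u : 0 <= fnorm u. Proof. exact: Lp_norm_ge0. Qed.

Lemma fnormD u v : X u -> X v -> fnorm (fun x => u x + v x) <= fnorm u + fnorm v.
Proof. by move=> Xu Xv; rewrite /fnorm frac_diffD (Lp_normD p1 (LuX Xu) (LuX Xv)). Qed.

Lemma fnormZ k u : X u -> fnorm (fun x => k * u x) = `|k| * fnorm u.
Proof. by move=> Xu; rewrite /fnorm frac_diffZ (Lp_normZ p1 _ (LuX Xu)). Qed.

Lemma fnormB u v : X u -> X v -> fnorm (fun x => u x - v x) <= fnorm u + fnorm v.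
Proof.
move=> Xu Xv; rewrite (_ : (fun x => u x - v x) = fun x => u x + (-1) * v x).
  apply: le_trans (fnormD Xu (X0Z (-1) Xv)) _.
  by rewrite (fnormZ (-1) Xv) normrN1 mul1r.
by apply/funext => x; rewrite mulN1r.
Qed.

Lemma fnorm_powR u : fnorm u `^ p = energy u.
Proof. exact: Lp_norm_powR. Qed.

Lemma fnorm_le u (M : R) : 0 <= M -> (fnorm u <= M) = (energy u <= M `^ p).
Proof.
move=> M0; apply/idP/idP => H.
  by rewrite -fnorm_powR ler_powR_base ?fnorm_ge0// ltW.
rewrite /fnorm Lp_normEE (_ : M = (M `^ p) `^ p^-1); last first.
  by rewrite -powRrM divff ?gt_eqF// powRr1.
by rewrite ler_powR_base ?Lp_energy_ge0// invr_ge0 ltW.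
Qed.

#[local] Opaque fnorm.

Lemma fnorm_eq0 u : X u -> fnorm u = 0 -> {ae mu, forall x, u x = 0}.
Proof.
move=> Xu n0; have [C C0 HC] := sobolev oO bO s01 p1 spN p0 (ltW lt_sobolev_exponent).
have I0 : \int[mu]_(x in Omega) (`|u x| `^ p) = 0.
  apply/eqP; rewrite eq_le Rintegral_ge0 ?andbT; last by move=> *; exact: powR_ge0.
  apply/ler_addgt0Pl => e e0; rewrite addr0.
  have C1 : 0 < C + 1 by rewrite ltr_wpDl.
  have t0 : 0 < (e / (C + 1)) `^ p^-1 by rewrite powR_gt0// divr_gt0.
  have [|_] := HC u _ (X0_measurable Xu) (X0_zero Xu) (X0_fLp oO p1 Xu) t0.
    by rewrite -[Lp_norm _ _ _]/(fnorm u) n0 ltW.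
  move=> /le_trans; apply; rewrite -powRrM mulVf ?gt_eqF// powRr1; last first.
    by rewrite divr_ge0// ltW.
  rewrite mulrA ler_pdivrMr// mulrDr mulr1 mulrC lerDl ltW//.
have iu : mu.-integrable Omega (EFin \o (fun x => `|u x| `^ p)) by case: Xu.
have : (\int[mu]_(x in Omega) `|(EFin \o (fun x => `|u x| `^ p)%R) x| = 0)%E.
  under eq_integral do rewrite /= ger0_norm ?powR_ge0//.
  by rewrite -[LHS]fineK ?(integrable_fin_num mO iu)//; congr EFin.
have mup : measurable_fun Omega (EFin \o (fun x => `|u x| `^ p)).
  exact: measurable_int iu.
move/(ae_eq_integral_abs mu mO mup) => H.
apply: filterS2 H (X0_zero Xu) => x H1 H2.
have [Ox|nO] := pselect (Omega x); last exact: H2.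
by have [/powR_eq0_eq0/eqP] := H1 Ox; rewrite normr_eq0 => /eqP.
Qed.

Lemma X0_integrable_box u a (r : R) : X u -> 0 < r ->
  mu.-integrable (cbox a r) (EFin \o u).
Proof.
move=> Xu r0; have mu_ := X0_measurable Xu.
have iu : mu.-integrable setT (EFin \o (fun x => `|u x| `^ p)).
  apply/integrableP; split; first exact/measurable_EFinP/measurable_norm_powR.
  under eq_integral do rewrite /= ger0_norm ?powR_ge0//.
  rewrite -(zero_outside_integral oO mu_ (X0_zero Xu) p0).
  case: Xu => _ /integrableP[_]; under eq_integral do rewrite /= ger0_norm ?powR_ge0//.
  by [].
have mB := measurable_cbox a r.
have iuB := integrableS measurableT mB (@subsetT _ _) iu.
have /andP[B0 B1] := lebesgue_cbox_fin a r0.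
by have [] := Rintegral_jensen mB p1 B0 B1 (measurable_funTS mu_) iuB.
Qed.

Lemma meanB u v a (r : R) : X u -> X v -> 0 < r ->
  mean (fun x => u x - v x) (cbox a r) = mean u (cbox a r) - mean v (cbox a r).
Proof.
move=> Xu Xv r0; rewrite /mean RintegralB ?mulrBl//; first exact: measurable_cbox.
  exact: X0_integrable_box.
exact: X0_integrable_box.
Qed.

Lemma mean_bounded a (r M : R) : 0 < r -> exists K : R, forall u, X u -> fnorm u <= M ->
  `|mean u (cbox a r)| <= K.
Proof.
move=> r0; have [C C0 HC] := sobolev oO bO s01 p1 spN p0 (ltW lt_sobolev_exponent).
have /andP[B0 B1] := lebesgue_cbox_fin a r0.
have V0 : 0 < fine (mu (cbox a r)) by rewrite fine_gt0// B0.
pose t := `|M| + 1; have t0 : 0 < t by rewrite ltr_wpDl.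
exists ((C * t `^ p / fine (mu (cbox a r))) `^ p^-1) => u Xu uM.
have mu_ := X0_measurable Xu; have mB := measurable_cbox a r.
have [|iu H] := HC u t mu_ (X0_zero Xu) (X0_fLp oO p1 Xu) t0.
  by rewrite -/(fnorm u) (le_trans uM)// (le_trans (ler_norm _))// lerDl.
have E := zero_outside_integral oO mu_ (X0_zero Xu) p0.
have iuT : mu.-integrable setT (EFin \o (fun x => `|u x| `^ p)).
  apply/integrableP; split; first exact/measurable_EFinP/measurable_norm_powR.
  under eq_integral do rewrite /= ger0_norm ?powR_ge0//.
  rewrite -E; case: Xu => _ /integrableP[_].
  by under eq_integral do rewrite /= ger0_norm ?powR_ge0//.
have iuB := integrableS measurableT mB (@subsetT _ _) iuT.
have [_ J] := Rintegral_jensen mB p1 B0 B1 (measurable_funTS mu_) iuB.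
have -> : `|mean u (cbox a r)| = (`|mean u (cbox a r)| `^ p) `^ p^-1.
  by rewrite -powRrM divff ?gt_eqF// powRr1.
apply: ler_powR_base; rewrite ?invr_ge0 ?powR_ge0 ?(ltW p0)//.
rewrite ler_pdivlMr// mulrC; apply: le_trans J _; apply: le_trans H.
rewrite -lee_fin fineK ?(integrable_fin_num mB iuB)// fineK ?(integrable_fin_num mO iu)//.
rewrite E; apply: ge0_subset_integral => //.
exact/measurable_EFinP/measurable_norm_powR.
Qed.

(* On a box of half-side e the oscillation of w around its average is controlled
   by e^(sp) times the local energy density. *)
Lemma lp_cover (e : R) : 0 < e -> exists cs : seq 'rV[R]_N, forall w, X w ->
  (\int[mu]_(x in Omega) (`|w x| `^ p)%:E <=
   (2 `^ p * ((N%:R * 2) `^ (N%:R + s * p) * e `^ (s * p) * energy w +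
    fine (mu Omega) * \sum_(c <- cs) `|mean w (cbox c e)| `^ p))%:E)%E.
Proof.
move=> e0; have [M M0 OM] := bounded_set_cbox bO.
have [cs Hcs] := @finite_cbox_cover _ N M e M0 e0; exists cs => w Xw.
have mw := X0_measurable Xw; have Lw := X0_fLp oO p1 Xw.
set K := (N%:R * 2) `^ _; set S := \sum_(c <- cs) _.
have K0 : 0 <= K by exact: powR_ge0.
have S0 : 0 <= S by rewrite sumr_ge0// => *; exact: powR_ge0.
have mg : measurable_fun Omega (gam s p w).
  by apply: measurable_funTS; exact: measurable_gam.
have Ke0 : 0 <= K * e `^ (s * p) by rewrite mulr_ge0// powR_ge0.
apply: (@le_trans _ _ (\int[mu]_(x in Omega)
   ((2 `^ p)%:E * ((K * e `^ (s * p))%:E * gam s p w x + S%:E)))%E).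
  apply: ae_ge0_le_integral => //.
  - by apply: measurable_funTS; exact/measurable_EFinP/measurable_norm_powR.
  - move=> x _; rewrite mule_ge0 ?lee_fin ?powR_ge0// adde_ge0 ?lee_fin//.
    by rewrite mule_ge0 ?lee_fin// gam_ge0.
  - by apply: measurable_funeM; apply: emeasurable_funD => //; exact: measurable_funeM.
  apply: filterS (gam_finite mw Lw) => x gx Ox.
  have [c cin Hc] := Hcs x (OM x Ox).
  have rho0 : 0 < N%:R * (2 * e) by rewrite !mulr_gt0.
  have [|_] := mean_dist s01 p1 mw gx (measurable_cbox c e) (lebesgue_cbox_fin c e0) rho0.
    by move=> y Hy; apply: (@enorm_cbox _ _ c) => //; exact: ltW.
  rewrite fine_lebesgue_cbox// (scale_frac_ker s01 p1)// -/K => H.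
  rewrite -(@fineK _ (gam s p w x)) ?ge0_fin_numE ?gam_ge0//.
  rewrite [X in (_ <= X)%E](_ : _ =
    (2 `^ p * (K * e `^ (s * p) * fine (gam s p w x) + S))%:E)// lee_fin.
  have g0 : 0 <= fine (gam s p w x) by rewrite fine_ge0// gam_ge0.
  apply: (@le_trans _ _ ((`|w x - mean w (cbox c e)| + `|mean w (cbox c e)|) `^ p)).
    apply: ler_powR_base => //; first exact: ltW.
    by rewrite -[X in `|X| <= _](subrK (mean w (cbox c e))) ler_normD.
  apply: le_trans (powRD_le (ltW p0) (normr_ge0 _) (normr_ge0 _)) _.
  rewrite ler_wpM2l ?powR_ge0// lerD//.
    have eN : 0 < e ^+ N by rewrite exprn_gt0.
    rewrite -(ler_pM2l eN).
    apply: (@le_trans _ _ ((2 * e) ^+ N * `|w x - mean w (cbox c e)| `^ p)).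
      rewrite ler_wpM2r ?powR_ge0// lerXn2r ?nnegrE ?(ltW e0)// ?mulr_ge0 ?(ltW e0)//.
      by move: e0; lra.
    apply: le_trans H _; rewrite le_eqVlt; apply/orP; left; apply/eqP.
    have ar (a b t v : R) : a * (t * b) * v = t * (a * b * v) by ring.
    exact: ar.
  rewrite /S (big_rem c)//= lerDl sumr_ge0// => *; exact: powR_ge0.
rewrite ge0_integralZl_EFin ?powR_ge0//; last 2 first.
- move=> x _; rewrite adde_ge0 ?lee_fin//.
  by rewrite mule_ge0 ?lee_fin// gam_ge0.
- by apply: emeasurable_funD => //; exact: measurable_funeM.
rewrite [X in (_ <= X)%E](_ : _ = (2 `^ p)%:E * ((K * e `^ (s * p))%:E * (energy w)%:E +
  (fine (mu Omega))%:E * S%:E))%E//.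
rewrite lee_wpmul2l ?lee_fin ?powR_ge0//.
rewrite ge0_integralD//; last 2 first.
- by move=> x _; rewrite mule_ge0 ?lee_fin// gam_ge0.
- exact: measurable_funeM.
rewrite ge0_integralZl_EFin//; last by move=> x _; exact: gam_ge0.
have -> : (\int[mu]_(x in Omega) S%:E = (fine (mu Omega))%:E * S%:E)%E.
  by rewrite integral_cst// fineK ?ge0_fin_numE// muleC.
rewrite leeD2r// lee_wpmul2l ?lee_fin//.
rewrite -integral_gam//; apply: ge0_subset_integral => //.
- exact: measurable_gam.
- by move=> x _; exact: gam_ge0.
Qed.

(** The averages on the boxes of all scales 1 / (i + 1) form a countable family of bounded
    sequences, which the diagonal extraction makes convergent at once. Given e, a fine scale makes
    the oscillation term of [lp_cover] small, and at that scale only finitely many averages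
    remain. *)
Lemma lp_cauchy_subseq (u_ : nat -> 'rV[R]_N -> R) (M : R) :
  (forall n, X (u_ n)) -> (forall n, fnorm (u_ n) <= M) ->
  exists2 phi : nat -> nat, (forall n, (n <= phi n)%N) &
  forall e : R, 0 < e -> exists k, forall n m, (k <= n)%N -> (k <= m)%N ->
    \int[mu]_(x in Omega) (`|u_ (phi n) x - u_ (phi m) x| `^ p) <= e.
Proof.
move=> Xu uM; have M0 : 0 <= M by exact: le_trans (fnorm_ge0 _) (uM 0%N).
have d0 i : 0 < i.+1%:R^-1 :> R by rewrite invr_gt0.
have /choice [cs Hcs] := fun i => lp_cover (d0 i).
pose B ik := cbox (nth 0 (cs ik.1) ik.2) (ik.1.+1%:R^-1) : set 'rV[R]_N.
pose a ik n := mean (u_ n) (B ik).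
have [|phi phige Hphi] := @diagonal_subseq R
    (fun m n => if unpickle m is Some ik then a ik n else 0).
  move=> m; case: (unpickle m) => [ik|]; last by exists 0 => n; rewrite normr0.
  have [K HK] := @mean_bounded (nth 0 (cs ik.1) ik.2) _ M (d0 ik.1).
  by exists K => n; exact: HK.
have {Hphi}ac ik : cvgn (a ik \o phi).
  by have := Hphi (pickle ik); rewrite pickleK.
exists phi => // e e0.
pose K := (N%:R * 2) `^ (N%:R + s * p) * (2 * M) `^ p.
have K0 : 0 <= K by rewrite mulr_ge0// powR_ge0.
have K1 : 0 < K + 1 by rewrite ltr_wpDl.
have P0 : 0 < 2 `^ p :> R by exact: powR_gt0.
(* [e1] and [e2] share e equally between oscillation and averages, after the factor 2^p of
   [lp_cover]. *)
pose e1 := e / (2 * 2 `^ p * (K + 1)).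
have e10 : 0 < e1 by rewrite divr_gt0// !mulr_gt0.
have [i _ /(_ i (leqnn i)) Hi] := near_infty_natSinv_lt (PosNum (powR_gt0 (s * p)^-1 e10)).
have {}Hi : (i.+1%:R^-1) `^ (s * p) <= e1.
  apply: (@le_trans _ _ ((e1 `^ (s * p)^-1) `^ (s * p))).
    by apply: ler_powR_base; rewrite ?(ltW sp0)// ltW.
  by rewrite -powRrM mulVf ?gt_eqF// powRr1// ltW.
have V0 : 0 <= fine (mu Omega) by rewrite fine_ge0.
pose e2 := e / (2 * 2 `^ p * (fine (mu Omega) + 1)).
have V1 : 0 < fine (mu Omega) + 1 by rewrite ltr_wpDl.
have e20 : 0 < e2 by rewrite divr_gt0// !mulr_gt0.
have [k Hk] := @sum_powR_cauchy _ R p (fun j n => a (i, j) (phi n))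
   (iota 0 (size (cs i))) p0 (fun j _ => ac (i, j)) e2 e20.
exists k => n m kn km.
pose w x := u_ (phi n) x - u_ (phi m) x.
have Xw : X w by exact: X0B.
have := Hcs i w Xw.
have iw : mu.-integrable Omega (EFin \o (fun x => `|w x| `^ p)) by case: Xw.
rewrite -[X in (X <= _)%E -> _]fineK ?(integrable_fin_num mO iw)// lee_fin.
move=> /le_trans; apply.
rewrite (big_nth 0) big_mkord.
have -> : \sum_(j < size (cs i)) `|mean w (cbox (nth 0 (cs i) j) i.+1%:R^-1)| `^ p =
    \sum_(j <- iota 0 (size (cs i))) `|a (i, j) (phi n) - a (i, j) (phi m)| `^ p.
  rewrite -[X in iota 0 X]subn0 -/(index_iota 0 _) big_mkord.
  apply: eq_bigr => j _.
  by rewrite /w (meanB _ (Xu (phi n)) (Xu (phi m)) (d0 i)).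
have Ew : energy w <= (2 * M) `^ p.
  rewrite -fnorm_le; last by rewrite mulr_ge0.
  by rewrite (le_trans (fnormB (Xu _) (Xu _)))// mulr_natl mulr2n lerD.
set S := \sum_(j <- _) _; have S2 : S <= e2 by exact: Hk.
have S0 : 0 <= S by rewrite sumr_ge0// => *; exact: powR_ge0.
set t := i.+1%:R^-1 `^ (s * p) in Hi *; set A := (N%:R * 2) `^ _.
have t0 : 0 <= t by exact: powR_ge0.
have A0 : 0 <= A by exact: powR_ge0.
have H1 : A * t * energy w <= e1 * (K + 1).
  apply: (@le_trans _ _ (A * e1 * (2 * M) `^ p)).
    apply: ler_pM => //; rewrite ?mulr_ge0 ?Lp_energy_ge0//.
    by rewrite ler_wpM2l.
  rewrite mulrAC -/K mulrC ler_wpM2l ?(ltW e10)// lerDl//.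
have H2 : fine (mu Omega) * S <= e2 * (fine (mu Omega) + 1).
  by rewrite mulrC ler_pM// lerDl.
apply: (@le_trans _ _ (2 `^ p * (e1 * (K + 1) + e2 * (fine (mu Omega) + 1)))).
  by rewrite ler_wpM2l ?(ltW P0)// lerD.
rewrite /e1 /e2 le_eqVlt; apply/orP; left; apply/eqP.
have ar (q v k' : R) : q != 0 -> v != 0 -> k' != 0 ->
   q * (e / (2 * q * k') * k' + e / (2 * q * v) * v) = e.
  by move=> *; field; apply/and3P.
by apply: ar; rewrite gt_eqF.
Qed.

Lemma energy_fatou (u_ : nat -> 'rV[R]_N -> R) u (M : R) : (forall n, X (u_ n)) ->
  measurable_fun setT u -> {ae mu, forall x, u_ n x @[n --> \oo] --> u x} ->
  (forall n, energy (u_ n) <= M) -> X u /\ energy u <= M.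
Proof.
move=> Xu mu_ cu uM.
have cd : {ae mu2, forall z, setT z ->
    `|frac_diff s p (u_ n) z| `^ p @[n --> \oo] --> `|frac_diff s p u z| `^ p}.
  apply: filterS (ae_prod cu) => z [c1 c2] _; apply: cvg_norm_powR => //.
  by apply: cvgM; [exact: cvgB|exact: cvg_cst].
have mfd := measurable_frac_diff s p mu_.
have [|||||i _ E] := @Rintegral_fatou _ _ _ mu2 setT measurableT
   (fun n z => `|frac_diff s p (u_ n) z| `^ p) (fun z => `|frac_diff s p u z| `^ p) M.
- by move=> n; case: (X0_fLp oO p1 (Xu n)).
- by move=> n z _; exact: powR_ge0.
- exact: measurable_norm_powR.
- exact: cd.
- by move=> n; have := uM n; rewrite Lp_energyE.
split; last by rewrite Lp_energyE.
apply: X0_intro => //.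
have u0 : {ae mu, forall x n, ~ Omega x -> u_ n x = 0}.
  by apply/ae_foralln => n; exact: X0_zero (Xu n).
apply: filterS2 cu u0 => x cx z nO.
have /cvg_lim <- // := cx.
by under eq_fun do rewrite z//; exact: lim_cst.
Qed.

(* Rellich-Kondrachov, with domination in L^r to feed dominated convergence. *)
Lemma X0_compact (r : R) (u_ : nat -> 'rV[R]_N -> R) (M : R) :
  p <= r -> r < sobolev_exponent (N := N) s p ->
  (forall n, X (u_ n)) -> (forall n, fnorm (u_ n) <= M) ->
  exists (psi : nat -> nat) (u h : 'rV[R]_N -> R), [/\ forall n, (n <= psi n)%N,
    X u /\ fnorm u <= M,
    measurable_fun Omega h /\ mu.-integrable Omega (EFin \o (fun x => `|h x| `^ r)),
    {ae mu, forall x, u_ (psi n) x @[n --> \oo] --> u x} &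
    {ae mu, forall x, Omega x -> forall n, `|u_ (psi n) x| <= h x}].
Proof.
move=> pr rps Xu uM; have M0 : 0 <= M by exact: le_trans (fnorm_ge0 _) (uM 0%N).
have r0 : 0 < r by exact: lt_le_trans pr.
have [phi phige Hphi] := lp_cauchy_subseq Xu uM.
set ps := sobolev_exponent s p in rps.
have ps0 : 0 < ps by exact: lt_trans rps.
have [Cs Cs0 HCs] := sobolev oO bO s01 p1 spN ps0 (lexx _).
have [Cr Cr0 HCr] := sobolev oO bO s01 p1 spN r0 (ltW rps).
have t0 : 0 < 2 * M + 1 by rewrite ltr_wpDl// mulr_ge0.
have in_ w : X w -> fnorm w <= 2 * M -> (mu.-integrable Omega (EFin \o (fun x => `|w x| `^ r)) /\
   mu.-integrable Omega (EFin \o (fun x => `|w x| `^ ps))) /\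
   \int[mu]_(x in Omega) (`|w x| `^ ps) <= Cs * (2 * M + 1) `^ ps.
  move=> Xw wM; have wt : fnorm w <= 2 * M + 1 by rewrite (le_trans wM)// lerDl.
  have [i1 _] := HCr w _ (X0_measurable Xw) (X0_zero Xw) (X0_fLp oO p1 Xw) t0 wt.
  by have [i2 H2] := HCs w _ (X0_measurable Xw) (X0_zero Xw) (X0_fLp oO p1 Xw) t0 wt.
have M2 : M <= 2 * M by lra.
have wB n k : fnorm (fun x => u_ (phi n) x - u_ (phi k) x) <= 2 * M.
  by rewrite (le_trans (fnormB (Xu _) (Xu _)))// mulr_natl mulr2n lerD.
have [|||psi [f [h [psige mf Hh cf domf]]]] :=
    @Lr_cauchy_dominated _ _ _ mu Omega mO r (fun n => u_ (phi n)) r0.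
- by move=> n; exact: X0_measurable.
- by move=> n; have [[]] := in_ _ (Xu (phi n)) (le_trans (uM _) M2).
- move=> e e0; pose D := Cs * (2 * M + 1) `^ ps.
  have D0 : 0 <= D by rewrite mulr_ge0// powR_ge0.
  have D1 : 0 < D + 1 by rewrite ltr_wpDl.
  have e1 : 0 < e / (2 * (D + 1)) by rewrite divr_gt0// mulr_gt0.
  (* Interpolation between L^p, where the sequence is Cauchy, and the critical space, where it is
     bounded by D. *)
  have [C C0 HC] := powR_interpolation p0 pr rps e1.
  have C1 : 0 < C + 1 by rewrite ltr_wpDl.
  have e2 : 0 < e / (2 * (C + 1)) by rewrite divr_gt0// mulr_gt0.
  have [k Hk] := Hphi _ e2; exists k => n m kn km.
  have Xw := X0B (Xu (phi n)) (Xu (phi m)).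
  have [[i1 i2] H2] := in_ _ Xw (wB n m).
  have ip : mu.-integrable Omega (EFin \o (fun x => `|u_ (phi n) x - u_ (phi m) x| `^ p)).
    by case: Xw.
  rewrite -[leLHS]fineK ?(integrable_fin_num mO i1)// lee_fin.
  have := @le_Rintegral _ _ _ mu Omega _ _ mO i1 (integrable_RD mO
    (integrable_RZ mO (e / (2 * (D + 1))) i2) (integrable_RZ mO C ip))
    (fun x _ => HC _ (normr_ge0 _)).
  move=> /le_trans; apply.
  rewrite RintegralD//; [|exact: integrable_RZ|exact: integrable_RZ].
  rewrite !RintegralZl// [leRHS]splitr lerD//.
    apply: (@le_trans _ _ (e / (2 * (D + 1)) * (D + 1))).
      by rewrite ler_wpM2l ?(ltW e1)// (le_trans H2)// lerDl.
    by rewrite le_eqVlt; apply/orP; left; apply/eqP; field; rewrite gt_eqF.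
  apply: (@le_trans _ _ ((C + 1) * (e / (2 * (C + 1))))).
    apply: ler_pM => //; last exact: Hk.
      by apply: Rintegral_ge0 => *; exact: powR_ge0.
    by rewrite lerDl.
  by rewrite le_eqVlt; apply/orP; left; apply/eqP; field; rewrite gt_eqF.
(* The extraction controls f on Omega only; outside, the limit has to be 0. *)
pose u x := if x \in Omega then f x else 0.
have mu_ : measurable_fun setT u.
  rewrite (_ : u = f \_ Omega); last by apply/funext => x; rewrite /u patchE.
  by apply/(measurable_restrictT _ _).1 => //; exact: measurable_funTS.
have cu : {ae mu, forall x, u_ (phi (psi n)) x @[n --> \oo] --> u x}.
  have u0 : {ae mu, forall x n, ~ Omega x -> u_ n x = 0}.
    by apply/ae_foralln => n; exact: X0_zero (Xu n).
  apply: filterS2 cf u0 => x c1 z; rewrite /u; case: ifPn => xO.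
    by apply: c1; exact: set_mem.
  have nO : ~ Omega x by move/mem_set; exact/negP.
  by under eq_fun do rewrite z//; exact: cvg_cst.
have [Xlim Elim] := energy_fatou (M := M `^ p) (fun n => Xu (phi (psi n))) mu_ cu
  (fun n => etrans (esym (fnorm_le _ M0)) (uM _)).
exists (phi \o psi), u, h; split => //.
- by move=> n; exact: leq_trans (psige n) (phige _).
- by split => //; rewrite fnorm_le.
Qed.

End fractional_compactness.

(** * Poincare-Miranda theorem and deformation of a square *)

Section parity.
Variables (n : nat) (A B : nat -> nat -> bool).
Hypotheses (A0 : forall j, (j <= n)%N -> A 0 j) (An : forall j, (j <= n)%N -> ~~ A n j).
Hypotheses (B0 : forall i, (i <= n)%N -> B i 0) (Bn : forall i, (i <= n)%N -> ~~ B i n).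

(* Sperner labels: 1 if not A, else 2 if not B, else 0; [door] marks the edges
   with label set {0, 1}. *)
Let door (a b a' b' : bool) : bool := ((a && b) && ~~ a') || (~~ a && (a' && b')).
Let H i j := door (A i j) (B i j) (A i.+1 j) (B i.+1 j).
Let V i j := door (A i j) (B i j) (A i j.+1) (B i j.+1).
Let D i j := door (A i j) (B i j) (A i.+1 j.+1) (B i.+1 j.+1).
Let cell (P : nat -> nat -> bool) i j :=
  [|| P i j, P i.+1 j, P i j.+1 | P i.+1 j.+1].

(** Sperner's parity argument on squares. If every cell misses one of the four signs, the number of
    doors around each cell is even (a check on the labels of its four corners), and the sides i = 0
    and i = n have no door, so the parity of doors is the same in all rows. It is odd in row 0,
    where B holds and A must change, and zero in row n, where label 0 is absent. *)
Lemma discrete_miranda : exists i j, [/\ (i < n)%N, (j < n)%N,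
  cell A i j && cell (fun i j => ~~ A i j) i j & cell B i j && cell (fun i j => ~~ B i j) i j].
Proof.
apply: contrapT => nE.
have HV i j : (i < n)%N -> (j < n)%N -> H i j (+) H i j.+1 = V i j (+) V i.+1 j.
  move=> ni nj; have : ~~ [&& cell A i j, cell (fun i j => ~~ A i j) i j, cell B i j &
      cell (fun i j => ~~ B i j) i j].
    by apply/negP => /and4P[? ? ? ?]; apply: nE; exists i, j; split => //; apply/andP.
  rewrite /cell /H /V /door.
  by case: (A i j) (B i j) (A i.+1 j) (B i.+1 j) (A i j.+1) (B i j.+1) (A i.+1 j.+1)
    (B i.+1 j.+1) => [] [] [] [] [] [] [] [].
pose Hs j := \big[addb/false]_(0 <= i < n) H i j.
have tele (F : nat -> bool) k : \big[addb/false]_(0 <= i < k) (F i (+) F i.+1) = F 0%N (+) F k.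
  elim: k => [|k IH]; first by rewrite big_nil addbb.
  by rewrite big_nat_recr//= IH; case: (F 0%N) (F k) (F k.+1) => [] [] [].
have HsS j : (j < n)%N -> Hs j = Hs j.+1.
  move=> jn; suff : Hs j (+) Hs j.+1 = false by case: (Hs j) (Hs j.+1) => [] [].
  rewrite /Hs -big_split/= (eq_big_nat _ _ (F2 := fun i => V i j (+) V i.+1 j)); last first.
    by move=> i /andP[_ ni]; rewrite HV.
  rewrite tele /V /door (A0 (ltnW jn)) (A0 jn) (negbTE (An (ltnW jn))) (negbTE (An jn)) /=.
  by rewrite andbF.
have Hs0n j : (j <= n)%N -> Hs 0%N = Hs j.
  by elim: j => [_|j IH jn]; [reflexivity | rewrite (IH (ltnW jn)); exact: HsS].
have := Hs0n n (leqnn n); rewrite /Hs.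
rewrite (eq_big_nat _ _ (F2 := fun i => A i 0 (+) A i.+1 0)); last first.
  move=> i /andP[_ ni]; rewrite /H /door (B0 (ltnW ni)) (B0 ni) /= !andbT.
  by case: (A i 0) (A i.+1 0) => [] [].
rewrite tele A0// (negbTE (An _))//= (eq_big_nat _ _ (F2 := fun i => false)); last first.
  move=> i /andP[_ ni]; rewrite /H /door (negbTE (Bn (ltnW ni))) (negbTE (Bn ni)).
  by rewrite !andbF.
by rewrite big1_eq.
Qed.

End parity.

Section unit_square.
Context {R : realType}.

Definition unitI (t : R) : Prop := 0 <= t <= 1.

Definition unif_cont2 (E : zmodType) (nrm : E -> R) (g : R -> R -> E) : Prop :=
  forall e : R, 0 < e -> exists2 d : R, 0 < d &
    forall s t s' t', unitI s -> unitI t -> unitI s' -> unitI t' ->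
    `|s - s'| <= d -> `|t - t'| <= d -> nrm (g s t - g s' t') <= e.

Lemma grid_unitI n (i : nat) : (i <= n.+1)%N -> unitI (i%:R / n.+1%:R).
Proof.
by move=> ni; rewrite /unitI divr_ge0// ler_pdivrMr// mul1r ler_nat.
Qed.

(** On a fine grid, a cell where both functions change sign provides a corner at which both are
    small; a limit point of such corners is a common zero. *)
Lemma poincare_miranda (h1 h2 : R -> R -> R) :
  unif_cont2 Num.norm h1 -> unif_cont2 Num.norm h2 ->
  (forall t, unitI t -> 0 < h1 0 t /\ h1 1 t < 0) ->
  (forall s, unitI s -> 0 < h2 s 0 /\ h2 s 1 < 0) ->
  exists s t, [/\ unitI s, unitI t, h1 s t = 0 & h2 s t = 0].
Proof.
move=> u1 u2 b1 b2.
have small n (e d : R) h : 0 < d ->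
    (forall s t s' t', unitI s -> unitI t -> unitI s' -> unitI t' ->
      `|s - s'| <= d -> `|t - t'| <= d -> `|h s t - h s' t'| <= e) ->
    n.+1%:R^-1 <= d -> forall i j, (i < n.+1)%N -> (j < n.+1)%N ->
    let P i j := 0 < h (i%:R / n.+1%:R) (j%:R / n.+1%:R) in
    [|| P i j, P i.+1 j, P i j.+1 | P i.+1 j.+1] &&
    [|| ~~ P i j, ~~ P i.+1 j, ~~ P i j.+1 | ~~ P i.+1 j.+1] ->
    `|h (i%:R / n.+1%:R) (j%:R / n.+1%:R)| <= e.
  move=> d0 hd nd i j ni nj P /andP[Hp Hn].
  have gi := grid_unitI (ltnW ni); have gj := grid_unitI (ltnW nj).
  have gi' := grid_unitI ni; have gj' := grid_unitI nj.
  have c (k : nat) : `|k%:R / n.+1%:R - k%:R / n.+1%:R| <= d by rewrite subrr normr0 ltW.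
  have c' (k : nat) : `|k%:R / n.+1%:R - k.+1%:R / n.+1%:R| <= d.
    by rewrite -mulrBl -natr1 opprD addNKr mulN1r normrN ger0_norm ?invr_ge0.
  rewrite ler_norml; apply/andP; split.
    have [x [Hx Px]] : exists x : R, `|h (i%:R / n.+1%:R) (j%:R / n.+1%:R) - x| <= e /\ 0 < x.
      case/or4P: Hp => Hx; eexists; (split; last exact: Hx); exact: hd.
    by move: Hx Px; rewrite ler_norml => /andP[]; lra.
  have [x [Hx Px]] : exists x : R, `|h (i%:R / n.+1%:R) (j%:R / n.+1%:R) - x| <= e /\ x <= 0.
    rewrite /P -!leNgt in Hn.
    case/or4P: Hn => Hx; eexists; (split; last exact: Hx); exact: hd.
  by move: Hx Px; rewrite ler_norml => /andP[]; lra.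
have /choice [x Hx] : forall k : nat, exists st : R * R,
    [/\ unitI st.1, unitI st.2, `|h1 st.1 st.2| <= k.+1%:R^-1 & `|h2 st.1 st.2| <= k.+1%:R^-1].
  move=> k; have k0 : 0 < k.+1%:R^-1 :> R by rewrite invr_gt0.
  have [d1 d10 H1] := u1 _ k0; have [d2 d20 H2] := u2 _ k0.
  have d0 : 0 < Num.min d1 d2 by rewrite lt_min d10.
  have [n _ /(_ n (leqnn n)) /= Hn] := near_infty_natSinv_lt (PosNum d0).
  move: Hn; rewrite lt_min => /andP[/ltW n1 /ltW n2].
  pose g (i : nat) : R := i%:R / n.+1%:R.
  have g0 : g 0%N = 0 by rewrite /g mul0r.
  have g1 : g n.+1 = 1 by rewrite /g divff.
  have [||||i [j [ni nj HA HB]]] := @discrete_miranda n.+1 (fun i j => 0 < h1 (g i) (g j))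
      (fun i j => 0 < h2 (g i) (g j)).
  - by move=> j jn; rewrite g0; have [] := b1 _ (grid_unitI jn).
  - by move=> j jn; rewrite g1 -leNgt ltW//; have [] := b1 _ (grid_unitI jn).
  - by move=> j jn; rewrite g0; have [] := b2 _ (grid_unitI jn).
  - by move=> j jn; rewrite g1 -leNgt ltW//; have [] := b2 _ (grid_unitI jn).
  exists (g i, g j); split => /=.
  - exact: grid_unitI (ltnW ni).
  - exact: grid_unitI (ltnW nj).
  - exact: (small n _ d1 h1 d10 H1 n1).
  - exact: (small n _ d2 h2 d20 H2 n2).
have bnd (y : nat -> R) : (forall k, unitI (y k)) -> bounded_fun y.
  move=> yu; exists 1; split; first exact: num_real.
  move=> M M1 k _ /=; have /andP[? ?] := yu k.
  by rewrite ger0_norm// ltW// (le_lt_trans _ M1).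
have [f1 i1 /cvg_ex[/= s Hs]] := bolzano_weierstrass (bnd (fun k => (x k).1) (fun k => let: And4 p _ _ _ := Hx k in p)).
have [f2 i2 /cvg_ex[/= t Ht]] := bolzano_weierstrass
   (bnd (fun k => (x (f1 k)).2) (fun k => let: And4 _ p _ _ := Hx (f1 k) in p)).
have inc (f : nat -> nat) : increasing_seq f -> forall n, (n <= f n)%N.
  move=> fi; elim=> // n IH; have : (f n < f n.+1)%O by rewrite (leW_mono fi) ltEnat /=.
  by rewrite ltEnat; exact: leq_ltn_trans.
have oo2 := cvg_ge_id (inc _ i2).
have Hs2 : (x (f1 (f2 k))).1 @[k --> \oo] --> s by exact: (cvg_comp _ _ oo2 Hs).
have lim01 (y : nat -> R) l : (forall k, unitI (y k)) -> y k @[k --> \oo] --> l -> unitI l.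
  move=> yu yl; have cy : cvgn y by apply/cvg_ex; exists l.
  rewrite /unitI -(cvg_lim _ yl)//; apply/andP; split.
    by apply: limr_ge => //; apply: nearW => k; case/andP: (yu k).
  by apply: limr_le => //; apply: nearW => k; case/andP: (yu k).
have sI : unitI s by apply: lim01 Hs2 => k; case: (Hx (f1 (f2 k))).
have tI : unitI t by apply: lim01 Ht => k; case: (Hx (f1 (f2 k))).
have fin (h : R -> R -> R) : unif_cont2 Num.norm h -> (forall k, `|h (x k).1 (x k).2| <= k.+1%:R^-1) -> h s t = 0.
  move=> uh hk; apply/eqP; rewrite -normr_le0; apply/ler_addgt0Pl => e e0; rewrite addr0.
  have e2 : 0 < e / 2 by rewrite divr_gt0.
  have [d d0 Hd] := uh _ e2.
  have /cvgrPdist_le/(_ _ d0)[N1 _ M1] := Hs2.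
  have /cvgrPdist_le/(_ _ d0)[N2 _ M2] := Ht.
  have [N3 _ M3] := near_infty_natSinv_lt (PosNum e2).
  pose k := maxn N1 (maxn N2 N3).
  have k1 : (N1 <= k)%N by exact: leq_maxl.
  have k2 : (N2 <= k)%N by rewrite leq_max leq_maxl orbT.
  have k3 : (N3 <= f1 (f2 k))%N.
    by rewrite (leq_trans _ (inc _ i1 _))// (leq_trans _ (inc _ i2 _))// !leq_max leqnn !orbT.
  have [xs xt _ _] := Hx (f1 (f2 k)).
  have := Hd _ _ _ _ sI tI xs xt (M1 _ k1) (M2 _ k2).
  have := hk (f1 (f2 k)); have /ltW := M3 _ k3 => /= A1 A2 A3.
  rewrite -[X in `|X|](subrK (h (x (f1 (f2 k))).1 (x (f1 (f2 k))).2)).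
  by rewrite (le_trans (ler_normD _ _))// [e]splitr lerD// (le_trans A2).
exists s, t; split => //; apply: fin => // k; by case: (Hx k).
Qed.

Let clamp (y : R) : R := if y <= 0 then 0 else if 1 <= y then 1 else y.

Let clampP (y : R) : [\/ y <= 0 /\ clamp y = 0, 1 <= y /\ clamp y = 1 |
  0 <= y <= 1 /\ clamp y = y].
Proof.
rewrite /clamp; case: (leP y 0) => y0; first by constructor 1.
case: (leP 1 y) => y1; first by constructor 2.
by constructor 3; split=> //; rewrite !ltW.
Qed.

Let clamp_le (y z : R) : y <= z -> clamp y <= clamp z <= clamp y + (z - y).
Proof.
move=> yz; have [[? ->]|[? ->]|[/andP[? ?] ->]] := clampP y;
  have [[? ->]|[? ->]|[/andP[? ?] ->]] := clampP z; apply/andP; split; lra.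
Qed.

(** The hat function of height 1 around i / n with half-width 1 / n; written as a difference of two
    shifted ramps, it makes the partition of unity a telescoping sum. *)
Definition tent n (i : nat) (t : R) : R :=
  clamp (n%:R * t - i%:R + 1) - clamp (n%:R * t - i%:R).

Lemma tent_ge0 n i t : 0 <= tent n i t.
Proof.
have /clamp_le/andP[H _] : n%:R * t - i%:R <= n%:R * t - i%:R + 1 by rewrite lerDl.
by rewrite subr_ge0.
Qed.

Lemma sum_tent n t : unitI t -> \sum_(i < n.+1) tent n i t = 1.
Proof.
move=> /andP[t0 t1]; rewrite /tent.
pose F (i : nat) : R := clamp (n%:R * t - i%:R + 1).
rewrite (eq_bigr (fun i : 'I_n.+1 => F i - F i.+1)); last first.
  move=> i _; rewrite /F -natr1; congr (_ - clamp _); lra.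
have -> : \sum_(i < n.+1) (F i - F i.+1) = F 0%N - F n.+1.
  rewrite -opprB -(@telescope_sumr _ 0 n.+1 F)// big_mkord -sumrN.
  by apply: eq_bigr => i _; rewrite opprB.
have n0 : 0 <= n%:R * t by rewrite mulr_ge0.
have n1 : n%:R * t <= n%:R by rewrite ler_piMr.
rewrite /F -natr1 subr0; move: n0 n1; move: (n%:R * t) => y n0 n1.
have [[? ->]|[? ->]|[/andP[? ?] ->]] := clampP (y + 1);
  have [[? ->]|[? ->]|[/andP[? ?] ->]] := clampP (y - (n%:R + 1) + 1); lra.
Qed.

Lemma tent_neq0 n i t : tent n.+1 i t != 0 -> `|t - i%:R / n.+1%:R| <= n.+1%:R^-1.
Proof.
move=> H; have : `|n.+1%:R * t - i%:R| <= 1.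
  move: H; apply: contra_neqT; rewrite -ltNge /tent.
  move: (n.+1%:R * t - i%:R) => y; rewrite ltr_normr => /orP[] y1;
  have [[? ->]|[? ->]|[/andP[? ?] ->]] := clampP (y + 1);
  have [[? ->]|[? ->]|[/andP[? ?] ->]] := clampP y; lra.
have n0 : 0 < n.+1%:R :> R by [].
have -> : n.+1%:R * t - i%:R = n.+1%:R * (t - i%:R / n.+1%:R).
  by rewrite mulrBr mulrCA divff ?gt_eqF// mulr1.
by rewrite normrM ger0_norm// -ler_pdivlMl// mulr1.
Qed.

Lemma tent_lip n i t t' : `|tent n i t - tent n i t'| <= 2 * n%:R * `|t - t'|.
Proof.
wlog tt : t t' / t' <= t.
  move=> W; have [|/ltW] := leP t' t; first exact: W.
  by move=> /W; rewrite distrC [X in _ * X]distrC.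
rewrite (ger0_norm (_ : 0 <= t - t')) ?subr_ge0// /tent.
have n0 : 0 <= n%:R * (t - t') by rewrite mulr_ge0// subr_ge0.
have le1 : n%:R * t' - i%:R + 1 <= n%:R * t - i%:R + 1 by move: n0; rewrite mulrBr; lra.
have le2 : n%:R * t' - i%:R <= n%:R * t - i%:R by move: n0; rewrite mulrBr; lra.
have /andP[a1 a2] := clamp_le le1; have /andP[b1 b2] := clamp_le le2.
move: a1 a2 b1 b2 n0; rewrite ler_norml -!mulrA !mulrBr.
move: (clamp (_ * t - _ + 1)) (clamp (_ * t - _)) (clamp (_ * t' - _ + 1)) (clamp (_ * t' - _)).
move: (n%:R * t) (n%:R * t') => e f a b c d *.
by apply/andP; split; lra.
Qed.

Lemma tent_le1 n i t : tent n i t <= 1.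
Proof.
have /clamp_le/andP[_] : n%:R * t - i%:R <= n%:R * t - i%:R + 1 by rewrite lerDl.
rewrite /tent; lra.
Qed.

Definition tent2 n (v : 'I_n.+1 * 'I_n.+1) (s t : R) : R := tent n v.1 s * tent n v.2 t.

Lemma sum_tent2 n s t : unitI s -> unitI t -> \sum_v tent2 (n := n) v s t = 1.
Proof.
move=> sI tI; rewrite -[RHS]mulr1 -{1}(sum_tent n sI) -(sum_tent n tI) big_distrlr/=.
by rewrite pair_big.
Qed.

Lemma tent2_ge0 n v s t : 0 <= tent2 (n := n) v s t.
Proof. by rewrite mulr_ge0 ?tent_ge0. Qed.

Lemma tent2_lip n v s t s' t' (d : R) : `|s - s'| <= d -> `|t - t'| <= d ->
  `|tent2 (n := n) v s t - tent2 v s' t'| <= 4 * n%:R * d.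
Proof.
move=> sd td; rewrite /tent2.
have -> : tent n v.1 s * tent n v.2 t - tent n v.1 s' * tent n v.2 t' =
  (tent n v.1 s - tent n v.1 s') * tent n v.2 t + tent n v.1 s' * (tent n v.2 t - tent n v.2 t').
  by ring.
have H (a b c : R) : 0 <= b -> b <= 1 -> `|a| <= c -> `|a| * `|b| <= c.
  move=> b0 b1 ac; rewrite (ger0_norm b0) -[leRHS]mulr1 ler_pM//.
apply: le_trans (ler_normD _ _) _; rewrite !normrM [X in _ + X]mulrC.
have -> : 4 * n%:R * d = 2 * n%:R * d + 2 * n%:R * d by ring.
apply: lerD; apply: H; rewrite ?tent_ge0 ?tent_le1//; apply: le_trans (tent_lip _ _ _ _) _;
  by rewrite ler_wpM2l// mulr_ge0.
Qed.

End unit_square.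

(** Here n and y are the distance to the centre and the energy of a point, n' and y' those after a
    step of length d W. Three invariants are propagated: n <= 7/8 r, the confinement y + eta0 / 2 (n
    - r/2) <= c, and the accumulated progress. A point that moves has y > c - 5/4 kappa, so the
    confinement and 10 kappa <= eta0 r give n < 3/4 r; a step of at most r/8 keeps it below 7/8 r.
    Beyond r/2 the step lowers y at rate eta0 / 2, which preserves the confinement. *)
Lemma deformation_step_bounds (R : realFieldType) (n n' h y y' W d eta eta0 kappa c r k : R) :
  0 < eta -> 0 < eta0 -> 0 < d -> d <= r / 8 -> 0 <= W -> W <= 1 -> 10 * kappa <= eta0 * r ->
  n <= 7 / 8 * r -> y <= c -> y + eta0 / 2 * (n - r / 2) <= c ->
  y <= c - kappa / 2 \/ y <= c - k * (eta / 2 * d) ->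
  n' <= h + n -> h <= d * W -> y' <= y - eta / 2 * (d * W) ->
  (r / 2 - d <= n -> y' <= y - eta0 / 2 * (d * W)) ->
  (c - kappa / 2 < y -> W = 1) -> (y <= c - 5 / 4 * kappa -> n' = n) ->
  [/\ n' <= 7 / 8 * r, y' <= c /\ y' + eta0 / 2 * (n' - r / 2) <= c &
      y' <= c - kappa / 2 \/ y' <= c - (k + 1) * (eta / 2 * d)].
Proof.
move=> eta_gt0 eta00 d0 dr W0 W1 kappa_le nr Ic Psi Ik tri hd Ir Ir0 WT WF.
have dW : d * W <= d by rewrite ler_piMr// ltW.
have dW0 : 0 <= d * W by rewrite mulr_ge0// ltW.
have eW : 0 <= eta / 2 * (d * W) by rewrite mulr_ge0// divr_ge0// ltW.
split.
- have [/WF -> //|Ihigh] := leP y (c - 5 / 4 * kappa).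
  have : eta0 / 2 * (n - r / 2) < eta0 / 2 * (r / 4) by lra.
  by rewrite ltr_pM2l ?divr_gt0//; lra.
- split; first by lra.
  have [gd|gd] := leP (r / 2 - d) n.
    have tri' : eta0 / 2 * n' <= eta0 / 2 * (n + d * W) by rewrite ler_pM2l ?divr_gt0//; lra.
    by have := Ir0 gd; move: tri' Psi; rewrite !mulrBr mulrDr; lra.
  have neg : eta0 / 2 * (n' - r / 2) <= 0 by rewrite pmulr_rle0 ?divr_gt0//; lra.
  by lra.
- have [Ilow|Ihigh] := leP y (c - kappa / 2); first by left; lra.
  have W_1 := WT Ihigh; right; case: Ik => [Ik|Ik]; first by lra.
  by move: Ir Ik; rewrite W_1 mulr1 mulrDl mul1r; lra.
Qed.

(** * Pseudo-gradient deformation of a square *)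

Section deformation.
Context {R : realType} {E : lmodType R}.
Variables (X : set E) (nrm : E -> R) (I : E -> R) (D : E -> E -> R) (x0 : E) (r : R).
Hypotheses (r0 : 0 < r) (Xx0 : X x0) (XD : forall x y, X x -> X y -> X (x + y))
  (XZ : forall a x, X x -> X (a *: x))
  (nrmD : forall x y, X x -> X y -> nrm (x + y) <= nrm x + nrm y)
  (nrmZ : forall a x, X x -> nrm (a *: x) = `|a| * nrm x)
  (DD : forall x h k, X x -> X h -> X k -> D x (h + k) = D x h + D x k)
  (DZ : forall x a h, X x -> X h -> D x (a *: h) = a * D x h).

Let B x := X x /\ nrm (x - x0) <= r.

Hypothesis Itaylor : forall e, 0 < e -> exists2 d, 0 < d &
  forall x h, B x -> X h -> nrm h <= d -> I (x + h) <= I x + D x h + e * nrm h.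
Hypothesis Icont : forall e, 0 < e -> exists2 d, 0 < d &
  forall x y, B x -> B y -> nrm (x - y) <= d -> `|I x - I y| <= e.
Hypothesis Dcont : forall e, 0 < e -> exists2 d, 0 < d &
  forall x y h, B x -> B y -> nrm (x - y) <= d -> X h -> nrm h <= 1 -> `|D x h - D y h| <= e.

Variables (eta eta0 : R).
Hypotheses (eta_gt0 : 0 < eta) (eta_le : eta <= eta0).
(** Two rates: [eta] on the whole ball and the better [eta0] away from the centre. Only [eta0]
    limits the admissible drop [kappa]; [eta] merely determines the number of steps. *)
Hypothesis descent : forall x, B x -> exists h, [/\ X h, nrm h <= 1, D x h <= - eta &
  r / 4 <= nrm (x - x0) -> D x h <= - eta0].

Let XX0 : X 0. Proof. by rewrite -(scale0r x0); exact: XZ. Qed.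

Let nrm0 : nrm 0 = 0. Proof. by rewrite -(scale0r x0) nrmZ// normr0 mul0r. Qed.

Let XB x y : X x -> X y -> X (x - y).
Proof. by move=> Xx Xy; rewrite -scaleN1r; apply: XD => //; exact: XZ. Qed.

Let nrmBC x y : X x -> X y -> nrm (x - y) = nrm (y - x).
Proof. by move=> Xx Xy; rewrite -(opprB y x) -(scaleN1r (y - x)) nrmZ ?normrN1 ?mul1r//; exact: XB. Qed.

Let nrm_tri z x y : X x -> X y -> X z -> nrm (x - y) <= nrm (x - z) + nrm (z - y).
Proof.
by move=> Xx Xy Xz; rewrite -[X in nrm X <= _](subrKA z); apply: nrmD; exact: XB.
Qed.

Let lincomb (T : Type) (l : seq T) (phi : T -> E) (a : T -> R) :
  (forall v, X (phi v) /\ nrm (phi v) <= 1) ->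
  [/\ X (\sum_(v <- l) a v *: phi v), nrm (\sum_(v <- l) a v *: phi v) <= \sum_(v <- l) `|a v| &
    forall x, X x -> D x (\sum_(v <- l) a v *: phi v) = \sum_(v <- l) a v * D x (phi v)].
Proof.
move=> Hphi; elim: l => [|v l [IX In ID]].
  rewrite !big_nil nrm0; split => // x Xx.
  by rewrite big_nil -(scale0r (0 : E)) DZ// mul0r.
have [Xv nv] := Hphi v; have Xav := XZ (a v) Xv.
rewrite !big_cons; split; first exact: XD.
  apply: le_trans (nrmD Xav IX) _; rewrite lerD// nrmZ//.
  by rewrite -[leRHS]mulr1 ler_wpM2l.
by move=> x Xx; rewrite DD// ID// DZ// big_cons.
Qed.

Variables (c kappa : R).
Hypotheses (kappa_gt0 : 0 < kappa) (kappa_le : 10 * kappa <= eta0 * r).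

(** In place of a flow, a single explicit displacement: descent directions are chosen at the nodes
    of a fine grid of the parameter square and mixed by the tent partition of unity, so continuity
    in (s, t) is that of the tents. W is the total weight of the active nodes. *)
Let deformation_step (d : R) : 0 < d -> d <= r / 8 ->
  (forall x h, B x -> X h -> nrm h <= d -> I (x + h) <= I x + D x h + eta / 4 * nrm h) ->
  forall g, unif_cont2 nrm g ->
  (forall s t, unitI s -> unitI t -> X (g s t) /\ nrm (g s t - x0) <= r) ->
  exists2 g', unif_cont2 nrm g' & forall s t, unitI s -> unitI t -> exists W,
    [/\ 0 <= W <= 1, X (g' s t), nrm (g' s t - g s t) <= d * W,
        I (g' s t) <= I (g s t) - eta / 2 * (d * W) /\
        (r / 2 - d <= nrm (g s t - x0) -> I (g' s t) <= I (g s t) - eta0 / 2 * (d * W)) &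
        (c - kappa / 2 < I (g s t) -> W = 1) /\
        (I (g s t) <= c - 5 / 4 * kappa -> W = 0 /\ g' s t = g s t)].
Proof.
move=> d0 dr Hd g ug gB.
have k4 : 0 < kappa / 4 by rewrite divr_gt0.
have e4 : 0 < eta / 4 by rewrite divr_gt0.
have r8 : 0 < r / 8 by rewrite divr_gt0.
have [dI dI0 HI] := Icont k4; have [dD dD0 HD] := Dcont e4.
have m0 : 0 < Num.min (Num.min dI dD) (r / 8) by rewrite !lt_min dI0 dD0.
have [dg dg0 Hg] := ug _ m0.
have [n _ /(_ n (leqnn n)) /= /ltW Hn] := near_infty_natSinv_lt (PosNum dg0).
pose V : finType := ('I_n.+2 * 'I_n.+2)%type.
have gI (i : 'I_n.+2) : unitI (i%:R / n.+1%:R : R) by apply: grid_unitI; rewrite -ltnS.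
pose p (v : V) := g (v.1%:R / n.+1%:R) (v.2%:R / n.+1%:R).
have pB v : B (p v) by have [? ?] := gB _ _ (gI v.1) (gI v.2).
have /choice[phi Hphi] := fun v => descent (pB v).
have phi1 v : X (phi v) /\ nrm (phi v) <= 1 by case: (Hphi v).
(* A node is active if its energy exceeds c - kappa. As energies vary by at most kappa / 4 between a
   point and its nodes, all nodes are active above c - kappa / 2 and none below c - 5/4 kappa. *)
pose a v : R := ((c - kappa < I (p v))%R : bool)%:R.
pose w s t v : R := tent2 v s t * a v.
pose h s t := \sum_v w s t v *: phi v.
have a0 v : 0 <= a v by [].
have a1 v : a v <= 1 by rewrite /a; case: (_ < _).
have w0 s t v : 0 <= w s t v by rewrite mulr_ge0 ?tent2_ge0.
have near_v s t v : unitI s -> unitI t -> tent2 v s t != 0 ->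
    [/\ `|I (g s t) - I (p v)| <= kappa / 4, nrm (g s t - p v) <= r / 8 &
     forall k, X k -> nrm k <= 1 -> `|D (g s t) k - D (p v) k| <= eta / 4].
  move=> sI tI; rewrite /tent2 mulf_eq0 negb_or => /andP[v1 v2].
  have := Hg _ _ _ _ sI tI (gI v.1) (gI v.2) (le_trans (tent_neq0 v1) Hn) (le_trans (tent_neq0 v2) Hn).
  rewrite !le_min => /andP[/andP[n1 n2] n3]; have [Xg gr] := gB _ _ sI tI.
  by split => //; [exact: HI | move=> k; exact: HD].
have w_tent s t v : w s t v != 0 -> tent2 v s t != 0 by rewrite mulf_eq0 negb_or => /andP[].
exists (fun s t => g s t + d *: h s t).
  move=> e e0; have e2 : 0 < e / 2 by rewrite divr_gt0.
  have [d1 d10 H1] := ug _ e2.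
  pose M : R := d * (#|V|%:R * (4 * n.+1%:R)).
  have M0 : 0 < M + 1 by rewrite ltr_pwDr// !mulr_ge0// ltW.
  exists (Num.min d1 (e / 2 / (M + 1))); first by rewrite lt_min d10 divr_gt0.
  move=> s t s' t' sI tI sI' tI' sd td; set dd := Num.min _ _ in sd td.
  have dd1 : dd <= d1 by rewrite ge_min lexx.
  have dd2 : dd * (M + 1) <= e / 2 by rewrite -ler_pdivlMr// ge_min lexx orbT.
  have dd0 : 0 <= dd by rewrite le_min !ltW// divr_gt0.
  have [Xg _] := gB _ _ sI tI; have [Xg' _] := gB _ _ sI' tI'.
  have [Xh nh _] := lincomb (index_enum _) (fun v => w s t v - w s' t' v) phi1.
  have -> : g s t + d *: h s t - (g s' t' + d *: h s' t') =
     g s t - g s' t' + d *: (\sum_v (w s t v - w s' t' v) *: phi v).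
    rewrite opprD addrACA -scalerBr /h -sumrB; congr (_ + _ *: _).
    by apply: eq_bigr => v _; rewrite scalerBl.
  apply: le_trans (nrmD (XB Xg Xg') (XZ d Xh)) _.
  rewrite [e]splitr; apply: lerD; first by apply: H1 => //; apply: le_trans dd1.
  rewrite nrmZ// gtr0_norm//; apply: le_trans dd2.
  have nsum : \sum_v `|w s t v - w s' t' v| <= (4 * n.+1%:R * dd) *+ #|V|.
    rewrite -sumr_const; apply: ler_sum => v _.
    rewrite /w -mulrBl normrM (ger0_norm (a0 v)) -[leRHS]mulr1.
    by apply: ler_pM => //; exact: tent2_lip.
  apply: le_trans (_ : d * (4 * n.+1%:R * dd *+ #|V|) <= _).
    by rewrite ler_pM2l//; exact: le_trans nsum.
  rewrite -mulr_natl /M; have ar (dd' dc m l : R) : 0 <= dd' -> d * (m * (l * dd')) <= dd' * (d * (m * l) + 1).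
    by move=> ?; rewrite mulrDr mulr1 -[leLHS]addr0 lerD//; rewrite le_eqVlt; apply/orP; left; apply/eqP; ring.
  exact: (ar _ 0).
move=> s t sI tI; have [Xg gr] := gB _ _ sI tI.
pose W := \sum_v w s t v.
have W0 : 0 <= W by apply: sumr_ge0.
have W1 : W <= 1.
  by rewrite -(sum_tent2 n.+1 sI tI); apply: ler_sum => v _; rewrite ler_piMr ?tent2_ge0.
have [Xh nh Dh] := lincomb (index_enum _) (w s t) phi1.
have {}nh : nrm (h s t) <= W.
  by apply: le_trans nh _; apply: ler_sum => v _; rewrite ger0_norm.
have Xdh : X (d *: h s t) by exact: XZ.
have dW : 0 <= d * W by rewrite mulr_ge0// ltW.
have dnh : nrm (d *: h s t) <= d * W by rewrite nrmZ// gtr0_norm// ler_pM2l.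
have HI' : I (g s t + d *: h s t) <= I (g s t) + d * D (g s t) (h s t) + eta / 4 * (d * W).
  apply: le_trans (Hd _ _ _ Xdh _) _ => //.
    by apply: le_trans dnh _; rewrite ler_piMr// ltW.
  by rewrite DZ// lerD2l ler_pM2l.
have rate e : (forall v, w s t v != 0 -> D (p v) (phi v) <= - e) -> eta <= e ->
    I (g s t + d *: h s t) <= I (g s t) - e / 2 * (d * W).
  move=> He ee.
  (* Passing from the nodes to g s t loses a quarter of the rate, the Taylor remainder another
     quarter: half of it is left. *)
  have : D (g s t) (h s t) <= - (3 / 4 * e) * W.
    rewrite Dh// mulr_sumr; apply: ler_sum => v _; rewrite [leRHS]mulrC.
    have [->|w_neq0] := eqVneq (w s t v) 0; first by rewrite !mul0r.
    have [_ _ /(_ (phi v) (phi1 v).1 (phi1 v).2)] := near_v _ _ _ sI tI (w_tent _ _ _ w_neq0).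
    rewrite ler_norml => /andP[_ Dv]; apply: ler_wpM2l => //; have := He v w_neq0.
    by move: Dv ee; move: (D _ _) (D _ _) => *; lra.
  rewrite -(ler_pM2l d0) => HDh; apply: le_trans HI' _.
  have ee' : eta / 4 * (d * W) <= e / 4 * (d * W) by rewrite ler_wpM2r// ler_pM2r.
  have ar (x y z u : R) : y <= d * (- (3 / 4 * e) * W) -> z <= e / 4 * (d * W) ->
     x + y + z <= x - e / 2 * (d * W).
    move=> yl zl; apply: le_trans (lerD (lerD (lexx x) yl) zl) _; rewrite le_eqVlt; apply/orP; left; apply/eqP; by field.
  exact: (ar _ _ _ 0).
exists W; rewrite W0 W1; split => //.
- exact: XD.
- by rewrite addrC addKr.
- split; first by apply: rate => // v _; case: (Hphi v).
  move=> gd; apply: rate => // v w_neq0; have [_ _ _] := Hphi v; apply.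
  have [_ pn _] := near_v _ _ _ sI tI (w_tent _ _ _ w_neq0).
  have := nrm_tri Xg Xx0 (pB v).1; move: gd pn dr.
  by move: (nrm (g s t - x0)) (nrm (g s t - p v)) (nrm _) => *; lra.
split => [Ic|Ic].
  rewrite -(sum_tent2 n.+1 sI tI); apply: eq_bigr => v _; rewrite /w.
  have [t0|t0] := eqVneq (tent2 v s t) 0; first by rewrite t0 mul0r.
  rewrite /a; case: (ltP (c - kappa) (I (p v))) => [|Ip]; first by rewrite mulr1.
  have [In _ _] := near_v _ _ _ sI tI t0.
  by exfalso; move: In; rewrite ler_norml => /andP[_]; move: Ip Ic kappa_gt0; move: (I _) (I _) => *; lra.
have w00 v : w s t v = 0.
  apply: contrapT => /eqP w_neq0; have [Ip _ _] := near_v _ _ _ sI tI (w_tent _ _ _ w_neq0).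
  move: w_neq0; rewrite /w /a; case: (ltP (c - kappa) (I (p v))) => [Iv|]; last by rewrite mulr0 eqxx.
  by move: Ip; rewrite ler_norml => /andP[Ip _] _; move: Ip Ic Iv kappa_gt0; move: (I _) (I _) => *; lra.
by rewrite /W /h; split; rewrite big1 ?scaler0 ?addr0// => v _; rewrite w00// scale0r.
Qed.

(** Iterated steps of fixed length d. The confinement holds at the start because g0 stays within
    r/2; a point starting below c - 2 kappa is never moved, its weight W being 0 at every step. *)
Lemma deformation g0 : unif_cont2 nrm g0 ->
  (forall s t, unitI s -> unitI t -> [/\ X (g0 s t), nrm (g0 s t - x0) <= r / 2 & I (g0 s t) <= c]) ->
  exists2 g, unif_cont2 nrm g & forall s t, unitI s -> unitI t ->
    [/\ X (g s t), nrm (g s t - x0) <= r, I (g s t) <= c - kappa / 2 &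
        I (g0 s t) <= c - 2 * kappa -> g s t = g0 s t].
Proof.
move=> ug0 Hg0; have e4 : 0 < eta / 4 by rewrite divr_gt0.
have [d1 d10 H1] := Itaylor e4.
pose d := Num.min d1 (r / 8).
have d0 : 0 < d by rewrite lt_min d10 divr_gt0.
have dr : d <= r / 8 by rewrite ge_min lexx orbT.
have Hd x h : B x -> X h -> nrm h <= d -> I (x + h) <= I x + D x h + eta / 4 * nrm h.
  by move=> Bx Xh hd; apply: H1 => //; apply: le_trans hd _; rewrite ge_min lexx.
have eta00 : 0 < eta0 by exact: lt_le_trans eta_le.
have ed0 : 0 < eta / 2 * d by rewrite mulr_gt0// divr_gt0.
have P k : exists2 g, unif_cont2 nrm g & forall s t, unitI s -> unitI t ->
    [/\ X (g s t), nrm (g s t - x0) <= 7 / 8 * r,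
        I (g s t) <= c /\ I (g s t) + eta0 / 2 * (nrm (g s t - x0) - r / 2) <= c,
        I (g s t) <= c - kappa / 2 \/ I (g s t) <= c - k%:R * (eta / 2 * d) &
        I (g0 s t) <= c - 2 * kappa -> g s t = g0 s t].
  elim: k => [|k [g ug Hg]].
    exists g0 => // s t sI tI; have [? nr Ic] := Hg0 _ _ sI tI; split => //.
    - by apply: le_trans nr _; lra.
    - split => //; rewrite -[leRHS]addr0 lerD//.
      by rewrite pmulr_rle0 ?divr_gt0// subr_le0.
    - by right; rewrite mul0r subr0.
  have gB s t : unitI s -> unitI t -> X (g s t) /\ nrm (g s t - x0) <= r.
    by move=> sI tI; have [? nr _ _ _] := Hg _ _ sI tI; split => //; lra.
  have [g' ug' Hg'] := deformation_step d0 dr Hd ug gB.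
  exists g' => // s t sI tI.
  have [Xg nr [Ic Psi] Ik gg0] := Hg _ _ sI tI.
  have [W [/andP[W0 W1] Xg' ng' [Ir Ir0] [WT WF]]] := Hg' _ _ sI tI.
  have kE : k.+1%:R = k%:R + 1 :> R by rewrite natr1.
  have [n' [Ic' Psi'] Ik'] : [/\ nrm (g' s t - x0) <= 7 / 8 * r,
      I (g' s t) <= c /\ I (g' s t) + eta0 / 2 * (nrm (g' s t - x0) - r / 2) <= c &
      I (g' s t) <= c - kappa / 2 \/ I (g' s t) <= c - (k%:R + 1) * (eta / 2 * d)].
    apply: (deformation_step_bounds eta_gt0 eta00 d0 dr W0 W1 kappa_le nr Ic Psi Ik _ ng' Ir Ir0) => [|/WT//|/WF[_ ->]//].
    exact: nrm_tri Xg' Xx0 Xg.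
  split; [exact: Xg'|exact: n'|exact: conj Ic' Psi'|by rewrite kE|].
  - move=> Ig0; have gg := gg0 Ig0; rewrite -gg; apply: (WF _).2.
    by rewrite gg; move: Ig0 kappa_gt0; lra.
(* After more than kappa / (eta / 2 d) steps the second alternative is a drop larger than kappa, so
   it implies the first. *)
have [k _ /(_ k (leqnn k)) /= Hk] := near_infty_natSinv_lt (PosNum (divr_gt0 ed0 kappa_gt0)).
have [g ug Hg] := P k.+1; exists g => // s t sI tI.
have [Xg nr _ Ik gg0] := Hg _ _ sI tI; split => //; first by lra.
case: Ik => // Ik; apply: le_trans Ik _; rewrite lerD2l lerN2.
have : kappa < k.+1%:R * (eta / 2 * d).
  by move: Hk; rewrite ltr_pdivlMr// mulrC -ltr_pdivlMr ?invr_gt0// invrK mulrC.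
by move: kappa_gt0; lra.
Qed.

End deformation.

(** * Maximum principles *)

Lemma max0P (R : realDomainType) (x : R) :
  Num.max 0 x = x /\ 0 <= x \/ Num.max 0 x = 0 /\ x <= 0.
Proof. by case: (leP 0 x) => [|/ltW] H; [left|right]. Qed.

(** Meant for d a difference of u and e the same difference of its negative part: they have opposite
    signs and e is the smaller one in absolute value. *)
Lemma signed_pow_opp_le (R : realType) (p d e : R) : 1 < p ->
  (0 <= d -> - d <= e <= 0) -> (d <= 0 -> 0 <= e <= - d) ->
  signed_pow p d * e <= - (`|e| `^ p).
Proof.
move=> p1 H1 H2; wlog d0 : d e H1 H2 / 0 <= d.
  move=> W; have [|d0] := leP 0 d; first exact: W.
  have /andP[e0 ed] := H2 (ltW d0).
  rewrite -[X in signed_pow _ X]opprK signed_powN mulNr -mulrN -(normrN e).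
  by apply: W => [_|d0'|]; [apply/andP; split; lra | lra | lra].
have /andP[de e0] := H1 d0.
have <- : signed_pow p (- e) * - e = `|e| `^ p by rewrite signed_powM// normrN.
rewrite mulrN opprK; apply: ler_wnM2r => //.
rewrite !signed_pow_ge0 ?oppr_ge0// ler_powR_base ?oppr_ge0 ?subr_ge0 ?(ltW p1)//.
by rewrite lerNl.
Qed.

Section Rintegral_zero.
Context d (T : measurableType d) (R : realType).
Variables (m : {measure set T -> \bar R}) (D : set T).
Hypothesis mD : measurable D.

Lemma Rintegral_le0_ae (f : T -> R) : m.-integrable D (EFin \o f) ->
  {ae m, forall x, D x -> 0 <= f x} -> \int[m]_(x in D) f x <= 0 ->
  {ae m, forall x, D x -> f x = 0}.
Proof.
move=> if_ f0 fle; have mf : measurable_fun D (EFin \o f) by exact: measurable_int if_.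
have E : (\int[m]_(x in D) `|(EFin \o f) x| = \int[m]_(x in D) (EFin \o f) x)%E.
  apply: ae_eq_integral => //; first exact: measurableT_comp mf.
  by apply: filterS f0 => x H Dx; rewrite /= ger0_norm// H.
have I0 : (\int[m]_(x in D) `|(EFin \o f) x| = 0)%E.
  apply/eqP; rewrite eq_le integral_ge0 ?andbT// E.
  by rewrite -[leLHS]fineK ?(integrable_fin_num mD if_)// lee_fin.
have := (ae_eq_integral_abs m mD mf).1 I0.
by apply: filterS => x H Dx; have [] := H Dx.
Qed.

End Rintegral_zero.

Section fractional_order.
Context {R : realType} {N : nat}.
Variables (Omega : set 'rV[R]_N) (s p : R).
Hypotheses (oO : open Omega) (bO : bounded_set Omega).
Hypotheses (s01 : 0 < s < 1) (p1 : 1 < p) (spN : s * p < N%:R).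
Local Notation mu := (lebesgue_rV R N).
Local Notation mu2 := (mu \x mu)%E.
Implicit Types (u v w : 'rV[R]_N -> R).
Local Notation energy u := (Lp_energy mu2 p (frac_diff s p u)).
Local Notation X := (X0 Omega s p).

Let p0 : 0 < p. Proof. by rewrite (lt_trans _ p1). Qed.
Let LX u (Xu : X u) : Lp mu2 p (frac_diff s p u) := X0_fLp oO p1 Xu.

(** Covers truncations, for which a = b and K = 0, as well as the product of a bounded function of
    X0 by a Lipschitz function of another one. *)
Lemma X0_lip2 a b v (K : R) : X a -> X b -> 0 <= K -> measurable_fun setT v ->
  zero_outside Omega v ->
  (forall x y, `|v x - v y| <= `|a x - a y| + K * `|b x - b y|) -> X v.
Proof.
move=> Xa Xb K0 mv v0 vab; apply: (X0_intro oO bO s01 p1 spN) => //.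
have abs c : X c -> Lp mu2 p (fun z => `|frac_diff s p c z|).
  move=> /LX Lc; apply: (Lp_dom p1 _ Lc) => [|z]; last by rewrite normr_id.
  by case: Lc => mc _; exact: measurableT_comp.
apply: (Lp_dom p1 (measurable_frac_diff s p mv) (LpD p1 (abs _ Xa) (LpZ K (abs _ Xb)))) => z.
rewrite [leRHS]ger0_norm ?addr_ge0 ?mulr_ge0// /frac_diff 3!normrM mulrA -mulrDl.
by rewrite ler_wpM2r.
Qed.

Definition neg_part u x : R := Num.max 0 (- u x).

Let neg_lip (a b : R) : `|Num.max 0 (- a) - Num.max 0 (- b)| <= `|a - b|.
Proof.
rewrite ler_norml; have := ler_norm (a - b); have := ler_norm (b - a); rewrite distrC.
by case: (max0P (- a)) (max0P (- b)) => -[-> ?] [] [-> ?] *; apply/andP; split; lra.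
Qed.

Lemma X0_neg_part u : X u -> X (neg_part u).
Proof.
move=> Xu; apply: (@X0_lip2 u u _ 0) => //.
- apply: measurable_maxr => //; apply: measurableT_comp => //; exact: X0_measurable Xu.
- by apply: filterS (X0_zero Xu) => x H nO; rewrite /neg_part H// oppr0 maxxx.
- by move=> x y; rewrite mul0r addr0; exact: neg_lip.
Qed.

(** Integrating [signed_pow_opp_le] shows that the pairing is at most minus the energy of the
    negative part, which therefore vanishes. *)
Lemma neg_part_test u : X u -> 0 <= frac_plap s p u (neg_part u) -> nonneg_ae u.
Proof.
move=> Xu; have Xn := X0_neg_part Xu; rewrite (frac_plapE _ p1) Lp_dualE => H.
have E0 : energy (neg_part u) <= 0.
  rewrite -oppr_ge0; apply: le_trans H _; rewrite Lp_energyE.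
  have [mn inn] := LX Xn.
  rewrite -mulN1r -RintegralZl//; apply: le_Rintegral => //.
  - by apply: (Lp_dual_integrable p1); exact: LX.
  - exact: integrable_RZ.
  move=> z _; rewrite mulN1r /frac_diff /neg_part.
  have k0 : 0 <= frac_ker s p z `^ (- p^-1) by exact: powR_ge0.
  apply: signed_pow_opp_le => //; move: (frac_ker _ _ _ `^ _) k0 => k.
    rewrite le_eqVlt => /orP[/eqP <-|k0]; first by rewrite !mulr0 oppr0 lexx.
    rewrite -mulNr (pmulr_lge0 _ k0) (ler_pM2r k0) (pmulr_lle0 _ k0).
    by case: (max0P (- u z.1)) (max0P (- u z.2)) => -[-> ?] [] [-> ?] ?; apply/andP; split; lra.
  rewrite le_eqVlt => /orP[/eqP <-|k0]; first by rewrite !mulr0 oppr0 lexx.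
  rewrite -mulNr (pmulr_lge0 _ k0) (ler_pM2r k0) (pmulr_lle0 _ k0).
  by case: (max0P (- u z.1)) (max0P (- u z.2)) => -[-> ?] [] [-> ?] ?; apply/andP; split; lra.
have n0 : fnorm s p (neg_part u) = 0.
  apply/eqP; rewrite eq_le fnorm_ge0 andbT (fnorm_le _ p1)// powR0 ?gt_eqF//.
apply: filterS (fnorm_eq0 oO bO s01 p1 spN Xn n0) => x.
by rewrite /neg_part; case: (max0P (- u x)) => -[-> ?]; lra.
Qed.

(* Testing with [phi * (1 - n u)^+] and letting n -> oo leaves only the
   interaction between the zero set of u (weighted by phi) and its complement. *)
Lemma strong_maximum u phi : X u -> nonneg_ae u -> ~ {ae mu, forall x, u x = 0} ->
  X phi -> (forall x, 0 <= phi x <= 1) -> positive_ae Omega phi ->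
  (forall w, X w -> (forall x, 0 <= w x) -> 0 <= frac_plap s p u w) ->
  positive_ae Omega u.
Proof.
move=> Xu u0 un0 Xphi phi01 phi0 super.
have mu_ := X0_measurable Xu; have mphi := X0_measurable Xphi.
pose m n x : R := Num.max 0 (1 - n%:R * Num.max 0 (u x)).
have m01 n x : 0 <= m n x <= 1.
  rewrite /m; have : 0 <= n%:R * Num.max 0 (u x) by rewrite mulr_ge0// le_max lexx.
  by case: (max0P (1 - n%:R * Num.max 0 (u x))) => -[-> ?] *; apply/andP; split; lra.
have m_anti n x y : u x <= u y -> m n y <= m n x.
  move=> uxy; have : Num.max 0 (u x) <= Num.max 0 (u y).
    by rewrite ge_max le_max lexx /= le_max uxy orbT.
  move=> /(ler_wpM2l (ler0n R n)); rewrite /m; move: (_ * _) (_ * _) => a b.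
  by case: (max0P (1 - a)) (max0P (1 - b)) => -[-> ?] [] [-> ?] *; lra.
have m_lip n x y : `|m n x - m n y| <= n%:R * `|u x - u y|.
  have : `|n%:R * Num.max 0 (u x) - n%:R * Num.max 0 (u y)| <= n%:R * `|u x - u y|.
    rewrite -mulrBr normrM ger0_norm//; apply: ler_wpM2l => //.
    have := ler_norm (u x - u y); have := ler_norm (u y - u x); rewrite distrC ler_norml.
    by case: (max0P (u x)) (max0P (u y)) => -[-> ?] [] [-> ?] *; apply/andP; split; lra.
  rewrite /m; move: (n%:R * Num.max 0 (u x)) (n%:R * Num.max 0 (u y)) (n%:R * `|_|) => a b c; rewrite !ler_norml => /andP[].
  by case: (max0P (1 - a)) (max0P (1 - b)) => -[-> ?] [] [-> ?] *; apply/andP; split; lra.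
pose w n x := phi x * m n x.
have mm n : measurable_fun setT (m n).
  apply: measurable_maxr => //; apply: measurable_funB => //; apply: measurable_funM => //.
  exact: measurable_maxr.
have Xw n : X (w n).
  apply: (X0_lip2 Xphi Xu (ler0n R n)).
  - exact: measurable_funM.
  - by apply: filterS (X0_zero Xphi) => x H nO; rewrite /w H// mul0r.
  move=> x y; have -> : w n x - w n y = (phi x - phi y) * m n x + phi y * (m n x - m n y).
    by rewrite /w; ring.
  have /andP[mx0 mx1] := m01 n x; have /andP[py0 py1] := phi01 y.
  apply: le_trans (ler_normD _ _) _; rewrite !normrM (ger0_norm mx0) (ger0_norm py0).
  apply: lerD; first by rewrite ler_piMr.
  by apply: le_trans (m_lip n x y); rewrite ler_piMl.
have w0 n x : 0 <= w n x.
  by have /andP[? _] := m01 n x; have /andP[? _] := phi01 x; rewrite mulr_ge0.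
pose w_oo x : R := if u x <= 0 then phi x else 0.
have mw_oo : measurable_fun setT w_oo.
  by apply: measurable_fun_ifT => //; exact: measurable_fun_ler.
have w_oo0 x : 0 <= w_oo x.
  by rewrite /w_oo; case: ifP => // _; case/andP: (phi01 x).
have w_cvg x : w n x @[n --> \oo] --> w_oo x.
  rewrite /w_oo /w; case: leP => ux.
    have -> : (fun n => phi x * m n x) = cst (phi x).
      by apply/funext => n; rewrite /m (max_l ux) mulr0 subr0 (max_r ler01) mulr1.
    exact: cvg_cst.
  rewrite -[X in _ --> X](mulr0 (phi x)); apply: cvgMr; apply: cvg_near_cst.
  exists (Num.truncn (u x)^-1).+1 => // n /= un; rewrite /m (max_r (ltW ux)) max_l//.
  rewrite subr_le0 -ler_pdivrMr// mul1r; apply: ltW; apply: lt_le_trans (truncnS_gt _) _.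
  by rewrite ler_nat.
pose T v z := signed_pow p (frac_diff s p u z) * frac_diff s p v z.
have Tint v : X v -> mu2.-integrable setT (EFin \o T v).
  by move=> Xv; apply: (Lp_dual_integrable p1); exact: LX.
(* [m n] decreases with u, so its own increments contribute a nonpositive amount to [T (w n)]; only
   those of phi remain, whence a majorant independent of n. This bound from above is all that
   Fatou's lemma requires. *)
pose dom z := `|T phi z|.
have idom : mu2.-integrable setT (EFin \o dom).
  by have := integrable_norm (Tint _ Xphi).
have TE v z : T v z = signed_pow p (frac_diff s p u z) * frac_ker s p z `^ (- p^-1) * (v z.1 - v z.2).
  by rewrite /T {2}/frac_diff; ring.
have fd_ge0 z : u z.2 <= u z.1 -> 0 <= signed_pow p (frac_diff s p u z) * frac_ker s p z `^ (- p^-1).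
  by move=> uz; rewrite /signed_pow /frac_diff !mulr_ge0 ?powR_ge0// subr_ge0.
have fd_le0 z : u z.1 <= u z.2 -> signed_pow p (frac_diff s p u z) * frac_ker s p z `^ (- p^-1) <= 0.
  move=> uz; rewrite /signed_pow /frac_diff mulr_le0_ge0 ?powR_ge0// mulr_ge0_le0 ?powR_ge0//.
  by rewrite mulr_le0_ge0 ?powR_ge0// subr_le0.
have wB n x y : u y <= u x -> w n x - w n y <= `|phi x - phi y|.
  move=> uxy; have -> : w n x - w n y = (phi x - phi y) * m n x + phi y * (m n x - m n y).
    by rewrite /w; ring.
  have /andP[mx0 mx1] := m01 n x; have /andP[py0 py1] := phi01 y.
  rewrite -[leRHS]addr0; apply: lerD.
    by apply: le_trans (ler_norm _) _; rewrite normrM (ger0_norm mx0) ler_piMr.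
  by rewrite mulr_ge0_le0// subr_le0 m_anti.
have Tdom n z : T (w n) z <= dom z.
  rewrite /dom !TE normrM; have [uz|/ltW uz] := leP (u z.2) (u z.1).
    by rewrite (ger0_norm (fd_ge0 _ uz)); apply: ler_wpM2l (wB _ _ _ uz); exact: fd_ge0.
  rewrite (ler0_norm (fd_le0 _ uz)) -[leLHS]mulrNN opprB distrC.
  by apply: ler_wpM2l (wB _ _ _ uz); rewrite oppr_ge0 fd_le0.
have mT v : measurable_fun setT v -> measurable_fun setT (T v).
  move=> mv; apply: measurable_funM; last exact: measurable_frac_diff.
  by apply: measurable_signed_pow; exact: measurable_frac_diff.
have [|||||if_ _ fM] := @Rintegral_fatou _ _ _ mu2 setT measurableT
   (fun n z => dom z - T (w n) z) (fun z => dom z - T w_oo z) (\int[mu2]_z dom z).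
- by move=> n; exact: (integrable_RB measurableT idom (Tint _ (Xw n))).
- by move=> n z _; rewrite subr_ge0.
- apply: measurable_funB; last exact: mT.
  by apply: measurableT_comp => //; exact: mT.
- apply: aeW => z _; apply: cvgB; first exact: cvg_cst.
  by apply: cvgMr; apply: cvgMl; apply: cvgB; exact: w_cvg.
- move=> n; rewrite (RintegralB measurableT idom (Tint _ (Xw n))).
  rewrite gerBl; have := super _ (Xw n) (w0 n).
  by rewrite (frac_plapE _ p1) Lp_dualE.
have iT : mu2.-integrable setT (EFin \o (fun z => - T w_oo z)).
  have := integrable_RB measurableT if_ idom.
  by apply: eq_integrable => // z _ /=; congr EFin; ring.
have u02 := ae_prod u0.
(* The supersolution property gives, in the limit, a nonnegative integral of [T w_oo], whereas its
   integrand is nonpositive almost everywhere. *)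
have T0 : {ae mu2, forall z, setT z -> - T w_oo z = 0}.
  apply: Rintegral_le0_ae => //.
    apply: filterS u02 => z [ux uy] _; rewrite oppr_ge0 TE.
    have wz x y : 0 <= u y -> u y < u x -> w_oo x - w_oo y <= 0.
      by move=> y0 yx; rewrite {1}/w_oo (leNgt (u x)) (le_lt_trans y0 yx) sub0r oppr_le0.
    case: (ltgtP (u z.1) (u z.2)) => uz.
    - by rewrite -mulrNN opprB mulr_ge0_le0 ?wz// oppr_ge0 fd_le0// ltW.
    - by rewrite mulr_ge0_le0 ?wz// fd_ge0// ltW.
    - by rewrite /frac_diff uz subrr mul0r signed_pow0 !mul0r.
  have -> : \int[mu2]_z (- T w_oo z) = \int[mu2]_z (dom z - T w_oo z) - \int[mu2]_z dom z.
    by rewrite -(RintegralB measurableT if_ idom); apply: eq_Rintegral => z _; ring.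
  by rewrite subr_le0.
(* On B x A the limit integrand is strictly negative, so this product is null and one of the factors
   is null: B null would make u vanish, and A null is the claim. *)
pose A := [set x | u x <= 0] `&` [set x | 0 < phi x].
pose B := [set x | 0 < u x].
have mA : measurable A.
  apply: measurableI.
    rewrite -[X in measurable X]setTI (_ : _ `&` _ = setT `&` u @^-1` `]-oo, 0]%classic); first exact: mu_.
    by apply/seteqP; split => x /=; rewrite in_itv.
  rewrite -[X in measurable X]setTI (_ : _ `&` _ = setT `&` phi @^-1` `]0, +oo[%classic); first exact: mphi.
  by apply/seteqP; split => x /=; rewrite in_itv/= andbT.
have mB : measurable B.
  rewrite -[X in measurable X]setTI (_ : _ `&` _ = setT `&` u @^-1` `]0, +oo[%classic); first exact: mu_.
  by apply/seteqP; split => x /=; rewrite in_itv/= andbT.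
have nBA : mu2.-negligible (B `*` A).
  apply: negligibleS T0 => z [/= Bz [Az1 Az2]] /(_ I) /eqP; apply/negP.
  rewrite oppr_eq0 TE /w_oo Az1 (leNgt (u z.1) 0) Bz/= sub0r mulrN oppr_eq0.
  have k0 : 0 < frac_ker s p z `^ (- p^-1).
    rewrite powR_gt0// powR_gt0// lt_neqAle enorm_ge0 andbT eq_sym; apply/eqP => /enorm_eq0/eqP.
    by rewrite subr_eq0 => /eqP zE; move: Az1 Bz; rewrite zE /B/= leNgt => /negP.
  rewrite gt_eqF// (mulr_gt0 _ Az2)// (mulr_gt0 _ k0)//.
  rewrite signed_pow_ge0//; last by rewrite mulr_ge0 ?powR_ge0// subr_ge0 (le_trans Az1)// ltW.
  by rewrite powR_gt0// mulr_gt0// subr_gt0 (le_lt_trans Az1).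
have : (mu B * mu A = 0)%E.
  exact: etrans (esym (product_measure1E _ _ mB mA)) (measure_negligible (measurableX mB mA) nBA).
move/eqP; rewrite mule_eq0 => /orP[/eqP B0|/eqP A0].
  exfalso; apply: un0; have nB : {ae mu, forall x, ~ B x}.
    by apply/(negligibleP _ _).2; [rewrite setCK|rewrite setCK].
  by apply: filterS2 nB u0 => x /negP; rewrite -leNgt => ux xu; apply/eqP; rewrite eq_le ux xu.
have nA : {ae mu, forall x, ~ A x}.
  by apply/(negligibleP _ _).2; [rewrite setCK|rewrite setCK].
apply: filterS2 nA phi0 => x Ax ph Ox; rewrite ltNge; apply/negP => ux.
by apply: Ax; split => //=; exact: ph.
Qed.

(** * An explicit nontrivial function of finite energy *)

Let h : R := 2^-1.

Let h01 : 0 < h < 1. Proof. by rewrite /h invr_gt0 ltr0n invf_lt1// ltr1n. Qed.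

Let N0 : 0 < N%:R :> R. Proof. exact: lt_trans (mulr_gt0 (andP s01).1 p0) spN. Qed.

(** Each y with f y nonzero is charged to some box k containing it on which c_k bounds f y; box k
    costs c_k times its volume, and these costs are geometric. *)
Let box_series (x : 'rV[R]_N) (D : set 'rV[R]_N) (rho c : nat -> R) (A q : R) (f : 'rV[R]_N -> R) :
  measurable D -> measurable_fun setT f -> (forall y, 0 <= f y) -> 0 <= A -> 0 <= q < 1 ->
  (forall k, 0 < rho k) -> (forall k, 0 <= c k) -> (forall k, c k * (2 * rho k) ^+ N <= A * q ^+ k) ->
  (forall y, D y -> f y != 0 -> exists k, cbox x (rho k) y /\ f y <= c k) ->
  (\int[mu]_(y in D) (f y)%:E <= (A / (1 - q))%:E)%E.
Proof.
move=> mD mf f0 A0 q01 rho0 c0 cA H.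
have mF k : measurable_fun D (fun y : 'rV[R]_N => ((c k)%:E * (\1_(cbox x (rho k)) y)%:E)%E).
  apply: measurable_funeM; apply/measurable_EFinP; apply: measurable_indic; exact: measurable_cbox.
have F0 k y : (0 <= (c k)%:E * (\1_(cbox x (rho k)) y)%:E)%E by rewrite mule_ge0// lee_fin.
apply: (@le_trans _ _ (\int[mu]_(y in D) \sum_(k <oo) ((c k)%:E * (\1_(cbox x (rho k)) y)%:E))%E).
  apply: ge0_le_integral => //.
  - by move=> y _; rewrite lee_fin.
  - by apply: measurable_funTS; exact/measurable_EFinP.
  - exact: ge0_emeasurable_sum.
  move=> y Dy; have [->|fy] := eqVneq (f y) 0; first by apply: nneseries_ge0.
  have [k [xy fc]] := H y Dy fy.
  apply: le_trans (nneseries_lim_ge k.+1 _) => //.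
  rewrite big_nat_recr//= indicE mem_set// mule1.
  by rewrite -[leLHS]add0e leeD ?lee_fin// sume_ge0.
rewrite integral_nneseries//.
apply: (@le_trans _ _ (\sum_(k <oo) (A%:E * (q ^+ k)%:E))%E).
  apply: lee_nneseries => [k _|k _]; first by move=> _; apply: integral_ge0.
  rewrite ge0_integralZl_EFin//; last first.
    by apply/measurable_EFinP; apply: measurable_indic; exact: measurable_cbox.
  rewrite integral_indic//; last exact: measurable_cbox.
  apply: (@le_trans _ _ ((c k)%:E * mu (cbox x (rho k)))%E).
    rewrite lee_wpmul2l ?lee_fin// le_measure ?inE//; last exact: measurable_cbox.
    by apply: measurableI => //; exact: measurable_cbox.
  by rewrite (lebesgue_cbox _ (ltW (rho0 k))) -!EFinM lee_fin.
rewrite nneseriesZl; last by move=> k _; rewrite lee_fin exprn_ge0//; case/andP: q01.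
by rewrite EFinM lee_wpmul2l ?lee_fin// geometric_nneseries_le.
Qed.

(** Majorant of the energy integrand of a function with oscillation at most r and Lipschitz constant
    N. *)
Let lip_ker (r : R) (z : 'rV[R]_N * 'rV[R]_N) : R :=
  Num.min r (N%:R * enorm (z.1 - z.2)) `^ p / frac_ker s p z.

Let notin_cbox (x y : 'rV[R]_N) (r : R) : ~ cbox x r y -> r < enorm (x - y).
Proof.
move=> H; rewrite ltNge; apply/negP => xy; apply: H => i.
by rewrite distrC; apply: le_trans xy; have := coord_le_enorm (x - y) i; rewrite !mxE.
Qed.

Let half_lt1 (a : R) : 0 < a -> h `^ a < 1.
Proof.
move=> a0; have /andP[h0 h1] := h01.
by have := gt0_ltr_powR a0 (ltW h0 : h \in Num.nneg) (ler01 : 1 \in Num.nneg) h1; rewrite powR1.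
Qed.

Let sp0 : 0 < s * p. Proof. by rewrite mulr_gt0//; case/andP: s01. Qed.
Let sp_lt : s * p < p. Proof. by rewrite gtr_pMl//; case/andP: s01. Qed.

Let measurable_lip_ker (r : R) : measurable_fun setT (lip_ker r).
Proof.
apply: measurable_funM.
  apply: (measurableT_comp (measurable_powR p)); apply: measurable_minr => //.
  by apply: measurable_funM => //; exact: measurable_enormB.
rewrite (_ : (fun z => _) = fun z => frac_ker s p z `^ (- 1)); last first.
  by apply/funext => z; rewrite powR_inv1// frac_ker_ge0.
exact: (measurableT_comp (measurable_powR _) (measurable_frac_ker s p)).
Qed.

Let Nsp0 : 0 <= N%:R + s * p. Proof. by rewrite addr_ge0// ltW. Qed.

Let scaled (c t : R) : 0 < c -> 0 < t ->
  (c * t) `^ (N%:R + s * p) = c `^ (N%:R + s * p) * (t ^+ N * t `^ (s * p)).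
Proof.
move=> c0 t0; rewrite powRM ?ltW//; congr (_ * _).
by rewrite powRD ?(gt_eqF t0) ?implybT// powR_mulrn// ltW.
Qed.

(** Near the diagonal, dyadic shells shrink with ratio h^(p - sp), thanks to the Lipschitz bound and
    s < 1; far from it, doubling boxes have ratio h^(sp), thanks to the bound r and s > 0. *)
Let integral_lip_ker (r : R) : 0 < r -> exists K : R, forall x,
  (\int[mu]_y (lip_ker r (x, y))%:E <= K%:E)%E.
Proof.
move=> r0; have /andP[h0 h1] := h01.
have hk0 k : 0 < h ^+ k by rewrite exprn_gt0.
have k20 k : 0 < 2 ^+ k :> R by rewrite exprn_gt0.
pose c1 k := (N%:R * (N%:R * h ^+ k)) `^ p / (h ^+ k.+1) `^ (N%:R + s * p).
pose c2 k := r `^ p / (2 ^+ k) `^ (N%:R + s * p).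
pose A1 := (N%:R * N%:R) `^ p / h `^ (N%:R + s * p) * 2 ^+ N.
pose A2 := r `^ p * 4 ^+ N.
exists (A1 / (1 - h `^ (p - s * p)) + A2 / (1 - h `^ (s * p))) => x.
have mf : measurable_fun setT (fun y => lip_ker r (x, y)).
  exact: (measurableT_comp (measurable_lip_ker r) (pair1_measurable x)).
have f0 y : 0 <= lip_ker r (x, y) by rewrite divr_ge0 ?powR_ge0// frac_ker_ge0.
have mC := measurable_cbox x 1.
have ker_ge y t : 0 < t -> t <= enorm (x - y) ->
    (frac_ker s p (x, y))^-1 <= (t `^ (N%:R + s * p))^-1.
  move=> t0 tx; rewrite lef_pV2 ?posrE ?powR_gt0//; last exact: lt_le_trans tx.
  by apply: ler_powR_base => //; exact: ltW.
rewrite -(setUv (cbox x 1)) ge0_integral_setU//; first last.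
- by rewrite disj_set2E setICr.
- by move=> y _; rewrite lee_fin.
- by rewrite setUv; exact/measurable_EFinP.
- exact: measurableC.
rewrite EFinD; apply: leeD.
  apply: (box_series (rho := fun k => h ^+ k) (c := c1)) => //.
  - by rewrite !mulr_ge0 ?invr_ge0 ?powR_ge0.
  - by rewrite powR_ge0 half_lt1// subr_gt0 sp_lt.
  - by move=> k; rewrite divr_ge0 ?powR_ge0.
  - move=> k; rewrite /c1 exprS scaled// mulrA powRM ?mulr_ge0 ?(ltW (hk0 k))// exprMn.
    have -> : (h ^+ k) `^ p = (h ^+ k) `^ (p - s * p) * (h ^+ k) `^ (s * p).
      by rewrite -powRD ?subrK// gt_eqF ?implybT.
    rewrite -exprn_powR ?(ltW h0)//.
    have ar (a b c d e g : R) : b != 0 -> c != 0 -> d != 0 ->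
        a * (g * b) / (d * (c * b)) * (e * c) = a / d * e * g.
      by move=> *; field; apply/and3P.
    rewrite /A1 le_eqVlt; apply/orP; left; apply/eqP; apply: ar; by rewrite gt_eqF ?powR_gt0// exprn_gt0.
  move=> y xy fy.
  have d0 : 0 < enorm (x - y).
    rewrite lt_neqAle enorm_ge0 andbT; apply: contra_neq fy => /esym.
    rewrite /lip_ker /= => ->; rewrite mulr0 min_r ?ltW// powR0 ?mul0r// gt_eqF//.
  have exk : exists k, `[< ~ cbox x (h ^+ k.+1) y >].
    exists (Num.truncn (N%:R / enorm (x - y))); apply/asboolP => xk.
    have : enorm (x - y) <= N%:R * h ^+ (Num.truncn (N%:R / enorm (x - y))).+1.
      by apply: enorm_le; [exact: ltW | move=> i; rewrite !mxE distrC].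
    apply/negP; rewrite -ltNge /h exprVn ltr_pdivrMr// mulrC -ltr_pdivrMr//.
    apply: lt_le_trans (truncnS_gt _) _.
    by rewrite -natrX ler_nat ltnW// ltn_expl.
  have [k /asboolP xk kmin] := ex_minnP exk.
  have ck : cbox x (h ^+ k) y.
    case: k kmin {xk} => [_|k kmin]; first by rewrite expr0.
    by apply: contrapT => /asboolP /kmin; rewrite ltnn.
  exists k; split => //; rewrite /c1; apply: ler_pM; rewrite ?powR_ge0 ?invr_ge0 ?frac_ker_ge0//.
    apply: ler_powR_base; rewrite ?(ltW p0)//.
      by rewrite le_min !ltW// mulr_gt0.
    rewrite ge_min; apply/orP; right; rewrite ler_wpM2l//.
    by apply: enorm_le; [exact: ltW | move=> i; rewrite !mxE distrC].
  by apply: ker_ge => //; apply: ltW; exact: notin_cbox.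
apply: (box_series (rho := fun k => 2 ^+ k.+1) (c := c2)) => //.
- exact: measurableC.
- by rewrite !mulr_ge0 ?powR_ge0.
- by rewrite powR_ge0 half_lt1.
- by move=> k; rewrite divr_ge0 ?powR_ge0.
- move=> k; rewrite /c2 -[in X in _ / X](mul1r (2 ^+ k)) scaled// powR1 mul1r exprS !mulrA exprMn.
  have -> : (h `^ (s * p)) ^+ k = ((2 ^+ k) `^ (s * p))^-1.
    rewrite -exprn_powR ?(ltW h0)// /h exprVn -powR_inv1 ?ltW// -powRrM mulN1r powRN//.
  rewrite /A2 -natrM; have ar (a b c d : R) : b != 0 -> c != 0 -> a / (b * c) * (d * b) = a * d / c.
    by move=> *; field; apply/andP.
  rewrite le_eqVlt; apply/orP; left; apply/eqP; apply: ar; by rewrite gt_eqF ?powR_gt0// exprn_gt0.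
move=> y xy fy.
have exk : exists k, `[< cbox x (2 ^+ k.+1) y >].
  exists (Num.truncn (enorm (x - y))); apply/asboolP => i.
  rewrite distrC; apply: (@le_trans _ _ (enorm (x - y))).
    by have := coord_le_enorm (x - y) i; rewrite !mxE.
  apply: ltW; apply: lt_le_trans (truncnS_gt _) _.
  by rewrite -natrX ler_nat ltnW// ltn_expl.
have [k /asboolP xk kmin] := ex_minnP exk.
have ck : ~ cbox x (2 ^+ k) y.
  case: k kmin {xk} => [_|k kmin]; first by rewrite expr0.
  by move=> /asboolP /kmin; rewrite ltnn.
exists k; split => //; rewrite /c2; apply: ler_pM; rewrite ?powR_ge0 ?invr_ge0 ?frac_ker_ge0//.
  apply: ler_powR_base; rewrite ?(ltW p0) ?ge_min ?lexx//.
  by rewrite le_min (ltW r0) mulr_ge0// enorm_ge0.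
by apply: ker_ge => //; apply: ltW; exact: notin_cbox.
Qed.

(** An l^1 cone supported in a box inside Omega. A pair of points contributes only if one of them
    lies in this box, so the energy is at most twice the volume of the box times the bound on the
    integral of [lip_ker]. *)
Lemma X0_nontrivial : Omega !=set0 -> exists u,
  [/\ X u, forall x, 0 <= u x & ~ {ae mu, forall x, u x = 0}].
Proof.
move=> [x0 Ox0]; have [r r0 rO] := open_cbox oO Ox0.
pose u (x : 'rV[R]_N) : R := Num.max 0 (r - \sum_i `|x ord0 i - x0 ord0 i|).
have mu_ : measurable_fun setT u.
  apply: measurable_maxr => //; apply: measurable_funB => //; apply: measurable_sum => i.
  apply: measurableT_comp => //; apply: measurable_funB => //; exact: measurable_row_coord.
have u0 x : 0 <= u x by rewrite /u le_max lexx.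
have ur x : u x <= r.
  by rewrite /u ge_max (ltW r0) gerBl sumr_ge0.
have ub x : ~ cbox x0 r x -> u x = 0.
  move=> H; rewrite /u max_l// subr_le0; apply: contrapT => /negP; rewrite -ltNge => xr.
  apply: H => i; apply: le_trans (ltW xr); rewrite (bigD1 i)//= lerDl sumr_ge0//.
have uL x y : `|u x - u y| <= N%:R * enorm (x - y).
  have : `|\sum_i `|x ord0 i - x0 ord0 i| - \sum_i `|y ord0 i - x0 ord0 i| | <= N%:R * enorm (x - y).
    rewrite -sumrB; apply: le_trans (ler_norm_sum _ _ _) _.
    rewrite -[X in X%:R * _](card_ord N) mulr_natl -sumr_const; apply: ler_sum => i _.
    apply: le_trans (ler_dist_dist _ _) _.
    have -> : x ord0 i - x0 ord0 i - (y ord0 i - x0 ord0 i) = x ord0 i - y ord0 i by ring.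
    by have := coord_le_enorm (x - y) i; rewrite !mxE.
  rewrite /u; move: (\sum_i _) (\sum_i _) => a b; rewrite !ler_norml => /andP[].
  by case: (max0P (r - a)) (max0P (r - b)) => -[-> ?] [] [-> ?] *; apply/andP; split; lra.
exists u; split => //.
  have uz : zero_outside Omega u by apply: aeW => x nO; apply: ub => /rO.
  apply: (X0_intro oO bO s01 p1 spN) => //; split; first exact: measurable_frac_diff.
  have [K HK] := integral_lip_ker r0.
  have mB := measurable_cbox x0 r.
  pose ind (x : 'rV[R]_N) : \bar R := (\1_(cbox x0 r) x)%:E.
  have mind : measurable_fun setT ind by apply/measurable_EFinP; exact: measurable_indic.
  have mfd : measurable_fun setT (fun z => (`|frac_diff s p u z| `^ p)%:E).
    by apply/measurable_EFinP; apply: measurable_norm_powR; exact: measurable_frac_diff.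
  have mlip : measurable_fun setT (fun z => (lip_ker r z)%:E).
    by apply/measurable_EFinP; exact: measurable_lip_ker.
  have lip0 z : 0 <= lip_ker r z by rewrite divr_ge0 ?powR_ge0// frac_ker_ge0.
  have ind0 x : (0 <= ind x)%E by rewrite lee_fin.
  pose F1 (z : 'rV[R]_N * 'rV[R]_N) := (ind z.1 * (lip_ker r z)%:E)%E.
  pose F2 (z : 'rV[R]_N * 'rV[R]_N) := (ind z.2 * (lip_ker r z)%:E)%E.
  have mF1 : measurable_fun setT F1.
    by apply: emeasurable_funM => //; exact: (measurableT_comp mind measurable_fst).
  have mF2 : measurable_fun setT F2.
    by apply: emeasurable_funM => //; exact: (measurableT_comp mind measurable_snd).
  have F10 z : (0 <= F1 z)%E by rewrite mule_ge0 ?lee_fin.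
  have F20 z : (0 <= F2 z)%E by rewrite mule_ge0 ?lee_fin.
  have lipC x y : lip_ker r (x, y) = lip_ker r (y, x) by rewrite /lip_ker /frac_ker /= enormBC.
  have IB : (\int[mu]_x (K%:E * ind x) < +oo)%E.
    have K0 : 0 <= K by rewrite -lee_fin; apply: le_trans (HK 0); apply: integral_ge0 => y _; rewrite lee_fin.
    rewrite ge0_integralZl_EFin// integral_indic// setIT.
    apply: lte_mul_pinfty; rewrite ?lee_fin//.
    by case/andP: (lebesgue_cbox_fin x0 r0).
  have I1 : (\int[mu2]_z F1 z < +oo)%E.
    rewrite fubini_tonelli1//; apply: le_lt_trans IB; apply: ge0_le_integral => //.
    - by move=> x _; apply: integral_ge0.
    - exact: measurable_fun_fubini_tonelli_F.
    - exact: measurable_funeM.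
    move=> x _; rewrite /fubini_F /F1 /= ge0_integralZl//.
    + by rewrite muleC lee_wpmul2r.
    + exact: (measurableT_comp mlip (pair1_measurable x)).
    + by move=> y _; rewrite lee_fin.
  have I2 : (\int[mu2]_z F2 z < +oo)%E.
    rewrite fubini_tonelli2//; apply: le_lt_trans IB; apply: ge0_le_integral => //.
    - by move=> x _; apply: integral_ge0.
    - exact: measurable_fun_fubini_tonelli_G.
    - exact: measurable_funeM.
    move=> x _; rewrite /fubini_G /F2 /= ge0_integralZl//.
    + rewrite muleC lee_wpmul2r//; under eq_integral do rewrite lipC; exact: HK.
    + exact: (measurableT_comp mlip (pair2_measurable x)).
    + by move=> y _; rewrite lee_fin.
  apply/integrableP; split => //.
  apply: (@le_lt_trans _ _ (\int[mu2]_z (F1 z + F2 z))%E); last first.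
    by rewrite ge0_integralD// lte_add_pinfty.
  apply: ge0_le_integral => //.
  - exact: measurableT_comp.
  - exact: emeasurable_funD.
  move=> [x y] _; rewrite /= ger0_norm ?powR_ge0// frac_diff_powR//= /F1 /F2 /ind /= !indicE.
  have lipu : `|u x - u y| `^ p / frac_ker s p (x, y) <= lip_ker r (x, y).
    rewrite /lip_ker ler_wpM2r ?invr_ge0 ?frac_ker_ge0// ler_powR_base ?(ltW p0)//=.
    rewrite le_min uL andbT ler_norml; have := u0 x; have := u0 y; have := ur x; have := ur y.
    by move: (u x) (u y) => *; apply/andP; split; lra.
  have l0 : (0 <= (lip_ker r (x, y))%:E)%E by rewrite lee_fin.
  rewrite -lee_fin in lipu.
  case: (boolP (x \in cbox x0 r)) => xB.
    rewrite mul1e; apply: le_trans lipu _; rewrite leeDl// mule_ge0// lee_fin.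
  case: (boolP (y \in cbox x0 r)) => yB; first by rewrite mul1e mul0e add0e.
  rewrite !mul0e adde0 (ub x) ?(ub y) ?subrr ?normr0 ?powR0 ?gt_eqF ?mul0r//.
    by move/mem_set; exact/negP.
  by move/mem_set; exact/negP.
move=> ae0; pose t := r / 2 / (N%:R + 1).
have t0 : 0 < t by rewrite !divr_gt0// ltr_wpDl.
have /andP[+ _] := lebesgue_cbox_fin x0 t0; apply/negP; rewrite -leNgt.
rewrite le_eqVlt; apply/orP; left; apply/eqP.
apply: (measure_negligible (measurable_cbox _ _)).
apply: negligibleS ae0 => x xt; apply/eqP; rewrite gt_eqF// /u lt_max subr_gt0; apply/orP; right.
apply: (@le_lt_trans _ _ (N%:R * t)).
  by rewrite -[X in X%:R * _](card_ord N) mulr_natl -sumr_const; apply: ler_sum => i _.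
rewrite /t mulrA ltr_pdivrMr ?ltr_wpDl// mulrC.
apply: (@lt_le_trans _ _ (r * N%:R)); last by rewrite ler_wpM2l ?(ltW r0)// lerDl.
by rewrite ltr_pM2r//; move: r0; lra.
Qed.

End fractional_order.

(** * Compact functionals of superposition type *)

Section nemytskii.
Context d (T : measurableType d) (R : realType).
Variables (m : {measure set T -> \bar R}) (D : set T).
Hypotheses (mD : measurable D) (Doo : (m D < +oo)%E).

(** Convergence almost everywhere with a majorant in L^r: the form in which compact embeddings are
    used, directly suited to dominated convergence. *)
Definition dom_cvg (r : R) (u_ : nat -> T -> R) (u : T -> R) : Prop :=
  [/\ forall n, measurable_fun setT (u_ n), measurable_fun setT u,
      {ae m, forall x, D x -> u_ n x @[n --> \oo] --> u x} &
      exists h : T -> R, [/\ measurable_fun D h,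
        m.-integrable D (EFin \o (fun x => `|h x| `^ r)) &
        {ae m, forall x, D x -> forall n, `|u_ n x| <= h x}]].

Lemma dom_cvg_cst (r : R) (u : T -> R) : measurable_fun setT u ->
  m.-integrable D (EFin \o (fun x => `|u x| `^ r)) -> dom_cvg r (fun=> u) u.
Proof.
move=> mu iu; split => //; first by apply: aeW => x _; exact: cvg_cst.
exists (fun x => `|u x|); split => //.
- by apply: measurableT_comp => //; exact: measurable_funTS.
- by under eq_fun do rewrite normr_id.
- exact: aeW.
Qed.

Definition Lr (r : R) (u : T -> R) : Prop :=
  measurable_fun setT u /\ m.-integrable D (EFin \o (fun x => `|u x| `^ r)).

(** Complete continuity of a potential N and of its derivative DN, expressed along dominated
    sequences. [cf_taylor] lets base point and direction vary with n; this is what later makes the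
    Taylor expansion uniform on balls. *)
Record compact_functional (r1 r2 : R) (N : (T -> R) -> (T -> R) -> R)
    (DN : (T -> R) -> (T -> R) -> (T -> R) -> (T -> R) -> R) : Prop := {
  cf_cvg : forall u_ u v_ v, dom_cvg r1 u_ u -> dom_cvg r2 v_ v ->
    N (u_ n) (v_ n) @[n --> \oo] --> N u v;
  cf_dcvg : forall u_ u v_ v w_ w z_ z, dom_cvg r1 u_ u -> dom_cvg r2 v_ v ->
    dom_cvg r1 w_ w -> dom_cvg r2 z_ z ->
    DN (u_ n) (v_ n) (w_ n) (z_ n) @[n --> \oo] --> DN u v w z;
  cf_taylor : forall u_ u v_ v w_ w z_ z (t_ : nat -> R), dom_cvg r1 u_ u -> dom_cvg r2 v_ v ->
    dom_cvg r1 w_ w -> dom_cvg r2 z_ z -> (forall n, 0 < t_ n <= 1) -> t_ n @[n --> \oo] --> (0 : R) ->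
    (t_ n)^-1 * (N (fun x => u_ n x + t_ n * w_ n x) (fun x => v_ n x + t_ n * z_ n x) -
      N (u_ n) (v_ n)) - DN (u_ n) (v_ n) (w_ n) (z_ n) @[n --> \oo] --> (0 : R);
  cf_D : forall u v w z w' z', Lr r1 u -> Lr r2 v -> Lr r1 w -> Lr r2 z -> Lr r1 w' -> Lr r2 z' ->
    DN u v (fun x => w x + w' x) (fun x => z x + z' x) = DN u v w z + DN u v w' z';
  cf_Z : forall u v w z (c : R), Lr r1 u -> Lr r2 v -> Lr r1 w -> Lr r2 z ->
    DN u v (fun x => c * w x) (fun x => c * z x) = c * DN u v w z
}.

Lemma compact_functionalD (r1 r2 c : R) N DN N' DN' :
  compact_functional r1 r2 N DN -> compact_functional r1 r2 N' DN' ->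
  compact_functional r1 r2 (fun u v => N u v + c * N' u v) (fun u v w z => DN u v w z + c * DN' u v w z).
Proof.
move=> H H'; split.
- move=> *; apply: cvgD; first exact: (cf_cvg H).
  by apply: cvgMr; exact: (cf_cvg H').
- move=> *; apply: cvgD; first exact: (cf_dcvg H).
  by apply: cvgMr; exact: (cf_dcvg H').
- move=> u_ u v_ v w_ w z_ z t_ h1 h2 h3 h4 h5 h6.
  have l1 := cf_taylor H h1 h2 h3 h4 h5 h6; have l2 := cf_taylor H' h1 h2 h3 h4 h5 h6.
  have -> : (0 : R) = 0 + c * 0 by ring.
  set A := (X in X @ _ --> _) in l1; set B := (X in X @ _ --> _) in l2.
  rewrite (_ : (fun n => _) = fun n => A n + c * B n).
    exact: (cvgD l1 (cvgM (cvg_cst c) l2)).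
  by apply/funext => n; rewrite /A /B; ring.
- by move=> *; rewrite (cf_D H)// (cf_D H')//; ring.
- by move=> *; rewrite (cf_Z H)// (cf_Z H')//; ring.
Qed.

(* H is a potential with partial derivatives Ha, Hb, of growth r1 and r2 in its
   two arguments.  The Taylor estimate (with intermediate points) replaces the
   differentiability of H, which is delicate at the kinks of positive parts. *)
Record nonlinearity (r1 r2 C : R) (H Ha Hb : T -> R -> R -> R) : Prop := {
  nl_meas : forall u v : T -> R, measurable_fun setT u -> measurable_fun setT v ->
    measurable_fun D (fun x => H x (u x) (v x));
  nl_measa : forall u v : T -> R, measurable_fun setT u -> measurable_fun setT v ->
    measurable_fun D (fun x => Ha x (u x) (v x));
  nl_measb : forall u v : T -> R, measurable_fun setT u -> measurable_fun setT v ->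
    measurable_fun D (fun x => Hb x (u x) (v x));
  nl_cont : forall (x : T) (a_ b_ : nat -> R) (a b : R), D x ->
    a_ n @[n --> \oo] --> a -> b_ n @[n --> \oo] --> b ->
    [/\ H x (a_ n) (b_ n) @[n --> \oo] --> H x a b,
        Ha x (a_ n) (b_ n) @[n --> \oo] --> Ha x a b &
        Hb x (a_ n) (b_ n) @[n --> \oo] --> Hb x a b];
  nl_taylor : forall (x : T) (a b a' b' : R), D x -> exists xi zeta : R,
    [/\ `|xi - a| <= `|a' - a|, `|zeta - b| <= `|b' - b| &
      `|H x a' b' - H x a b - (Ha x a b * (a' - a) + Hb x a b * (b' - b))| <=
      (`|Ha x xi b' - Ha x a b'| + `|Ha x a b' - Ha x a b|) * `|a' - a| +
      `|Hb x a zeta - Hb x a b| * `|b' - b|];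
  nl_growth : forall (x : T) (a b w z : R), D x -> `|Ha x a b| * `|w| + `|Hb x a b| * `|z| <=
    C * (1 + `|a| `^ r1 + `|b| `^ r2 + `|w| `^ r1 + `|z| `^ r2);
  nl_growth0 : forall (x : T) (a b : R), D x -> `|H x a b| <= C * (1 + `|a| `^ r1 + `|b| `^ r2)
}.

Variables (r1 r2 C : R) (H Ha Hb : T -> R -> R -> R).
Hypotheses (r1p : 0 < r1) (r2p : 0 < r2) (C0 : 0 <= C).
Hypothesis nl : nonlinearity r1 r2 C H Ha Hb.

Definition nem (u v : T -> R) : R := \int[m]_(x in D) H x (u x) (v x).

Definition dnem (u v w z : T -> R) : R :=
  \int[m]_(x in D) (Ha x (u x) (v x) * w x + Hb x (u x) (v x) * z x).

Let int_cst (c : R) : m.-integrable D (EFin \o cst c).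
Proof.
apply/integrableP; split; first exact/measurable_EFinP.
by rewrite /= integral_cst// lte_mul_pinfty// lee_fin.
Qed.

Let pow_add (r a b : R) : 0 < r ->
  `| `|a| + `|b| | `^ r <= 2 `^ r * (`|a| `^ r + `|b| `^ r).
Proof. by move=> r0; rewrite ger0_norm ?addr_ge0// powRD_le// ltW. Qed.

Lemma dom_cvg_at (r : R) u_ u n : dom_cvg r u_ u -> dom_cvg r (fun=> u_ n) (u_ n).
Proof.
move=> [mu_ mu cu [h [mh ih dh]]]; split => //.
  by apply: aeW => x _; exact: cvg_cst.
by exists h; split => //; apply: filterS dh => x H1 Dx k; exact: H1.
Qed.

Lemma dom_cvg_integrable (r : R) u_ u n : 0 < r -> dom_cvg r u_ u ->
  m.-integrable D (EFin \o (fun x => `|u_ n x| `^ r)).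
Proof.
move=> r0 [mu_ mu cu [h [mh ih dh]]].
have mun : measurable_fun D (fun x => `|u_ n x| `^ r).
  by apply: measurable_funTS; exact: measurable_norm_powR.
have [] // := Rintegral_dominated mD (fun=> mun) mun _ ih.
  by apply: aeW => x _; exact: cvg_cst.
apply: filterS dh => x H1 Dx _; rewrite ger0_norm ?powR_ge0//.
by apply: ler_powR_base; [exact: ltW|by []|exact: le_trans (H1 Dx n) (ler_norm _)].
Qed.

Lemma dom_cvg_scale (r : R) u_ u (t_ : nat -> R) (t : R) : 0 < r -> (forall n, `|t_ n| <= 1) ->
  t_ n @[n --> \oo] --> t -> dom_cvg r u_ u -> dom_cvg r (fun n x => t_ n * u_ n x) (fun x => t * u x).
Proof.
move=> r0 t1 ct [mu_ mu cu [h [mh ih dh]]]; split.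
- by move=> n; exact: measurable_funM.
- exact: measurable_funM.
- by apply: filterS cu => x cu Dx; apply: cvgM => //; exact: cu.
exists h; split => //; apply: filterS dh => x dh Dx n.
by rewrite normrM; apply: le_trans (dh Dx n); rewrite ler_piMl.
Qed.

Lemma dom_cvgD (r : R) u_ u v_ v : 0 < r -> dom_cvg r u_ u -> dom_cvg r v_ v ->
  dom_cvg r (fun n x => u_ n x + v_ n x) (fun x => u x + v x).
Proof.
move=> r0 [mu_ mu cu [h [mh ih dh]]] [mv_ mv cv [k [mk ik dk]]]; split.
- by move=> n; exact: measurable_funD.
- exact: measurable_funD.
- by apply: filterS2 cu cv => x cu cv Dx; apply: cvgD; [exact: cu|exact: cv].
exists (fun x => `|h x| + `|k x|).
have mhk : measurable_fun D (fun x => `|h x| + `|k x|) by apply: measurable_funD; exact: measurableT_comp.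
split => //.
  apply: (@integrable_dom _ _ _ m D mD _ (fun x => 2 `^ r * (`|h x| `^ r + `|k x| `^ r))).
  - apply: (measurableT_comp (measurable_powR r)); exact: measurableT_comp.
  - by move=> x _; rewrite (ger0_norm (powR_ge0 _ _)); exact: pow_add.
  - by apply: integrable_RZ => //; exact: integrable_RD.
apply: filterS2 dh dk => x dh dk Dx n; apply: le_trans (ler_normD _ _) _.
by apply: lerD; [exact: le_trans (dh Dx n) (ler_norm _)|exact: le_trans (dk Dx n) (ler_norm _)].
Qed.

Lemma nem_cvg u_ u v_ v : dom_cvg r1 u_ u -> dom_cvg r2 v_ v ->
  m.-integrable D (EFin \o (fun x => H x (u x) (v x))) /\
  nem (u_ n) (v_ n) @[n --> \oo] --> nem u v.
Proof.
move=> [mu_ mu cu [hu [mhu ihu du]]] [mv_ mv cv [hv [mhv ihv dv]]].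
apply: (Rintegral_dominated mD (g := fun x => C * (1 + `|hu x| `^ r1 + `|hv x| `^ r2))).
- by move=> n; exact: (nl_meas nl).
- exact: (nl_meas nl).
- by apply: filterS2 cu cv => x cu cv Dx; have [] := nl_cont nl Dx (cu Dx) (cv Dx).
- by apply: integrable_RZ => //; do 2!apply: integrable_RD => //; exact: int_cst.
apply: filterS2 du dv => x du dv Dx n.
apply: le_trans (nl_growth0 nl _ _ Dx) _; apply: ler_wpM2l => //.
have Hh (a h r : R) : 0 < r -> `|a| <= h -> `|a| `^ r <= `|h| `^ r.
  by move=> r0 ah; apply: ler_powR_base; [exact: ltW|by []|exact: le_trans (ler_norm _)].
have d1 := du Dx n; have d2 := dv Dx n.
by rewrite !lerD// Hh.
Qed.

Lemma dnem_cvg u_ u v_ v w_ w z_ z : dom_cvg r1 u_ u -> dom_cvg r2 v_ v ->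
  dom_cvg r1 w_ w -> dom_cvg r2 z_ z ->
  m.-integrable D (EFin \o (fun x => Ha x (u x) (v x) * w x + Hb x (u x) (v x) * z x)) /\
  dnem (u_ n) (v_ n) (w_ n) (z_ n) @[n --> \oo] --> dnem u v w z.
Proof.
move=> [mu_ mu cu [hu [mhu ihu du]]] [mv_ mv cv [hv [mhv ihv dv]]].
move=> [mw_ mw cw [hw [mhw ihw dw]]] [mz_ mz cz [hz [mhz ihz dz]]].
have mI u' v' w' z' : measurable_fun setT u' -> measurable_fun setT v' -> measurable_fun setT w' ->
    measurable_fun setT z' -> measurable_fun D (fun x => Ha x (u' x) (v' x) * w' x + Hb x (u' x) (v' x) * z' x).
  move=> ? ? ? ?; apply: measurable_funD; apply: measurable_funM.
  - exact: (nl_measa nl).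
  - exact: measurable_funTS.
  - exact: (nl_measb nl).
  - exact: measurable_funTS.
apply: (Rintegral_dominated mD
  (g := fun x => C * (1 + `|hu x| `^ r1 + `|hv x| `^ r2 + `|hw x| `^ r1 + `|hz x| `^ r2))).
- by move=> n; exact: mI.
- exact: mI.
- have cc : {ae m, forall x, D x -> (u_ n x @[n --> \oo] --> u x) /\ (v_ n x @[n --> \oo] --> v x)}.
    by apply: filterS2 cu cv => x cu cv Dx; split; [exact: cu|exact: cv].
  apply: filterS3 cc cw cz => x cc cw cz Dx; have [cu' cv'] := cc Dx.
  have [_ ca cb] := nl_cont nl Dx cu' cv'.
  by apply: cvgD; apply: cvgM => //; [exact: cw|exact: cz].
- by apply: integrable_RZ => //; do 4!apply: integrable_RD => //; exact: int_cst.
have dd : {ae m, forall x, D x -> forall n, `|u_ n x| <= hu x /\ `|v_ n x| <= hv x}.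
  by apply: filterS2 du dv => x du dv Dx n; split; [exact: du|exact: dv].
apply: filterS3 dd dw dz => x dd dw dz Dx n.
apply: le_trans (ler_normD _ _) _; rewrite !normrM.
apply: le_trans (nl_growth nl _ _ _ _ Dx) _; apply: ler_wpM2l => //.
have Hh (a h r : R) : 0 < r -> `|a| <= h -> `|a| `^ r <= `|h| `^ r.
  by move=> r0 ah; apply: ler_powR_base; [exact: ltW|by []|exact: le_trans (ler_norm _)].
have [d1 d2] := dd Dx n; have d3 := dw Dx n; have d4 := dz Dx n.
by rewrite !lerD// Hh.
Qed.

Let near_cvg (a_ b_ y : nat -> R) (a : R) : a_ n @[n --> \oo] --> a -> b_ n @[n --> \oo] --> (0 : R) ->
  (forall n, `|y n - a_ n| <= `|b_ n|) -> y n @[n --> \oo] --> a.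
Proof.
move=> ca cb yab; rewrite -[X in _ --> X]add0r.
rewrite (_ : y = fun n => (y n - a_ n) + a_ n); last by apply/funext => n; rewrite subrK.
apply: cvgD => //; apply: norm_cvg0; apply: (@squeeze_cvgr _ _ _ _ (cst 0) (fun n => `|b_ n|)).
- by apply: nearW => n; rewrite normr_ge0 yab.
- exact: cvg_cst.
- by rewrite -[X in _ --> X](normr0 R); exact: cvg_norm.
Qed.

(** [nl_taylor] bounds the remainder by increments of the derivatives at intermediate points that
    tend to u x and v x. These points are chosen for each x separately and enter only the pointwise
    estimates, so their measurability is immaterial. *)
Lemma taylor_cvg u_ u v_ v w_ w z_ z (t_ : nat -> R) :
  dom_cvg r1 u_ u -> dom_cvg r2 v_ v -> dom_cvg r1 w_ w -> dom_cvg r2 z_ z ->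
  (forall n, 0 < t_ n <= 1) -> t_ n @[n --> \oo] --> (0 : R) ->
  (t_ n)^-1 * (nem (fun x => u_ n x + t_ n * w_ n x) (fun x => v_ n x + t_ n * z_ n x) -
    nem (u_ n) (v_ n) - dnem (u_ n) (v_ n) (fun x => t_ n * w_ n x) (fun x => t_ n * z_ n x))
  @[n --> \oo] --> (0 : R).
Proof.
move=> du dv dw dz t01 t0.
have t1 n : `|t_ n| <= 1 by have /andP[t0' t1'] := t01 n; rewrite ger0_norm// ltW.
have dtw := dom_cvg_scale r1p t1 t0 dw; have dtz := dom_cvg_scale r2p t1 t0 dz.
have duw := dom_cvgD r1p du dtw; have dvz := dom_cvgD r2p dv dtz.
pose E n x := (t_ n)^-1 * (H x (u_ n x + t_ n * w_ n x) (v_ n x + t_ n * z_ n x) - H x (u_ n x) (v_ n x) -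
   (Ha x (u_ n x) (v_ n x) * (t_ n * w_ n x) + Hb x (u_ n x) (v_ n x) * (t_ n * z_ n x))).
have EE n : (t_ n)^-1 * (nem (fun x => u_ n x + t_ n * w_ n x) (fun x => v_ n x + t_ n * z_ n x) -
    nem (u_ n) (v_ n) - dnem (u_ n) (v_ n) (fun x => t_ n * w_ n x) (fun x => t_ n * z_ n x)) =
    \int[m]_(x in D) E n x.
  have [i1 _] := nem_cvg (dom_cvg_at n duw) (dom_cvg_at n dvz).
  have [i2 _] := nem_cvg (dom_cvg_at n du) (dom_cvg_at n dv).
  have [i3 _] := dnem_cvg (dom_cvg_at n du) (dom_cvg_at n dv) (dom_cvg_at n dtw) (dom_cvg_at n dtz).
  rewrite /nem /dnem -(RintegralB mD i1 i2) -(RintegralB mD (integrable_RB mD i1 i2) i3).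
  by rewrite -(RintegralZl _ mD (integrable_RB mD (integrable_RB mD i1 i2) i3)).
rewrite (_ : (fun n => _) = fun n => \int[m]_(x in D) E n x); last by apply/funext => n; exact: EE.
move: (du) (dv) (dw) (dz) => [mu_ mu cu [hu [mhu ihu bu]]] [mv_ mv cv [hv [mhv ihv bv]]]
  [mw_ mw cw [hw [mhw ihw bw]]] [mz_ mz cz [hz [mhz ihz bz]]].
(* Bounds u_n, u_n + t_n w_n and the intermediate points simultaneously, since t_n <= 1. *)
pose hA x := `|hu x| + `|hw x|; pose hB x := `|hv x| + `|hz x|.
pose g x := C * (1 + `|hA x| `^ r1 + `|hB x| `^ r2 + `|hw x| `^ r1 + `|hz x| `^ r2).
have ihA : m.-integrable D (EFin \o (fun x => `|hA x| `^ r1)).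
  apply: (@integrable_dom _ _ _ m D mD _ (fun x => 2 `^ r1 * (`|hu x| `^ r1 + `|hw x| `^ r1))).
  - by apply: (measurableT_comp (measurable_powR r1)); apply: measurableT_comp => //;
      apply: measurable_funD; exact: measurableT_comp.
  - by move=> x _; rewrite (ger0_norm (powR_ge0 _ _)); exact: pow_add.
  - by apply: integrable_RZ => //; exact: integrable_RD.
have ihB : m.-integrable D (EFin \o (fun x => `|hB x| `^ r2)).
  apply: (@integrable_dom _ _ _ m D mD _ (fun x => 2 `^ r2 * (`|hv x| `^ r2 + `|hz x| `^ r2))).
  - by apply: (measurableT_comp (measurable_powR r2)); apply: measurableT_comp => //;
      apply: measurable_funD; exact: measurableT_comp.
  - by move=> x _; rewrite (ger0_norm (powR_ge0 _ _)); exact: pow_add.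
  - by apply: integrable_RZ => //; exact: integrable_RD.
have mE n : measurable_fun D (E n).
  have [Mw Mz] : measurable_fun D (w_ n) /\ measurable_fun D (z_ n) by split; exact: measurable_funTS.
  have [Muw Mvz] : measurable_fun setT (fun x => u_ n x + t_ n * w_ n x) /\
      measurable_fun setT (fun x => v_ n x + t_ n * z_ n x) by split; [case: duw|case: dvz].
  apply: measurable_funM => //; apply: measurable_funB; [apply: measurable_funB|apply: measurable_funD].
  - exact: (nl_meas nl).
  - exact: (nl_meas nl).
  - by apply: measurable_funM; [exact: (nl_measa nl)|exact: measurable_funM].
  - by apply: measurable_funM; [exact: (nl_measb nl)|exact: measurable_funM].
pose B n x (xi zeta : R) :=
  (`|Ha x xi (v_ n x + t_ n * z_ n x) - Ha x (u_ n x) (v_ n x + t_ n * z_ n x)| +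
   `|Ha x (u_ n x) (v_ n x + t_ n * z_ n x) - Ha x (u_ n x) (v_ n x)|) * `|w_ n x| +
  `|Hb x (u_ n x) zeta - Hb x (u_ n x) (v_ n x)| * `|z_ n x|.
have EB n x : D x -> exists xz : R * R, [/\ `|xz.1 - u_ n x| <= `|t_ n * w_ n x|,
    `|xz.2 - v_ n x| <= `|t_ n * z_ n x| & `|E n x| <= B n x xz.1 xz.2].
  move=> Dx; have [xi [zeta [H1 H2 H3]]] := nl_taylor nl (u_ n x) (v_ n x)
    (u_ n x + t_ n * w_ n x) (v_ n x + t_ n * z_ n x) Dx.
  have ad (a b : R) : a + b - a = b by rewrite addrAC subrr add0r.
  rewrite !ad in H1 H2 H3; exists (xi, zeta); split => //=.
  have /andP[tn0 _] := t01 n; rewrite /E normrM gtr0_norm ?invr_gt0// mulrC ler_pdivrMr//.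
  apply: le_trans H3 _; rewrite !normrM (gtr0_norm tn0) /B mulrDl.
  by rewrite le_eqVlt; apply/orP; left; apply/eqP; ring.
(* The remainder consists of three differences, each at most 2 g. *)
have [||||] := @Rintegral_dominated _ _ _ m D mD E (cst 0) (fun x => 6 * g x) mE.
- exact: measurable_cst.
- have cuv : {ae m, forall x, D x -> (u_ n x @[n --> \oo] --> u x) /\ (v_ n x @[n --> \oo] --> v x)}.
    by apply: filterS2 cu cv => x cu cv Dx; split; [exact: cu|exact: cv].
  apply: filterS3 cuv cw cz => x cuv cw cz Dx; have [cu' cv'] := cuv Dx.
  have {}cw := cw Dx; have {}cz := cz Dx.
  have /choice[xz Hxz] := fun n => EB n x Dx.
  have ctw : t_ n * w_ n x @[n --> \oo] --> (0 : R).
    by rewrite -(mul0r (w x)); exact: cvgM.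
  have ctz : t_ n * z_ n x @[n --> \oo] --> (0 : R).
    by rewrite -(mul0r (z x)); exact: cvgM.
  have cxi : (xz n).1 @[n --> \oo] --> u x.
    by apply: near_cvg cu' ctw _ => n; have [] := Hxz n.
  have czeta : (xz n).2 @[n --> \oo] --> v x.
    by apply: near_cvg cv' ctz _ => n; have [] := Hxz n.
  have cvz : v_ n x + t_ n * z_ n x @[n --> \oo] --> v x.
    by rewrite -[X in _ --> X]addr0; exact: cvgD.
  have [_ c1 _] := nl_cont nl Dx cxi cvz; have [_ c2 _] := nl_cont nl Dx cu' cvz.
  have [_ c3 c4] := nl_cont nl Dx cu' cv'; have [_ _ c5] := nl_cont nl Dx cu' czeta.
  have cB : B n x (xz n).1 (xz n).2 @[n --> \oo] --> (0 : R).
    have dif (a_ b_ : nat -> R) (l : R) : a_ n @[n --> \oo] --> l -> b_ n @[n --> \oo] --> l ->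
       `|a_ n - b_ n| @[n --> \oo] --> (0 : R).
      by move=> ca cb; rewrite -(normr0 R) -(subrr l); apply: cvg_norm; exact: cvgB.
    have -> : (0 : R) = (0 + 0) * `|w x| + 0 * `|z x| by ring.
    have l1 := cvgM (cvgD (dif _ _ _ c1 c2) (dif _ _ _ c2 c3)) (cvg_norm cw).
    have l2 := cvgM (dif _ _ _ c5 c4) (cvg_norm cz).
    exact: (cvgD (l1 _ _ _) (l2 _ _)).
  apply: norm_cvg0; apply: (@squeeze_cvgr _ _ _ _ (cst 0) (fun n => B n x (xz n).1 (xz n).2)) => //.
    by apply: nearW => n; rewrite normr_ge0; have [] := Hxz n.
  exact: cvg_cst.
- apply: integrable_RZ => //; apply: integrable_RZ => //.
  by do 4!apply: integrable_RD => //; exact: int_cst.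
- have buv : {ae m, forall x, D x -> forall n, `|u_ n x| <= hu x /\ `|v_ n x| <= hv x}.
    by apply: filterS2 bu bv => x bu bv Dx n; split; [exact: bu|exact: bv].
  apply: filterS3 buv bw bz => x buv bw bz Dx n.
  have [bu' bv'] := buv Dx n; have {}bw := bw Dx n; have {}bz := bz Dx n.
  have [[xi zeta] /= [H1 H2 H3]] := EB n x Dx; apply: le_trans H3 _.
  have G a b : `|a| <= hA x -> `|b| <= hB x -> `|Ha x a b| * `|w_ n x| <= g x /\ `|Hb x a b| * `|z_ n x| <= g x.
    move=> aA bB; have := nl_growth nl a b (w_ n x) (z_ n x) Dx.
    set l := C * _ => Hl; have lg : l <= g x.
      have Hh (a' h r : R) : 0 < r -> `|a'| <= h -> `|a'| `^ r <= `|h| `^ r.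
        by move=> r0 ah; apply: ler_powR_base; [exact: ltW|by []|exact: le_trans (ler_norm _)].
      by apply: ler_wpM2l => //; rewrite !lerD// Hh.
    split; apply: le_trans lg; apply: le_trans Hl; first by rewrite lerDl mulr_ge0.
    by rewrite lerDr mulr_ge0.
  have tri (a b h k t : R) : `|t| <= 1 -> `|a| <= h -> `|b| <= k -> forall y, `|y - a| <= `|t * b| -> `|y| <= `|h| + `|k|.
    move=> t1' ah bk y ya; rewrite -(subrK a y) addrC; apply: le_trans (ler_normD _ _) _.
    apply: lerD; first exact: le_trans (ler_norm _).
    apply: le_trans ya _; rewrite normrM; apply: le_trans (le_trans bk (ler_norm _)).
    by rewrite ler_piMl.
  have axi : `|xi| <= hA x by apply: tri H1.
  have azeta : `|zeta| <= hB x by apply: tri H2.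
  have au : `|u_ n x| <= hA x by apply: (tri _ _ _ _ _ (t1 n) bu' bw); rewrite subrr normr0.
  have av : `|v_ n x| <= hB x by apply: (tri _ _ _ _ _ (t1 n) bv' bz); rewrite subrr normr0.
  have avz : `|v_ n x + t_ n * z_ n x| <= hB x.
    by apply: (tri _ _ _ _ _ (t1 n) bv' bz); rewrite addrAC subrr add0r.
  have [g1 _] := G _ _ axi avz; have [g2 _] := G _ _ au avz; have [g3 g4] := G _ _ au av.
  have [_ g5] := G _ _ au azeta.
  rewrite /B; have D1 (a b c' k : R) : 0 <= c' -> `|a| * c' <= k -> `|b| * c' <= k -> `|a - b| * c' <= k + k.
    move=> c0 ak bk; apply: le_trans (lerD ak bk); rewrite -mulrDl; apply: ler_wpM2r => //.
    by rewrite (le_trans (ler_normB _ _)).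
  have := D1 _ _ _ _ (normr_ge0 _) g1 g2; have := D1 _ _ _ _ (normr_ge0 _) g2 g3.
  have := D1 _ _ _ _ (normr_ge0 _) g5 g4; rewrite mulrDl; lra.
by move=> _; rewrite /Rintegral integral0.
Qed.

Lemma nem_compact : compact_functional r1 r2 nem dnem.
Proof.
have int_d u v w z : Lr r1 u -> Lr r2 v -> Lr r1 w -> Lr r2 z ->
    m.-integrable D (EFin \o (fun x => Ha x (u x) (v x) * w x + Hb x (u x) (v x) * z x)).
  move=> [mu iu] [mv iv] [mw iw] [mz iz].
  by have [] := dnem_cvg (dom_cvg_cst mu iu) (dom_cvg_cst mv iv) (dom_cvg_cst mw iw) (dom_cvg_cst mz iz).
have linZ u v w z (c : R) : Lr r1 u -> Lr r2 v -> Lr r1 w -> Lr r2 z ->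
    dnem u v (fun x => c * w x) (fun x => c * z x) = c * dnem u v w z.
  move=> ? ? ? ?; rewrite /dnem -(RintegralZl c mD (int_d _ _ _ _ _ _ _ _))//.
  by apply: eq_Rintegral => x _; ring.
have at_ (r : R) u_ u n : 0 < r -> dom_cvg r u_ u -> Lr r (u_ n).
  by move=> r0 du; split; [case: du|exact: dom_cvg_integrable du].
split => //.
- by move=> *; apply: (nem_cvg _ _).2.
- by move=> *; apply: (dnem_cvg _ _ _ _).2.
- move=> u_ u v_ v w_ w z_ z t_ h1 h2 h3 h4 h5 h6.
  apply: cvg_trans (taylor_cvg h1 h2 h3 h4 h5 h6); apply: near_eq_cvg; apply: nearW => n /=.
  have [L1 L2] := (at_ _ _ _ n r1p h1, at_ _ _ _ n r2p h2).
  have [L3 L4] := (at_ _ _ _ n r1p h3, at_ _ _ _ n r2p h4).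
  by rewrite linZ// mulrBr mulKf// gt_eqF//; case/andP: (h5 n).
- move=> u v w z w' z' *; rewrite /dnem -(RintegralD mD (int_d u v w z _ _ _ _) (int_d u v w' z' _ _ _ _))//.
  by apply: eq_Rintegral => x _; ring.
Qed.

End nemytskii.

(** * Abstract energy spaces *)

Lemma cvg_dist (R : realType) (a_ : nat -> R) (a e : R) : a_ n @[n --> \oo] --> a -> 0 < e ->
  exists k, forall n, (k <= n)%N -> `|a - a_ n| <= e.
Proof. by move=> /cvgrPdist_le H e0; have [k _ Hk] := H e e0; exists k => n /Hk. Qed.

Section energy_spaces.
Context d (T : measurableType d) (R : realType).
Variables (m : {measure set T -> \bar R}) (D : set T).
Hypotheses (mD : measurable D) (Doo : (m D < +oo)%E).
Local Notation F := (T -> R).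

Lemma dom_cvg_sub (r : R) (u_ : nat -> F) u (psi : nat -> nat) : (forall n, (n <= psi n)%N) ->
  dom_cvg m D r u_ u -> dom_cvg m D r (fun n => u_ (psi n)) u.
Proof.
move=> psige [mu_ mu' cu [h [mh ih dh]]]; split => //.
  apply: filterS cu => x cu Dx; exact: cvg_comp (cvg_ge_id psige) (cu Dx).
by exists h; split => //; apply: filterS dh => x dh Dx n; exact: dh.
Qed.

Lemma dom_cvg_ae (r : R) (u_ : nat -> F) u v : measurable_fun setT v ->
  {ae m, forall x, u x = v x} -> dom_cvg m D r u_ u -> dom_cvg m D r u_ v.
Proof.
move=> mv uv [mu_ mu' cu H]; split => //.
by apply: filterS2 uv cu => x <-.
Qed.

(* A space X of functions with norm nm, such that u |-> nm u ^ p has the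
   uniformly continuous derivative p * pl u, with compact embedding into L^r(D):
   Lim M u_ u means that u_ converges weakly to u in the ball of radius M. *)
Record energy_space (p r : R) (X : set F) (nm : F -> R) (pl : F -> F -> R)
    (Lim : R -> (nat -> F) -> F -> Prop) : Prop := {
  es_p1 : 1 < p;
  es_r0 : 0 < r;
  es_0 : X (cst 0);
  es_D : forall u v, X u -> X v -> X (fun x => u x + v x);
  es_Z : forall c u, X u -> X (fun x => c * u x);
  es_ge0 : forall u, 0 <= nm u;
  es_nD : forall u v, X u -> X v -> nm (fun x => u x + v x) <= nm u + nm v;
  es_nZ : forall c u, X u -> nm (fun x => c * u x) = `|c| * nm u;
  es_plD : forall u v w, X u -> X v -> X w -> pl u (fun x => v x + w x) = pl u v + pl u w;
  es_plZ : forall c u v, X u -> X v -> pl u (fun x => c * v x) = c * pl u v;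
  es_plZl : forall c u v, X u -> X v -> 0 <= c -> pl (fun x => c * u x) v = c `^ (p - 1) * pl u v;
  es_self : forall u, X u -> pl u u = nm u `^ p;
  es_convex : forall u v, X u -> X v -> nm u `^ p + p * pl u (fun x => v x - u x) <= nm v `^ p;
  es_unif : forall M e, 0 < e -> exists2 d : R, 0 < d & forall u v w, X u -> X v -> X w ->
    nm u <= M -> nm w <= 1 -> nm (fun x => u x - v x) <= d -> `|pl u w - pl v w| <= e;
  es_Lr : forall u, X u -> Lr m D r u;
  es_sob : exists2 C : R, 0 <= C & forall u, X u -> \int[m]_(x in D) (`|u x| `^ r) <= C * nm u `^ r;
  es_compact : forall M (u_ : nat -> F), (forall n, X (u_ n)) -> (forall n, nm (u_ n) <= M) ->
    exists (psi : nat -> nat) u, (forall n, (n <= psi n)%N) /\ Lim M (fun n => u_ (psi n)) u;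
  es_lim : forall M (u_ : nat -> F) u, Lim M u_ u -> [/\ X u, nm u <= M & dom_cvg m D r u_ u];
  es_lsc : forall M M' (u_ : nat -> F) u, (forall n, X (u_ n)) -> Lim M u_ u ->
    (forall n, nm (u_ n) <= M') -> nm u <= M';
  es_sub : forall M (u_ : nat -> F) u (psi : nat -> nat), (forall n, (n <= psi n)%N) ->
    Lim M u_ u -> Lim M (fun n => u_ (psi n)) u;
  es_unique : forall M (u_ v_ : nat -> F) u v, (forall n, X (u_ n)) -> (forall n, X (v_ n)) ->
    (forall n, nm (fun x => u_ n x - v_ n x) <= n.+1%:R^-1) ->
    Lim M u_ u -> Lim M v_ v -> {ae m, forall x, u x = v x};
  es_strong : forall M (u_ : nat -> F) u, (forall n, X (u_ n)) -> Lim M u_ u ->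
    (forall e : R, 0 < e -> exists k, forall n, (k <= n)%N -> pl (u_ n) (fun x => u_ n x - u x) <= e) ->
    forall e : R, 0 < e -> exists k, forall n, (k <= n)%N -> nm (fun x => u_ n x - u x) <= e
}.

Section one_space.
Variables (p r : R) (X : set F) (nm : F -> R) (pl : F -> F -> R) (Lim : R -> (nat -> F) -> F -> Prop).
Hypothesis es : energy_space p r X nm pl Lim.

Let p1 : 1 < p := es_p1 es.
Let p0 : 0 < p. Proof. by rewrite (lt_trans _ p1). Qed.

Lemma es_B u v : X u -> X v -> X (fun x => u x - v x).
Proof.
move=> Xu Xv; rewrite (_ : (fun x => u x - v x) = fun x => u x + -1 * v x).
  by apply: (es_D es) => //; exact: (es_Z es).
by apply/funext => x; rewrite mulN1r.
Qed.

Lemma es_nB u v : X u -> X v -> nm (fun x => u x - v x) <= nm u + nm v.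
Proof.
move=> Xu Xv; rewrite (_ : (fun x => u x - v x) = fun x => u x + -1 * v x).
  by apply: le_trans (es_nD es Xu (es_Z es _ Xv)) _; rewrite (es_nZ es)// normrN1 mul1r.
by apply/funext => x; rewrite mulN1r.
Qed.

Lemma es_n0 : nm (cst 0) = 0.
Proof.
have E : cst 0 = (fun x => 0 * cst 0 x) :> F by apply/funext => x; rewrite mul0r.
by rewrite E (es_nZ es 0 (es_0 es)) normr0 mul0r.
Qed.

Lemma es_pl0 u : X u -> pl u (cst 0) = 0.
Proof.
have E : cst 0 = (fun x => 0 * cst 0 x) :> F by apply/funext => x; rewrite mul0r.
by move=> Xu; rewrite E (es_plZ es 0 Xu (es_0 es)) mul0r.
Qed.

(** The convexity inequality between u and u + w bounds p times [pl u w] by the p-th power of the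
    norm of u + w. *)
Lemma es_bound M : exists2 K : R, 0 <= K & forall u w, X u -> X w -> nm u <= M -> nm w <= 1 ->
  `|pl u w| <= K.
Proof.
have ar (a b c k : R) : 0 <= k -> 0 <= b -> c <= k -> b + p * a <= c -> a <= k.
  move=> k0 b0 ck bc; have [a0|a0] := leP a 0; first exact: le_trans a0 k0.
  apply: le_trans (_ : p * a <= _); last by move: b0 ck bc; lra.
  by rewrite ler_peMl ?ltW.
exists ((`|M| + 1) `^ p); first exact: powR_ge0.
have H u w : X u -> X w -> nm u <= M -> nm w <= 1 -> pl u w <= (`|M| + 1) `^ p.
  move=> Xu Xw uM w1; have := es_convex es Xu (es_D es Xu Xw).
  rewrite (_ : (fun x => u x + w x - u x) = w); last by apply/funext => x; ring.
  have uw : nm (fun x => u x + w x) <= `|M| + 1.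
    apply: le_trans (es_nD es Xu Xw) _.
    by apply: lerD => //; exact: le_trans uM (ler_norm M).
  apply: ar; [exact: powR_ge0|exact: (powR_ge0 (nm u) p)|].
  exact: ler_powR_base (ltW p0) (es_ge0 es _) uw.
move=> u w Xu Xw uM w1; rewrite ler_norml (H _ _ Xu Xw uM w1) andbT lerNl.
have := H u (fun x => -1 * w x) Xu (es_Z es (-1) Xw) uM.
by rewrite (es_plZ es (-1) Xu Xw) mulN1r; apply; rewrite (es_nZ es (-1) Xw) normrN1 mul1r.
Qed.

(** Convexity at u + t w, read towards u, bounds the energy from above with the derivative at u + t
    w; uniform continuity moves it to u. Only this upper estimate is needed for descent. *)
Lemma es_taylor M (e : R) : 0 < e -> exists2 d : R, 0 < d & forall u w (t : R),
  X u -> X w -> nm u <= M -> nm w <= 1 -> 0 < t -> t <= d ->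
  nm (fun x => u x + t * w x) `^ p / p <= nm u `^ p / p + t * pl u w + e * t.
Proof.
move=> e0.
have ar (a b c k t : R) : 0 < t -> - e <= a - b -> c + p * (- t * b) <= k -> c / p <= k / p + t * a + e * t.
  move=> t0 ab ck.
  have tb : p * (t * b) <= p * (t * (a + e)) by rewrite ler_pM2l// ler_pM2l//; lra.
  rewrite ler_pdivrMr//.
  have -> : (k / p + t * a + e * t) * p = k + p * (t * (a + e)) by field; rewrite gt_eqF.
  by move: ck tb; rewrite mulNr mulrN; lra.
have [d' d0 Hd] := es_unif es M e0; exists d' => // u w t Xu Xw uM w1 t0 td.
have Xtw := es_Z es t Xw; have Xutw := es_D es Xu Xtw.
have E : (fun x => u x - (u x + t * w x)) = fun x => - t * w x by apply/funext => x; ring.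
have tw : nm (fun x => u x - (u x + t * w x)) <= d'.
  rewrite E (es_nZ es _ Xw) normrN gtr0_norm//.
  by apply: le_trans td; rewrite ler_piMr// ltW.
have := es_convex es Xutw Xu; have := Hd u _ w Xu Xutw Xw uM w1 tw.
rewrite E (es_plZ es _ Xutw Xw) ler_norml => /andP[+ _].
exact: (ar _ _ _ _ _ t0).
Qed.

End one_space.

Lemma es_extract (k : nat) (p r M : nat -> R) (X : nat -> set F) (nm : nat -> F -> R)
    (pl : nat -> F -> F -> R) (Lim : nat -> R -> (nat -> F) -> F -> Prop) (u_ : nat -> nat -> F) :
  (forall j, (j < k)%N -> energy_space (p j) (r j) (X j) (nm j) (pl j) (Lim j)) ->
  (forall j n, (j < k)%N -> X j (u_ j n) /\ nm j (u_ j n) <= M j) ->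
  exists2 psi : nat -> nat, (forall n, (n <= psi n)%N) &
    exists u : nat -> F, forall j, (j < k)%N -> Lim j (M j) (fun n => u_ j (psi n)) (u j).
Proof.
elim: k => [|k IH] A B; first by exists id => //; exists (fun=> cst 0).
have [||psi psige [u Hu]] := IH.
- by move=> j jk; apply: A; exact: ltnW.
- by move=> j n jk; apply: B; exact: ltnW.
have Ak := A k (ltnSn k).
have [phi [v [phige Hv]]] := es_compact Ak
   (fun n => (B k (psi n) (ltnSn k)).1) (fun n => (B k (psi n) (ltnSn k)).2).
exists (psi \o phi) => [n|]; first exact: leq_trans (phige n) (psige _).
exists (fun j => if j == k then v else u j) => j; rewrite ltnS leq_eqVlt => /orP[/eqP ->|jk].
  by rewrite eqxx.
rewrite (ltn_eqF jk); apply: (es_sub (A j (ltnW jk)) phige (Hu j jk)).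
Qed.

(** * Functionals on a pair of energy spaces *)

Section two_spaces.
Variables (p1 r1 p2 r2 : R) (X1 X2 : set F) (n1 n2 : F -> R) (pl1 pl2 : F -> F -> R).
Variables (Lim1 Lim2 : R -> (nat -> F) -> F -> Prop).
Hypotheses (A1 : energy_space p1 r1 X1 n1 pl1 Lim1) (A2 : energy_space p2 r2 X2 n2 pl2 Lim2).
Variables (Nf : F -> F -> R) (DN : F -> F -> F -> F -> R).
Hypothesis cf : compact_functional m D r1 r2 Nf DN.

(** Sequences are listed alternately: even indices belong to the first space, odd ones to the
    second. *)
Let param {A : Type} (a b : A) (j : nat) : A := if odd j then b else a.

Let Apar j : energy_space (param p1 p2 j) (param r1 r2 j) (param X1 X2 j) (param n1 n2 j)
  (param pl1 pl2 j) (param Lim1 Lim2 j).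
Proof.
have H (b : bool) : energy_space (if b then p2 else p1) (if b then r2 else r1) (if b then X2 else X1)
    (if b then n2 else n1) (if b then pl2 else pl1) (if b then Lim2 else Lim1) by case: b.
exact: H.
Qed.

Definition in_ball (M : R) (u v : F) : Prop := [/\ X1 u, X2 v, n1 u <= M & n2 v <= M].

(** By contradiction and compactness: values tending to infinity are incompatible with convergence
    along an extracted subsequence. *)
Lemma cf_bound M : exists2 K : R, 0 <= K & forall u v w z, in_ball M u v -> in_ball 1 w z ->
  `|Nf u v| <= K /\ `|DN u v w z| <= K.
Proof.
apply: contrapT => nE.
have /choice[f Hf] : forall n : nat, exists q : (F * F) * (F * F),
    [/\ in_ball M q.1.1 q.1.2, in_ball 1 q.2.1 q.2.2 &
      n%:R < `|Nf q.1.1 q.1.2| + `|DN q.1.1 q.1.2 q.2.1 q.2.2| ].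
  move=> n; apply: contrapT => nq; apply: nE; exists n%:R => // u v w z uv wz.
  apply: contrapT => nK; apply: nq; exists ((u, v), (w, z)); split => //=.
  rewrite ltNge; apply/negP => le; apply: nK; split; apply: le_trans le; by rewrite ?lerDl ?lerDr.
pose us (n : nat) := [:: (f n).1.1; (f n).1.2; (f n).2.1; (f n).2.2].
have [|j n jk|psi psige [l Hl]] := @es_extract 4 (param p1 p2) (param r1 r2)
  (fun j => if (j < 2)%N then M else 1) (param X1 X2) (param n1 n2) (param pl1 pl2) (param Lim1 Lim2) (fun j n => nth (cst 0) (us n) j).
- by move=> j _; exact: Apar.
- have [[a1 a2 a3 a4] [b1 b2 b3 b4] _] := Hf n.
  case: j jk => [|[|[|[|j]]]] jk; [exact (conj a1 a3)|exact (conj a2 a4)|exact (conj b1 b3)|exact (conj b2 b4)|by move: jk].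
have [_ _ du] := es_lim A1 (Hl 0%N isT); have [_ _ dv] := es_lim A2 (Hl 1%N isT).
have [_ _ dw] := es_lim A1 (Hl 2%N isT); have [_ _ dz] := es_lim A2 (Hl 3%N isT).
rewrite /= in du dv dw dz.
pose L := `|Nf (l 0%N) (l 1%N)| + `|DN (l 0%N) (l 1%N) (l 2%N) (l 3%N)|.
have [k Hk] := cvg_dist (cvgD (cvg_norm (cf_cvg cf du dv)) (cvg_norm (cf_dcvg cf du dv dw dz))) ltr01.
pose n := maxn k (Num.truncn (L + 1)).+1.
have /= := Hk n (leq_maxl _ _); rewrite -/L ler_norml => /andP[Hn _].
have [_ _] := Hf (psi n); apply/negP; rewrite -leNgt.
apply: (@le_trans _ _ (L + 1)); last first.
  apply: le_trans (ltW (truncnS_gt _)) _; rewrite ler_nat.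
  by apply: leq_trans (psige n); exact: leq_maxr.
have ar (x y : R) : -1 <= x - y -> y <= x + 1 by move=> *; lra.
exact: ar Hn.
Qed.

(** Two sequences at vanishing distance have the same weak limit, so the derivatives along both
    converge to the same value. *)
Lemma cf_unif M (e : R) : 0 < e -> exists2 d : R, 0 < d & forall u v u' v' w z,
  in_ball M u v -> in_ball M u' v' -> in_ball 1 w z ->
  n1 (fun x => u x - u' x) <= d -> n2 (fun x => v x - v' x) <= d ->
  `|DN u v w z - DN u' v' w z| <= e.
Proof.
move=> e0; apply: contrapT => nE.
have /choice[f Hf] : forall n : nat, exists q : (F * F) * (F * F) * (F * F),
    [/\ in_ball M q.1.1.1 q.1.1.2 /\ in_ball M q.1.2.1 q.1.2.2, in_ball 1 q.2.1 q.2.2,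
      n1 (fun x => q.1.1.1 x - q.1.2.1 x) <= n.+1%:R^-1,
      n2 (fun x => q.1.1.2 x - q.1.2.2 x) <= n.+1%:R^-1 &
      e < `|DN q.1.1.1 q.1.1.2 q.2.1 q.2.2 - DN q.1.2.1 q.1.2.2 q.2.1 q.2.2| ].
  move=> n; apply: contrapT => nq; apply: nE; exists n.+1%:R^-1; first by rewrite invr_gt0.
  move=> u v u' v' w z uv uv' wz du dv; rewrite leNgt; apply/negP => H.
  by apply: nq; exists (((u, v), (u', v')), (w, z)); exact: And5 (conj uv uv') wz du dv H.
pose us (n : nat) := [:: (f n).1.1.1; (f n).1.1.2; (f n).1.2.1; (f n).1.2.2; (f n).2.1; (f n).2.2].
have [|j n jk|psi psige [l Hl]] := @es_extract 6 (param p1 p2) (param r1 r2)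
  (fun j => if (j < 4)%N then M else 1) (param X1 X2) (param n1 n2) (param pl1 pl2) (param Lim1 Lim2) (fun j n => nth (cst 0) (us n) j).
- by move=> j _; exact: Apar.
- have [[[a1 a2 a3 a4] [b1 b2 b3 b4]] [c1 c2 c3 c4] _ _ _] := Hf n.
  case: j jk => [|[|[|[|[|[|j]]]]]] jk; [exact (conj a1 a3)|exact (conj a2 a4)|exact (conj b1 b3)|
    exact (conj b2 b4)|exact (conj c1 c3)|exact (conj c2 c4)|by move: jk].
have L0 := Hl 0%N isT; have L1 := Hl 1%N isT; have L2 := Hl 2%N isT.
have L3 := Hl 3%N isT;
  have [_ _ dw] := es_lim A1 (Hl 4%N isT); have [_ _ dz] := es_lim A2 (Hl 5%N isT).
rewrite /= in L0 L1 L2 L3 dw dz.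
have le_psi n : (psi n).+1%:R^-1 <= n.+1%:R^-1 :> R by rewrite lef_pV2 ?posrE// ler_nat ltnS.
have e1 : {ae m, forall x, l 2%N x = l 0%N x}.
  have H := @es_unique _ _ _ _ _ _ A1 M _ _ _ _ _ _ _ L0 L2.
  suff : {ae m, forall x, l 0%N x = l 2%N x} by apply: filterS => x ->.
  apply: H => n.
  - by have [[[? _ _ _] _] _ _ _ _] := Hf (psi n).
  - by have [[_ [? _ _ _]] _ _ _ _] := Hf (psi n).
  - by have [_ _ H _ _] := Hf (psi n); exact: le_trans H (le_psi n).
have e2 : {ae m, forall x, l 3%N x = l 1%N x}.
  have H := @es_unique _ _ _ _ _ _ A2 M _ _ _ _ _ _ _ L1 L3.
  suff : {ae m, forall x, l 1%N x = l 3%N x} by apply: filterS => x ->.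
  apply: H => n.
  - by have [[[_ ? _ _] _] _ _ _ _] := Hf (psi n).
  - by have [[_ [_ ? _ _]] _ _ _ _] := Hf (psi n).
  - by have [_ _ _ H _] := Hf (psi n); exact: le_trans H (le_psi n).
have [X0l _ d0] := es_lim A1 L0; have [X1l _ d1] := es_lim A2 L1.
have [_ _ d2] := es_lim A1 L2; have [_ _ d3] := es_lim A2 L3.
have d2' := dom_cvg_ae (es_Lr A1 X0l).1 e1 d2; have d3' := dom_cvg_ae (es_Lr A2 X1l).1 e2 d3.
have [k /(_ k (leqnn k))] := cvg_dist (cvgB (cf_dcvg cf d0 d1 dw dz) (cf_dcvg cf d2' d3' dw dz)) e0; rewrite /= subrr sub0r normrN.
have [_ _ _ _ H1] := Hf (psi k) => H2.
by move: (lt_le_trans H1 H2); rewrite ltxx.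
Qed.

Lemma cf_taylor_unif M (e : R) : 0 < e -> exists2 d : R, 0 < d & forall u v w z (t : R),
  in_ball M u v -> in_ball 1 w z -> 0 < t -> t <= d ->
  `|Nf (fun x => u x + t * w x) (fun x => v x + t * z x) - Nf u v - t * DN u v w z| <= e * t.
Proof.
move=> e0; apply: contrapT => nE.
have /choice[f Hf] : forall n : nat, exists q : (F * F) * (F * F) * R,
    [/\ in_ball M q.1.1.1 q.1.1.2, in_ball 1 q.1.2.1 q.1.2.2, 0 < q.2, q.2 <= n.+1%:R^-1 &
      e * q.2 < `|Nf (fun x => q.1.1.1 x + q.2 * q.1.2.1 x) (fun x => q.1.1.2 x + q.2 * q.1.2.2 x) -
         Nf q.1.1.1 q.1.1.2 - q.2 * DN q.1.1.1 q.1.1.2 q.1.2.1 q.1.2.2| ].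
  move=> n; apply: contrapT => nq; apply: nE; exists n.+1%:R^-1; first by rewrite invr_gt0.
  move=> u v w z t uv wz t0 tn; rewrite leNgt; apply/negP => H.
  by apply: nq; exists (((u, v), (w, z)), t); exact: And5 uv wz t0 tn H.
pose us (n : nat) := [:: (f n).1.1.1; (f n).1.1.2; (f n).1.2.1; (f n).1.2.2].
have [|j n jk|psi psige [l Hl]] := @es_extract 4 (param p1 p2) (param r1 r2)
  (fun j => if (j < 2)%N then M else 1) (param X1 X2) (param n1 n2) (param pl1 pl2) (param Lim1 Lim2) (fun j n => nth (cst 0) (us n) j).
- by move=> j _; exact: Apar.
- have [[a1 a2 a3 a4] [b1 b2 b3 b4] _ _ _] := Hf n.
  case: j jk => [|[|[|[|j]]]] jk; [exact (conj a1 a3)|exact (conj a2 a4)|exact (conj b1 b3)|exact (conj b2 b4)|by move: jk].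
have [_ _ du] := es_lim A1 (Hl 0%N isT); have [_ _ dv] := es_lim A2 (Hl 1%N isT).
have [_ _ dw] := es_lim A1 (Hl 2%N isT); have [_ _ dz] := es_lim A2 (Hl 3%N isT).
rewrite /= in du dv dw dz.
pose t_ n := (f (psi n)).2.
have le_psi n : (psi n).+1%:R^-1 <= n.+1%:R^-1 :> R by rewrite lef_pV2 ?posrE// ler_nat ltnS.
have t0 n : 0 < t_ n by have [] := Hf (psi n).
have tn n : t_ n <= n.+1%:R^-1 by have [_ _ _ H _] := Hf (psi n); exact: le_trans H (le_psi n).
have t01 n : 0 < t_ n <= 1 by rewrite t0 (le_trans (tn n))// invf_le1// ler1n.
have ct : t_ n @[n --> \oo] --> (0 : R).
  apply: (@squeeze_cvgr _ _ _ _ (cst 0) (fun n => n.+1%:R^-1)).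
  - by apply: nearW => n; rewrite tn ltW.
  - exact: cvg_cst.
  - exact: cvg_harmonic.
have /cvgrPdist_lt/(_ e e0)[k _ /(_ k (leqnn k))] /= := cf_taylor cf du dv dw dz t01 ct.
rewrite sub0r normrN; have [_ _ _ _ +] := Hf (psi k); rewrite -/(t_ k) => H1 H2.
move: H1; apply/negP; rewrite -leNgt.
have tk := t0 k.
rewrite -ler_pdivrMr// mulrC -[X in X * _](gtr0_norm (_ : 0 < (t_ k)^-1)) ?invr_gt0// -normrM.
by rewrite mulrBr mulKf ?gt_eqF//; exact: ltW.
Qed.

Definition func (u v : F) : R := n1 u `^ p1 / p1 + n2 v `^ p2 / p2 - Nf u v.

Definition dfunc (u v w z : F) : R :=
  pl1 u w + pl2 v z - DN u v w z.

Lemma in_ballX M u v : in_ball M u v -> X1 u /\ X2 v. Proof. by case. Qed.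

Let L1 u (Xu : X1 u) : Lr m D r1 u := es_Lr A1 Xu.
Let L2 u (Xu : X2 u) : Lr m D r2 u := es_Lr A2 Xu.

Lemma dfuncD u v w z w' z' : X1 u -> X2 v -> X1 w -> X2 z -> X1 w' -> X2 z' ->
  dfunc u v (fun x => w x + w' x) (fun x => z x + z' x) = dfunc u v w z + dfunc u v w' z'.
Proof.
move=> Xu Xv Xw Xz Xw' Xz'; rewrite /dfunc (es_plD A1 Xu Xw Xw') (es_plD A2 Xv Xz Xz').
by rewrite (cf_D cf (L1 Xu) (L2 Xv) (L1 Xw) (L2 Xz) (L1 Xw') (L2 Xz')); ring.
Qed.

Lemma dfuncZ c u v w z : X1 u -> X2 v -> X1 w -> X2 z ->
  dfunc u v (fun x => c * w x) (fun x => c * z x) = c * dfunc u v w z.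
Proof.
move=> Xu Xv Xw Xz; rewrite /dfunc (es_plZ A1 c Xu Xw) (es_plZ A2 c Xv Xz).
by rewrite (cf_Z cf c (L1 Xu) (L2 Xv) (L1 Xw) (L2 Xz)); ring.
Qed.

Lemma dfunc_bound M : exists2 K : R, 0 <= K & forall u v w z, in_ball M u v -> in_ball 1 w z ->
  `|dfunc u v w z| <= K.
Proof.
have ar (a b c K1 K2 K3 : R) : `|a| <= K1 -> `|b| <= K2 -> `|c| <= K3 -> `|a + b - c| <= K1 + K2 + K3.
  move=> h1 h2 h3; apply: le_trans (ler_normB _ _) _; apply: lerD => //.
  by apply: le_trans (ler_normD _ _) _; exact: lerD.
have [K1 K10 H1] := es_bound A1 M; have [K2 K20 H2] := es_bound A2 M.
have [K3 K30 H3] := cf_bound M.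
exists (K1 + K2 + K3); first by rewrite !addr_ge0.
move=> u v w z uv wz; have [_ h3] := H3 _ _ _ _ uv wz.
by case: uv => Xu Xv uM vM; case: wz => Xw Xz w1 z1; apply: ar h3; [exact: H1|exact: H2].
Qed.

Lemma dfunc_unif M (e : R) : 0 < e -> exists2 d : R, 0 < d & forall u v u' v' w z,
  in_ball M u v -> in_ball M u' v' -> in_ball 1 w z ->
  n1 (fun x => u x - u' x) <= d -> n2 (fun x => v x - v' x) <= d ->
  `|dfunc u v w z - dfunc u' v' w z| <= e.
Proof.
move=> e0; have e3 : 0 < e / 3 by rewrite divr_gt0.
have ar (a b c a' b' c' : R) : `|a - a'| <= e / 3 -> `|b - b'| <= e / 3 -> `|c - c'| <= e / 3 ->
    `|a + b - c - (a' + b' - c')| <= e.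
  by rewrite !ler_norml => /andP[? ?] /andP[? ?] /andP[? ?]; apply/andP; split; lra.
have [d1 d10 H1] := es_unif A1 M e3; have [d2 d20 H2] := es_unif A2 M e3.
have [d3 d30 H3] := cf_unif M e3.
exists (Num.min (Num.min d1 d2) d3); first by rewrite !lt_min d10 d20.
move=> u v u' v' w z uv uv' wz; rewrite !le_min => /andP[/andP[u1 _] u3] /andP[/andP[_ v2] v3].
have h3 := H3 _ _ _ _ _ _ uv uv' wz u3 v3.
case: uv => Xu Xv uM vM; case: uv' => Xu' Xv' _ _; case: wz => Xw Xz w1 z1.
apply: ar h3; [exact: H1|exact: H2].
Qed.

Lemma func_taylor M (e : R) : 0 < e -> exists2 d : R, 0 < d & forall u v w z (t : R),
  in_ball M u v -> in_ball 1 w z -> 0 < t -> t <= d ->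
  func (fun x => u x + t * w x) (fun x => v x + t * z x) <=
    func u v + t * dfunc u v w z + e * t.
Proof.
move=> e0; have e3 : 0 < e / 3 by rewrite divr_gt0.
have ar (a b c a' b' c' x y n t : R) : a' <= a + t * x + e / 3 * t -> b' <= b + t * y + e / 3 * t ->
    `|c' - c - t * n| <= e / 3 * t -> a' + b' - c' <= a + b - c + t * (x + y - n) + e * t.
  by rewrite ler_norml => h1 h2 /andP[? ?]; rewrite mulrBr mulrDr; lra.
have [d1 d10 H1] := es_taylor A1 M e3; have [d2 d20 H2] := es_taylor A2 M e3.
have [d3 d30 H3] := cf_taylor_unif M e3.
exists (Num.min (Num.min d1 d2) d3); first by rewrite !lt_min d10 d20.
move=> u v w z t uv wz t0; rewrite !le_min => /andP[/andP[u1 u2] u3].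
have h3 := H3 _ _ _ _ _ uv wz t0 u3.
case: uv => Xu Xv uM vM; case: wz => Xw Xz w1 z1.
by apply: ar h3; [exact: H1|exact: H2].
Qed.

Let dom_cvgB p r X nm pl Lim u_ u : energy_space p r X nm pl Lim -> X u -> dom_cvg m D r u_ u ->
  dom_cvg m D r (fun n x => u_ n x - u x) (cst 0).
Proof.
move=> A Xu du; have r0 := es_r0 A; have [mu iu] := es_Lr A Xu.
have nm1 (n : nat) : `|-1| <= 1 :> R by rewrite normrN1.
have c1 : (fun=> -1) n @[n --> \oo] --> (-1 : R) by exact: cvg_cst.
have := dom_cvgD mD r0 du (dom_cvg_scale r0 nm1 c1 (dom_cvg_cst mu iu)).
rewrite (_ : (fun n x => u_ n x + _) = fun n x => u_ n x - u x); last first.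
  by apply/funext => n; apply/funext => x; rewrite mulN1r.
by rewrite (_ : (fun x => u x + _) = cst 0)//; apply/funext => x; rewrite mulN1r subrr.
Qed.

Lemma in_ballZ c u v : 0 <= c -> in_ball c u v -> 0 < c -> in_ball 1 (fun x => c^-1 * u x) (fun x => c^-1 * v x).
Proof.
move=> c0 [Xu Xv uc vc] c1; split; [exact: (es_Z A1)|exact: (es_Z A2)| |].
  by rewrite (es_nZ A1 _ Xu) gtr0_norm ?invr_gt0// ler_pdivrMl// mulr1.
by rewrite (es_nZ A2 _ Xv) gtr0_norm ?invr_gt0// ler_pdivrMl// mulr1.
Qed.

(** Testing with (u_n - u, 0) and (0, v_n - v), the compact part tends to 0, so the pairings of the
    principal parts have upper limit at most 0 and [es_strong] gives strong convergence. The limit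
    is then critical by uniform continuity of the derivative. *)
Lemma palais_smale M (u_ v_ : nat -> F) : (forall n, in_ball M (u_ n) (v_ n)) ->
  (forall n w z, in_ball 1 w z -> `|dfunc (u_ n) (v_ n) w z| <= n.+1%:R^-1) ->
  exists u v, [/\ in_ball M u v, forall w z, X1 w -> X2 z -> dfunc u v w z = 0 &
    forall e : R, 0 < e -> exists n, n1 (fun x => u_ n x - u x) <= e /\ n2 (fun x => v_ n x - v x) <= e].
Proof.
move=> B small; have M0 : 0 <= M by have [_ _ h _] := B 0%N; exact: le_trans (es_ge0 A1 _) h.
have [|j n jk|psi psige [l Hl]] := @es_extract 2 (param p1 p2) (param r1 r2)
  (fun=> M) (param X1 X2) (param n1 n2) (param pl1 pl2) (param Lim1 Lim2) (fun j n => nth (cst 0) [:: u_ n; v_ n] j).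
- by move=> j _; exact: Apar.
- have [a1 a2 a3 a4] := B n.
  case: j jk => [|[|j]] jk; [exact (conj a1 a3)|exact (conj a2 a4)|by move: jk].
have Lu := Hl 0%N isT; have Lv := Hl 1%N isT; rewrite /= in Lu Lv.
set u := l 0%N in Lu; set v := l 1%N in Lv.
have [Xu uM du] := es_lim A1 Lu; have [Xv vM dv] := es_lim A2 Lv.
have Xu_ n : X1 (u_ n) by case: (B n).
have Xv_ n : X2 (v_ n) by case: (B n).
have c0 : 0 < 2 * M + 1 by rewrite ltr_wpDl// mulr_ge0.
have test W_ Z_ : (forall n, in_ball (2 * M + 1) (W_ n) (Z_ n)) ->
    dom_cvg m D r1 W_ (cst 0) -> dom_cvg m D r2 Z_ (cst 0) ->
    forall e : R, 0 < e -> exists k, forall n, (k <= n)%N ->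
      pl1 (u_ (psi n)) (W_ n) + pl2 (v_ (psi n)) (Z_ n) <= e.
  have ar (a b c k e : R) : `|a + b - c| <= k -> `|0 - c| <= e / 2 -> k <= e / 2 -> a + b <= e.
    by rewrite !ler_norml => /andP[? ?] /andP[? ?] ?; lra.
  move=> WZ dW dZ e e0; have e2 : 0 < e / 2 by rewrite divr_gt0.
  have D0 : DN u v (cst 0) (cst 0) = 0.
    have E w : cst 0 = (fun x => 0 * w x) :> F by apply/funext => x; rewrite mul0r.
    by rewrite {1}(E u) (E v) (cf_Z cf 0 (L1 Xu) (L2 Xv) (L1 Xu) (L2 Xv)) mul0r.
  have [k1 Hk1] := cvg_dist (cf_dcvg cf du dv dW dZ) e2; rewrite D0 in Hk1.
  have [k2 _ Hk2] := near_infty_natSinv_lt (PosNum (divr_gt0 e2 c0)).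
  exists (maxn k1 k2) => n; rewrite geq_max => /andP[/Hk1 kn1 /Hk2 /= kn2].
  have [XW XZ] := in_ballX (WZ n).
  have := small (psi n) _ _ (in_ballZ (ltW c0) (WZ n) c0).
  rewrite (dfuncZ _ (Xu_ _) (Xv_ _) XW XZ) normrM gtr0_norm ?invr_gt0// ler_pdivrMl// => h.
  apply: (ar _ _ _ _ _ h kn1); rewrite mulrC -ler_pdivlMr//.
  by apply: le_trans (ltW kn2); rewrite lef_pV2 ?posrE// ler_nat ltnS.
have X10 := es_0 A1; have X20 := es_0 A2.
have bnd (a b c : R) : a <= b + c -> b <= M -> c <= M -> a <= 2 * M + 1 by move=> *; lra.
have SU : forall e : R, 0 < e -> exists k, forall n, (k <= n)%N -> n1 (fun x => u_ (psi n) x - u x) <= e.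
  apply: (es_strong A1 (fun n => Xu_ (psi n)) Lu) => e e0.
  have [|||k Hk] := test (fun n x => u_ (psi n) x - u x) (fun=> cst 0) _ _ _ e e0.
  - move=> n; split; [exact: (es_B A1 (Xu_ _) Xu)|exact: X20| |].
      by apply: (bnd _ _ _ (es_nB A1 (Xu_ _) Xu) _ uM); case: (B (psi n)).
    by rewrite (es_n0 A2) ltW.
  - exact: (dom_cvgB A1 Xu du).
  - by have [? ?] := es_Lr A2 X20; exact: dom_cvg_cst.
  - by exists k => n kn; have := Hk n kn; rewrite (es_pl0 A2 (Xv_ _)) addr0.
have SV : forall e : R, 0 < e -> exists k, forall n, (k <= n)%N -> n2 (fun x => v_ (psi n) x - v x) <= e.
  apply: (es_strong A2 (fun n => Xv_ (psi n)) Lv) => e e0.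
  have [|||k Hk] := test (fun=> cst 0) (fun n x => v_ (psi n) x - v x) _ _ _ e e0.
  - move=> n; split; [exact: X10|exact: (es_B A2 (Xv_ _) Xv)| |].
      by rewrite (es_n0 A1) ltW.
    by apply: (bnd _ _ _ (es_nB A2 (Xv_ _) Xv) _ vM); case: (B (psi n)).
  - by have [? ?] := es_Lr A1 X10; exact: dom_cvg_cst.
  - exact: (dom_cvgB A2 Xv dv).
  - by exists k => n kn; have := Hk n kn; rewrite (es_pl0 A1 (Xu_ _)) add0r.
have Buv : in_ball M u v by split.
exists u, v; split => //.
  have D0 w z : in_ball 1 w z -> dfunc u v w z = 0.
    move=> wz; apply/eqP; rewrite -normr_le0; apply/ler_addgt0Pl => e e0; rewrite addr0.
    have e2 : 0 < e / 2 by rewrite divr_gt0.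
    have [d' d0 Hd] := dfunc_unif M e2.
    have [k1 Hk1] := SU d' d0; have [k2 Hk2] := SV d' d0.
    have [k3 _ Hk3] := near_infty_natSinv_lt (PosNum e2).
    pose n := maxn k3 (maxn k1 k2).
    have h1 := Hd _ _ _ _ _ _ (B (psi n)) Buv wz (Hk1 n _) (Hk2 n _).
    have h2 := small (psi n) w z wz.
    have ar (a b k : R) : `|a - b| <= e / 2 -> `|a| <= k -> k <= e / 2 -> `|b| <= e.
      by rewrite !ler_norml => /andP[? ?] /andP[? ?] ?; apply/andP; split; lra.
    apply: ar (h1 _ _) h2 _; rewrite ?leq_max ?leqnn ?orbT//.
    apply: le_trans (ltW (Hk3 n _)); last by rewrite /= leq_maxl.
    by rewrite lef_pV2 ?posrE// ler_nat ltnS.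
  move=> w z Xw Xz; pose c := n1 w + n2 z + 1.
  have c1 : 0 < c by rewrite ltr_wpDl// addr_ge0 ?(es_ge0 A1) ?(es_ge0 A2).
  have wz : in_ball c w z.
    by split => //; rewrite /c -?addrA ?lerDl ?addr_ge0 ?(es_ge0 A1) ?(es_ge0 A2)// addrCA lerDl addr_ge0 ?(es_ge0 A1) ?(es_ge0 A2).
  have := D0 _ _ (in_ballZ (ltW c1) wz c1); rewrite (dfuncZ _ Xu Xv Xw Xz) => /eqP.
  by rewrite mulf_eq0 invr_eq0 (gt_eqF c1) => /eqP.
move=> e e0; have [k1 Hk1] := SU e e0; have [k2 Hk2] := SV e e0.
by exists (psi (maxn k1 k2)); split; [apply: Hk1|apply: Hk2]; rewrite leq_max leqnn ?orbT.
Qed.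

End two_spaces.

End energy_spaces.

(** * Nehari set *)

Section ray_estimates.
Context {R : realFieldType}.
Implicit Types (a b c d e k n q t y h : R).

Lemma taylor_contra a b c q y h : 0 < y * h -> q <= y * - (h / 2) -> a <= b -> c <= a ->
  b <= c + q + h / 4 * y -> False.
Proof. by move=> *; lra. Qed.

Lemma ler_dist1 t d : 1 - d <= t -> t <= 1 + d -> - d <= t - 1 <= d.
Proof. by move=> *; apply/andP; split; lra. Qed.

Lemma half_interval d : 0 < d -> d <= 2^-1 -> [/\ 0 < 1 - d, 1 - d <= 1 + d, 1 - d <= 3 / 2 & 1 + d <= 3 / 2].
Proof. by move=> *; split; lra. Qed.

Lemma radius_bound n e : 0 < n -> e <= 1 / 2 -> 3 / 2 * n <= 2 * n + 2 - 3 / 2 * e.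
Proof. by move=> *; lra. Qed.

Lemma radius_self n : 0 < n -> n <= 2 * n + 2. Proof. by move=> *; lra. Qed.

Lemma step_bound e d : 0 < d -> e <= d / 2 -> 3 / 2 * e <= d. Proof. by move=> *; lra. Qed.

Lemma sign_lower e k a : e <= k -> - e <= a - k -> 0 <= a. Proof. by move=> *; lra. Qed.

Lemma sign_upper e k a : e <= - k -> a - k <= e -> a <= 0. Proof. by move=> *; lra. Qed.

Lemma perturbed_gt0 n e k a : 0 < n -> e <= n / 2 -> k <= e -> n <= a + k -> 0 < a.
Proof. by move=> *; lra. Qed.

Lemma half_slope a b : a - b <= - b / 2 -> a <= - (- b / 2). Proof. by move=> *; lra. Qed.

End ray_estimates.

Section nehari.
Context d (T : measurableType d) (R : realType).
Variables (m : {measure set T -> \bar R}) (D : set T).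
Hypotheses (mD : measurable D) (Doo : (m D < +oo)%E).
Local Notation F := (T -> R).
Variables (p r : R) (X : set F) (nm : F -> R) (pl : F -> F -> R) (Lim : R -> (nat -> F) -> F -> Prop).
Hypothesis es : energy_space m D p r X nm pl Lim.
Variables (C alpha theta : R) (G g : T -> R -> R).
Hypotheses (C0 : 0 <= C) (pr : p < r) (palpha : p < alpha) (theta0 : 0 <= theta < 1).

Let p1 : 1 < p := es_p1 es.
Let p0 : 0 < p. Proof. by rewrite (lt_trans _ p1). Qed.
Let r0 : 0 < r := es_r0 es.

Hypothesis nl : nonlinearity D r r C (fun x a _ => G x a) (fun x a _ => g x a) (fun _ _ _ => 0).

Definition pot (u : F) : R := \int[m]_(x in D) G x (u x).

Definition dpot (u w : F) : R := \int[m]_(x in D) (g x (u x) * w x).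

Lemma pot_compact : compact_functional m D r r (fun u _ => pot u) (fun u _ w _ => dpot u w).
Proof.
have := nem_compact mD Doo r0 r0 C0 nl; congr (compact_functional _ _ _ _ _).
apply/funext => u; apply/funext => v; apply/funext => w; apply/funext => z.
by apply: eq_Rintegral => x _; rewrite mul0r addr0.
Qed.

Let cf := pot_compact.

Definition Jf (u : F) : R := nm u `^ p / p - pot u.

Definition dJf (u w : F) : R := pl u w - dpot u w.

Let in_b M u : X u -> nm u <= M -> in_ball X X nm nm M u (cst 0).
Proof.
move=> Xu uM; split => //; first exact: (es_0 es).
by rewrite (es_n0 es) (le_trans (es_ge0 es u)).
Qed.

(** The scalar functional is that of a pair with second component 0, so the results on pairs of
    spaces apply to it. *)
Let JfE u : Jf u = func p p nm nm (fun u _ => pot u) u (cst 0).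
Proof. by rewrite /func (es_n0 es) powR0 ?gt_eqF// mul0r addr0. Qed.

Let dJfE u w : dJf u w = dfunc pl pl (fun u _ w _ => dpot u w) u (cst 0) w (cst 0).
Proof. by rewrite /dfunc (es_pl0 es (es_0 es)) addr0. Qed.

Lemma Jf_taylor M (e : R) : 0 < e -> exists2 del : R, 0 < del & forall u w (t : R),
  X u -> nm u <= M -> X w -> nm w <= 1 -> 0 < t -> t <= del ->
  Jf (fun x => u x + t * w x) <= Jf u + t * dJf u w + e * t.
Proof.
move=> e0; have [del d0 Hd] := func_taylor es es cf M e0; exists del => // u w t Xu uM Xw w1 t0 td.
have := Hd _ _ _ _ t (in_b Xu uM) (in_b Xw w1) t0 td.
rewrite (_ : (fun x => cst 0 x + t * cst 0 x) = cst 0); first by rewrite !JfE dJfE.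
by apply/funext => x; rewrite /cst; ring.
Qed.

Lemma dJf_unif M (e : R) : 0 < e -> exists2 del : R, 0 < del & forall u u' w,
  X u -> nm u <= M -> X u' -> nm u' <= M -> X w -> nm w <= 1 ->
  nm (fun x => u x - u' x) <= del -> `|dJf u w - dJf u' w| <= e.
Proof.
move=> e0; have [del d0 Hd] := dfunc_unif es es cf M e0; exists del => // u u' w Xu uM Xu' uM' Xw w1 uu'.
have := Hd _ _ _ _ _ _ (in_b Xu uM) (in_b Xu' uM') (in_b Xw w1) uu'.
rewrite -!dJfE; apply.
rewrite (_ : (fun x => cst 0 x - cst 0 x) = cst 0); first by rewrite (es_n0 es) ltW.
by apply/funext => x; rewrite subrr.
Qed.

Lemma dJf_bound M : exists2 K : R, 0 <= K & forall u w, X u -> nm u <= M -> X w -> nm w <= 1 -> `|dJf u w| <= K.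
Proof.
have [K K0 H] := dfunc_bound es es cf M; exists K => // u w Xu uM Xw w1.
by rewrite dJfE; exact: H (in_b Xu uM) (in_b Xw w1).
Qed.

Lemma dJfD u w w' : X u -> X w -> X w' -> dJf u (fun x => w x + w' x) = dJf u w + dJf u w'.
Proof.
move=> Xu Xw Xw'; rewrite /dJf (es_plD es Xu Xw Xw').
rewrite (cf_D cf (es_Lr es Xu) (es_Lr es Xu) (es_Lr es Xw) (es_Lr es Xu) (es_Lr es Xw') (es_Lr es Xu)).
ring.
Qed.

Lemma dJfZ c u w : X u -> X w -> dJf u (fun x => c * w x) = c * dJf u w.
Proof.
move=> Xu Xw; rewrite /dJf (es_plZ es c Xu Xw).
by rewrite (cf_Z cf c (es_Lr es Xu) (es_Lr es Xu) (es_Lr es Xw) (es_Lr es Xw)) mulrBr.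
Qed.

Definition Kf u : R := dJf u u.

Lemma Kf_unif M (e : R) : 0 < e -> exists2 del : R, 0 < del & forall u u',
  X u -> nm u <= M -> X u' -> nm u' <= M -> nm (fun x => u x - u' x) <= del -> `|Kf u - Kf u'| <= e.
Proof.
move=> e0; pose M' := `|M| + 1; have M'0 : 0 < M' by rewrite ltr_wpDl.
have e1 : 0 < e / 2 / M' by rewrite !divr_gt0.
have [d1 d10 H1] := dJf_unif M e1; have [K K0 HK] := dJf_bound M.
have K1 : 0 < K + 1 by rewrite ltr_wpDl.
exists (Num.min d1 (e / 2 / (K + 1))); first by rewrite lt_min d10 !divr_gt0.
move=> u u' Xu uM Xu' uM'; rewrite le_min => /andP[du1 du2]; rewrite /Kf.
have scale w y c : X w -> X y -> nm w <= c -> 0 < c -> (forall z, X z -> nm z <= 1 -> `|dJf y z| <= K) ->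
   `|dJf y w| <= c * K.
  move=> Xw Xy wc c0 H; have := H (fun x => c^-1 * w x) (es_Z es _ Xw) _.
  rewrite (es_nZ es _ Xw) gtr0_norm ?invr_gt0// ler_pdivrMl// mulr1 => /(_ wc).
  by rewrite (dJfZ _ Xy Xw) normrM gtr0_norm ?invr_gt0// ler_pdivrMl.
have uM1 : nm u <= M' by apply: le_trans uM _; rewrite (le_trans (ler_norm M))// lerDl.
have Xd := es_B es Xu Xu'.
have E : dJf u u - dJf u' u' = (dJf u u - dJf u' u) + dJf u' (fun x => u x - u' x).
  have -> : dJf u' (fun x => u x - u' x) = dJf u' u - dJf u' u'.
    rewrite (_ : (fun x => u x - u' x) = fun x => u x + -1 * u' x); last by apply/funext => x; rewrite mulN1r.
    by rewrite (dJfD Xu' Xu (es_Z es (-1) Xu')) (dJfZ (-1) Xu' Xu') mulN1r.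
  ring.
rewrite E; apply: le_trans (ler_normD _ _) _; rewrite [e]splitr; apply: lerD.
  have Xs := es_Z es M'^-1 Xu.
  have s1 : nm (fun x => M'^-1 * u x) <= 1.
    by rewrite (es_nZ es _ Xu) gtr0_norm ?invr_gt0// ler_pdivrMl// mulr1.
  have := H1 u u' _ Xu uM Xu' uM' Xs s1 du1.
  rewrite (dJfZ _ Xu Xu) (dJfZ _ Xu' Xu) -mulrBr normrM gtr0_norm ?invr_gt0// ler_pdivrMl//.
  by rewrite mulrC divfK ?gt_eqF.
(* [nm] may vanish on a function that is not identically 0; dividing by the norm is then replaced by
   dividing by arbitrarily small radii. *)
have [n0|n0] := eqVneq (nm (fun x => u x - u' x)) 0.
  apply/ler_addgt0Pl => k k0; apply: (@le_trans _ _ (k / (K + 1) * K)).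
    by apply: (scale _ _ _ Xd Xu'); rewrite ?n0 ?ltW ?divr_gt0// => z Xz z1; exact: HK.
  rewrite mulrAC ler_pdivrMr//; apply: (@le_trans _ _ (k * (K + 1))).
    by rewrite ler_pM2l// lerDl.
  by rewrite ler_pM2r// lerDl divr_ge0// ltW.
have np : 0 < nm (fun x => u x - u' x) by rewrite lt_neqAle eq_sym n0 (es_ge0 es).
apply: (@le_trans _ _ (nm (fun x => u x - u' x) * K)).
  by apply: (scale _ _ _ Xd Xu') => // z Xz z1; exact: HK.
apply: (@le_trans _ _ (e / 2 / (K + 1) * (K + 1))); last by rewrite divfK ?gt_eqF.
by apply: ler_pM => //; rewrite ?lerDl ?(es_ge0 es).
Qed.

Hypothesis dpot_self_le : forall u, X u -> dpot u u <= theta * nm u `^ p + C * nm u `^ r.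

(** Since theta < 1, part of the p-th power of the norm is left to be balanced by its r-th power,
    and r > p. *)
Lemma nehari_lower : exists2 rho : R, 0 < rho & forall u, X u -> 0 < nm u -> Kf u <= 0 -> rho <= nm u.
Proof.
have /andP[th0 th1] := theta0; have C1 : 0 < C + 1 by rewrite ltr_wpDl.
have rp0 : 0 < r - p by rewrite subr_gt0.
pose k := (1 - theta) / (C + 1); have k0 : 0 < k by rewrite divr_gt0// subr_gt0.
exists (k `^ (r - p)^-1); first exact: powR_gt0.
move=> u Xu n0; rewrite /Kf /dJf (es_self es Xu) subr_le0 => /le_trans /(_ (dpot_self_le Xu)).
set n := nm u in n0 *; have np : 0 < n `^ p by exact: powR_gt0.
have -> : n `^ r = n `^ (r - p) * n `^ p by rewrite -powRD ?subrK// gt_eqF ?implybT.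
rewrite mulrA -mulrDl -[leLHS]mul1r ler_pM2r// => H.
have kn : k <= n `^ (r - p).
  rewrite /k ler_pdivrMr// mulrDr mulr1; have := powR_ge0 n (r - p); move: H.
  by move: (n `^ (r - p)) => b; rewrite mulrC; lra.
have -> : n = (n `^ (r - p)) `^ (r - p)^-1.
  by rewrite -powRrM divff ?gt_eqF// powRr1// ltW.
by apply: ler_powR_base => //; rewrite ?invr_ge0 ltW.
Qed.

Lemma dpot_self_0 u : X u -> nm u = 0 -> dpot u u <= 0.
Proof. by move=> Xu n0; have := dpot_self_le Xu; rewrite n0 !powR0 ?gt_eqF// !mulr0 addr0. Qed.

Hypothesis gpos : forall x a, D x -> 0 < a -> 0 < alpha * G x a <= a * g x a.
Hypothesis gneg : forall x a, D x -> a <= 0 -> G x a = 0 /\ g x a = 0.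
Hypothesis gfib : forall x a t, D x -> 0 < a -> 0 < t ->
  (t < 1 -> g x (t * a) * (t * a) < t `^ p * (g x a * a)) /\
  (1 < t -> t `^ p * (g x a * a) < g x (t * a) * (t * a)).
Hypothesis Gfib : forall x a t, D x -> 0 < a -> 0 < t -> t != 1 ->
  G x a + (t `^ p - 1) / p * (g x a * a) < G x (t * a).
Hypothesis Gsuper : forall x a t, D x -> 0 < a -> 1 <= t -> t `^ alpha * G x a <= G x (t * a).

Let Xt t u : X u -> X (fun x => t * u x). Proof. exact: (es_Z es). Qed.

Let int_pot u : X u -> m.-integrable D (EFin \o (fun x => G x (u x))).
Proof.
move=> Xu; have [mu iu] := es_Lr es Xu.
by have [] := nem_cvg mD Doo r0 r0 C0 nl (dom_cvg_cst mu iu) (dom_cvg_cst mu iu).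
Qed.

Let int_dpot u w : X u -> X w -> m.-integrable D (EFin \o (fun x => g x (u x) * w x)).
Proof.
move=> Xu Xw; have [mu iu] := es_Lr es Xu; have [mw iw] := es_Lr es Xw.
have [+ _] := dnem_cvg mD Doo r0 r0 C0 nl (dom_cvg_cst mu iu) (dom_cvg_cst mu iu) (dom_cvg_cst mw iw) (dom_cvg_cst mu iu).
by apply: eq_integrable => // x _ /=; rewrite mul0r addr0.
Qed.

(** An integral <= 0 would force f = 0, hence u <= 0, almost everywhere; but then the source pairing
    of u with itself vanishes. *)
Let integral_gt0 (f : F) u : X u -> 0 < dpot u u -> m.-integrable D (EFin \o f) ->
  (forall x, D x -> u x <= 0 -> f x = 0) -> (forall x, D x -> 0 < u x -> 0 < f x) ->
  0 < \int[m]_(x in D) f x.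
Proof.
move=> Xu du if_ f0 fp; rewrite ltNge; apply/negP => fle.
have fge x : D x -> 0 <= f x.
  by move=> Dx; have [/(f0 x Dx) ->//|/(fp x Dx)/ltW] := leP (u x) 0.
have H := Rintegral_le0_ae mD if_ (aeW m fge) fle.
move: du; rewrite ltNge => /negP; apply; rewrite /dpot.
rewrite (@Rintegral_ae_eq _ _ _ m D mD _ (cst 0)); first by rewrite /Rintegral integral0.
- by apply/measurable_EFinP; exact: measurable_int (int_dpot Xu Xu).
- exact: measurable_cst.
apply: filterS H => x Hx Dx /=; have [u0|u0] := leP (u x) 0.
  by rewrite (gneg Dx u0).2 mul0r.
by have := fp x Dx u0; rewrite (Hx Dx) ltxx.
Qed.

(** [Gfib] is integrated; [Kf u = 0] turns the integral of g u into the p-th power of the norm, so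
    the subtracted term is exactly the change of the principal part along the ray. *)
Lemma Jf_fiber u t : X u -> 0 < dpot u u -> Kf u = 0 -> 0 < t -> t != 1 -> Jf (fun x => t * u x) < Jf u.
Proof.
move=> Xu du Ku t0 t1.
have Xtu := Xt t Xu.
have iD := integrable_RB mD (integrable_RB mD (int_pot Xtu) (int_pot Xu))
   (integrable_RZ mD ((t `^ p - 1) / p) (int_dpot Xu Xu)).
have : 0 < \int[m]_(x in D) (G x (t * u x) - G x (u x) - (t `^ p - 1) / p * (g x (u x) * u x)).
  apply: integral_gt0 Xu du iD _ _ => x Dx ux.
    rewrite (gneg Dx ux).1 (gneg Dx ux).2 (gneg Dx (_ : t * u x <= 0)).1 ?pmulr_rle0//; ring.
  by rewrite -addrA -opprD subr_gt0; exact: Gfib.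
rewrite (RintegralB mD (integrable_RB mD (int_pot Xtu) (int_pot Xu)) (integrable_RZ mD _ (int_dpot Xu Xu))).
rewrite (RintegralB mD (int_pot Xtu) (int_pot Xu)) (RintegralZl _ mD (int_dpot Xu Xu)).
rewrite -/(pot _) -/(pot u) -/(dpot u u) /Jf (es_nZ es _ Xu) gtr0_norm// powRM ?(ltW t0) ?(es_ge0 es)//.
move: Ku; rewrite /Kf /dJf (es_self es Xu) => /eqP; rewrite subr_eq0 => /eqP ->.
move: (dpot u u) (pot u) (pot _) (t `^ p) => a b c k H.
have -> : k * a / p = a / p + (k - 1) / p * a by field; rewrite gt_eqF.
by move: H; lra.
Qed.

Lemma Kf_fiber u t : X u -> 0 < dpot u u -> Kf u = 0 -> 0 < t ->
  (t < 1 -> 0 < Kf (fun x => t * u x)) /\ (1 < t -> Kf (fun x => t * u x) < 0).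
Proof.
move=> Xu du Ku t0; have Xtu := Xt t Xu.
have KE : Kf (fun x => t * u x) = \int[m]_(x in D) (t `^ p * (g x (u x) * u x) - g x (t * u x) * (t * u x)).
  rewrite (RintegralB mD (integrable_RZ mD _ (int_dpot Xu Xu)) (int_dpot Xtu Xtu)).
  rewrite (RintegralZl _ mD (int_dpot Xu Xu)) -/(dpot u u) -/(dpot _ _).
  rewrite /Kf /dJf (es_self es Xtu) (es_nZ es _ Xu) gtr0_norm// powRM ?(ltW t0) ?(es_ge0 es)//.
  by move: Ku; rewrite /Kf /dJf (es_self es Xu) => /eqP; rewrite subr_eq0 => /eqP ->.
have z x : D x -> u x <= 0 -> g x (u x) * u x = 0 /\ g x (t * u x) * (t * u x) = 0.
  by move=> Dx ux; rewrite (gneg Dx ux).2 (gneg Dx (_ : t * u x <= 0)).2 ?pmulr_rle0// !mul0r.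
split => t1; rewrite KE.
  apply: (integral_gt0 Xu du (integrable_RB mD (integrable_RZ mD _ (int_dpot Xu Xu)) (int_dpot Xtu Xtu))) => x Dx ux.
    by have [-> ->] := z x Dx ux; rewrite mulr0 subr0.
  by rewrite subr_gt0; exact: (gfib Dx ux t0).1.
have i1 := integrable_RZ mD (t `^ p) (int_dpot Xu Xu); have i2 := int_dpot Xtu Xtu.
have iN := integrable_RB mD i2 i1.
rewrite -oppr_gt0 (RintegralB mD i1 i2) opprB -(RintegralB mD i2 i1).
apply: (integral_gt0 Xu du iN) => x Dx ux.
  by have [-> ->] := z x Dx ux; rewrite mulr0 subr0.
by rewrite subr_gt0; exact: (gfib Dx ux t0).2.
Qed.

Lemma Kf_root u (a b : R) : X u -> a <= b -> 0 <= Kf (fun x => a * u x) -> Kf (fun x => b * u x) <= 0 ->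
  exists2 t, a <= t <= b & Kf (fun x => t * u x) = 0.
Proof.
move=> Xu ab Ka Kb.
have ct : {within `[a, b], continuous (fun t => Kf (fun x => t * u x))}.
  apply: continuous_subspaceT => t; apply/cvgrPdist_le => e e0.
  have [del d0 Hd] := Kf_unif ((`|t| + 1) * nm u) e0.
  have n1 : 0 < nm u + 1 by rewrite ltr_wpDl// (es_ge0 es).
  have k0 : 0 < Num.min 1 (del / (nm u + 1)) by rewrite lt_min ltr01 divr_gt0.
  apply/nbhs_ballP; exists (Num.min 1 (del / (nm u + 1))) => //= t'; rewrite /ball/= lt_min.
  move=> /andP[/ltW t1 /ltW t2]; apply: Hd; [exact: Xt| |exact: Xt| |].
  - by rewrite (es_nZ es _ Xu) ler_wpM2r ?(es_ge0 es)// lerDl.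
  - rewrite (es_nZ es _ Xu) ler_wpM2r ?(es_ge0 es)// -lerBlDl.
    by apply: le_trans t1; rewrite distrC; exact: lerB_dist.
  - rewrite (_ : (fun x => _) = fun x => (t - t') * u x); last by apply/funext => x; rewrite mulrBl.
    rewrite (es_nZ es _ Xu); apply: (@le_trans _ _ (del / (nm u + 1) * (nm u + 1))).
      by apply: ler_pM => //; [exact: es_ge0 es _|rewrite lerDl].
    by rewrite divfK ?gt_eqF.
have [|t] := IVT ab ct (v := 0).
  rewrite ge_min le_max Ka Kb !orbT//.
by rewrite in_itv/= => ht Kt; exists t.
Qed.

Definition nehari (u : F) : Prop := [/\ X u, 0 < nm u & Kf u = 0].

Lemma nehari_dpot u : nehari u -> 0 < dpot u u.
Proof.
move=> [Xu n0]; rewrite /Kf /dJf (es_self es Xu) => /eqP; rewrite subr_eq0 => /eqP <-.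
exact: powR_gt0.
Qed.

(** The Ambrosetti-Rabinowitz condition with alpha > p: J is coercive on the Nehari set, so
    minimising sequences are bounded. *)
Lemma nehari_Jf u : nehari u -> (p^-1 - alpha^-1) * nm u `^ p <= Jf u.
Proof.
move=> [Xu n0 Ku]; rewrite /Jf mulrBl [_^-1 * _]mulrC lerD2l lerN2.
have a0 : 0 < alpha by exact: lt_trans palpha.
rewrite ler_pdivlMl//.
move: Ku; rewrite /Kf /dJf (es_self es Xu) => /eqP; rewrite subr_eq0 => /eqP ->.
rewrite /pot -(RintegralZl _ mD (int_pot Xu)); apply: (le_Rintegral mD) => //.
- exact: integrable_RZ mD _ _ (int_pot Xu).
- exact: int_dpot.
move=> x Dx; have [u0|u0] := leP (u x) 0.
  by rewrite (gneg Dx u0).1 (gneg Dx u0).2 mul0r mulr0.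
by have /andP[_] := gpos Dx u0; rewrite [_ * g _ _]mulrC.
Qed.

Lemma nehari_scale u : X u -> 0 < dpot u u -> Kf u <= 0 -> exists t, [/\ 0 < t, t <= 1 & nehari (fun x => t * u x)].
Proof.
move=> Xu du Ku; have [rho rho0 Hrho] := nehari_lower.
have n0 : 0 < nm u.
  rewrite lt_neqAle (es_ge0 es) andbT eq_sym; apply/eqP => n0.
  by have := dpot_self_0 Xu n0; rewrite leNgt du.
have ru := Hrho u Xu n0 Ku.
(* At norm rho / 2, below the bound of [nehari_lower], [Kf] cannot be negative: this is the left end
   for the intermediate value theorem. *)
pose a := rho / 2 / nm u; have a0 : 0 < a by rewrite !divr_gt0.
have a1 : a <= 1 by rewrite ler_pdivrMr// mul1r; apply: le_trans ru; move: rho0; lra.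
have na : nm (fun x => a * u x) = rho / 2.
  by rewrite (es_nZ es _ Xu) gtr0_norm// divfK ?gt_eqF.
have [||t /andP[at_ t1] Kt] := Kf_root Xu a1; last 1 first.
- have t0 : 0 < t by exact: lt_le_trans at_.
  exists t; split => //; split => //; first exact: Xt.
  by rewrite (es_nZ es _ Xu) mulr_gt0// normr_gt0 gt_eqF.
- rewrite leNgt; apply/negP => /ltW Ka.
  have := Hrho _ (Xt a Xu) _ Ka; rewrite na => H.
  have : rho <= rho / 2 by apply: H; rewrite divr_gt0.
  by move: rho0; lra.
- by rewrite (_ : (fun x => 1 * u x) = u)//; apply/funext => x; rewrite mul1r.
Qed.

Hypothesis Xpos : exists2 u, X u & ~ {ae m, forall x, D x -> u x <= 0}.

Lemma nehari_nonempty : exists u, nehari u.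
Proof.
have [u Xu un0] := Xpos; have a0 : 0 < alpha by exact: lt_trans palpha.
have pot0 : 0 < pot u.
  rewrite ltNge; apply/negP => ple; apply: un0.
  have Gge x : D x -> 0 <= G x (u x).
    move=> Dx; have [u0|u0] := leP (u x) 0; first by rewrite (gneg Dx u0).1.
    by have /andP[+ _] := gpos Dx u0; rewrite pmulr_rgt0// => /ltW.
  apply: filterS (Rintegral_le0_ae mD (int_pot Xu) (aeW m Gge) ple) => x Hx Dx.
  rewrite leNgt; apply/negP => u0; have /andP[+ _] := gpos Dx u0.
  by rewrite (Hx Dx) mulr0 ltxx.
have grow t : 1 <= t -> alpha * t `^ alpha * pot u <= dpot (fun x => t * u x) (fun x => t * u x).
  move=> t1; have t0 : 0 < t by exact: lt_le_trans t1.
  rewrite /pot -(RintegralZl _ mD (int_pot Xu)); apply: (le_Rintegral mD) => //.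
  - exact: integrable_RZ mD _ _ (int_pot Xu).
  - exact: int_dpot (Xt t Xu) (Xt t Xu).
  move=> x Dx; have [u0|u0] := leP (u x) 0.
    by rewrite (gneg Dx u0).1 mulr0 (gneg Dx (_ : t * u x <= 0)).2 ?pmulr_rle0// mul0r.
  have tu0 : 0 < t * u x by rewrite mulr_gt0.
  have /andP[_ H] := gpos Dx tu0; rewrite [leRHS]mulrC; apply: le_trans H.
  by rewrite -mulrA ler_pM2l//; exact: Gsuper.
have ap0 : 0 < alpha - p by rewrite subr_gt0.
pose k := nm u `^ p / (alpha * pot u).
have k0 : 0 <= k by rewrite divr_ge0 ?powR_ge0// mulr_ge0// ltW.
(* Then t^(alpha - p) >= k, which makes the source dominate the norm; the summand 1 ensures t >= 1
   for [grow]. *)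
pose t := 1 + k `^ (alpha - p)^-1.
have t1 : 1 <= t by rewrite lerDl powR_ge0.
have t0 : 0 < t by exact: lt_le_trans t1.
have Xtu := Xt t Xu.
have dt : 0 < dpot (fun x => t * u x) (fun x => t * u x).
  by apply: lt_le_trans (grow t t1); rewrite !mulr_gt0// powR_gt0.
have Kt : Kf (fun x => t * u x) <= 0.
  rewrite /Kf /dJf (es_self es Xtu) subr_le0; apply: le_trans (grow t t1).
  rewrite (es_nZ es _ Xu) gtr0_norm// powRM ?(ltW t0) ?(es_ge0 es)//.
  have -> : t `^ alpha = t `^ p * t `^ (alpha - p).
    by rewrite -powRD ?gt_eqF ?implybT// addrC subrK.
  rewrite [leRHS](_ : _ = t `^ p * (t `^ (alpha - p) * (alpha * pot u))); last by ring.
  rewrite ler_pM2l ?powR_gt0// -ler_pdivrMr ?mulr_gt0//.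
  rewrite -/k -[leLHS](powRr1 k0) -(mulVf (_ : alpha - p != 0)) ?gt_eqF// powRrM.
  by apply: ler_powR_base => //; rewrite ?powR_ge0 ?(ltW ap0)// lerDr.
by have [t' [_ _ H]] := nehari_scale Xtu dt Kt; exists (fun x => t' * (t * u x)).
Qed.

(** The norm is only lower semicontinuous, so the limit u of a minimising sequence may have
    [Kf u < 0]; it is brought back to the Nehari set by a factor t <= 1. No level is gained: each
    u_n maximises J on its ray, so J (t u_n) <= J (u_n), and in J (t u_n) the norm is replaced by
    the source term, which does converge. The limit is nontrivial because the source terms stay
    above rho^p. *)
Lemma nehari_minimizer : exists2 w, nehari w & forall u, nehari u -> Jf w <= Jf u.
Proof.
have ap0 : 0 < p^-1 - alpha^-1.
  by rewrite subr_gt0 ltf_pV2// posrE// (lt_trans p0 palpha).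
pose S := [set Jf u | u in nehari].
have S0 : S !=set0 by have [u Hu] := nehari_nonempty; exists (Jf u), u.
have Slb : lbound S 0.
  by move=> _ [u Hu <-]; apply: le_trans (nehari_Jf Hu); rewrite mulr_ge0 ?powR_ge0// ltW.
have hS : has_inf S by split => //; exists 0.
pose c := inf S.
have clb u : nehari u -> c <= Jf u by move=> Hu; apply: ge_inf; [exists 0|exists u].
have /choice[u_ Hu] : forall n : nat, exists u, nehari u /\ Jf u <= c + n.+1%:R^-1.
  move=> n; have n0 : 0 < n.+1%:R^-1 :> R by rewrite invr_gt0.
  by have [_ [u Hu <-] Hlt] := inf_adherent n0 hS; exists u; split => //; exact: ltW.
have Xu_ n : X (u_ n) by case: (Hu n) => -[].
have Ku_ n : nm (u_ n) `^ p = dpot (u_ n) (u_ n).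
  by have [[_ _]] := Hu n; rewrite /Kf /dJf (es_self es (Xu_ n)) => /eqP; rewrite subr_eq0 => /eqP.
pose M := ((c + 1) / (p^-1 - alpha^-1)) `^ p^-1.
have uM n : nm (u_ n) <= M.
  rewrite -[leLHS](powRr1 (es_ge0 es _)) -(divff (_ : p != 0)) ?gt_eqF// powRrM.
  apply: ler_powR_base; rewrite ?powR_ge0 ?invr_ge0 ?(ltW p0)//.
  rewrite ler_pdivlMr// mulrC; have [Hn Jn] := Hu n.
  apply: le_trans (nehari_Jf Hn) (le_trans Jn _); rewrite lerD2l.
  by rewrite invf_le1// ler1n.
have [psi [u [psige Lu]]] := es_compact es Xu_ uM.
have [Xu _ du] := es_lim es Lu.
have cS := cf_dcvg cf du du du du.
have [rho rho0 Hrho] := nehari_lower.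
have dl : rho `^ p <= dpot u u.
  have cv : cvgn (fun n => dpot (u_ (psi n)) (u_ (psi n))) by apply/cvg_ex; exists (dpot u u).
  rewrite -(cvg_lim _ cS)//; apply: limr_ge => //; apply: nearW => n.
  rewrite -Ku_; apply: ler_powR_base; [exact: ltW|exact: ltW|].
  by have [[Xn n0 Kn] _] := Hu (psi n); apply: Hrho => //; rewrite Kn.
have dpos : 0 < dpot u u by apply: lt_le_trans dl; exact: powR_gt0.
have nle : nm u `^ p <= dpot u u.
  apply/ler_addgt0Pl => e e0; have [k Hk] := cvg_dist cS e0.
  have psik n : (n <= n + k)%N by exact: leq_addr.
  have E0 : 0 <= e + dpot u u by rewrite addr_ge0// ltW.
  have H : nm u <= (e + dpot u u) `^ p^-1.
    apply: (es_lsc es (fun n => Xu_ _) (es_sub es psik Lu)) => n.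
    rewrite -[leLHS](powRr1 (es_ge0 es _)) -(divff (_ : p != 0)) ?gt_eqF// powRrM.
    apply: ler_powR_base; rewrite ?powR_ge0 ?invr_ge0 ?(ltW p0)// Ku_.
    have := Hk (n + k)%N (leq_addl _ _); rewrite ler_norml => /andP[+ _].
    by move: (dpot _ _) (dpot _ _) => a b; lra.
  apply: le_trans (ler_powR_base (ltW p0) (es_ge0 es _) H) _.
  by rewrite -powRrM mulVf ?gt_eqF// powRr1.
have Ku : Kf u <= 0 by rewrite /Kf /dJf (es_self es Xu) subr_le0.
have [t [t0 t1 Hw]] := nehari_scale Xu dpos Ku.
exists (fun x => t * u x) => // v Hv; apply: le_trans (clb v Hv).
have t1' (n : nat) : `|t| <= 1 by rewrite gtr0_norm.
have ct : (fun=> t) n @[n --> \oo] --> t by exact: cvg_cst.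
have dtu := dom_cvg_scale r0 t1' ct du.
have cP := cf_cvg cf dtu dtu.
have cJ : t `^ p / p * dpot (u_ (psi n)) (u_ (psi n)) - pot (fun x => t * u_ (psi n) x) @[n --> \oo] -->
    t `^ p / p * dpot u u - pot (fun x => t * u x).
  by apply: cvgB => //; apply: cvgMr.
have Jt n : t `^ p / p * dpot (u_ (psi n)) (u_ (psi n)) - pot (fun x => t * u_ (psi n) x) <=
    c + n.+1%:R^-1.
  have [Hn Jn] := Hu (psi n); have [Xn n0 Kn] := Hn.
  have -> : t `^ p / p * dpot (u_ (psi n)) (u_ (psi n)) - pot (fun x => t * u_ (psi n) x) =
      Jf (fun x => t * u_ (psi n) x).
    rewrite /Jf (es_nZ es _ Xn) gtr0_norm// powRM ?(ltW t0) ?(es_ge0 es)// Ku_.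
    by congr (_ - _); rewrite mulrAC.
  have le1 : Jf (fun x => t * u_ (psi n) x) <= Jf (u_ (psi n)).
    have [->|tn1] := eqVneq t 1; last by apply/ltW/Jf_fiber => //; exact: nehari_dpot.
    by rewrite (_ : (fun x => 1 * u_ (psi n) x) = u_ (psi n))//; apply/funext => x; rewrite mul1r.
  apply: le_trans le1 (le_trans Jn _); rewrite lerD2l lef_pV2 ?posrE// ler_nat ltnS.
  exact: psige.
apply: (@le_trans _ _ (t `^ p / p * dpot u u - pot (fun x => t * u x))).
  rewrite /Jf lerD2r (es_nZ es _ Xu) gtr0_norm// powRM ?(ltW t0) ?(es_ge0 es)// mulrAC.
  by apply: ler_wpM2l => //; rewrite divr_ge0 ?powR_ge0// ltW.
rewrite -[leRHS]addr0; apply: ler_cvg_to cJ (cvgD (cvg_cst c) cvg_harmonic) _.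
by apply: nearW => n; exact: Jt.
Qed.

(** Suppose J decreases at w in the direction psi and put v = w + eps psi. [Kf] changes sign between
    (1 - del) w and (1 + del) w, hence between the same multiples of v, so some t v with t near 1 is
    in the Nehari set. By Taylor, J (t v) < J (t w) <= J w, against minimality. *)
Lemma nehari_critical w : nehari w -> (forall u, nehari u -> Jf w <= Jf u) -> forall phi, X phi -> dJf w phi = 0.
Proof.
move=> Hw wmin phi Xphi; have [Xw nw Kw] := Hw; have dw := nehari_dpot Hw.
suff neg psi : X psi -> nm psi <= 1 -> dJf w psi < 0 -> False.
  have scaled psi : X psi -> dJf w psi < 0 -> False.
    move=> Xpsi dpsi; have c0 : 0 < nm psi + 1 by rewrite ltr_wpDl// (es_ge0 es).
    apply: (neg (fun x => (nm psi + 1)^-1 * psi x)); first exact: Xt.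
      by rewrite (es_nZ es _ Xpsi) gtr0_norm ?invr_gt0// ler_pdivrMl// mulr1 lerDl.
    by rewrite (dJfZ _ Xw Xpsi) pmulr_rlt0// invr_gt0.
  apply/eqP; rewrite eq_le; apply/andP; split; rewrite leNgt; apply/negP => H.
    by apply: (scaled (fun x => -1 * phi x)) (Xt _ Xphi) _; rewrite (dJfZ _ Xw Xphi) mulN1r oppr_lt0.
  exact: scaled Xphi H.
move=> Xpsi psi1 dneg; pose eta := - dJf w psi; have eta0 : 0 < eta by rewrite oppr_gt0.
pose M := 2 * nm w + 2.
have wM : nm w <= M := radius_self nw.
have eta2 : 0 < eta / 2 by rewrite divr_gt0.
have eta4 : 0 < eta / 4 by rewrite divr_gt0.
have [d1 d10 H1] := dJf_unif M eta2; have [d3 d30 H3] := Jf_taylor M eta4.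
pose del := Num.min 2^-1 (d1 / nm w).
have del0 : 0 < del by rewrite lt_min invr_gt0 ltr0n divr_gt0.
have del1 : del <= 2^-1 by rewrite ge_min lexx.
have deld : del * nm w <= d1 by rewrite -ler_pdivlMr// ge_min lexx orbT.
have [tl0 ab tl1 tr1] := half_interval del0 del1.
have [/(_ _)K1 _] := Kf_fiber Xw dw Kw tl0.
have tr0 : 0 < 1 + del by rewrite addr_gt0.
have [_ /(_ _)K2] := Kf_fiber Xw dw Kw tr0.
have {}K1 : 0 < Kf (fun x => (1 - del) * w x) by apply: K1; rewrite gtrBl.
have {}K2 : Kf (fun x => (1 + del) * w x) < 0 by apply: K2; rewrite ltrDl.
pose e := Num.min (Kf (fun x => (1 - del) * w x)) (- Kf (fun x => (1 + del) * w x)).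
have e0 : 0 < e by rewrite lt_min K1 oppr_gt0.
have [d2 d20 H2] := Kf_unif M e0.
(* The four bounds keep t v in the ball of radius M, the norm of v positive, t v within the modulus
   [d2] of [Kf], and t eps within the Taylor range [d3], all for t <= 3/2. *)
pose eps := Num.min (Num.min (1 / 2) (nm w / 2)) (Num.min (d2 / 2) (d3 / 2)).
have eps0 : 0 < eps by rewrite !lt_min !divr_gt0.
have [eps1 eps2] : eps <= 1 / 2 /\ eps <= nm w / 2 by split; rewrite !ge_min lexx ?orbT.
have [eps3 eps4] : eps <= d2 / 2 /\ eps <= d3 / 2 by split; rewrite !ge_min lexx ?orbT.
pose v x := w x + eps * psi x.
have Xv : X v by apply: (es_D es) => //; exact: Xt.
have nepsi t : 0 <= t -> t <= 3 / 2 -> nm (fun x => (t * eps) * psi x) <= 3 / 2 * eps.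
  move=> t0 t2; rewrite (es_nZ es _ Xpsi) ger0_norm; last by rewrite mulr_ge0// ltW.
  apply: (@le_trans _ _ (t * eps)); first by rewrite ler_piMr// mulr_ge0// ltW.
  by rewrite ler_pM2r.
have tvE t : (fun x => t * v x) = fun x => t * w x + (t * eps) * psi x.
  by apply/funext => x; rewrite /v; ring.
have nt t : 0 <= t -> t <= 3 / 2 -> nm (fun x => t * w x) <= M - 3 / 2 * eps.
  move=> t0 t2; rewrite (es_nZ es _ Xw) ger0_norm//.
  apply: (@le_trans _ _ (3 / 2 * nm w)); first by rewrite ler_pM2r.
  exact: radius_bound.
have ntv t : 0 <= t -> t <= 3 / 2 -> nm (fun x => t * v x) <= M.
  move=> t0 t2; rewrite tvE; apply: le_trans (es_nD es (Xt _ Xw) (Xt _ Xpsi)) _.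
  by apply: le_trans (lerD (nt t t0 t2) (nepsi t t0 t2)) _; rewrite subrK.
have Kdist t : 0 <= t -> t <= 3 / 2 -> `|Kf (fun x => t * v x) - Kf (fun x => t * w x)| <= e.
  move=> t0 t2; apply: H2; [exact: Xt|exact: ntv|exact: Xt| |].
    by apply: le_trans (nt t t0 t2) _; rewrite gerBl mulr_ge0// ltW.
  rewrite (_ : (fun x => _) = fun x => (t * eps) * psi x); last by apply/funext => x; rewrite /v; ring.
  exact: le_trans (nepsi t t0 t2) (step_bound d20 eps3).
have [||t /andP[tl tr] Kt] := Kf_root Xv ab.
- have := Kdist (1 - del) (ltW tl0) tl1; rewrite ler_norml => /andP[+ _].
  have : e <= Kf (fun x => (1 - del) * w x) by rewrite ge_min lexx.
  exact: sign_lower.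
- have := Kdist (1 + del) (ltW tr0) tr1; rewrite ler_norml => /andP[_].
  have : e <= - Kf (fun x => (1 + del) * w x) by rewrite ge_min lexx orbT.
  exact: sign_upper.
have t0 : 0 < t by exact: lt_le_trans tl.
have t2 : t <= 3 / 2 := le_trans tr tr1.
have Htv : nehari (fun x => t * v x).
  split => //; first exact: Xt.
  rewrite (es_nZ es _ Xv) gtr0_norm// mulr_gt0//.
  have wE : (fun x => v x - eps * psi x) = w by apply/funext => x; rewrite /v addrK.
  have := es_nB es Xv (Xt eps Xpsi); rewrite wE (es_nZ es _ Xpsi) gtr0_norm//.
  have : eps * nm psi <= eps by rewrite ler_piMr// ltW.
  exact: perturbed_gt0 nw eps2.
have le1 : Jf w <= Jf (fun x => t * v x) by exact: wmin.
have le2 : Jf (fun x => t * w x) <= Jf w.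
  have [->|tn1] := eqVneq t 1; last by apply/ltW/Jf_fiber.
  by rewrite (_ : (fun x => 1 * w x) = w)//; apply/funext => x; rewrite mul1r.
have te0 : 0 < t * eps by rewrite mulr_gt0.
have ted : t * eps <= d3.
  by apply: le_trans (step_bound d30 eps4); rewrite ler_pM2r.
have ntw : nm (fun x => t * w x) <= M.
  by apply: le_trans (nt t (ltW t0) t2) _; rewrite gerBl mulr_ge0// ltW.
have := H3 _ psi (t * eps) (Xt t Xw) ntw Xpsi psi1 te0 ted; rewrite -tvE.
have : `|dJf (fun x => t * w x) psi - dJf w psi| <= eta / 2.
  apply: H1 => //; first exact: Xt.
  rewrite (_ : (fun x => _) = fun x => (t - 1) * w x); last by apply/funext => x; ring.
  rewrite (es_nZ es _ Xw); apply: le_trans deld; rewrite ler_pM2r// ler_norml.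
  exact: ler_dist1 tl tr.
rewrite ler_norml => /andP[_ ds].
have ds' : dJf (fun x => t * w x) psi <= - (eta / 2) by exact: half_slope ds.
have dq : t * eps * dJf (fun x => t * w x) psi <= t * eps * - (eta / 2) by rewrite ler_pM2l.
exact: taylor_contra (mulr_gt0 te0 eta0) dq le1 le2.
Qed.

End nehari.

(** * Critical point near a pair of ground states *)

Section gap_estimates.
Context {R : realFieldType}.
Implicit Types (a b c e k r x y : R).

Lemma gap_first c k x y : 0 <= y -> 2 * k <= x -> c - x - y <= c - 2 * k. Proof. by move=> *; lra. Qed.

Lemma gap_both c x y : 0 <= x -> 0 <= y -> c - x - y <= c. Proof. by move=> *; lra. Qed.

Lemma near_gt0 r x a b : r < x -> x <= a + b -> b <= r -> 0 < a. Proof. by move=> *; lra. Qed.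

Lemma addr_le_both r a b : 0 <= a -> 0 <= b -> a + b <= r -> a <= r /\ b <= r. Proof. by move=> *; lra. Qed.

Lemma level_contra a y e k : a - e <= y -> y <= a + e - k / 2 -> e < k / 4 -> False. Proof. by move=> *; lra. Qed.

Lemma lerDB a b e a' b' e' : a' <= a -> b' <= b -> e <= e' -> a' + b' - e' <= a + b - e. Proof. by move=> *; lra. Qed.

End gap_estimates.

Section two_ground_states.
Context d (T : measurableType d) (R : realType).
Variables (m : {measure set T -> \bar R}) (D : set T).
Hypotheses (mD : measurable D) (Doo : (m D < +oo)%E).
Local Notation F := (T -> R).

Lemma compact_functionall (r r' : R) P S : compact_functional m D r r (fun u _ => P u) (fun u _ w _ => S u w) ->
  compact_functional m D r r' (fun u _ => P u) (fun u _ w _ => S u w).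
Proof.
move=> H; split.
- by move=> u_ u v_ v du _; exact: (cf_cvg H du du).
- by move=> u_ u v_ v w_ w z_ z du _ dw _; exact: (cf_dcvg H du du dw dw).
- by move=> u_ u v_ v w_ w z_ z t_ du _ dw _; exact: (cf_taylor H du du dw dw).
- by move=> u v w z w' z' du _ dw _ dw' _; exact: (cf_D H du du dw dw dw' dw').
- by move=> u v w z c du _ dw _; exact: (cf_Z H c du du dw dw).
Qed.

Lemma compact_functionalr (r r' : R) P S : compact_functional m D r r (fun u _ => P u) (fun u _ w _ => S u w) ->
  compact_functional m D r' r (fun _ u => P u) (fun _ u _ w => S u w).
Proof.
move=> H; split.
- by move=> u_ u v_ v _ du; exact: (cf_cvg H du du).
- by move=> u_ u v_ v w_ w z_ z _ du _ dw; exact: (cf_dcvg H du du dw dw).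
- by move=> u_ u v_ v w_ w z_ z t_ _ du _ dw; exact: (cf_taylor H du du dw dw).
- by move=> u v w z w' z' _ du _ dw _ dw'; exact: (cf_D H du du dw dw dw' dw').
- by move=> u v w z c _ du _ dw; exact: (cf_Z H c du du dw dw).
Qed.

(** What the deformation argument needs from each w_i. As [rad] is below its norm, the ball of
    radius [rad] around it avoids elements of norm 0, so zeros of the Nehari functional found there
    can be compared through [gs_min]. *)
Record ground_state (p : R) (X : set F) (nm : F -> R) (pl : F -> F -> R) (P : F -> R)
    (S : F -> F -> R) (w : F) (rad : R) : Prop := {
  gs_X : X w;
  gs_pos : rad < nm w;
  gs_min : forall u, X u -> 0 < nm u -> pl u u - S u u = 0 ->
    nm w `^ p / p - P w <= nm u `^ p / p - P u;
  gs_fiber : forall t, 0 < t -> t != 1 ->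
    nm (fun x => t * w x) `^ p / p - P (fun x => t * w x) < nm w `^ p / p - P w;
  gs_slope : forall t, 0 < t ->
    (t < 1 -> 0 < pl (fun x => t * w x) (fun x => t * w x) - S (fun x => t * w x) (fun x => t * w x)) /\
    (1 < t -> pl (fun x => t * w x) (fun x => t * w x) - S (fun x => t * w x) (fun x => t * w x) < 0);
  gs_unif : forall M e, 0 < e -> exists2 del : R, 0 < del & forall u u',
    X u -> nm u <= M -> X u' -> nm u' <= M -> nm (fun x => u x - u' x) <= del ->
    `|(pl u u - S u u) - (pl u' u' - S u' u')| <= e;
  gs_isolated : forall u, X u -> nm (fun x => u x - w x) <= rad -> (forall phi, X phi -> pl u phi - S u phi = 0) ->
    nm (fun x => u x - w x) = 0
}.

Variables (p1 r1 p2 r2 : R) (X1 X2 : set F) (n1 n2 : F -> R) (pl1 pl2 : F -> F -> R).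
Variables (Lim1 Lim2 : R -> (nat -> F) -> F -> Prop).
Hypotheses (A1 : energy_space m D p1 r1 X1 n1 pl1 Lim1) (A2 : energy_space m D p2 r2 X2 n2 pl2 Lim2).
Variables (P1 P2 : F -> R) (S1 S2 : F -> F -> R) (w1 w2 : F) (rad : R).
Hypothesis (cf1 : compact_functional m D r1 r1 (fun u _ => P1 u) (fun u _ w _ => S1 u w)).
Hypothesis (cf2 : compact_functional m D r2 r2 (fun u _ => P2 u) (fun u _ w _ => S2 u w)).
Hypotheses (gs1 : ground_state p1 X1 n1 pl1 P1 S1 w1 rad) (gs2 : ground_state p2 X2 n2 pl2 P2 S2 w2 rad).
Hypothesis rad0 : 0 < rad.
Variables (Nc : F -> F -> R) (DNc : F -> F -> F -> F -> R).
Hypothesis cfc : compact_functional m D r1 r2 Nc DNc.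

Let Nf lam u v := P1 u + 1 * P2 v + lam * Nc u v.
Let DNf lam u v w z := S1 u w + 1 * S2 v z + lam * DNc u v w z.

Let cf lam : compact_functional m D r1 r2 (Nf lam) (DNf lam).
Proof.
have H := compact_functionalD 1 (compact_functionall r2 cf1) (compact_functionalr r1 cf2).
exact (compact_functionalD lam H cfc).
Qed.

Let I lam := func p1 p2 n1 n2 (Nf lam).
Let dI lam := dfunc pl1 pl2 (DNf lam).

Let M := n1 w1 + n2 w2 + rad.

Let Bw u v := [/\ X1 u, X2 v & n1 (fun x => u x - w1 x) + n2 (fun x => v x - w2 x) <= rad].

Let B_ball u v : Bw u v -> in_ball X1 X2 n1 n2 M u v.
Proof.
move=> [Xu Xv uv]; have X1w := gs_X gs1; have X2w := gs_X gs2.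
have h1 := es_nD A1 (es_B A1 Xu X1w) X1w; have h2 := es_nD A2 (es_B A2 Xv X2w) X2w.
have E (a b : F) : (fun x => a x - b x + b x) = a by apply/funext => x; rewrite subrK.
rewrite !E in h1 h2; have := es_ge0 A1 (fun x => u x - w1 x); have := es_ge0 A2 (fun x => v x - w2 x).
have := es_ge0 A1 w1; have := es_ge0 A2 w2.
by move=> *; split => //; rewrite /M; lra.
Qed.

(** Without a uniform rate on Q, points of Q with derivative tending to 0 form a Palais-Smale
    sequence, and its limit is a critical point approximated from Q. *)
Let rate_or_critical lam (Q : F -> F -> Prop) :
  (exists2 eta : R, 0 < eta & forall u v, Bw u v -> Q u v -> exists w z,
     [/\ X1 w, X2 z, n1 w + n2 z <= 1 & dI lam u v w z <= - eta]) \/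
  (exists u v, [/\ Bw u v, forall w z, X1 w -> X2 z -> dI lam u v w z = 0 &
     forall e : R, 0 < e -> exists u' v', [/\ Bw u' v', Q u' v',
       n1 (fun x => u' x - u x) <= e & n2 (fun x => v' x - v x) <= e]]).
Proof.
apply: contrapT => /not_orP[nE nC]; apply: nC.
have /choice[f Hf] : forall n : nat, exists q : F * F, [/\ Bw q.1 q.2, Q q.1 q.2 &
    forall w z, X1 w -> X2 z -> n1 w + n2 z <= 1 -> - (n.+1%:R^-1 / 2) < dI lam q.1 q.2 w z].
  move=> n; apply: contrapT => nq; apply: nE; exists (n.+1%:R^-1 / 2); first by rewrite divr_gt0// invr_gt0.
  move=> u v Buv Quv; apply: contrapT => nwz; apply: nq; exists (u, v); split => // w z Xw Xz wz.
  by rewrite ltNge; apply/negP => H; apply: nwz; exists w, z.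
have XB n : X1 (f n).1 /\ X2 (f n).2 by have [[]] := Hf n.
have [||u [v [[Xu Xv _ _] D0 lim]]] := @palais_smale _ _ _ m D mD p1 r1 p2 r2 X1 X2 n1 n2 pl1 pl2 Lim1 Lim2
   A1 A2 _ _ (cf lam) M (fun n => (f n).1) (fun n => (f n).2).
- by move=> n; apply: B_ball; case: (Hf n).
(* A pair with both norms at most 1 has sum at most 2; halving it explains the factor 1/2 in the
   choice of f. *)
- have half n w z : in_ball X1 X2 n1 n2 1 w z -> - n.+1%:R^-1 <= dI lam (f n).1 (f n).2 w z.
    move=> [Xw Xz w1' z1']; have [_ _ H] := Hf n; have [Xf1 Xf2] := XB n.
    have := H _ _ (es_Z A1 2^-1 Xw) (es_Z A2 2^-1 Xz).
    rewrite (es_nZ A1 _ Xw) (es_nZ A2 _ Xz) gtr0_norm ?invr_gt0//.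
    rewrite /dI (dfuncZ A1 A2 (cf lam) _ Xf1 Xf2 Xw Xz) => H'.
    have /H' : 2^-1 * n1 w + 2^-1 * n2 z <= 1 by lra.
    by move: (dfunc _ _ _ _ _ _ _) (n.+1%:R^-1) => a b; lra.
  move=> n w z wz; rewrite ler_norml; apply/andP; split; first exact: half.
  rewrite -lerN2.
  have [Xw Xz w1' z1'] := wz; have [Xf1 Xf2] := XB n.
  have := half n (fun x => -1 * w x) (fun x => -1 * z x).
  rewrite /dI (dfuncZ A1 A2 (cf lam) _ Xf1 Xf2 Xw Xz) mulN1r; apply; split.
  + exact: es_Z A1 _ _ Xw.
  + exact: es_Z A2 _ _ Xz.
  + by rewrite (es_nZ A1 _ Xw) normrN1 mul1r.
  + by rewrite (es_nZ A2 _ Xz) normrN1 mul1r.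
exists u, v; split => //; last first.
  by move=> e e0; have [n [h1 h2]] := lim e e0; have [? ? _] := Hf n; exists (f n).1, (f n).2.
split => //; apply/ler_addgt0Pl => e e0; have e2 : 0 < e / 2 by rewrite divr_gt0.
have [n [h1 h2]] := lim _ e2; have [[Xf1 Xf2 hB] _ _] := Hf n.
have tri X nm p r pl Lim (a b c : F) : energy_space m D p r X nm pl Lim -> X a -> X b -> X c ->
    nm (fun x => a x - c x) <= nm (fun x => b x - a x) + nm (fun x => b x - c x).
  move=> A Xa Xb Xc; have := es_nB A (es_B A Xb Xc) (es_B A Xb Xa).
  rewrite (_ : (fun x => _) = fun x => a x - c x); last by apply/funext => x; ring.
  by rewrite addrC.
have := tri _ _ _ _ _ _ _ _ _ A1 Xu Xf1 (gs_X gs1); have := tri _ _ _ _ _ _ _ _ _ A2 Xv Xf2 (gs_X gs2).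
move: h1 h2 hB; lra.
Qed.

Let dI_split lam u v w z : dI lam u v w z = dI 0 u v w z - lam * DNc u v w z.
Proof. by rewrite /dI /dfunc /DNf; ring. Qed.

Let J1 u := n1 u `^ p1 / p1 - P1 u.
Let J2 u := n2 u `^ p2 / p2 - P2 u.

Let I_split lam u v : I lam u v = J1 u + J2 v - lam * Nc u v.
Proof. by rewrite /I /func /Nf /J1 /J2; ring. Qed.

(** For lambda = 0 the system decouples, so by isolation a critical pair in the ball is at distance
    0 from (w1, w2) and is not a limit of points at distance at least rad / 4. The rate obtained for
    lambda = 0 loses at most half when lambda times the bound on [DNc] is small. *)
Let annulus_rate : exists2 eta0 : R, 0 < eta0 & exists2 L0 : R, 0 < L0 & forall lam, 0 < lam -> lam <= L0 ->
  forall u v, Bw u v -> rad / 4 <= n1 (fun x => u x - w1 x) + n2 (fun x => v x - w2 x) -> exists w z,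
     [/\ X1 w, X2 z, n1 w + n2 z <= 1 & dI lam u v w z <= - eta0].
Proof.
have [[eta eta0 H]|[u [v [[Xu Xv uv] crit lim]]]] := rate_or_critical 0
    (fun u v => rad / 4 <= n1 (fun x => u x - w1 x) + n2 (fun x => v x - w2 x)); last first.
  have L1 u' : X1 u' -> Lr m D r1 u' by exact: es_Lr A1 _.
  have L2 u' : X2 u' -> Lr m D r2 u' by exact: es_Lr A2 _.
  have S20 : S2 v (cst 0) = 0.
    have E : cst 0 = (fun x => 0 * cst 0 x) :> F by apply/funext => x; rewrite mul0r.
    by rewrite E (cf_Z cf2 0 (L2 _ Xv) (L2 _ Xv) (L2 _ (es_0 A2)) (L2 _ (es_0 A2))) mul0r.
  have S10 : S1 u (cst 0) = 0.
    have E : cst 0 = (fun x => 0 * cst 0 x) :> F by apply/funext => x; rewrite mul0r.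
    by rewrite E (cf_Z cf1 0 (L1 _ Xu) (L1 _ Xu) (L1 _ (es_0 A1)) (L1 _ (es_0 A1))) mul0r.
  have g1 := es_ge0 A1 (fun x => u x - w1 x); have g2 := es_ge0 A2 (fun x => v x - w2 x).
  have u0 : n1 (fun x => u x - w1 x) = 0.
    apply: (gs_isolated gs1 Xu); first by lra.
    move=> phi Xphi; have := crit _ _ Xphi (es_0 A2).
    by rewrite /dI /dfunc /DNf (es_pl0 A2 Xv) S20 mul0r mulr0 !addr0.
  have v0 : n2 (fun x => v x - w2 x) = 0.
    apply: (gs_isolated gs2 Xv); first by lra.
    move=> phi Xphi; have := crit _ _ (es_0 A1) Xphi.
    by rewrite /dI /dfunc /DNf (es_pl0 A1 Xu) S10 mul0r mul1r add0r addr0 add0r.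
  have e0 : 0 < rad / 16 by rewrite divr_gt0.
  have [u' [v' [[Xu' Xv' _] Q d1 d2]]] := lim _ e0.
  have tri X nm p r pl Lim (a b c : F) : energy_space m D p r X nm pl Lim -> X a -> X b -> X c ->
      nm (fun x => a x - c x) <= nm (fun x => a x - b x) + nm (fun x => b x - c x).
    move=> A Xa Xb Xc; have := es_nD A (es_B A Xa Xb) (es_B A Xb Xc).
    by rewrite (_ : (fun x => _) = fun x => a x - c x)//; apply/funext => x; ring.
  have t1 := tri _ _ _ _ _ _ _ _ _ A1 Xu' Xu (gs_X gs1); have t2 := tri _ _ _ _ _ _ _ _ _ A2 Xv' Xv (gs_X gs2).
  by exfalso; move: t1 t2; move: Q d1 d2 u0 v0 rad0; lra.
have [K K0 HK] := cf_bound A1 A2 cfc M.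
have ar (a b x : R) lam : 0 < lam -> lam <= eta / (2 * (K + 1)) -> `|x| <= K -> a <= - eta -> a - lam * x <= - (eta / 2).
  move=> l0 lL xK ae; have : lam * - x <= eta / 2.
    apply: (@le_trans _ _ (lam * (K + 1))).
      by rewrite ler_pM2l//; move: xK; rewrite ler_norml => /andP[? _]; lra.
    rewrite -ler_pdivlMr; last by lra.
    by apply: le_trans lL _; rewrite invfM mulrA.
  by rewrite mulrN; lra.
exists (eta / 2); first by rewrite divr_gt0.
exists (eta / (2 * (K + 1))); first by rewrite divr_gt0// mulr_gt0//; lra.
move=> lam lam0 lamL u v Buv Q; have [w [z [Xw Xz wz1 D0]]] := H u v Buv Q.
exists w, z; split => //; rewrite dI_split; apply: (ar) => //.
have w0 := es_ge0 A1 w; have z0 := es_ge0 A2 z.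
have wz : in_ball X1 X2 n1 n2 1 w z by split => //; lra.
by have [] := HK _ _ _ _ (B_ball Buv) wz.
Qed.

Let E : lmodType R := ((T -> R^o) * (T -> R^o))%type.
Let nrm (x : E) := n1 x.1 + n2 x.2.
Let XE : set E := [set x : E | X1 x.1 /\ X2 x.2].
Let IE lam (x : E) := I lam x.1 x.2.
Let DE lam (x h : E) := dI lam x.1 x.2 h.1 h.2.
Let x0 : E := (w1, w2).
Let BE x := XE x /\ nrm (x - x0) <= rad.

Let BE_ball x : BE x -> in_ball X1 X2 n1 n2 M x.1 x.2.
Proof. by move=> [[X1x X2x] xr]; apply: B_ball. Qed.

Let nrm_ball h : XE h -> nrm h <= 1 -> in_ball X1 X2 n1 n2 1 h.1 h.2.
Proof. by move=> [? ?] h1; have := es_ge0 A1 h.1; have := es_ge0 A2 h.2; move: h1; rewrite /nrm => *; split => //; lra. Qed.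

Let nrm_ge0 x : 0 <= nrm x. Proof. exact: addr_ge0 (es_ge0 A1 _) (es_ge0 A2 _). Qed.

Let XED x y : XE x -> XE y -> XE (x + y).
Proof. by move=> [? ?] [? ?]; split; [exact: (es_D A1)|exact: (es_D A2)]. Qed.

Let XEZ a x : XE x -> XE (a *: x).
Proof. by move=> [? ?]; split; [exact: (es_Z A1)|exact: (es_Z A2)]. Qed.

Let XEB x y : XE x -> XE y -> XE (x - y).
Proof. by move=> Xx Xy; rewrite -scaleN1r; apply: XED => //; exact: XEZ. Qed.

Let nrmD x y : XE x -> XE y -> nrm (x + y) <= nrm x + nrm y.
Proof. by move=> [? ?] [? ?]; rewrite /nrm addrACA; apply: lerD; [exact: (es_nD A1)|exact: (es_nD A2)]. Qed.

Let nrmZ a x : XE x -> nrm (a *: x) = `|a| * nrm x.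
Proof. by move=> [Xx Xy]; rewrite /nrm mulrDr -(es_nZ A1 a Xx) -(es_nZ A2 a Xy). Qed.

Let nrmBC x y : XE x -> XE y -> nrm (x - y) = nrm (y - x).
Proof. by move=> Xx Xy; rewrite -(opprB y x) -(scaleN1r (y - x)) nrmZ ?normrN1 ?mul1r//; exact: XEB. Qed.

Let DED lam x h k : XE x -> XE h -> XE k -> DE lam x (h + k) = DE lam x h + DE lam x k.
Proof. by move=> [? ?] [? ?] [? ?]; exact: (dfuncD A1 A2 (cf lam)). Qed.

Let DEZ lam x a h : XE x -> XE h -> DE lam x (a *: h) = a * DE lam x h.
Proof. by move=> [? ?] [? ?]; exact: (dfuncZ A1 A2 (cf lam)). Qed.

Let IE_taylor lam e : 0 < e -> exists2 d, 0 < d &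
  forall x h, BE x -> XE h -> nrm h <= d -> IE lam (x + h) <= IE lam x + DE lam x h + e * nrm h.
Proof.
move=> e0; have [d' d0 H] := func_taylor A1 A2 (cf lam) M e0; exists d' => // x h Bx Xh hd.
have Ht t : 0 < t -> nrm h <= t -> t <= d' -> IE lam (x + h) <= IE lam x + DE lam x h + e * t.
  move=> t0 ht td; have Xh' := XEZ t^-1 Xh.
  have nh' : nrm (t^-1 *: h) <= 1 by rewrite nrmZ// gtr0_norm ?invr_gt0// ler_pdivrMl// mulr1.
  have := H _ _ _ _ t (BE_ball Bx) (nrm_ball Xh' nh') t0 td.
  rewrite -[dfunc _ _ _ _ _ _ _]/(DE lam x (t^-1 *: h)) (DEZ lam t^-1 Bx.1 Xh) mulrA divff ?gt_eqF// mul1r.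
  have e1 (a : R) (f g : F) : t != 0 -> (fun y => f y + t * (a * t^-1 * g y)) = fun y => f y + a * g y.
    by move=> tn; apply/funext => y; field.
  rewrite -[func _ _ _ _ _ _ _]/(IE lam (x + t *: (t^-1 *: h))) scalerA divff ?gt_eqF// scale1r.
  by [].
have [h0|h0] := ltP 0 (nrm h); first exact: Ht.
have -> : nrm h = 0 by apply/eqP; rewrite eq_le h0 nrm_ge0.
rewrite mulr0 addr0; apply/ler_addgt0Pr => eps eps0.
have t0 : 0 < Num.min d' (eps / e) by rewrite lt_min d0 divr_gt0.
apply: le_trans (Ht _ t0 (le_trans h0 (ltW t0)) _) _; first by rewrite ge_min lexx.
by rewrite lerD2l mulrC -ler_pdivlMr// ge_min lexx orbT.
Qed.

Let DE_bound lam : exists2 K : R, 0 <= K & forall x h, BE x -> XE h -> DE lam x h <= K * nrm h.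
Proof.
have [K K0 H] := dfunc_bound A1 A2 (cf lam) M; exists (K + 1); first by lra.
move=> x h Bx Xh.
have Ht t : 0 < t -> nrm h <= t -> DE lam x h <= t * K.
  move=> t0 ht; have Xh' := XEZ t^-1 Xh.
  have nh' : nrm (t^-1 *: h) <= 1 by rewrite nrmZ// gtr0_norm ?invr_gt0// ler_pdivrMl// mulr1.
  have := H _ _ _ _ (BE_ball Bx) (nrm_ball Xh' nh').
  rewrite -[dfunc _ _ _ _ _ _ _]/(DE lam x (t^-1 *: h)) (DEZ lam t^-1 Bx.1 Xh) => /(le_trans (ler_norm _)).
  by rewrite ler_pdivrMl.
have [h0|h0] := ltP 0 (nrm h).
  by apply: le_trans (Ht _ h0 (lexx _)) _; rewrite mulrC ler_pM2r// lerDl.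
have -> : nrm h = 0 by apply/eqP; rewrite eq_le h0 nrm_ge0.
rewrite mulr0; apply/ler_addgt0Pr => eps eps0; rewrite add0r.
have K1 : 0 < K + 1 by lra.
have t0 : 0 < eps / (K + 1) by rewrite divr_gt0.
apply: le_trans (Ht _ t0 (le_trans h0 (ltW t0))) _.
by rewrite -mulrA ler_piMr ?(ltW eps0)// ler_pdivrMl// mulr1 lerDl.
Qed.

Let IE_cont lam e : 0 < e -> exists2 d, 0 < d &
  forall x y, BE x -> BE y -> nrm (x - y) <= d -> `|IE lam x - IE lam y| <= e.
Proof.
move=> e0; have [d1 d10 H] := IE_taylor lam ltr01; have [K K0 HK] := DE_bound lam.
have K1 : 0 < K + 1 by lra.
have half x y : BE x -> BE y -> nrm (x - y) <= Num.min d1 (e / (K + 1)) -> IE lam x <= IE lam y + e.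
  move=> Bx By; rewrite le_min => /andP[n1' n2']; have Xxy := XEB Bx.1 By.1.
  have := H y (x - y) By Xxy n1'; rewrite addrC subrK mul1r => /le_trans; apply.
  rewrite -addrA lerD2l; apply: le_trans (_ : (K + 1) * nrm (x - y) <= _); last by rewrite -ler_pdivlMl// mulrC.
  by rewrite mulrDl mul1r lerD2r; exact: HK.
exists (Num.min d1 (e / (K + 1))); first by rewrite lt_min d10 divr_gt0.
move=> x y Bx By xy; rewrite ler_norml; have h1 := half x y Bx By xy.
rewrite nrmBC in xy; [|exact: Bx.1|exact: By.1]; have h2 := half y x By Bx xy.
by apply/andP; split; lra.
Qed.

Let DE_cont lam e : 0 < e -> exists2 d, 0 < d &
  forall x y h, BE x -> BE y -> nrm (x - y) <= d -> XE h -> nrm h <= 1 -> `|DE lam x h - DE lam y h| <= e.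
Proof.
move=> e0; have [d' d0 H] := dfunc_unif A1 A2 (cf lam) M e0; exists d' => // x y h Bx By xy Xh h1.
have g1 := es_ge0 A1 (x - y).1; have g2 := es_ge0 A2 (x - y).2.
apply: H; [exact: BE_ball|exact: BE_ball|exact: nrm_ball| |].
  by apply: le_trans xy; rewrite /nrm lerDl.
by apply: le_trans xy; rewrite /nrm lerDr.
Qed.

(** If there is no critical point in the ball, the square is pushed below c - kap / 2 with its
    boundary fixed, c exceeding J1 w1 + J2 w2 by lam K. A common zero of the two Nehari functionals
    on the deformed square has energy at least J1 w1 + J2 w2 - lam K, and lam K < kap / 4 makes this
    impossible. *)
Lemma third_critical_point : exists2 Lam : R, 0 < Lam & forall lam, 0 < lam < Lam ->
  exists u v, [/\ X1 u, X2 v, n1 (fun x => u x - w1 x) + n2 (fun x => v x - w2 x) <= rad &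
    forall w z, X1 w -> X2 z -> pl1 u w + pl2 v z = S1 u w + S2 v z + lam * DNc u v w z].
Proof.
have [eta0 eta00 [L0 L00 annulus]] := annulus_rate.
have [K K0 HK] := cf_bound A1 A2 cfc M.
have W1 := gs_pos gs1; have W2 := gs_pos gs2; have Xw1 := gs_X gs1; have Xw2 := gs_X gs2.
pose W := n1 w1 + n2 w2; have W0 : 0 < W by move: rad0 W1 W2; rewrite /W; lra.
(* The bound 1/2 keeps the factors of the rays positive; the other one places the square within rad
   / 2 of (w1, w2), where the deformation must start. *)
pose del := Num.min 2^-1 (rad / (2 * W)).
have del0 : 0 < del by rewrite lt_min divr_gt0 ?mulr_gt0// invr_gt0 ltr0Sn.
have del2 : del <= 2^-1 by rewrite ge_min lexx.
have delW : del * W <= rad / 2.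
  by rewrite -ler_pdivlMr// (_ : rad / 2 / W = rad / (2 * W)) ?ge_min ?lexx ?orbT// invfM mulrA.
pose a (s : R) := 1 - del + 2 * del * s.
have a_bd s : unitI s -> 0 < a s /\ `|a s - 1| <= del.
  move=> /andP[s0 s1]; have : 0 <= del * s <= del by rewrite mulr_ge0 ?(ltW del0)//= ler_piMr// ltW.
  by rewrite ler_norml /a => /andP[? ?]; split; [|apply/andP; split]; move: del2; lra.
pose sc (c : R) (w : F) : F := fun x => c * w x.
have sc1 w : sc 1 w = w by apply/funext => x; rewrite /sc mul1r.
pose gap1 c := J1 w1 - J1 (sc c w1); pose gap2 c := J2 w2 - J2 (sc c w2).
have gap1_gt0 c : 0 < c -> c != 1 -> 0 < gap1 c by move=> c0 c1; rewrite subr_gt0; exact: (gs_fiber gs1).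
have gap2_gt0 c : 0 < c -> c != 1 -> 0 < gap2 c by move=> c0 c1; rewrite subr_gt0; exact: (gs_fiber gs2).
have gap1_ge0 c : 0 < c -> 0 <= gap1 c.
  by move=> c0; have [->|c1] := eqVneq c 1; [rewrite /gap1 sc1 subrr|exact/ltW/gap1_gt0].
have gap2_ge0 c : 0 < c -> 0 <= gap2 c.
  by move=> c0; have [->|c1] := eqVneq c 1; [rewrite /gap2 sc1 subrr|exact/ltW/gap2_gt0].
have [am am1] : 0 < 1 - del /\ 1 - del < 1 by lra.
have [ap ap1] : 0 < 1 + del /\ 1 < 1 + del by lra.
(* At most half of the fall of J_i at the ends of the rays, so that boundary points start below c -
   2 kap and stay fixed; the second bound is the confinement condition of the deformation. Neither
   involves lambda. *)
pose kap := Num.min (Num.min (Num.min (gap1 (1 - del)) (gap1 (1 + del))) (Num.min (gap2 (1 - del)) (gap2 (1 + del))) / 2) (eta0 * rad / 10).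
have kap0 : 0 < kap.
  rewrite lt_min; apply/andP; split; last by rewrite divr_gt0// mulr_gt0.
  by rewrite divr_gt0// !lt_min !gap1_gt0 ?gap2_gt0 ?(lt_eqF am1) ?(gt_eqF ap1).
have kap_gap x : x \in [:: gap1 (1 - del); gap1 (1 + del); gap2 (1 - del); gap2 (1 + del)] -> 2 * kap <= x.
  move=> xin; rewrite mulrC -ler_pdivlMr// /kap ge_min; apply/orP; left.
  rewrite ler_pM2r ?invr_gt0// !ge_min; move: xin; rewrite !inE => /or4P[] /eqP ->; by rewrite lexx ?orbT.
have kap_eta : 10 * kap <= eta0 * rad by rewrite mulrC -ler_pdivlMr// ge_min lexx orbT.
exists (Num.min L0 (kap / (4 * (K + 1)))); first by rewrite lt_min L00 divr_gt0// mulr_gt0//; lra.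
move=> lam /andP[lam0]; rewrite lt_min => /andP[lamL lamK].
have {}lamK : lam * K < kap / 4.
  apply: (@le_lt_trans _ _ (lam * (K + 1))); first by rewrite ler_pM2l//; lra.
  by rewrite -ltr_pdivlMr; [apply: lt_le_trans lamK _; rewrite invfM mulrA|lra].
have [[eta eta_gt0 rate]|[u [v [[Xu Xv uv] crit _]]]] := rate_or_critical lam (fun _ _ => True); last first.
  exists u, v; split => // w z Xw Xz; have := crit w z Xw Xz.
  by rewrite /dI /dfunc /DNf mul1r => /eqP; rewrite subr_eq0 => /eqP.
exfalso; pose eta' := Num.min eta eta0.
have eta'0 : 0 < eta' by rewrite lt_min eta_gt0.
have eta'e : eta' <= eta0 by rewrite ge_min lexx orbT.
have descent x : BE x -> exists h, [/\ XE h, nrm h <= 1, DE lam x h <= - eta' &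
    rad / 4 <= nrm (x - x0) -> DE lam x h <= - eta0].
  move=> [[Xx1 Xx2] xr]; have Bx : Bw x.1 x.2 by [].
  have [Q|Q] := leP (rad / 4) (nrm (x - x0)).
    have [w [z [Xw Xz wz Dw]]] := annulus lam lam0 (ltW lamL) _ _ Bx Q.
    by exists (w, z); split => //; apply: le_trans Dw _; rewrite lerN2.
  have [w [z [Xw Xz wz Dw]]] := rate _ _ Bx Logic.I.
  exists (w, z); split; [by []|exact: wz| |].
  - by apply: le_trans Dw _; rewrite lerN2 ge_min lexx.
  - by [].
pose g0 (s t : R) : E := (sc (a s) w1, sc (a t) w2).
pose c := J1 w1 + J2 w2 + lam * K.
have Xx0 : XE x0 by [].
have Xg0 s t : XE (g0 s t) by split; [exact: (es_Z A1)|exact: (es_Z A2)].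
have ng0 (b b' : R) : nrm ((sc b w1, sc b' w2) : E) = `|b| * n1 w1 + `|b'| * n2 w2.
  by rewrite /nrm (es_nZ A1 b Xw1) (es_nZ A2 b' Xw2).
have scB (b b' : R) w : (sc b w - sc b' w : T -> R^o) = sc (b - b') w.
  by apply/funext => x; rewrite /sc mulrBl.
have ug0 : unif_cont2 nrm g0.
  move=> e e0; exists (e / (2 * del * W)); first by rewrite divr_gt0// !mulr_gt0.
  move=> s t s' t' _ _ _ _; rewrite !ler_pdivlMr ?mulr_gt0// => ss tt.
  have -> : g0 s t - g0 s' t' = (sc (2 * del * (s - s')) w1, sc (2 * del * (t - t')) w2).
    congr (_, _); rewrite scB; congr sc; rewrite /a; ring.
  have d2 : 0 < 2 * del by rewrite mulr_gt0.
  rewrite ng0 !(normrM (2 * del)) !(gtr0_norm d2).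
  have ar (x k W1' W2' : R) : 0 <= W1' -> 0 <= W2' -> x * (k * (W1' + W2')) <= e -> forall y, y * (k * (W1' + W2')) <= e ->
      0 < k -> k * x * W1' + k * y * W2' <= e.
    move=> W10 W20 h1 y h2 k0; have [xy|/ltW xy] := leP x y.
      apply: le_trans h2; rewrite mulrCA -!mulrA -mulrDr ler_pM2l// mulrDr lerD2r; exact: ler_wpM2r.
    apply: le_trans h1; rewrite mulrCA -!mulrA -mulrDr ler_pM2l// mulrDr lerD2l; exact: ler_wpM2r.
  exact: (ar _ _ _ _ (es_ge0 A1 w1) (es_ge0 A2 w2) ss _ tt d2).
have Bg0 s t : unitI s -> unitI t -> nrm (g0 s t - x0) <= rad / 2.
  move=> sI tI; have -> : g0 s t - x0 = (sc (a s - 1) w1, sc (a t - 1) w2).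
    by congr (_, _); rewrite -scB sc1.
  rewrite ng0; apply: le_trans delW; rewrite /W mulrDr.
  have [[_ as1] [_ at1]] := (a_bd s sI, a_bd t tI).
  exact: lerD (ler_wpM2r (es_ge0 A1 w1) as1) (ler_wpM2r (es_ge0 A2 w2) at1).
have Ig0 s t : unitI s -> unitI t -> IE lam (g0 s t) <= c - gap1 (a s) - gap2 (a t).
  move=> sI tI; have Bg : BE (g0 s t).
    by split; [exact: Xg0|apply: le_trans (Bg0 s t sI tI) _; move: rad0; lra].
  have [+ _] := HK _ _ _ _ (BE_ball Bg) (nrm_ball (XEZ 0 Xx0) ltac:(by rewrite nrmZ// normr0 mul0r)).
  rewrite ler_norml => /andP[+ _]; rewrite -(ler_pM2l lam0) mulrN => h.
  rewrite /IE I_split /c /gap1 /gap2 /= -/(sc (a s) w1).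
  by move: h; rewrite /=; lra.
have Ig0c s t : unitI s -> unitI t -> [/\ XE (g0 s t), nrm (g0 s t - x0) <= rad / 2 & IE lam (g0 s t) <= c].
  move=> sI tI; split; [exact: Xg0|exact: Bg0|apply: le_trans (Ig0 s t sI tI) _].
  have [as0 _] := a_bd s sI; have [at0 _] := a_bd t tI.
  exact: gap_both (gap1_ge0 _ as0) (gap2_ge0 _ at0).
have [g ug Hg] := deformation rad0 Xx0 XED XEZ nrmD nrmZ (@DED lam) (@DEZ lam) (IE_taylor lam)
  (IE_cont lam) (DE_cont lam) eta'0 eta'e descent kap0 kap_eta ug0 Ig0c.
have a0 : a 0 = 1 - del by rewrite /a mulr0 addr0.
have a1 : a 1 = 1 + del by rewrite /a; ring.
have I0 : unitI (0 : R) by rewrite /unitI lexx ler01.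
have I1 : unitI (1 : R) by rewrite /unitI lexx ler01.
have fix1 s t : unitI s -> unitI t -> 2 * kap <= gap1 (a s) -> g s t = g0 s t.
  move=> sI tI k; have [_ _ _] := Hg s t sI tI; apply; apply: le_trans (Ig0 s t sI tI) _.
  by have [at0 _] := a_bd t tI; exact: gap_first (gap2_ge0 _ at0) k.
have fix2 s t : unitI s -> unitI t -> 2 * kap <= gap2 (a t) -> g s t = g0 s t.
  move=> sI tI k; have [_ _ _] := Hg s t sI tI; apply; apply: le_trans (Ig0 s t sI tI) _.
  by have [as0 _] := a_bd s sI; rewrite addrAC; exact: gap_first (gap1_ge0 _ as0) k.
have gB s t : unitI s -> unitI t -> in_ball X1 X2 n1 n2 M (g s t).1 (g s t).2.
  by move=> sI tI; have [Xg gr _ _] := Hg s t sI tI; exact: BE_ball.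
pose h1 s t := pl1 (g s t).1 (g s t).1 - S1 (g s t).1 (g s t).1.
pose h2 s t := pl2 (g s t).2 (g s t).2 - S2 (g s t).2 (g s t).2.
have uh1 : unif_cont2 Num.norm h1.
  move=> e e0; have [d' d0 Hd] := gs_unif gs1 M e0; have [d1 d10 Hd1] := ug _ d0.
  exists d1 => // s t s' t' sI tI sI' tI' ss tt; have [? _ ? _] := gB s t sI tI; have [? _ ? _] := gB s' t' sI' tI'.
  apply: Hd => //; apply: le_trans (Hd1 s t s' t' sI tI sI' tI' ss tt).
  by rewrite /nrm lerDl; exact: es_ge0 A2 _.
have uh2 : unif_cont2 Num.norm h2.
  move=> e e0; have [d' d0 Hd] := gs_unif gs2 M e0; have [d1 d10 Hd1] := ug _ d0.
  exists d1 => // s t s' t' sI tI sI' tI' ss tt; have [_ ? _ ?] := gB s t sI tI; have [_ ? _ ?] := gB s' t' sI' tI'.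
  apply: Hd => //; apply: le_trans (Hd1 s t s' t' sI tI sI' tI' ss tt).
  by rewrite /nrm lerDr; exact: es_ge0 A1 _.
(* On the sides g equals g0, where the Nehari functionals have the signs of [gs_slope]: positive for
   factors below 1, negative above. *)
have [||s [t [sI tI z1 z2]]] := poincare_miranda uh1 uh2.
- move=> t tI; rewrite /h1 !fix1 ?a0 ?a1//; try (by apply: kap_gap; rewrite !inE eqxx ?orbT).
  rewrite /g0 /= a0 a1; split.
    exact: (gs_slope gs1 am).1 am1.
  exact: (gs_slope gs1 ap).2 ap1.
- move=> s sI; rewrite /h2 !fix2 ?a0 ?a1//; try (by apply: kap_gap; rewrite !inE eqxx ?orbT).
  rewrite /g0 /= a0 a1; split.
    exact: (gs_slope gs2 am).1 am1.
  exact: (gs_slope gs2 ap).2 ap1.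
have [[Xg1 Xg2] gr Ig _] := Hg s t sI tI.
have pos X nm p r pl Lim (u w : F) : energy_space m D p r X nm pl Lim -> X u -> X w -> rad < nm w ->
    nm (fun x => u x - w x) <= rad -> 0 < nm u.
  move=> A Xu Xw rw uw; have := es_nB A Xu (es_B A Xu Xw).
  rewrite (_ : (fun x => u x - (u x - w x)) = w); last by apply/funext => x; ring.
  by move=> h; exact: near_gt0 rw h uw.
have q1 := es_ge0 A1 (g s t - x0).1; have q2 := es_ge0 A2 (g s t - x0).2.
have [qq1 qq2] := addr_le_both q1 q2 gr.
have m1 := gs_min gs1 Xg1 (pos _ _ _ _ _ _ _ _ A1 Xg1 Xw1 W1 qq1) z1.
have m2 := gs_min gs2 Xg2 (pos _ _ _ _ _ _ _ _ A2 Xg2 Xw2 W2 qq2) z2.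
have [+ _] := HK _ _ _ _ (gB s t sI tI) (nrm_ball (XEZ 0 Xx0) ltac:(by rewrite nrmZ// normr0 mul0r)).
rewrite ler_norml => /andP[_]; rewrite -(ler_pM2l lam0) => hN.
apply: (level_contra _ Ig lamK); rewrite /IE I_split.
exact: lerDB.
Qed.

End two_ground_states.

(** * Fractional energy spaces *)

Section fractional_functionals.
Context {R : realType} {N : nat}.
Variable (Omega : set 'rV[R]_N).
Hypotheses (oO : open Omega) (bO : bounded_set Omega).
Local Notation mu := (lebesgue_rV R N).
Local Notation mu2 := (mu \x mu)%E.
Local Notation F := ('rV[R]_N -> R).

Definition admissible (s p r : R) : Prop :=
  [/\ 0 < s < 1, 1 < p, s * p < N%:R, p <= r & r < sobolev_exponent (N := N) s p].

#[local] Opaque X0 fnorm frac_plap powR.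

Let mO : measurable Omega. Proof. exact: open_measurable_rV. Qed.

Lemma admissible_gt0 s p r : admissible s p r -> 0 < r.
Proof. by move=> [_ p1 _ pr _]; rewrite (lt_le_trans _ pr)// (lt_trans _ p1). Qed.

Lemma X0_dom_cvg_cst s p r u : admissible s p r -> X0 Omega s p u ->
  dom_cvg mu Omega r (fun=> u) u.
Proof.
move=> A Xu; have r0 := admissible_gt0 A; case: A => s01 p1 spN pr rs.
have [C C0 HC] := sobolev oO bO s01 p1 spN r0 (ltW rs).
have t0 : 0 < fnorm s p u + 1 by rewrite ltr_wpDl// fnorm_ge0.
apply: dom_cvg_cst; first exact: X0_measurable Xu.
have [|//] := HC u _ (X0_measurable Xu) (X0_zero Xu) (X0_fLp oO p1 Xu) t0.
by rewrite -/(fnorm s p u) lerDl.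
Qed.

Lemma X0_Lr s p r u : admissible s p r -> X0 Omega s p u -> Lr mu Omega r u.
Proof.
move=> A Xu; split; first exact: X0_measurable Xu.
exact: (dom_cvg_integrable mO 0 (admissible_gt0 A) (X0_dom_cvg_cst A Xu)).
Qed.

(** The last clause asks for convergence on the whole space, since the Gagliardo energy also sees
    points outside Omega, whereas [dom_cvg] only concerns Omega. *)
Definition X0_limit s p r (M : R) (u_ : nat -> F) (u : F) : Prop :=
  [/\ X0 Omega s p u /\ fnorm s p u <= M, dom_cvg mu Omega r u_ u &
      {ae mu, forall x, u_ n x @[n --> \oo] --> u x}].

Lemma X0_limit_sub s p r M (u_ : nat -> F) u (psi : nat -> nat) : (forall n, (n <= psi n)%N) ->
  X0_limit s p r M u_ u -> X0_limit s p r M (fun n => u_ (psi n)) u.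
Proof.
move=> psige [Xu du cu]; split => //; first exact: dom_cvg_sub.
by apply: filterS cu => x cu; exact: cvg_comp (cvg_ge_id psige) cu.
Qed.

Lemma X0_limit_unique s p r M (u_ v_ : nat -> F) u v : admissible s p r ->
  (forall n, X0 Omega s p (u_ n)) -> (forall n, X0 Omega s p (v_ n)) ->
  (forall n, fnorm s p (fun x => u_ n x - v_ n x) <= n.+1%:R^-1) ->
  X0_limit s p r M u_ u -> X0_limit s p r M v_ v -> {ae mu, forall x, u x = v x}.
Proof.
move=> [s01 p1 spN pr rs] Xu_ Xv_ uv [[Xu _] _ cu] [[Xv _] _ cv].
have XB w w' := @X0B _ _ Omega s p oO bO s01 p1 spN w w'.
have Xw := XB _ _ Xu Xv.
have n0 : fnorm s p (fun x => u x - v x) = 0.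
  apply/eqP; rewrite eq_le fnorm_ge0 andbT; apply/ler_addgt0Pl => e e0; rewrite addr0.
  have [k _ Hk] := near_infty_natSinv_lt (PosNum e0).
  have e1 : 0 <= e by exact: ltW.
  rewrite (fnorm_le _ p1)//.
  apply: (energy_fatou oO bO s01 p1 spN (u_ := fun n x => u_ (n + k)%N x - v_ (n + k)%N x) _ _ _ _).2.
  - by move=> n; exact: (XB _ _ (Xu_ _) (Xv_ _)).
  - exact: X0_measurable Xw.
  - apply: filterS2 cu cv => x cu cv.
    have kk n : (n <= n + k)%N by exact: leq_addr.
    by apply: cvgB; [exact: cvg_comp (cvg_ge_id kk) cu|exact: cvg_comp (cvg_ge_id kk) cv].
  - move=> n; rewrite -(fnorm_le _ p1)//; apply: le_trans (uv _) _; apply/ltW/Hk.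
    by rewrite /= leq_addl.
apply: filterS (fnorm_eq0 oO bO s01 p1 spN Xw n0) => x /eqP.
by rewrite subr_eq0 => /eqP.
Qed.

Section one_space.
Variables (s p r : R).
Hypothesis A : admissible s p r.
Local Notation X := (X0 Omega s p).
Local Notation nm := (fnorm s p).

Let s01 : 0 < s < 1. Proof. by case: A. Qed.
Let p1 : 1 < p. Proof. by case: A. Qed.
Let spN : s * p < N%:R. Proof. by case: A. Qed.
Let p0 : 0 < p. Proof. by rewrite (lt_trans _ p1). Qed.
Let LX u (Xu : X u) : Lp mu2 p (frac_diff s p u) := X0_fLp oO p1 Xu.
Let XB u v : X u -> X v -> X (fun x => u x - v x).
Proof. exact: (X0B oO bO s01 p1 spN). Qed.
Let XD u v : X u -> X v -> X (fun x => u x + v x).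
Proof. exact: (X0D oO bO s01 p1 spN). Qed.
Let XZ c u : X u -> X (fun x => c * u x).
Proof. exact: (X0Z oO bO s01 p1 spN). Qed.
Let energyE u : Lp_energy mu2 p (frac_diff s p u) = nm u `^ p.
Proof. by rewrite (fnorm_powR _ p1). Qed.

Lemma plapD u w w' : X u -> X w -> X w' ->
  frac_plap s p u (fun x => w x + w' x) = frac_plap s p u w + frac_plap s p u w'.
Proof.
by move=> Xu Xw Xw'; rewrite !(frac_plapE _ p1) frac_diffD (Lp_dualD p1 (LX Xu) (LX Xw) (LX Xw')).
Qed.

Lemma plapZ c u w : X u -> X w -> frac_plap s p u (fun x => c * w x) = c * frac_plap s p u w.
Proof. by move=> Xu Xw; rewrite !(frac_plapE _ p1) frac_diffZ (Lp_dualZ p1 c (LX Xu) (LX Xw)). Qed.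

Lemma plapZl u w c : X u -> X w -> 0 <= c ->
  frac_plap s p (fun x => c * u x) w = c `^ (p - 1) * frac_plap s p u w.
Proof.
by move=> Xu Xw c0; rewrite !(frac_plapE _ p1) frac_diffZ (Lp_dualZl p1 (LX Xu) (LX Xw) c0).
Qed.

Lemma plap_self (u : F) : frac_plap s p u u = nm u `^ p.
Proof. by rewrite (frac_plapE _ p1) (Lp_dual_self mu2 p1) energyE. Qed.

Lemma plap_convex u w : X u -> X w ->
  nm u `^ p + p * frac_plap s p u (fun x => w x - u x) <= nm w `^ p.
Proof.
by move=> Xu Xw; have := Lp_energy_convex p1 (LX Xu) (LX Xw); rewrite !energyE (frac_plapE _ p1) frac_diffB.
Qed.

Lemma plap_unif M (e : R) : 0 < e -> exists2 d : R, 0 < d & forall u u' w,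
  X u -> X u' -> X w -> nm u <= M -> nm w <= 1 -> nm (fun x => u x - u' x) <= d ->
  `|frac_plap s p u w - frac_plap s p u' w| <= e.
Proof.
move=> e0; have [d d0 Hd] := Lp_dual_unif mu2 p1 (`|M| `^ p) e0.
exists (d `^ p^-1); first exact: powR_gt0.
move=> u u' w Xu Xu' Xw uM w1 uu'; rewrite !(frac_plapE _ p1).
apply: (Hd _ _ _ (LX Xu) (LX Xu') (LX Xw)).
- by rewrite -(fnorm_le _ p1)// (le_trans uM)// ler_norm.
- rewrite -frac_diffB; have -> : d = (d `^ p^-1) `^ p by rewrite -powRrM mulVf ?gt_eqF// powRr1// ltW.
  by rewrite -(fnorm_le _ p1)// powR_ge0.
- have := fnorm_le s p1 w ler01; by rewrite powR1 => <-.
Qed.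

(** Convexity at u_n bounds the energy of u_n by that of u plus p times the pairing, so no energy is
    lost in the limit and [Lp_strong_cvg] applies. *)
Lemma plap_strong M (u_ : nat -> F) u : (forall n, X (u_ n)) -> X0_limit s p r M u_ u ->
  (forall e : R, 0 < e -> exists k, forall n, (k <= n)%N -> frac_plap s p (u_ n) (fun x => u_ n x - u x) <= e) ->
  forall e : R, 0 < e -> exists k, forall n, (k <= n)%N -> nm (fun x => u_ n x - u x) <= e.
Proof.
have ar (a b c e : R) : a * p <= e -> b + p * (-1 * a) <= c -> b <= c + e by move=> *; lra.
move=> Xu_ [[Xu _] _ cu] H e e0.
have cd : {ae mu2, forall z, (fun n => frac_diff s p (u_ n) z) n @[n --> \oo] --> frac_diff s p u z}.
  apply: filterS (ae_prod cu) => z [c1 c2]; rewrite /frac_diff.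
  by apply: cvgM; [exact: cvgB|exact: cvg_cst].
have S := Lp_strong_cvg p1 (fun n => LX (Xu_ n)) (LX Xu) cd.
have [|k Hk] := cvg_dist (S _) (powR_gt0 p e0).
  move=> e' e'0; have [k Hk] := H (e' / p) (divr_gt0 e'0 p0); exists k => n kn.
  rewrite !energyE; have := plap_convex (Xu_ n) Xu.
  rewrite (_ : (fun x => u x - u_ n x) = fun x => -1 * (u_ n x - u x)); last by apply/funext => x; ring.
  rewrite (plapZ (-1) (Xu_ n) (XB (Xu_ n) Xu)).
  have := Hk n kn; rewrite ler_pdivlMr//.
  exact: ar.
exists k => n /Hk; rewrite sub0r normrN -frac_diffB ger0_norm ?(Lp_energy_ge0 _ _ _)//.
by rewrite -(fnorm_le _ p1)// ltW.
Qed.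

Lemma X0_energy_space : energy_space mu Omega p r X nm (frac_plap s p) (X0_limit s p r).
Proof.
have r0 := admissible_gt0 A; have [_ _ _ pr rs] := A.
split; [exact: p1|exact: r0|exact: (X00 oO bO s01 p1 spN)|exact: XD|exact: XZ| | | | | | | | | | | | | | | | |].
- by move=> u; exact: fnorm_ge0.
- by move=> u v Xu Xv; exact: (fnormD oO p1 Xu Xv).
- by move=> c u Xu; exact: (fnormZ oO p1 c Xu).
- exact: plapD.
- exact: plapZ.
- by move=> c u v Xu Xv c0; exact: plapZl.
- by move=> u _; exact: plap_self.
- exact: plap_convex.
- exact: plap_unif.
- by move=> u; exact: (X0_Lr A).
- have [C C0 HC] := sobolev oO bO s01 p1 spN r0 (ltW rs).
  exists C => // u Xu; have [n0|/eqP n0] := eqVneq (nm u) 0; last first.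
    have np : 0 < nm u by rewrite lt_neqAle eq_sym; apply/andP; split; [apply/eqP|exact: fnorm_ge0].
    exact: (HC u _ (X0_measurable Xu) (X0_zero Xu) (X0_fLp oO p1 Xu) np (lexx _)).2.
  have mf : measurable_fun Omega (fun x => `|u x| `^ r).
    apply: (measurable_funS measurableT) => //.
    apply: (measurableT_comp (measurable_powR r)); apply: measurableT_comp => //.
    exact: X0_measurable Xu.
  have m0 : measurable_fun Omega (fun=> 0 : R) by exact: measurable_cst.
  rewrite n0 powR0 ?gt_eqF// mulr0 (Rintegral_ae_eq mO mf m0).
    by rewrite Rintegral_cst// mul0r.
  apply: filterS (fnorm_eq0 oO bO s01 p1 spN Xu n0) => x -> _.
  by rewrite normr0 powR0// gt_eqF.
- move=> M u_ Xu_ uM.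
  have [psi [u [h [psige Xu [mh ih] cu dh]]]] := X0_compact oO bO s01 p1 spN pr rs Xu_ uM.
  exists psi, u; split => //; split => //; split.
  + by move=> n; exact: X0_measurable (Xu_ _).
  + by case: Xu => Xu _; exact: X0_measurable Xu.
  + by apply: filterS cu => x cx _.
  + by exists h.
- by move=> M u_ u [[Xu uM] du _].
- move=> M M' u_ u Xu_ [[Xu _] _ cu] uM'.
  have M0 : 0 <= M' := le_trans (fnorm_ge0 _ _ _) (uM' 0%N).
  rewrite (fnorm_le _ p1)//.
  apply: (energy_fatou oO bO s01 p1 spN Xu_ (X0_measurable Xu) cu _).2.
  by move=> n; rewrite -(fnorm_le _ p1).
- by move=> M u_ u psi psige; exact: X0_limit_sub.
- by move=> M u_ v_ u v; exact: X0_limit_unique.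
- exact: plap_strong.
Qed.

End one_space.

End fractional_functionals.

(** * Superposition by continuous nonlinearities *)

(** u is replaced by its rounding down to multiples of 1 / (n + 1), which takes countably many
    values; continuity in the second variable recovers the limit. *)
Lemma measurable_caratheodory d (T : measurableType d) (R : realType) (D : set T) (h : T -> R -> R) (u : T -> R) :
  measurable D -> (forall a, measurable_fun D (fun x => h x a)) ->
  (forall x (a_ : nat -> R) a, D x -> a_ n @[n --> \oo] --> a -> h x (a_ n) @[n --> \oo] --> h x a) ->
  measurable_fun setT u -> measurable_fun D (fun x => h x (u x)).
Proof.
move=> mD mh ch mu.
pose fl n x : R := (Num.floor (n.+1%:R * u x))%:~R / n.+1%:R.
apply: (measurable_fun_cvg (h := fun n x => h x (fl n x))) => [n|x Dx].
- move=> _ Y mY.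
  pose A (k : int) := (D `&` (fun x => h x (k%:~R / n.+1%:R)) @^-1` Y) `&`
    (fun x => n.+1%:R * u x) @^-1` `[k%:~R, (k + 1)%:~R[%classic.
  rewrite (_ : _ `&` _ = \bigcup_k A k).
    apply: countable_bigcupT_measurable => [|k]; first exact: countableP.
    apply: measurableI; first exact: mh.
    rewrite -[X in measurable X]setTI; apply: measurable_funM => //; exact: measurable_cst.
  apply/seteqP; split => [x [Dx Yx]|x [k _ [[Dx Yx]]]].
    by exists (Num.floor (n.+1%:R * u x)) => //; split => //; rewrite /= in_itv/= floor_itv.
  by rewrite /= in_itv/= => kx; split => //; rewrite /= /fl (floor_def kx).
- apply: ch => //; apply/cvgrPdist_le => e e0; near=> n.
  have n0 : 0 < n.+1%:R :> R by [].
  rewrite /fl; have -> (k : R) : u x - k / n.+1%:R = (n.+1%:R * u x - k) / n.+1%:R by field; rewrite gt_eqF.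
  rewrite normrM [X in _ * X]gtr0_norm ?invr_gt0//.
  have /andP[f1 f2] := floor_itv (n.+1%:R * u x).
  apply: (@le_trans _ _ (1 * n.+1%:R^-1)).
    rewrite ler_pM2r ?invr_gt0// ger0_norm ?subr_ge0// lerBlDl.
    by apply: ltW; move: f2; rewrite intrD.
  rewrite mul1r; apply: ltW; near: n; exact: (near_infty_natSinv_lt (PosNum e0)).
Unshelve. all: by end_near. Qed.

Lemma mvt_between (R : realType) (f df : R -> R) (a b : R) : (forall x : R, is_derive x 1 f (df x)) ->
  exists2 xi, `|xi - a| <= `|b - a| & f b - f a = df xi * (b - a).
Proof.
move=> H; have cf (i : interval R) : {within [set` i], continuous f}.
  by apply: continuous_subspaceT => x; apply/differentiable_continuous/derivable1_diffP; case: (H x).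
have [ab|/ltW ba] := leP a b.
  have [c + E] := MVT_segment ab (fun x _ => H x) (cf _).
  by rewrite in_itv/= => /andP[ac cb]; exists c => //; rewrite !ger0_norm ?subr_ge0//; lra.
have [c + E] := MVT_segment ba (fun x _ => H x) (cf _).
rewrite in_itv/= => /andP[bc ca]; exists c; first by rewrite !ler0_norm ?subr_le0//; lra.
by rewrite -[LHS]opprB E -mulrN opprB.
Qed.

(** The Taylor estimate is the mean value theorem along the path (a, b), (a, b'), (a', b'), one
    variable at a time. The factor 4 covers the bound on H, which adds two instances of the growth
    condition. *)
Lemma nonlinearity_intro d (T : measurableType d) (R : realType) (D : set T) (r1 r2 C : R)
    (H Ha Hb : T -> R -> R -> R) : measurable D -> 0 < r1 -> 0 < r2 -> 0 <= C ->
  (forall a b, [/\ measurable_fun D (fun x => H x a b), measurable_fun D (fun x => Ha x a b) &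
     measurable_fun D (fun x => Hb x a b)]) ->
  (forall x (a_ b_ : nat -> R) (a b : R), D x ->
    a_ n @[n --> \oo] --> a -> b_ n @[n --> \oo] --> b ->
    [/\ H x (a_ n) (b_ n) @[n --> \oo] --> H x a b,
        Ha x (a_ n) (b_ n) @[n --> \oo] --> Ha x a b &
        Hb x (a_ n) (b_ n) @[n --> \oo] --> Hb x a b]) ->
  (forall x (a b : R), D x -> is_derive a 1 (fun t => H x t b) (Ha x a b) /\ is_derive b 1 (H x a) (Hb x a b)) ->
  (forall x, D x -> H x 0 0 = 0) ->
  (forall x (a b w z : R), D x -> `|Ha x a b| * `|w| + `|Hb x a b| * `|z| <=
    C * (1 + `|a| `^ r1 + `|b| `^ r2 + `|w| `^ r1 + `|z| `^ r2)) ->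
  nonlinearity D r1 r2 (4 * C) H Ha Hb.
Proof.
move=> mD r10 r20 C0 mH cH dH H0 gH.
have meas (h : T -> R -> R -> R) : (forall a b, measurable_fun D (fun x => h x a b)) ->
    (forall x (a_ b_ : nat -> R) (a b : R), D x -> a_ n @[n --> \oo] --> a -> b_ n @[n --> \oo] --> b ->
      h x (a_ n) (b_ n) @[n --> \oo] --> h x a b) ->
    forall u v : T -> R, measurable_fun setT u -> measurable_fun setT v -> measurable_fun D (fun x => h x (u x) (v x)).
  move=> mh ch u v mu mv; apply: (@measurable_caratheodory _ _ _ _ (fun x b => h x (u x) b)) => // [b|x a_ a Dx Ha_].
    apply: (@measurable_caratheodory _ _ _ _ (fun x a => h x a b)) => // x a_ a Dx Ha_.
    by apply: ch => //; exact: cvg_cst.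
  by apply: ch => //; exact: cvg_cst.
split.
- by apply: meas => [a b|x a_ b_ a b Dx Ha' Hb']; [case: (mH a b)|case: (cH x a_ b_ a b Dx Ha' Hb')].
- by apply: meas => [a b|x a_ b_ a b Dx Ha' Hb']; [case: (mH a b)|case: (cH x a_ b_ a b Dx Ha' Hb')].
- by apply: meas => [a b|x a_ b_ a b Dx Ha' Hb']; [case: (mH a b)|case: (cH x a_ b_ a b Dx Ha' Hb')].
- exact: cH.
- move=> x a b a' b' Dx.
  have [xi xia E1] := @mvt_between R (fun t => H x t b') (fun t => Ha x t b') a a' (fun t => (dH x t b' Dx).1).
  have [ze zeb E2] := @mvt_between R (H x a) (Hb x a) b b' (fun t => (dH x a t Dx).2).
  exists xi, ze; split => //.
  rewrite (_ : H x a' b' - H x a b - _ = ((Ha x xi b' - Ha x a b') + (Ha x a b' - Ha x a b)) * (a' - a) +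
     (Hb x a ze - Hb x a b) * (b' - b)).
    apply: le_trans (ler_normD _ _) _; rewrite !normrM lerD2r.
    by apply: ler_wpM2r => //; exact: ler_normD.
  have -> : H x a' b' - H x a b = (H x a' b' - H x a b') + (H x a b' - H x a b) by ring.
  by rewrite E1 E2; ring.
- move=> x a b w z Dx; apply: le_trans (gH x a b w z Dx) _.
  have : 0 <= C * (1 + `|a| `^ r1 + `|b| `^ r2 + `|w| `^ r1 + `|z| `^ r2) by rewrite mulr_ge0// !addr_ge0// powR_ge0.
  by rewrite -mulrA; move: (C * _) => y; lra.
- move=> x a b Dx.
  have [xi xia E1] := @mvt_between R (fun t => H x t b) (fun t => Ha x t b) 0 a (fun t => (dH x t b Dx).1).
  have [ze zeb E2] := @mvt_between R (H x 0) (Hb x 0) 0 b (fun t => (dH x 0 t Dx).2).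
  rewrite !subr0 in xia zeb E1 E2.
  have -> : H x a b = Ha x xi b * a + Hb x 0 ze * b by rewrite -E1 -E2 H0//; ring.
  apply: le_trans (ler_normD _ _) _; rewrite !normrM.
  have h1 := gH x xi b a 0 Dx; have h2 := gH x 0 ze 0 b Dx.
  rewrite !normr0 !mulr0 ?add0r ?addr0 (powR0 (lt0r_neq0 r10)) (powR0 (lt0r_neq0 r20)) ?addr0 in h1 h2.
  apply: le_trans (lerD h1 h2) _; rewrite -mulrDr -mulrA [leRHS]mulrCA ler_wpM2l//.
  have p1 : `|xi| `^ r1 <= `|a| `^ r1 by rewrite ler_powR_base// ltW.
  have p2 : `|ze| `^ r2 <= `|b| `^ r2 by rewrite ler_powR_base// ltW.
  by move: p1 p2 (powR_ge0 `|a| r1) (powR_ge0 `|b| r2); lra.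
Qed.

Lemma nonlinearity_le d (T : measurableType d) (R : realType) (D : set T) (r1 r2 C C' : R)
    (H Ha Hb : T -> R -> R -> R) : C <= C' -> nonlinearity D r1 r2 C H Ha Hb -> nonlinearity D r1 r2 C' H Ha Hb.
Proof.
move=> CC' [m1 m2 m3 c t g g0]; split => // [x a b w z Dx|x a b Dx].
  by apply: le_trans (g x a b w z Dx) _; apply: ler_wpM2r => //; rewrite !addr_ge0// powR_ge0.
by apply: le_trans (g0 x a b Dx) _; apply: ler_wpM2r => //; rewrite !addr_ge0// powR_ge0.
Qed.

(** * One-sided derivatives and positive parts *)

Section half_line.
Context {R : realType}.
Local Notation "a ^+0" := (Num.max 0 a) (at level 2, format "a ^+0").

Lemma deriv_Rplus_unique (h : R -> R) (t l l' : R) : 0 <= t -> deriv_Rplus h t l -> deriv_Rplus h t l' -> l = l'.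
Proof.
move=> t0; have sub : 0^'+ `=>` within [set k : R | 0 <= t + k] 0^'.
  move=> A HA; have HA' : nbhs (0 : R) [set k | k != 0 -> 0 <= t + k -> A k] := HA.
  apply: (filterS _ HA') => k Hk k0.
  by apply: Hk; [rewrite gt_eqF|rewrite addr_ge0// ltW].
move=> H H'; apply: (@cvg_unique _ _ (k^-1 * (h (t + k) - h t) @[k --> 0^'+])) => //.
  exact: cvg_trans (cvg_app _ sub) H.
exact: cvg_trans (cvg_app _ sub) H'.
Qed.

(** The zero slope at 0 matches the constant continuation to the left, so the kink of the positive
    part disappears. *)
Lemma is_derive_pos_part (h dh : R -> R) : (forall t, 0 <= t -> deriv_Rplus h t (dh t)) -> dh 0 = 0 ->
  forall t : R, is_derive t 1 (fun t => h (Num.max 0 t)) (dh (Num.max 0 t)).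
Proof.
move=> H dh0 t.
suff c : k^-1 *: (h (Num.max 0 (k *: (1 : R^o) + t)) - h (Num.max 0 t)) @[k --> 0^'] --> (dh (Num.max 0 t) : R^o).
  by apply: DeriveDef; [exact: cvgP c|exact: cvg_lim c].
apply/cvgrPdist_le => e e0.
have near_abs (r : R) : 0 < r -> \forall k \near (0 : R)^', `|k| < r.
  move=> r0; apply: nbhs_dnbhs; apply/nbhs_ballP; exists r => //= k; by rewrite /ball/= sub0r normrN.
have Z (k : R) : k *: (1 : R^o) = k by rewrite /GRing.scale/= mulr1.
have [t0|t0] := ltP t 0.
  near=> k; have kt : `|k| < - t by near: k; apply: near_abs; rewrite oppr_gt0.
  rewrite Z !max_l ?(ltW t0)//; last by move: kt; rewrite ltr_norml => /andP[_ ?]; lra.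
  by rewrite subrr scaler0 subr0 dh0 normr0 ltW.
have /cvgrPdist_le/(_ e e0) Ht := H t t0.
have near_t : \forall k \near (0 : R)^', 0 < t -> `|k| < t.
  have [/near_abs t'|_] := ltP 0 t; last exact: nearW.
  by apply: filterS t' => k.
near=> k; rewrite Z.
have Hk : 0 <= t + k -> `|dh t - k^-1 * (h (t + k) - h t)| <= e by near: k; exact: Ht.
have [kt|kt] := leP 0 (k + t); first by rewrite (addrC k t) in kt *; exact: (Hk kt).
move: t0; rewrite le_eqVlt => /predU1P[t0|t0].
  by rewrite -t0 subrr scaler0 subr0 dh0 normr0 ltW.
have k_t : `|k| < t by move: t0; near: k.
by exfalso; move: k_t kt; rewrite ltr_norml => /andP[? _]; lra.
Unshelve. all: by end_near. Qed.

Lemma within_continuous_seq (T : topologicalType) (S : topologicalType) (A : set T) (f : T -> S) (z_ : nat -> T) z :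
  {within A, continuous f} -> A z -> (forall n, A (z_ n)) -> z_ n @[n --> \oo] --> z -> f (z_ n) @[n --> \oo] --> f z.
Proof.
move=> /subspace_continuousP cf Az Az_ cz.
have cz' : z_ n @[n --> \oo] --> within A (nbhs z).
  move=> B HB; have HB' : nbhs z [set x | A x -> B x] := HB.
  have HB'' : nbhs \oo [set n | A (z_ n) -> B (z_ n)] := cz _ HB'.
  by apply: (filterS _ HB'') => n /= H; exact: H (Az_ n).
exact: cvg_comp cz' (cf z Az).
Qed.

Lemma cvg_pos_part (a_ : nat -> R) a : a_ n @[n --> \oo] --> a -> Num.max 0 (a_ n) @[n --> \oo] --> Num.max 0 a.
Proof.
move=> /cvgrPdist_le H; apply/cvgrPdist_le => e e0; apply: filterS (H e e0) => n.
apply: le_trans.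
by case: (max0P a) => -[-> ?]; case: (max0P (a_ n)) => -[-> ?]; rewrite ler_norml; apply/andP; split;
  have := ler_norm (a - a_ n); have := lerNnormlW (lexx `|a - a_ n|); lra.
Qed.

End half_line.

Lemma cvg_pair_nbhs (V : Type) (F : set_system V) (FF : Filter F) (S U : topologicalType) (f : V -> S) (g : V -> U)
    (a : S) (b : U) : f x @[x --> F] --> a -> g x @[x --> F] --> b -> (f x, g x) @[x --> F] --> (a, b).
Proof. by move=> ca cb; exact: cvg_pair ca cb. Qed.

Section scalar_nonlinearity.
Context {R : realType} {N : nat}.
Variable Omega : set 'rV[R]_N.
Hypothesis oO : open Omega.
Local Notation mu := (lebesgue_rV R N).
Local Notation leb := (@lebesgue_measure R).
Local Notation Rplus := [set t : R | 0 <= t].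

Let mO : measurable Omega. Proof. exact: open_measurable_rV. Qed.

Let pos (a : R) := Num.max 0 a.
Let pos_ge0 a : 0 <= pos a. Proof. by rewrite /pos le_max lexx. Qed.
Let pos_le a : pos a <= `|a|. Proof. by rewrite /pos ge_max normr_ge0 ler_norm. Qed.

Variable g : 'rV[R]_N -> R -> R.
Hypothesis g_meas : forall t, 0 <= t -> measurable_fun Omega (fun x => g x t).
Hypothesis g_cont : {within closure Omega `*` Rplus, continuous (fun z : 'rV[R]_N * R => g z.1 z.2)}.
Hypothesis g_ge0 : forall x t, Omega x -> 0 <= t -> 0 <= g x t.
Variables (C p q : R).
Hypotheses (p1 : 1 < p) (pq : p < q) (C0 : 0 <= C).
Hypothesis g_growth : forall x u, Omega x -> 0 <= u -> `|g x u| <= C * (`|u| `^ (p - 1) + `|u| `^ (q - 1)).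

Lemma growth_at0 x : Omega x -> g x 0 = 0.
Proof.
move=> Ox; apply/eqP; rewrite -normr_le0; apply: le_trans (g_growth Ox (lexx 0)) _.
by rewrite normr0 !powR0 ?addr0 ?mulr0// gt_eqF// subr_gt0// (lt_trans p1).
Qed.

Lemma pos_ext_cvg x (a_ : nat -> R) a : Omega x -> a_ n @[n --> \oo] --> a ->
  g x (Num.max 0 (a_ n)) @[n --> \oo] --> g x (Num.max 0 a).
Proof.
move=> Ox ca; have cO := @subset_closure _ Omega x Ox.
apply: (within_continuous_seq (z_ := fun n => (x, Num.max 0 (a_ n))) (z := (x, Num.max 0 a)) g_cont).
- by split => //=; exact: pos_ge0.
- by move=> n; split => //=; exact: pos_ge0.
- exact (cvg_pair_nbhs _ (cvg_cst x) (cvg_pos_part ca)).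
Qed.

Let gp x a := g x (pos a).

Lemma pos_ext_continuous x : Omega x -> continuous (fun a : R => g x (Num.max 0 a)).
Proof.
move=> Ox a; apply/cvgrPdist_le => e e0; apply: contrapT => nE.
have /choice[a_ Ha] : forall n : nat, exists b : R, `|a - b| < n.+1%:R^-1 /\ ~ (`|g x (Num.max 0 a) - g x (Num.max 0 b)| <= e).
  move=> n; apply: contrapT => nb; apply: nE; apply/nbhs_ballP; exists n.+1%:R^-1; first by rewrite /= invr_gt0.
  by move=> b ab; apply: contrapT => H; apply: nb; exists b.
have ca : a_ n @[n --> \oo] --> a.
  apply/cvgrPdist_le => d d0; apply: filterS (near_infty_natSinv_lt (PosNum d0)) => n /= /ltW nd.
  by apply: le_trans nd; apply/ltW; case: (Ha n).
have /cvgrPdist_le/(_ e e0)[k _ /(_ k (leqnn k)) H] := pos_ext_cvg Ox ca.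
by have [_] := Ha k; apply.
Qed.

(** g is continued to negative arguments by its value at 0, and integrals start at -1: every t >= 0
    becomes an interior point, where the two-sided fundamental theorem applies. *)
Lemma primitive_deriv x t : Omega x -> 0 <= t -> deriv_Rplus (primitive g x) t (g x t).
Proof.
move=> Ox t0; have cg := pos_ext_continuous Ox.
have ig (a b : R) : leb.-integrable `[a, b] (EFin \o gp x).
  by apply: continuous_compact_integrable; [exact: segment_compact|apply: continuous_subspaceT => y; exact: cg].
have PE y : 0 <= y -> primitive g x y = \int[leb]_(s in `[-1, y]) gp x s - \int[leb]_(s in `[-1, 0]) gp x s.
  move=> y0; rewrite (@Rintegral_itvB _ _ (BLeft (-1)) (BRight y) 0)//=; last by rewrite bnd_simp.
  rewrite Rintegral_itv_obnd_cbnd; last first.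
      apply: integrableS (ig 0 y) => // s.
      by rewrite /= !in_itv/= => /andP[/ltW -> ->].
  apply: eq_Rintegral => s; rewrite inE/= in_itv/= => /andP[s0 _].
  by rewrite /gp /pos max_r.
have tt : t < t + 1 by rewrite ltrDl.
have t1 : -1 < t by lra.
have [dF FE] := continuous_FTC1_closed tt (ig (-1) (t + 1)) t1 (cg t).
have D : is_derive t 1 (fun y => \int[leb]_(s in `[-1, y]) gp x s) (g x t).
  by apply: DeriveDef => //; rewrite -derive1E FE /gp /pos max_r.
have c : k^-1 *: (\int[leb]_(s in `[-1, k *: (1 : R^o) + t]) gp x s - \int[leb]_(s in `[-1, t]) gp x s) @[k --> 0^'] --> (g x t : R^o).
  by case: D => dF' <-; exact: dF'.
move=> A /c HA; pose I y := \int[leb]_(s in `[-1, y]) gp x s.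
have HA' : nbhs (0 : R) [set k : R | k != 0 -> A (k^-1 *: (I (k *: (1 : R^o) + t) - I t))] := HA.
suff : nbhs (0 : R) [set k : R | k != 0 -> 0 <= t + k -> A (k^-1 * (primitive g x (t + k) - primitive g x t))] by [].
apply: (filterS _ HA') => k Hk k0 tk; have := Hk k0.
rewrite !PE// [k *: (1 : R^o)]mulr1 [k + t]addrC -!/(I _) /GRing.scale/=; congr A; congr (_ * _); ring.
Qed.

Lemma primitive0 x : primitive g x 0 = 0.
Proof. by rewrite /primitive set_itv1 Rintegral_set1. Qed.

Lemma measurable_primitive t : measurable_fun Omega (fun x => primitive g x t).
Proof.
pose D := Omega `*` (`[0, t]%classic : set (measurableTypeR R)).
have mD : measurable D by apply: measurableX.
have mh : measurable_fun D (fun z : 'rV[R]_N * measurableTypeR R => g z.1 (Num.max 0 z.2)).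
  apply: (@measurable_caratheodory _ _ _ _ (fun z a => g z.1 (Num.max 0 a)) snd) => // [a|z a_ a [/= Oz _]].
    apply: (@measurable_comp _ _ _ _ _ _ Omega (fun x => g x (Num.max 0 a)) _ fst) => //.
    - by move=> _ [z [Oz _] <-].
    - exact: g_meas.
    - exact: measurable_funS measurable_fst.
  exact: pos_ext_cvg.
pose f := (fun z : 'rV[R]_N * measurableTypeR R => (g z.1 (Num.max 0 z.2))%:E) \_ D.
have mh' := (measurable_EFinP _ _).2 mh.
have mf : measurable_fun setT f by exact: (measurable_restrictT _ mD).1 mh'.
have f0 z : (0 <= f z)%E.
  rewrite /f patchE; case: ifPn => // /set_mem [Oz _]; rewrite lee_fin; exact: g_ge0.
have mF := @measurable_fun_fubini_tonelli_F _ _ _ _ _ leb f mf f0.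
have : measurable_fun Omega (fine \o fubini_F leb f).
  by apply: (measurable_funS measurableT) => //; exact: measurableT_comp.
apply: eq_measurable_fun => x; rewrite inE => Ox.
rewrite /= /fubini_F /primitive /Rintegral [in RHS]integral_mkcond; congr fine.
apply: eq_integral => y _; rewrite /f !patchE.
have [/set_mem yt|yt] := boolP (y \in _).
  rewrite mem_set ?max_r//; by move: yt; rewrite /= in_itv/= => /andP[].
by rewrite memNset// => -[_ /= yt']; move: yt; rewrite mem_set.
Qed.

Lemma scalar_nonlinearity : nonlinearity Omega q q (4 * (4 * C)) (fun x a _ => primitive g x (Num.max 0 a))
  (fun x a _ => g x (Num.max 0 a)) (fun _ _ _ => 0).
Proof.
have q0 : 0 < q by rewrite (lt_trans _ pq)// (lt_trans _ p1).
have dG x : Omega x -> forall t : R, is_derive t 1 (fun a => primitive g x (Num.max 0 a)) (g x (Num.max 0 t)).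
  by move=> Ox; apply: is_derive_pos_part => [t t0|]; [exact: primitive_deriv|exact: growth_at0].
apply: (nonlinearity_intro mO q0 q0); first by rewrite mulr_ge0.
- move=> a _; split; [exact: measurable_primitive|exact: g_meas|exact: measurable_cst].
- move=> x a_ _ a _ Ox ca _; split; [|exact: pos_ext_cvg|exact: cvg_cst].
  have /differentiable_continuous cG : differentiable (fun a : R => primitive g x (Num.max 0 a)) a.
    by apply/derivable1_diffP; case: (dG x Ox a).
  exact: cvg_comp ca cG.
- by move=> x a b Ox; split; [exact: dG|exact: is_derive_cst].
- by move=> x Ox; rewrite maxxx primitive0.
- move=> x a b w z Ox; rewrite normr0 mul0r addr0.
  have := g_growth Ox (pos_ge0 a); rewrite (ger0_norm (pos_ge0 _)) => h.
  have [p10 q10] : 0 <= p - 1 /\ 0 <= q - 1 by move: p1 pq; lra.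
  have ha := ler_powR_base p10 (pos_ge0 a) (pos_le a); have hb := ler_powR_base q10 (pos_ge0 a) (pos_le a).
  have {}h : `|g x (pos a)| <= C * (`|a| `^ (p - 1) + `|a| `^ (q - 1)).
    by apply: le_trans h _; apply: ler_wpM2l => //; exact: lerD.
  apply: le_trans (ler_wpM2r (normr_ge0 w) h) _.
  rewrite [4 * C]mulrC -!mulrA ler_wpM2l// mulrDl.
  have q1' : 1 <= q by move: p1 pq; lra.
  have h1 := powR_mul_le (ltW p1) (normr_ge0 a) (normr_ge0 w).
  have h2 := powR_mul_le q1' (normr_ge0 a) (normr_ge0 w).
  have p00 : 0 <= p by move: p1; lra.
  have h3 := powR_le_mixed p00 (ltW pq) (normr_ge0 a); have h4 := powR_le_mixed p00 (ltW pq) (normr_ge0 w).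
  by move: h1 h2 h3 h4 (powR_ge0 `|a| q) (powR_ge0 `|w| q) (powR_ge0 `|b| q) (powR_ge0 `|z| q); lra.
Qed.

End scalar_nonlinearity.

(** * The coupling term *)

Section coupling_nonlinearity.
Context {R : realType} {N : nat}.
Variable Omega : set 'rV[R]_N.
Hypothesis oO : open Omega.
Local Notation mu := (lebesgue_rV R N).
Local Notation Rplus := [set t : R | 0 <= t].

Let mO : measurable Omega. Proof. exact: open_measurable_rV. Qed.

Lemma ae_cbox (P : 'rV[R]_N -> Prop) a (r : R) : 0 < r -> {ae mu, forall x, P x} -> exists2 x, cbox a r x & P x.
Proof.
move=> r0 [A [mA A0 PA]]; apply: contrapT => nE.
have sub : cbox a r `<=` A.
  by move=> x ax; apply: PA => /= Px; apply: nE; exists x.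
have : (mu (cbox a r) <= 0)%E by rewrite -A0; exact: (le_measure mu (mem_set (measurable_cbox a r)) (mem_set mA) sub).
by rewrite lebesgue_cbox ?(ltW r0)// lee_fin leNgt exprn_gt0// mulr_gt0.
Qed.

Lemma continuous3_near (f : 'rV[R]_N -> R -> R -> R) x a b (e : R) : continuous3 Omega f -> Omega x -> 0 <= a -> 0 <= b ->
  0 < e -> \forall y \near x, Omega y -> `|f x a b - f y a b| <= e.
Proof.
move=> /subspace_continuousP cf Ox a0 b0 e0.
have Az : ((Omega `*` Rplus) `*` Rplus) (x, a, b) by [].
have /cvgrPdist_le/(_ e e0) H := cf _ Az.
have H' : nbhs (x, a, b) [set z | ((Omega `*` Rplus) `*` Rplus) z -> `|f x a b - f z.1.1 z.1.2 z.2| <= e] := H.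
have cm : (y, a, b) @[y --> x] --> (x, a, b).
  exact: (cvg_pair_nbhs _ (cvg_pair_nbhs _ cvg_id (cvg_cst a)) (cvg_cst b)).
have H'' : nbhs x [set y | ((Omega `*` Rplus) `*` Rplus) (y, a, b) -> `|f x a b - f y a b| <= e] := cm _ H'.
by apply: (filterS _ H'') => y Hy Oy; apply: Hy.
Qed.

Lemma continuous3_measurable (f : 'rV[R]_N -> R -> R -> R) a b : continuous3 Omega f -> 0 <= a -> 0 <= b ->
  measurable_fun Omega (fun x => f x a b).
Proof.
move=> cf a0 b0; apply: (measurability _ (RGenOInfty.measurableE R)).
move=> _ [_ [c ->] <-]; apply: open_measurable_rV.
rewrite openE => x [Ox]; rewrite /= in_itv/= andbT => cx.
have e0 : 0 < (f x a b - c) / 2 by rewrite divr_gt0// subr_gt0.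
have Onear : \forall y \near x, Omega y by exact: open_nbhs_nbhs.
apply: filterS2 (continuous3_near cf Ox a0 b0 e0) Onear => y Hy Oy.
split => //=; rewrite in_itv/= andbT; have := Hy Oy; rewrite ler_norml => /andP[_ ?]; lra.
Qed.

Lemma continuous3_seq (f : 'rV[R]_N -> R -> R -> R) x (a_ b_ : nat -> R) (a b : R) : continuous3 Omega f -> Omega x ->
  a_ n @[n --> \oo] --> a -> b_ n @[n --> \oo] --> b ->
  f x (Num.max 0 (a_ n)) (Num.max 0 (b_ n)) @[n --> \oo] --> f x (Num.max 0 a) (Num.max 0 b).
Proof.
have m0 (y : R) : 0 <= Num.max 0 y by rewrite le_max lexx.
move=> cf Ox ca cb; apply: (within_continuous_seq (z_ := fun n => (x, Num.max 0 (a_ n), Num.max 0 (b_ n)))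
   (z := (x, Num.max 0 a, Num.max 0 b)) cf).
- by split; [split|]; [|exact: m0|exact: m0].
- by move=> n; split; [split|]; [|exact: m0|exact: m0].
- exact (cvg_pair_nbhs _ (cvg_pair_nbhs _ (cvg_cst x) (cvg_pos_part ca)) (cvg_pos_part cb)).
Qed.

Lemma continuous3_ae0 (f : 'rV[R]_N -> R -> R -> R) a b : continuous3 Omega f -> 0 <= a -> 0 <= b ->
  {ae mu, forall x, Omega x -> f x a b = 0} -> forall x, Omega x -> f x a b = 0.
Proof.
move=> cf a0 b0 f0 x Ox; apply/eqP; rewrite -normr_le0; apply/ler_addgt0Pr => e e0; rewrite add0r.
have Onear : \forall y \near x, Omega y by exact: open_nbhs_nbhs.
have /open_cbox H : open ([set y | Omega y /\ `|f x a b - f y a b| <= e]^°)%classic by exact: open_interior.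
have [|r r0 Hr] := H x.
  by apply: filterS2 (continuous3_near cf Ox a0 b0 e0) Onear => y Hy Oy; split => //; exact: Hy.
have [y ry fy] := ae_cbox x r0 f0; have [Oy] := interior_subset (Hr y ry).
by rewrite fy// subr0.
Qed.

Variables (f1 f2 F : 'rV[R]_N -> R -> R -> R) (q C : R).
Hypotheses (FC1 : C1_regular Omega F) (dF : forall x u v, Omega x -> 0 <= u -> 0 <= v ->
   deriv_Rplus (fun t => F x t v) u (f1 x u v) /\ deriv_Rplus (fun t => F x u t) v (f2 x u v)).
Hypotheses (q1 : 1 <= q) (C0 : 0 <= C) (growth : forall x u v, Omega x -> 0 <= u -> 0 <= v ->
   `|f1 x u v| + `|f2 x u v| <= C * (`|u| `^ (q - 1) + `|v| `^ (q - 1) + 1)).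
Hypotheses (f1_axes : {ae mu, forall x, Omega x -> forall u v, 0 <= u -> 0 <= v -> f1 x u 0 = 0 /\ f1 x 0 v = 0})
  (f2_axes : {ae mu, forall x, Omega x -> forall u v, 0 <= u -> 0 <= v -> f2 x u 0 = 0 /\ f2 x 0 v = 0}).

Lemma C1_continuous3 : continuous3 Omega f1 /\ continuous3 Omega f2.
Proof.
have [_ [Fx [Fu [Fv [_ cu cv D]]]]] := FC1.
have E (f g : 'rV[R]_N -> R -> R -> R) : (forall x u v, Omega x -> 0 <= u -> 0 <= v -> f x u v = g x u v) ->
    continuous3 Omega g -> continuous3 Omega f.
  move=> fg; rewrite /continuous3; apply: subspace_eq_continuous => z.
  by rewrite inE => -[[? ?] ?] /=; rewrite /from_subspace fg.
split; [apply: E cu|apply: E cv] => x u v Ox u0 v0; have [_ d1 d2] := D x u v Ox u0 v0; have [e1 e2] := dF Ox u0 v0.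
  exact: deriv_Rplus_unique u0 e1 d1.
exact: deriv_Rplus_unique v0 e2 d2.
Qed.

(** f1 and f2 agree with the continuous partial derivatives of F and are thus continuous in x too; a
    property that holds almost everywhere then holds everywhere, as boxes have positive measure. *)
Lemma axes0 x t : Omega x -> 0 <= t -> [/\ f1 x t 0 = 0, f1 x 0 t = 0, f2 x t 0 = 0 & f2 x 0 t = 0].
Proof.
move=> Ox t0; have [c1 c2] := C1_continuous3; split.
- by apply: (continuous3_ae0 c1 t0 (lexx 0) _ Ox); apply: filterS f1_axes => y Hy Oy; exact: (Hy Oy t t t0 t0).1.
- by apply: (continuous3_ae0 c1 (lexx 0) t0 _ Ox); apply: filterS f1_axes => y Hy Oy; exact: (Hy Oy t t t0 t0).2.
- by apply: (continuous3_ae0 c2 t0 (lexx 0) _ Ox); apply: filterS f2_axes => y Hy Oy; exact: (Hy Oy t t t0 t0).1.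
- by apply: (continuous3_ae0 c2 (lexx 0) t0 _ Ox); apply: filterS f2_axes => y Hy Oy; exact: (Hy Oy t t t0 t0).2.
Qed.

(** Vanishing on the axes is what makes F differentiable after composition with positive parts.
    Subtracting F x 0 0 normalises the potential, which the growth of f1, f2 then controls. *)
Lemma coupling_nonlinearity (r1 r2 : R) : q <= r1 -> q <= r2 -> nonlinearity Omega r1 r2 (4 * (10 * C))
  (fun x a b => F x (Num.max 0 a) (Num.max 0 b) - F x 0 0)
  (fun x a b => f1 x (Num.max 0 a) (Num.max 0 b)) (fun x a b => f2 x (Num.max 0 a) (Num.max 0 b)).
Proof.
move=> qr1 qr2; have [c1 c2] := C1_continuous3; have [cF _] := FC1.
have m0 (y : R) : 0 <= Num.max 0 y by rewrite le_max lexx.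
have mle (y : R) : Num.max 0 y <= `|y| by rewrite ge_max normr_ge0 ler_norm.
have [q0 [r10 r20]] : 0 < q /\ 0 < r1 /\ 0 < r2 by split; [|split]; move: q1 qr1 qr2; lra.
apply: (nonlinearity_intro mO r10 r20); first by rewrite mulr_ge0.
- move=> a b; split; [|exact: continuous3_measurable|exact: continuous3_measurable].
  by apply: measurable_funB; exact: continuous3_measurable.
- move=> x a_ b_ a b Ox ca cb; split; [|exact: continuous3_seq|exact: continuous3_seq].
  by apply: cvgB; [exact: continuous3_seq|exact: cvg_cst].
- move=> x a b Ox; split.
    have D := @is_derive_pos_part R (fun t => F x t (Num.max 0 b)) (fun t => f1 x t (Num.max 0 b))
      (fun t t0 => (dF Ox t0 (m0 b)).1).
    have [_ E _ _] := axes0 Ox (m0 b); have {}D := D E a.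
    by have := is_deriveB D (is_derive_cst (F x 0 0) a 1); rewrite subr0.
  have D := @is_derive_pos_part R (fun t => F x (Num.max 0 a) t) (fun t => f2 x (Num.max 0 a) t)
    (fun t t0 => (dF Ox (m0 a) t0).2).
  have [_ _ E _] := axes0 Ox (m0 a); have {}D := D E b.
  by have := is_deriveB D (is_derive_cst (F x 0 0) b 1); rewrite subr0.
- by move=> x Ox; rewrite maxxx subrr.
- move=> x a b w z Ox; have := growth Ox (m0 a) (m0 b).
  have q10 : 0 <= q - 1 by move: q1; lra.
  rewrite !(ger0_norm (m0 _)) => h.
  have ha := ler_powR_base q10 (m0 a) (mle a); have hb := ler_powR_base q10 (m0 b) (mle b).
  have {}h : `|f1 x (Num.max 0 a) (Num.max 0 b)| + `|f2 x (Num.max 0 a) (Num.max 0 b)| <=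
      C * (`|a| `^ (q - 1) + `|b| `^ (q - 1) + 1).
    by apply: le_trans h _; apply: ler_wpM2l => //; rewrite lerD2r; exact: lerD.
  apply: (@le_trans _ _ (C * (`|a| `^ (q - 1) + `|b| `^ (q - 1) + 1) * (`|w| + `|z|))).
    apply: le_trans (ler_wpM2r (addr_ge0 (normr_ge0 w) (normr_ge0 z)) h).
    have := normr_ge0 w; have := normr_ge0 z.
    have := normr_ge0 (f1 x (Num.max 0 a) (Num.max 0 b)); have := normr_ge0 (f2 x (Num.max 0 a) (Num.max 0 b)).
    move: `|f1 _ _ _| `|f2 _ _ _| `|w| `|z| => s t w' z' s0 t0 w0 z0.
    rewrite mulrDl !mulrDr -addrA lerD2l addrA lerDr.
    exact: (addr_ge0 (mulr_ge0 t0 w0) (mulr_ge0 s0 z0)).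
  rewrite [10 * C]mulrC -!mulrA ler_wpM2l// !mulrDl !mulrDr !mul1r.
  have h1 := powR_mul_le q1 (normr_ge0 a) (normr_ge0 w); have h2 := powR_mul_le q1 (normr_ge0 a) (normr_ge0 z).
  have h3 := powR_mul_le q1 (normr_ge0 b) (normr_ge0 w); have h4 := powR_mul_le q1 (normr_ge0 b) (normr_ge0 z).
  have k1 := powR_le_mixed (ltW q0) qr1 (normr_ge0 a); have k2 := powR_le_mixed (ltW q0) qr1 (normr_ge0 w).
  have k3 := powR_le_mixed (ltW q0) qr2 (normr_ge0 b); have k4 := powR_le_mixed (ltW q0) qr2 (normr_ge0 z).
  have l1 := powR_le_mixed ler01 (le_trans q1 qr1) (normr_ge0 w); have l2 := powR_le_mixed ler01 (le_trans q1 qr2) (normr_ge0 z).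
  rewrite !powRr1// in l1 l2.
  move: h1 h2 h3 h4 k1 k2 k3 k4 l1 l2 (powR_ge0 `|a| r1) (powR_ge0 `|b| r2) (powR_ge0 `|w| r1) (powR_ge0 `|z| r2).
  by lra.
Qed.

End coupling_nonlinearity.

(** * Fibering maps *)

Section fibering.
Context {R : realType}.
Variables (g G : R -> R) (p alpha : R).
Hypotheses (p1 : 1 < p) (dG : forall t : R, is_derive t 1 G (g t)).

Let p0 : 0 < p. Proof. by rewrite (lt_trans _ p1). Qed.

Let powRS (t b : R) : 0 < t -> t `^ (b + 1) = t `^ b * t.
Proof. by move=> t0; rewrite powRD ?powRr1 ?(ltW t0)// (gt_eqF t0) implybT. Qed.

Let powR_pred (t : R) : 0 < t -> t `^ p = t `^ (p - 1) * t.
Proof. by move=> t0; rewrite -powRS// subrK. Qed.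

Let cont (f df : R -> R) (i : interval R) : (forall t, t \in i -> is_derive t 1 f (df t)) ->
  {within [set` i], continuous f}.
Proof.
by move=> H; apply: derivable_within_continuous => t ti; case: (H t ti).
Qed.

Let dGa a (t : R) : is_derive t 1 (fun y => G (y * a)) (g (t * a) * a).
Proof.
have D : is_derive t 1 (fun y : R => y * a) a.
  by have := is_deriveM (is_derive_id t 1) (is_derive_cst a t 1); rewrite scaler0 add0r /GRing.scale/= mulr1.
exact: (is_derive1_comp (dG _) D).
Qed.

Lemma fiber_strict (a t : R) : (forall u u', 0 < u -> u < u' -> g u / u `^ (p - 1) < g u' / u' `^ (p - 1)) ->
  0 < a -> 0 < t -> (t < 1 -> g (t * a) * (t * a) < t `^ p * (g a * a)) /\
  (1 < t -> t `^ p * (g a * a) < g (t * a) * (t * a)).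
Proof.
move=> inc a0 t0; have ta0 : 0 < t * a by rewrite mulr_gt0.
have tp := powR_gt0 (p - 1) t0; have ap := powR_gt0 (p - 1) a0.
rewrite (powR_pred t0) (_ : t `^ (p - 1) * t * (g a * a) = t `^ (p - 1) * g a * (t * a)); last by ring.
rewrite !(ltr_pM2r ta0); split => t1.
- have := inc (t * a) a ta0; rewrite gtr_pMl// => /(_ t1).
  by rewrite powRM ?(ltW t0) ?(ltW a0)// ltr_pdivrMr ?mulr_gt0// mulrCA divfK ?gt_eqF.
- have := inc a (t * a) a0; rewrite ltr_pMl// => /(_ t1).
  by rewrite powRM ?(ltW t0) ?(ltW a0)// ltr_pdivlMr ?mulr_gt0// mulrCA divfK ?gt_eqF.
Qed.

(** By [fiber_strict], the derivative of psi is negative before 1 and positive after it, so psi has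
    a strict minimum at 1. *)
Lemma fiber_primitive (a t : R) : (forall u u', 0 < u -> u < u' -> g u / u `^ (p - 1) < g u' / u' `^ (p - 1)) ->
  0 < a -> 0 < t -> t != 1 -> G a + (t `^ p - 1) / p * (g a * a) < G (t * a).
Proof.
move=> inc a0 t0 t1; pose psi y := G (y * a) - y `^ p * (g a * a / p).
pose dpsi y := g (y * a) * a - p * y `^ (p - 1) * (g a * a / p).
have D (y : R) : 0 < y -> is_derive y 1 psi (dpsi y).
  move=> y0; apply: is_deriveB; first exact: dGa.
  have := is_deriveM (is_derive1_powR p y0) (is_derive_cst (g a * a / p) y 1).
  by rewrite scaler0 add0r => H; apply: is_derive_eq H _; exact: mulrC.
have dpsiE y : 0 < y -> dpsi y = (g (y * a) * (y * a) - y `^ p * (g a * a)) / y.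
  by move=> y0; rewrite /dpsi (powR_pred y0); field; rewrite !gt_eqF.
suff : psi 1 < psi t.
  rewrite /psi powR1 !mul1r ltrBrDr; apply: le_lt_trans.
  by rewrite le_eqVlt; apply/orP; left; apply/eqP; field; rewrite gt_eqF.
have [lt1|gt1] := ltP t 1.
  have Dt (y : R) : y \in `[t, 1] -> is_derive y 1 psi (dpsi y).
    by rewrite in_itv/= => /andP[ty _]; apply: D; exact: lt_le_trans t0 ty.
  have Do (y : R) : y \in `]t, 1[ -> is_derive y 1 psi (dpsi y).
    by move=> yt1; apply: Dt; exact: subset_itv_oo_cc yt1.
  have [c + E] := MVT lt1 Do (cont Dt).
  rewrite in_itv/= => /andP[tc c1]; have c0 := lt_trans t0 tc.
  rewrite -subr_lt0 E nmulr_rlt0 ?subr_gt0//.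
  by rewrite (dpsiE _ c0) pmulr_llt0 ?invr_gt0// subr_lt0; exact: (fiber_strict inc a0 c0).1.
have {}gt1 : 1 < t by rewrite lt_neqAle eq_sym t1.
have Dt (y : R) : y \in `[1, t] -> is_derive y 1 psi (dpsi y).
  by rewrite in_itv/= => /andP[ty _]; apply: D; exact: lt_le_trans ltr01 ty.
have Do (y : R) : y \in `]1, t[ -> is_derive y 1 psi (dpsi y).
    by move=> yt1; apply: Dt; exact: subset_itv_oo_cc yt1.
  have [c + E] := MVT gt1 Do (cont Dt).
rewrite in_itv/= => /andP[c1 ct]; have c0 := lt_trans ltr01 c1.
rewrite -subr_gt0 E (dpsiE _ c0) mulr_gt0 ?[0 < t - 1]subr_gt0//.
by rewrite mulr_gt0 ?invr_gt0// subr_gt0; exact: (fiber_strict inc a0 c0).2.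
Qed.

(** The condition alpha G u <= u g u says that y^(-alpha) G (y a) is nondecreasing in y. *)
Lemma superhomogeneous (a t : R) : (forall u, 0 < u -> alpha * G u <= u * g u) ->
  0 < a -> 1 <= t -> t `^ alpha * G a <= G (t * a).
Proof.
move=> AR a0 t1; pose chi y := G (y * a) * y `^ (- alpha).
pose dchi y := G (y * a) * (- alpha * y `^ (- alpha - 1)) + y `^ (- alpha) * (g (y * a) * a).
have t0 : 0 < t by exact: lt_le_trans t1.
have D (y : R) : y \in `[1, t] -> is_derive y 1 chi (dchi y).
  rewrite in_itv/= => /andP[y1 _]; have y0 : 0 < y by exact: lt_le_trans y1.
  exact: (is_deriveM (dGa a y) (is_derive1_powR (- alpha) y0)).
have Do (y : R) : y \in `]1, t[ -> is_derive y 1 chi (dchi y).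
  by move=> yt1; apply: D; exact: subset_itv_oo_cc yt1.
have [c + E] := MVT_segment t1 Do (cont D).
rewrite in_itv/= => /andP[c1 ct]; have c0 : 0 < c by exact: lt_le_trans c1.
have : chi 1 <= chi t.
  rewrite -subr_ge0 E mulr_ge0 ?subr_ge0//.
  have -> : dchi c = c `^ (- alpha - 1) * (c * a * g (c * a) - alpha * G (c * a)).
    have cE : c `^ (- alpha) = c `^ (- alpha - 1) * c.
      by rewrite -powRS// subrK.
    by rewrite /dchi cE; ring.
  by rewrite mulr_ge0 ?powR_ge0// subr_ge0 AR// mulr_gt0.
rewrite /chi mul1r powR1 mulr1 powRN ler_pdivlMr ?powR_gt0//.
by rewrite mulrC.
Qed.

End fibering.

(** * Slope at zero below the first eigenvalue *)

Section subcritical_slope.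
Context {R : realType} {N : nat}.
Variable Omega : set 'rV[R]_N.
Hypotheses (oO : open Omega) (bO : bounded_set Omega) (O0 : Omega !=set0).
Local Notation mu := (lebesgue_rV R N).
Variables (s p r C : R) (g : 'rV[R]_N -> R -> R).
Hypothesis A : admissible (N := N) s p r.
Hypotheses (pr : p < r) (C0 : 0 <= C) (g_ge0 : forall x t, Omega x -> 0 <= t -> 0 <= g x t).
Hypothesis g_growth : forall x u, Omega x -> 0 <= u -> `|g x u| <= C * (`|u| `^ (p - 1) + `|u| `^ (r - 1)).
Local Notation lam1 := (lambda1 Omega s p).

Let p1 : 1 < p. Proof. by case: A. Qed.
Let p0 : 0 < p. Proof. by rewrite (lt_trans _ p1). Qed.
Let mO : measurable Omega. Proof. exact: open_measurable_rV. Qed.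

Let powRS (t b : R) : 0 < t -> t `^ (b - 1) * t = t `^ b.
Proof. by move=> t0; rewrite -[in LHS](powRr1 (ltW t0)) -powRrM mul1r -powRD ?subrK// (gt_eqF t0) implybT. Qed.

Lemma limsup0_bound : (limsup0 Omega g p < lam1)%E -> exists2 l : R, 0 <= l /\ (l%:E < lam1)%E &
  exists2 del : R, 0 < del & forall x t, Omega x -> 0 < t -> t < del -> g x t <= l * t `^ (p - 1).
Proof.
move=> /ereal_inf_lt[y [V V0 <-]] yl.
have ratio x t : Omega x -> 0 < t -> V t ->
    ((g x t / t `^ (p - 1))%:E <= ereal_sup [set ereal_sup [set (g x t / (`|t| `^ (p - 2) * t))%:E | x in Omega] | t in V])%E.
  move=> Ox t0 Vt; apply: (@le_trans _ _ (ereal_sup [set (g x t / (`|t| `^ (p - 2) * t))%:E | x in Omega])).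
    apply: ereal_sup_ubound; exists x => //; rewrite (gtr0_norm t0) -[p - 1](_ : p - 2 + 1 = _); last by ring.
    by rewrite -(powRS (p - 2 + 1) t0) addrK.
  by apply: ereal_sup_ubound; exists t.
have [del del0 Hdel] : exists2 del : R, 0 < del & forall t, 0 < t -> t < del -> V t.
  have V' : nbhs (0 : R) [set t | 0 < t -> V t] := V0.
  have [e /= e0 He] := (nbhs_ballP _ _).1 V'; exists e => // t t0 te.
  by apply: He => //; rewrite /ball/= sub0r normrN gtr0_norm.
(* A point of Omega bounds the supremum below by 0, which excludes -oo and yields [0 <= l]. *)
have [x0 Ox0] := O0; have d2 : 0 < del / 2 by rewrite divr_gt0.
have Vd : V (del / 2) by apply: Hdel => //; lra.
have r0 := ratio x0 _ Ox0 d2 Vd.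
move: yl r0 ratio; case: (ereal_sup _) => [l yl r0 ratio| |]; [|by rewrite ltNge leey|by []].
exists l; first split => //.
  by move: r0; rewrite lee_fin; apply: le_trans; rewrite divr_ge0 ?powR_ge0// g_ge0// ltW.
exists del => // x t Ox t0 td; have := ratio x t Ox t0 (Hdel t t0 td).
by rewrite lee_fin ler_pdivrMr// powR_gt0.
Qed.

Lemma lambda1_le (l : R) u : (l%:E <= lam1)%E -> X0 Omega s p u ->
  l * \int[mu]_(x in Omega) (`|u x| `^ p) <= fnorm s p u `^ p.
Proof.
move=> ll Xu; have [_ _ spN _ _] := A; set I := Rintegral _ _ _.
have I0 : 0 <= I by apply: Rintegral_ge0 => x _; exact: powR_ge0.
have [E|/eqP In0] := eqVneq I 0; first by rewrite E mulr0 powR_ge0.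
have Ip : 0 < I by rewrite lt_neqAle eq_sym I0 andbT; apply/eqP.
have mup : measurable_fun Omega (fun x => `|u x| `^ p).
  apply: (measurable_funS measurableT) => //.
  apply: (measurableT_comp (measurable_powR p)); apply: measurableT_comp => //.
  exact: X0_measurable Xu.
have un0 : ~ (u = cst 0 %[ae mu]).
  move=> u0; apply: In0.
  have m0 : measurable_fun Omega (fun=> 0 : R) by exact: measurable_cst.
  rewrite /I (Rintegral_ae_eq mO mup m0); first by rewrite Rintegral_cst// mul0r.
  by apply: filterS u0 => x /(_ Logic.I) -> _; rewrite normr0 powR0// gt_eqF.
have : (lam1 <= (X0norm Omega s p u `^ p / Lpnorm Omega p u `^ p)%:E)%E.
  by apply: ereal_inf_lbound; exists u.
move=> /(le_trans ll); rewrite lee_fin.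
rewrite (X0norm_Lp oO p1 Xu) -/(fnorm s p u).
have -> : Lpnorm Omega p u `^ p = I by rewrite /Lpnorm -powRrM mulVf ?gt_eqF// powRr1.
by rewrite ler_pdivlMr.
Qed.

(** Below del the slope bound l applies, and above it all growth is absorbed into the r-th power.
    The quotient theta = l / l' is below 1 because l' lies strictly above l and still does not
    exceed the first eigenvalue. *)
Lemma subcritical_at0 : (limsup0 Omega g p < lam1)%E ->
  (forall u, X0 Omega s p u -> mu.-integrable Omega (EFin \o (fun x => g x (Num.max 0 (u x)) * u x))) ->
  exists theta K : R, [/\ 0 <= theta < 1, 0 <= K & forall u, X0 Omega s p u ->
    \int[mu]_(x in Omega) (g x (Num.max 0 (u x)) * u x) <= theta * fnorm s p u `^ p + K * fnorm s p u `^ r].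
Proof.
move=> /limsup0_bound[l [l0 ll] [del del0 Hdel]] int.
(* A real l' is needed even if the infimum is infinite. *)
have [l' ll' l'l] : exists2 l' : R, l < l' & (l'%:E <= lam1)%E.
  move: ll; case: lam1 => [b| |] //; first by rewrite lte_fin; exists b.
  by exists (l + 1); rewrite ?ltrDl ?leey.
have l'0 : 0 < l' by exact: le_lt_trans ll'.
have r0 : 0 < r by rewrite (lt_trans p0).
pose k := C * (1 + del `^ p / del `^ r).
have k0 : 0 <= k by rewrite mulr_ge0// addr_ge0// divr_ge0// powR_ge0.
have g00 x : Omega x -> g x 0 = 0 by exact: (growth_at0 p1 pr g_growth).
have pw x a : Omega x -> g x (Num.max 0 a) * a <= l * `|a| `^ p + k * `|a| `^ r.
  move=> Ox; have [a0|a0] := ltP 0 a; last first.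
    by rewrite g00// mul0r addr_ge0// mulr_ge0// powR_ge0.
  rewrite (gtr0_norm a0) -(powRS p a0) mulrA; have [ad|da] := ltP a del.
    apply: ler_wpDr; first by rewrite mulr_ge0// powR_ge0.
    by rewrite ler_pM2r//; exact: Hdel.
  apply: ler_wpDl; first by rewrite mulr_ge0 ?(ltW a0)// mulr_ge0// powR_ge0.
  have ap : a `^ p <= del `^ p / del `^ r * a `^ r.
    have ad1 : 1 <= a / del by rewrite ler_pdivlMr// mul1r.
    have E b : a `^ b = del `^ b * (a / del) `^ b.
      by rewrite -powRM ?(ltW del0) ?divr_ge0 ?(ltW a0) ?(ltW del0)// mulrC divfK// gt_eqF.
    rewrite (E p) (E r) -mulrA mulKf ?gt_eqF ?powR_gt0//.
    by apply: ler_wpM2l; [exact: powR_ge0|apply: ler_powR => //; exact: ltW].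
  have := g_growth Ox (ltW a0); rewrite (gtr0_norm a0) => /(le_trans (ler_norm _)) h.
  apply: le_trans (ler_wpM2r (ltW a0) h) _.
  rewrite -mulrA mulrDl !powRS// /k -mulrA ler_wpM2l// mulrDl mul1r addrC lerD2l.
  exact: ap.
have A' := A; have [s01 _ spN _ _] := A'.
have es := X0_energy_space oO bO A; have [Cs Cs0 HCs] := es_sob es.
exists (l / l'), (k * Cs); split.
- by rewrite divr_ge0 ?(ltW l'0)//= ltr_pdivrMr// mul1r.
- by rewrite mulr_ge0.
- move=> u Xu; have [_ ip _ _] := Xu; have [_ ir] := es_Lr es Xu.
  have i1 := integrable_RZ mO l ip; have i2 := integrable_RZ mO k ir.
  apply: (@le_trans _ _ (\int[mu]_(x in Omega) (l * `|u x| `^ p + k * `|u x| `^ r))).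
    apply: (le_Rintegral mO (int u Xu)); first exact: integrable_RD.
    by move=> x Ox; exact: pw.
  rewrite (RintegralD mO i1 i2) (RintegralZl _ mO ip) (RintegralZl _ mO ir); apply: lerD.
    rewrite mulrAC -mulrA; apply: ler_wpM2l => //; rewrite ler_pdivlMr// mulrC.
    exact: lambda1_le.
  by rewrite -mulrA; apply: ler_wpM2l => //; exact: HCs.
Qed.

End subcritical_slope.

(** * Scalar problem *)

Section representatives.
Context {R : realType} {N : nat}.
Variable (Omega : set 'rV[R]_N).
Hypotheses (oO : open Omega) (bO : bounded_set Omega).
Local Notation mu := (lebesgue_rV R N).
Variables (s p r : R).
Hypothesis A : admissible (N := N) s p r.
Local Notation X := (X0 Omega s p).
Local Notation nm := (fnorm s p).

Let s01 : 0 < s < 1. Proof. by case: A. Qed.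
Let p1 : 1 < p. Proof. by case: A. Qed.
Let spN : s * p < N%:R. Proof. by case: A. Qed.
Let p0 : 0 < p. Proof. by rewrite (lt_trans _ p1). Qed.

Lemma fnorm_ae0 u : X u -> {ae mu, forall x, u x = 0} -> nm u = 0.
Proof.
move=> Xu u0; have [mf _] := X0_fLp oO p1 Xu.
have mfp : measurable_fun setT (fun z => `|frac_diff s p u z| `^ p).
  by apply: (measurableT_comp (measurable_powR p)); exact: measurableT_comp.
have m0 : measurable_fun [set: 'rV[R]_N * 'rV[R]_N] (fun=> 0 : R) by exact: measurable_cst.
rewrite /fnorm Lp_normEE Lp_energyE (Rintegral_ae_eq measurableT mfp m0).
  by rewrite /Rintegral integral0 powR0// invr_neq0// gt_eqF.
apply: filterS (ae_prod u0) => z [z1 z2] _.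
by rewrite /frac_diff z1 z2 subrr mul0r normr0 powR0// gt_eqF.
Qed.

#[local] Opaque X0 fnorm frac_plap.

Let es := X0_energy_space oO bO A.

(** Independence of the representative is uniform continuity of the duality map at distance 0. *)
Lemma frac_plap_ae u u' w : X u -> X u' -> X w -> {ae mu, forall x, u x = u' x} ->
  frac_plap s p u w = frac_plap s p u' w.
Proof.
move=> Xu Xu' Xw uu'; have d0 : nm (fun x => u x - u' x) = 0.
  by apply: (fnorm_ae0 (es_B es Xu Xu')); apply: filterS uu' => x ->; rewrite subrr.
have c0 : 0 < nm w + 1 by rewrite ltr_wpDl// (es_ge0 es).
have Xw' := es_Z es (nm w + 1)^-1 Xw.
have w'1 : nm (fun x => (nm w + 1)^-1 * w x) <= 1.
  by rewrite (es_nZ es _ Xw) gtr0_norm ?invr_gt0// ler_pdivrMl// mulr1 lerDl.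
suff : frac_plap s p u (fun x => (nm w + 1)^-1 * w x) = frac_plap s p u' (fun x => (nm w + 1)^-1 * w x).
  by rewrite (es_plZ es _ Xu Xw) (es_plZ es _ Xu' Xw) => /(mulfI _); apply; rewrite invr_neq0// gt_eqF.
apply/eqP; rewrite -subr_eq0 -normr_le0; apply/ler_addgt0Pr => e e0; rewrite add0r.
have [d dd H] := es_unif es (nm u) e0.
by apply: (H _ _ _ Xu Xu' Xw' (lexx _) w'1); rewrite d0 ltW.
Qed.

Lemma X0_pos_part u : X u -> X (fun x => Num.max 0 (u x)).
Proof.
move=> Xu; apply: (X0_lip2 oO bO s01 p1 spN Xu Xu (lexx 0)).
- by apply: measurable_maxr; [exact: measurable_cst|exact: X0_measurable Xu].
- by apply: filterS (X0_zero Xu) => x H nO; rewrite H// maxxx.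
- move=> x y; rewrite mul0r addr0.
  case: (max0P (u x)) => -[-> ?]; case: (max0P (u y)) => -[-> ?]; rewrite ler_norml; apply/andP; split;
    have := ler_norm (u x - u y); have := lerNnormlW (lexx `|u x - u y|); lra.
Qed.

Lemma X0_min1 u : X u -> X (fun x => Num.min (Num.max 0 (u x)) 1).
Proof.
move=> Xu; have Xp := X0_pos_part Xu; apply: (X0_lip2 oO bO s01 p1 spN Xp Xp (lexx 0)).
- by apply: measurable_minr; [exact: X0_measurable Xp|exact: measurable_cst].
- by apply: filterS (X0_zero Xu) => x H nO; rewrite H// maxxx min_l.
- move=> x y; rewrite mul0r addr0; move: (Num.max 0 (u x)) (Num.max 0 (u y)) => a b.
  case: (leP a 1) => ?; case: (leP b 1) => ?; rewrite ler_norml; apply/andP; split;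
    have := ler_norm (a - b); have := lerNnormlW (lexx `|a - b|); lra.
Qed.

(** The truncation of u0 at 1 provides the weight, positive on Omega with values in [0, 1], that
    [strong_maximum] tests with. *)
Lemma positive_of_super u u0 : X u -> nonneg_ae u -> ~ {ae mu, forall x, u x = 0} -> X u0 -> positive_ae Omega u0 ->
  (forall w, X w -> (forall x, 0 <= w x) -> 0 <= frac_plap s p u w) -> positive_ae Omega u.
Proof.
move=> Xu u_ge0 un0 Xu0 pu0 super.
apply: (strong_maximum oO bO s01 p1 spN Xu u_ge0 un0 (X0_min1 Xu0) _ _ super).
  by move=> x; rewrite le_min ler01 le_max lexx ge_min lexx orbT.
apply: filterS pu0 => x Hx Ox; rewrite lt_min ltr01 andbT lt_max (Hx Ox) orbT.
by [].
Qed.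

Lemma nonneg_pos_part u : nonneg_ae u -> {ae mu, forall x, Num.max 0 (u x) = u x}.
Proof. by apply: filterS => x ux; rewrite max_r. Qed.

End representatives.

Section scalar_problem.
Context {R : realType} {N : nat}.
Variable (Omega : set 'rV[R]_N).
Hypotheses (oO : open Omega) (bO : bounded_set Omega) (O0 : Omega !=set0).
Local Notation mu := (lebesgue_rV R N).
Local Notation Rplus := [set t : R | 0 <= t].
Variables (s p r C alpha : R) (g : 'rV[R]_N -> R -> R).
Hypothesis A : admissible (N := N) s p r.
Hypotheses (pr : p < r) (palpha : p < alpha) (C0 : 0 <= C).
Hypothesis g_meas : forall t, 0 <= t -> measurable_fun Omega (fun x => g x t).
Hypothesis g_cont : {within closure Omega `*` Rplus, continuous (fun z : 'rV[R]_N * R => g z.1 z.2)}.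
Hypothesis g_ge0 : forall x t, Omega x -> 0 <= t -> 0 <= g x t.
Hypothesis g_growth : forall x u, Omega x -> 0 <= u -> `|g x u| <= C * (`|u| `^ (p - 1) + `|u| `^ (r - 1)).
Hypothesis AR : forall x u, Omega x -> 0 < u -> 0 < alpha * primitive g x u <= u * g x u.
Hypothesis slope0 : (limsup0 Omega g p < lambda1 Omega s p)%E.
Hypothesis inc : forall x u u', Omega x -> 0 < u -> u < u' -> g x u / u `^ (p - 1) < g x u' / u' `^ (p - 1).
Local Notation X := (X0 Omega s p).
Local Notation nm := (fnorm s p).
Local Notation pl := (frac_plap s p).

Definition gplus (h : 'rV[R]_N -> R -> R) x a := h x (Num.max 0 a).
Local Notation S := (dpot mu Omega (gplus g)).
Local Notation P := (pot mu Omega (gplus (primitive g))).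

Let s01 : 0 < s < 1. Proof. by case: A. Qed.
Let p1 : 1 < p. Proof. by case: A. Qed.
Let spN : s * p < N%:R. Proof. by case: A. Qed.
Let p0 : 0 < p. Proof. by rewrite (lt_trans _ p1). Qed.
Let r0 : 0 < r. Proof. by rewrite (lt_trans p0). Qed.
Let mO : measurable Omega. Proof. exact: open_measurable_rV. Qed.
Let muO : (mu Omega < +oo)%E. Proof. exact: lebesgue_bounded_lty. Qed.

#[local] Opaque X0 fnorm frac_plap.

Let es := X0_energy_space oO bO A.
Let nl := scalar_nonlinearity oO g_meas g_cont g_ge0 p1 pr C0 g_growth.
Let C16 : 0 <= 4 * (4 * C). Proof. by rewrite !mulr_ge0. Qed.

Lemma source_compact : compact_functional mu Omega r r (fun u _ => P u) (fun u _ w _ => S u w).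
Proof. exact: (pot_compact mO muO es C16 nl). Qed.

Lemma source_integrable u w : X u -> X w -> mu.-integrable Omega (EFin \o (fun x => g x (Num.max 0 (u x)) * w x)).
Proof.
move=> Xu Xw; have du := X0_dom_cvg_cst oO bO A Xu; have dw := X0_dom_cvg_cst oO bO A Xw.
have [+ _] := dnem_cvg mO muO r0 r0 C16 nl du du dw du.
by apply: eq_integrable => // x _ /=; rewrite mul0r addr0.
Qed.

Lemma source_neg_part u : S u (neg_part u) = 0.
Proof.
rewrite /dpot; transitivity (\int[mu]_(x in Omega) (0 : R)); last by rewrite Rintegral_cst ?mul0r.
apply: eq_Rintegral => x /set_mem Ox.
rewrite /gplus /neg_part; case: (max0P (u x)) => -[-> ux].
  by rewrite max_l ?mulr0// oppr_le0.
by rewrite (growth_at0 p1 pr g_growth Ox) mul0r.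
Qed.

Lemma source_ge0 u w : (forall x, 0 <= w x) -> 0 <= S u w.
Proof.
move=> w0; apply: Rintegral_ge0 => x Ox; rewrite mulr_ge0//.
by apply: g_ge0 => //; rewrite le_max lexx.
Qed.

Lemma critical_nonneg u : X u -> (forall phi, X phi -> pl u phi = S u phi) -> nonneg_ae u.
Proof.
move=> Xu crit; apply: (neg_part_test oO bO s01 p1 spN Xu).
by rewrite (crit _ (X0_neg_part oO bO s01 p1 spN Xu)) source_neg_part.
Qed.

(** The variational source is g at the positive part of u; passing to this representative, equal to
    u almost everywhere, turns it into g at the solution itself. *)
Lemma critical_solution u : X u -> (forall phi, X phi -> pl u phi = S u phi) ->
  scalar_solution Omega s p g (fun x => Num.max 0 (u x)) /\ {ae mu, forall x, Num.max 0 (u x) = u x}.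
Proof.
move=> Xu crit; have up := nonneg_pos_part (critical_nonneg Xu crit); split; [|exact: up].
have Xp := X0_pos_part oO bO A Xu; split; first exact: Xp.
  by apply: aeW => x; rewrite le_max lexx.
move=> w Xw; rewrite (frac_plap_ae oO bO A Xp Xu Xw up) (crit w Xw).
exact: eq_Rintegral.
Qed.

(** Isolation is left as a premise: it comes from uniqueness of the positive solution, while w
    itself serves both halves of the theorem. *)
Lemma ground_state_exists : exists w, [/\ X w, 0 < nm w, forall phi, X phi -> pl w phi = S w phi &
  forall rad, rad < nm w ->
  (forall u, X u -> nm (fun x => u x - w x) <= rad -> (forall phi, X phi -> pl u phi - S u phi = 0) ->
    nm (fun x => u x - w x) = 0) ->
  ground_state p X nm pl P S w rad].
Proof.
have [theta [K [th0 K0 self]]] := subcritical_at0 oO bO O0 A pr C0 g_ge0 g_growth slope0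
  (fun u Xu => source_integrable Xu Xu).
pose C' := 4 * (4 * C) + K.
have C'0 : 0 <= C' by rewrite addr_ge0.
have nl' := nonlinearity_le (_ : 4 * (4 * C) <= C') nl.
have {}nl' := nl' ltac:(by rewrite lerDl).
have self' u : X u -> S u u <= theta * nm u `^ p + C' * nm u `^ r.
  move=> Xu; apply: le_trans (self u Xu) _; rewrite lerD2l; apply: ler_wpM2r; first exact: powR_ge0.
  by rewrite lerDr.
have pos_r (a : R) : 0 < a -> Num.max 0 a = a by move=> a0; rewrite max_r// ltW.
have dG x : Omega x -> forall t : R, is_derive t 1 (gplus (primitive g) x) (gplus g x t).
  move=> Ox; apply: is_derive_pos_part => [t t0|]; last exact: (growth_at0 p1 pr g_growth Ox).
  exact: (primitive_deriv g_cont Ox t0).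
have inc' x : Omega x -> forall u u', 0 < u -> u < u' -> gplus g x u / u `^ (p - 1) < gplus g x u' / u' `^ (p - 1).
  move=> Ox u u' u0 uu'; have u'0 := lt_trans u0 uu'.
  by rewrite /gplus (pos_r _ u0) (pos_r _ u'0); exact: (inc Ox u0 uu').
have gpos x a : Omega x -> 0 < a -> 0 < alpha * gplus (primitive g) x a <= a * gplus g x a.
  by move=> Ox a0; rewrite /gplus pos_r//; exact: AR.
have gneg x a : Omega x -> a <= 0 -> gplus (primitive g) x a = 0 /\ gplus g x a = 0.
  by move=> Ox a0; rewrite /gplus max_l// primitive0 (growth_at0 p1 pr g_growth Ox).
have gfib x a t : Omega x -> 0 < a -> 0 < t ->
  (t < 1 -> gplus g x (t * a) * (t * a) < t `^ p * (gplus g x a * a)) /\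
  (1 < t -> t `^ p * (gplus g x a * a) < gplus g x (t * a) * (t * a)).
  by move=> Ox a0 t0; exact: (fiber_strict (inc' x Ox) a0 t0).
have Gfib x a t : Omega x -> 0 < a -> 0 < t -> t != 1 ->
    gplus (primitive g) x a + (t `^ p - 1) / p * (gplus g x a * a) < gplus (primitive g) x (t * a).
  by move=> Ox a0 t0 t1; exact: (fiber_primitive p1 (dG x Ox) (inc' x Ox) a0 t0 t1).
have Gsuper x a t : Omega x -> 0 < a -> 1 <= t -> t `^ alpha * gplus (primitive g) x a <= gplus (primitive g) x (t * a).
  move=> Ox a0 t1; apply: (superhomogeneous (dG x Ox) _ a0 t1) => u u0.
  by have /andP[] := gpos x u Ox u0.
have Xpos : exists2 u, X u & ~ {ae mu, forall x, Omega x -> u x <= 0}.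
  have [u [Xu u0 un0]] := X0_nontrivial oO bO s01 p1 spN O0; exists u => // H; apply: un0.
  apply: filterS2 H (X0_zero Xu) => x Hx zx; have [Ox|/zx//] := pselect (Omega x).
  by apply/eqP; rewrite eq_le u0 andbT; exact: Hx.
have [w Nw wmin] := nehari_minimizer mO muO es C'0 pr palpha th0 nl' self' gpos gneg Gfib Gsuper Xpos.
have crit := nehari_critical mO muO es C'0 nl' gneg gfib Gfib Nw wmin.
have [Xw nw Kw] := Nw; have dw := nehari_dpot es Nw.
exists w; split; [exact: Xw|exact: nw| |].
  by move=> phi Xphi; apply/eqP; rewrite -subr_eq0; apply/eqP; exact: crit.
move=> rad radw isol; split; [exact: Xw|exact: radw| | | | |exact: isol].
- by move=> u Xu u0 Ku; exact: (wmin u (And3 Xu u0 Ku)).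
- by move=> t t0 t1; exact: (Jf_fiber mO muO es C'0 nl' gneg Gfib Xw dw Kw t0 t1).
- by move=> t t0; exact: (Kf_fiber mO muO es C'0 nl' gneg gfib Xw dw Kw t0).
- by move=> M e e0; exact: (Kf_unif mO muO es C'0 nl' M e0).
Qed.

Lemma source0 w : S (cst 0) w = 0.
Proof.
rewrite /dpot; transitivity (\int[mu]_(x in Omega) (0 : R)); last by rewrite Rintegral_cst ?mul0r.
by apply: eq_Rintegral => x /set_mem Ox; rewrite /gplus maxxx (growth_at0 p1 pr g_growth Ox) mul0r.
Qed.

Lemma near_neq0 u w rad : X u -> X w -> rad < nm w -> nm (fun x => u x - w x) <= rad -> ~ {ae mu, forall x, u x = 0}.
Proof.
move=> Xu Xw radw uw u0; have n0 := fnorm_ae0 oO A Xu u0.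
have := es_nB es Xu (es_B es Xu Xw); rewrite n0 add0r.
rewrite (_ : (fun x => u x - (u x - w x)) = w); last by apply/funext => x; ring.
by move/(lt_le_trans radw); rewrite ltNge uw.
Qed.

(** As rad is below the norm of w, a critical point in the ball is nontrivial, hence positive by the
    maximum principle, hence equal to the unique positive solution u0. This applies to w as well, so
    both agree almost everywhere. *)
Lemma unique_isolated w rad : X w -> 0 <= rad -> rad < nm w -> (forall phi, X phi -> pl w phi = S w phi) ->
  unique_positive_solution Omega s p g -> exists u0, [/\ X u0, positive_ae Omega u0 &
  forall u, X u -> nm (fun x => u x - w x) <= rad -> (forall phi, X phi -> pl u phi - S u phi = 0) ->
    nm (fun x => u x - w x) = 0].
Proof.
move=> Xw rad0 radw wcrit [u0 [[Xu0 _ _] pu0 uniq]]; exists u0; split => //.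
have eq_u0 u : X u -> nm (fun x => u x - w x) <= rad -> (forall phi, X phi -> pl u phi = S u phi) ->
    {ae mu, forall x, u x = u0 x}.
  move=> Xu uw crit; have [sol up] := critical_solution Xu crit.
  have pu : positive_ae Omega u.
    apply: (positive_of_super oO bO A Xu (critical_nonneg Xu crit) (near_neq0 Xu Xw radw uw) Xu0 pu0).
    by move=> v Xv v0; rewrite crit//; exact: source_ge0.
  have /uniq : scalar_solution Omega s p g (fun x => Num.max 0 (u x)) by [].
  have ppu : positive_ae Omega (fun x => Num.max 0 (u x)).
    by apply: filterS pu => x Hx Ox; rewrite lt_max (Hx Ox) orbT.
  move=> /(_ ppu) E; apply: filterS2 up E => x Hx /(_ Logic.I) <-; by rewrite Hx.
move=> u Xu uw crit.
have crit' phi : X phi -> pl u phi = S u phi by move=> Xphi; apply/eqP; rewrite -subr_eq0 crit.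
apply: (fnorm_ae0 oO A (es_B es Xu Xw)).
have ww : nm (fun x => w x - w x) <= rad.
  have E : (fun x => w x - w x) = cst 0 by apply/funext => x; rewrite subrr.
  by rewrite E (es_n0 es).
by apply: filterS2 (eq_u0 u Xu uw crit') (eq_u0 w Xw ww wcrit) => x -> ->; rewrite subrr.
Qed.

End scalar_problem.

(** * The system *)

Section system.
Context {R : realType} {N : nat}.
Variable (Omega : set 'rV[R]_N).
Hypotheses (oO : open Omega) (bO : bounded_set Omega).
Local Notation mu := (lebesgue_rV R N).
Local Notation Rplus := [set t : R | 0 <= t].
Variables (s1 p1 r1 K1 s2 p2 r2 K2 : R) (g1 g2 : 'rV[R]_N -> R -> R).
Hypotheses (A1 : admissible (N := N) s1 p1 r1) (A2 : admissible (N := N) s2 p2 r2).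
Hypotheses (pr1 : p1 < r1) (pr2 : p2 < r2) (K10 : 0 <= K1) (K20 : 0 <= K2).
Hypothesis g1_meas : forall t, 0 <= t -> measurable_fun Omega (fun x => g1 x t).
Hypothesis g2_meas : forall t, 0 <= t -> measurable_fun Omega (fun x => g2 x t).
Hypothesis g1_cont : {within closure Omega `*` Rplus, continuous (fun z : 'rV[R]_N * R => g1 z.1 z.2)}.
Hypothesis g2_cont : {within closure Omega `*` Rplus, continuous (fun z : 'rV[R]_N * R => g2 z.1 z.2)}.
Hypothesis g1_ge0 : forall x t, Omega x -> 0 <= t -> 0 <= g1 x t.
Hypothesis g2_ge0 : forall x t, Omega x -> 0 <= t -> 0 <= g2 x t.
Hypothesis g1_growth : forall x u, Omega x -> 0 <= u -> `|g1 x u| <= K1 * (`|u| `^ (p1 - 1) + `|u| `^ (r1 - 1)).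
Hypothesis g2_growth : forall x u, Omega x -> 0 <= u -> `|g2 x u| <= K2 * (`|u| `^ (p2 - 1) + `|u| `^ (r2 - 1)).
Variables (f1 f2 F : 'rV[R]_N -> R -> R -> R) (q C : R).
Hypotheses (f1_ge0 : forall x u v, Omega x -> 0 <= u -> 0 <= v -> 0 <= f1 x u v)
  (f2_ge0 : forall x u v, Omega x -> 0 <= u -> 0 <= v -> 0 <= f2 x u v).
Hypothesis axes : forall x t, Omega x -> 0 <= t -> [/\ f1 x t 0 = 0, f1 x 0 t = 0, f2 x t 0 = 0 & f2 x 0 t = 0].
Local Notation "a ^+0" := (Num.max 0 a) (at level 2, format "a ^+0").
Hypotheses (C0 : 0 <= C) (nl : nonlinearity Omega r1 r2 C (fun x a b => F x a^+0 b^+0 - F x 0 0)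
  (fun x a b => f1 x a^+0 b^+0) (fun x a b => f2 x a^+0 b^+0)).
Local Notation X1 := (X0 Omega s1 p1).
Local Notation X2 := (X0 Omega s2 p2).
Local Notation pl1 := (frac_plap s1 p1).
Local Notation pl2 := (frac_plap s2 p2).
Local Notation S1 := (dpot mu Omega (gplus g1)).
Local Notation S2 := (dpot mu Omega (gplus g2)).
Local Notation DN := (dnem mu Omega (fun x a b => f1 x a^+0 b^+0) (fun x a b => f2 x a^+0 b^+0)).

#[local] Opaque X0 fnorm frac_plap.

Let mO : measurable Omega. Proof. exact: open_measurable_rV. Qed.
Let muO : (mu Omega < +oo)%E. Proof. exact: lebesgue_bounded_lty. Qed.
Let r10 : 0 < r1. Proof. exact: admissible_gt0 A1. Qed.
Let r20 : 0 < r2. Proof. exact: admissible_gt0 A2. Qed.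
Let es1 := X0_energy_space oO bO A1.
Let es2 := X0_energy_space oO bO A2.
Let p1_gt1 : 1 < p1. Proof. exact: es_p1 es1. Qed.
Let p2_gt1 : 1 < p2. Proof. exact: es_p1 es2. Qed.
Let m0 (a : R) : 0 <= a^+0. Proof. by rewrite le_max lexx. Qed.

Let cpl1 u v w := \int[mu]_(x in Omega) (f1 x (u x)^+0 (v x)^+0 * w x).
Let cpl2 u v z := \int[mu]_(x in Omega) (f2 x (u x)^+0 (v x)^+0 * z x).

Let int0 (h : 'rV[R]_N -> R) : (forall x, Omega x -> h x = 0) -> \int[mu]_(x in Omega) h x = 0.
Proof.
move=> h0; transitivity (\int[mu]_(x in Omega) (0 : R)); last by rewrite Rintegral_cst ?mul0r.
by apply: eq_Rintegral => x /set_mem; exact: h0.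
Qed.

Lemma coupling_integrable u v w z : X1 u -> X2 v -> X1 w -> X2 z ->
  mu.-integrable Omega (EFin \o (fun x => f1 x (u x)^+0 (v x)^+0 * w x)) /\
  mu.-integrable Omega (EFin \o (fun x => f2 x (u x)^+0 (v x)^+0 * z x)).
Proof.
move=> Xu Xv Xw Xz.
have du := X0_dom_cvg_cst oO bO A1 Xu; have dv := X0_dom_cvg_cst oO bO A2 Xv.
have dw := X0_dom_cvg_cst oO bO A1 Xw; have dz := X0_dom_cvg_cst oO bO A2 Xz.
have d01 := X0_dom_cvg_cst oO bO A1 (es_0 es1); have d02 := X0_dom_cvg_cst oO bO A2 (es_0 es2).
have [i1 _] := dnem_cvg mO muO r10 r20 C0 nl du dv dw d02.
have [i2 _] := dnem_cvg mO muO r10 r20 C0 nl du dv d01 dz.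
split; [apply: eq_integrable i1 => // x _ /=|apply: eq_integrable i2 => // x _ /=].
  by rewrite mulr0 addr0.
by rewrite mulr0 add0r.
Qed.

Let DN_split u v w z : X1 u -> X2 v -> X1 w -> X2 z -> DN u v w z = cpl1 u v w + cpl2 u v z.
Proof. by move=> Xu Xv Xw Xz; have [i1 i2] := coupling_integrable Xu Xv Xw Xz; exact: (RintegralD mO i1 i2). Qed.

Definition critical lam u v : Prop := [/\ X1 u, X2 v & forall w z, X1 w -> X2 z ->
  pl1 u w + pl2 v z = S1 u w + S2 v z + lam * DN u v w z].

Lemma critical_split lam u v : critical lam u v ->
  (forall w, X1 w -> pl1 u w = S1 u w + lam * cpl1 u v w) /\
  (forall z, X2 z -> pl2 v z = S2 v z + lam * cpl2 u v z).
Proof.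
move=> [Xu Xv crit].
have z1 : S1 u (cst 0) = 0 by apply: int0 => x _; rewrite mulr0.
have z2 : S2 v (cst 0) = 0 by apply: int0 => x _; rewrite mulr0.
have c1 : cpl1 u v (cst 0) = 0 by apply: int0 => x _; rewrite mulr0.
have c2 : cpl2 u v (cst 0) = 0 by apply: int0 => x _; rewrite mulr0.
split => [w Xw|z Xz].
  have := crit w _ Xw (es_0 es2); rewrite (DN_split Xu Xv Xw (es_0 es2)) (es_pl0 es2 Xv) z2 c2.
  by rewrite !addr0.
have := crit _ z (es_0 es1) Xz; rewrite (DN_split Xu Xv (es_0 es1) Xz) (es_pl0 es1 Xu) z1 c1.
by rewrite !add0r.
Qed.

(** Where u is negative, f1 is evaluated at first argument 0, on an axis, so the coupling does not
    see the negative part of u; likewise for v. *)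
Lemma critical_ge0 lam u v : critical lam u v -> nonneg_ae u /\ nonneg_ae v.
Proof.
move=> cr; have [c1 c2] := critical_split cr; have [Xu Xv _] := cr.
have [s101 _ spN1 _ _] := A1; have [s201 _ spN2 _ _] := A2.
have neg1 : cpl1 u v (neg_part u) = 0.
  apply: int0 => x Ox; rewrite /neg_part; case: (max0P (u x)) => -[-> ux].
    by rewrite [(- u x)^+0]max_l ?mulr0// oppr_le0.
  by have [_ -> _ _] := axes Ox (m0 (v x)); rewrite mul0r.
have neg2 : cpl2 u v (neg_part v) = 0.
  apply: int0 => x Ox; rewrite /neg_part; case: (max0P (v x)) => -[-> vx].
    by rewrite [(- v x)^+0]max_l ?mulr0// oppr_le0.
  by have [_ _ -> _] := axes Ox (m0 (u x)); rewrite mul0r.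
split.
  apply: (neg_part_test oO bO s101 p1_gt1 spN1 Xu).
  rewrite (c1 _ (X0_neg_part oO bO s101 p1_gt1 spN1 Xu)) neg1 mulr0 addr0.
  by rewrite (source_neg_part oO A1 pr1 g1_growth).
apply: (neg_part_test oO bO s201 p2_gt1 spN2 Xv).
rewrite (c2 _ (X0_neg_part oO bO s201 p2_gt1 spN2 Xv)) neg2 mulr0 addr0.
by rewrite (source_neg_part oO A2 pr2 g2_growth).
Qed.

Definition pos_pair (u v : 'rV[R]_N -> R) : ('rV[R]_N -> R) * ('rV[R]_N -> R) :=
  (fun x => (u x)^+0, fun x => (v x)^+0).

Lemma critical_system lam u v : critical lam u v ->
  system_solution Omega s1 s2 p1 p2 lam f1 f2 g1 g2 (pos_pair u v).
Proof.
move=> cr; have [c1 c2] := critical_split cr; have [Xu Xv _] := cr.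
have [/nonneg_pos_part up /nonneg_pos_part vp] := critical_ge0 cr.
have Xu' := X0_pos_part oO bO A1 Xu; have Xv' := X0_pos_part oO bO A2 Xv.
split; [exact: Xu'|exact: Xv'| | |].
- by apply: aeW => x; exact: m0.
- by apply: aeW => x; exact: m0.
move=> w z Xw Xz; have [i1 i2] := coupling_integrable Xu Xv Xw Xz.
have j1 := source_integrable oO bO A1 pr1 K10 g1_meas g1_cont g1_ge0 g1_growth Xu Xw.
have j2 := source_integrable oO bO A2 pr2 K20 g2_meas g2_cont g2_ge0 g2_growth Xv Xz.
rewrite (frac_plap_ae oO bO A1 Xu' Xu Xw up) (frac_plap_ae oO bO A2 Xv' Xv Xz vp) (c1 w Xw) (c2 z Xz).
congr (_ + _).
  rewrite /cpl1 -(RintegralZl lam mO i1) addrC -(RintegralD mO (integrable_RZ mO lam i1) j1).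
  by apply: eq_Rintegral => x _; rewrite mulrDl mulrA.
rewrite /cpl2 -(RintegralZl lam mO i2) addrC -(RintegralD mO (integrable_RZ mO lam i2) j2).
by apply: eq_Rintegral => x _; rewrite mulrDl mulrA.
Qed.

Let pl_0 (p r s : R) w : admissible (N := N) s p r -> X0 Omega s p w -> frac_plap s p (cst 0) w = 0.
Proof.
move=> A Xw; have es := X0_energy_space oO bO A.
have E : cst 0 = (fun x => 0 * cst 0 x) :> ('rV[R]_N -> R) by apply/funext => x; rewrite mul0r.
by rewrite E (es_plZl es (es_0 es) Xw (lexx 0)) powR0 ?mul0r// gt_eqF// subr_gt0 (es_p1 es).
Qed.

Lemma critical00 lam : critical lam (cst 0) (cst 0).
Proof.
split; [exact: es_0 es1|exact: es_0 es2|] => w z Xw Xz.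
rewrite (pl_0 A1 Xw) (pl_0 A2 Xz) (source0 oO A1 pr1 g1_growth) (source0 oO A2 pr2 g2_growth).
rewrite /dnem int0 ?mulr0 ?addr0// => x Ox; rewrite maxxx.
by have [-> _ -> _] := axes Ox (lexx 0); rewrite !mul0r addr0.
Qed.

Lemma critical_left lam u : X1 u -> (forall w, X1 w -> pl1 u w = S1 u w) -> critical lam u (cst 0).
Proof.
move=> Xu c; split; [exact: Xu|exact: es_0 es2|] => w z Xw Xz.
rewrite (pl_0 A2 Xz) (source0 oO A2 pr2 g2_growth) (c w Xw).
rewrite /dnem int0 ?mulr0 ?addr0// => x Ox; rewrite maxxx.
by have [-> _ -> _] := axes Ox (m0 (u x)); rewrite !mul0r addr0.
Qed.

Lemma critical_right lam v : X2 v -> (forall w, X2 w -> pl2 v w = S2 v w) -> critical lam (cst 0) v.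
Proof.
move=> Xv c; split; [exact: es_0 es1|exact: Xv|] => w z Xw Xz.
rewrite (pl_0 A1 Xw) (source0 oO A1 pr1 g1_growth) (c z Xz).
rewrite /dnem int0 ?mulr0 ?addr0// => x Ox; rewrite maxxx.
by have [_ -> _ ->] := axes Ox (m0 (v x)); rewrite !mul0r addr0.
Qed.

Lemma critical_positive lam u v u0 v0 : 0 <= lam -> critical lam u v ->
  ~ {ae mu, forall x, u x = 0} -> ~ {ae mu, forall x, v x = 0} ->
  X1 u0 -> positive_ae Omega u0 -> X2 v0 -> positive_ae Omega v0 ->
  positive_ae Omega u /\ positive_ae Omega v.
Proof.
move=> lam0 cr un0 vn0 Xu0 pu0 Xv0 pv0; have [c1 c2] := critical_split cr; have [Xu Xv _] := cr.
have [u_ge0 v_ge0] := critical_ge0 cr; split.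
  apply: (positive_of_super oO bO A1 Xu u_ge0 un0 Xu0 pu0) => w Xw w0; rewrite (c1 w Xw).
  apply: addr_ge0; first exact: (source_ge0 g1_ge0).
  by apply: mulr_ge0 => //; apply: Rintegral_ge0 => x Ox; rewrite mulr_ge0// f1_ge0.
apply: (positive_of_super oO bO A2 Xv v_ge0 vn0 Xv0 pv0) => w Xw w0; rewrite (c2 w Xw).
apply: addr_ge0; first exact: (source_ge0 g2_ge0).
by apply: mulr_ge0 => //; apply: Rintegral_ge0 => x Ox; rewrite mulr_ge0// f2_ge0.
Qed.

End system.

Lemma powR_between (R : realType) (x b c d : R) : 0 <= x -> 0 < b -> b <= c -> c <= d -> x `^ c <= x `^ b + x `^ d.
Proof.
move=> x0 b0 bc cd; have [->|xn0] := eqVneq x 0.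
  by rewrite [leLHS]powR0 ?addr_ge0 ?powR_ge0// gt_eqF// (lt_le_trans b0).
have xp : 0 < x by rewrite lt_neqAle eq_sym xn0.
have [x1|/ltW x1] := leP x 1.
  apply: le_trans (_ : x `^ b <= _); last by rewrite lerDl powR_ge0.
  by apply: ger_powR => //; rewrite xp.
apply: le_trans (_ : x `^ d <= _); last by rewrite lerDr powR_ge0.
exact: ler_powR.
Qed.

Lemma growth_weaken (R : realType) (y x K p q r : R) : 1 < p -> p < q -> q <= r -> 0 <= K ->
  `|y| <= K * (`|x| `^ (p - 1) + `|x| `^ (q - 1)) -> `|y| <= 2 * K * (`|x| `^ (p - 1) + `|x| `^ (r - 1)).
Proof.
move=> p1 pq qr K0 /le_trans; apply; rewrite [2 * K]mulrC -mulrA ler_wpM2l//.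
have [b0 bc cd] : [/\ 0 < p - 1, p - 1 <= q - 1 & q - 1 <= r - 1] by split; lra.
by have := powR_between (normr_ge0 x) b0 bc cd; have := powR_ge0 `|x| (r - 1); lra.
Qed.

Lemma admissible_max (R : realType) (N : nat) (s p t q : R) : 0 < s < 1 -> 1 < p < N%:R / s ->
  p < t < sobolev_exponent (N := N) s p -> q < sobolev_exponent (N := N) s p ->
  admissible (N := N) s p (Num.max t q).
Proof.
move=> s01 /andP[p1 pN] /andP[pt tS] qS; have /andP[s0 _] := s01; split => //.
- by rewrite mulrC -ltr_pdivlMr.
- by rewrite le_max (ltW pt).
- by rewrite gt_max tS.
Qed.

Lemma below_both (R : realFieldType) (a b : R) : 0 < a -> 0 < b -> exists r : R, [/\ 0 < r, r < a & r < b].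
Proof.
by move=> a0 b0; exists (Num.min a b / 2); have := lt_min 0 a b; rewrite a0 b0; split; case: (leP a b) => ?; lra.
Qed.

#[local] Opaque X0 fnorm frac_plap.

Theorem theorem2p2 (R : realType) (N : nat) (Omega : set 'rV[R]_N)
    (s1 s2 p1 p2 : R)
    (f1 f2 : 'rV[R]_N -> R -> R -> R) (g1 g2 : 'rV[R]_N -> R -> R)
    (q1 q2 Cg1 Cg2 alpha1 alpha2 q C3 beta1 beta2 C4 R0 : R)
    (Omega_smooth : smooth_bounded_domain Omega)
    (s1_01 : 0 < s1 < 1) (s2_01 : 0 < s2 < 1)
    (p1_range : 1 < p1 < N%:R / s1) (p2_range : 1 < p2 < N%:R / s2)
    (f1_ge0 : forall x u v, Omega x -> 0 <= u -> 0 <= v -> 0 <= f1 x u v)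
    (f2_ge0 : forall x u v, Omega x -> 0 <= u -> 0 <= v -> 0 <= f2 x u v)
    (g1_ge0 : forall x u, Omega x -> 0 <= u -> 0 <= g1 x u)
    (g2_ge0 : forall x u, Omega x -> 0 <= u -> 0 <= g2 x u)
    (f1_cara : caratheodory2 Omega f1) (f2_cara : caratheodory2 Omega f2)
    (g1_cara : caratheodory1 Omega g1) (g2_cara : caratheodory1 Omega g2)
    (A1 : exists F : 'rV[R]_N -> R -> R -> R, C1_regular Omega F /\
       forall x u v, Omega x -> 0 <= u -> 0 <= v ->
         deriv_Rplus (fun t => F x t v) u (f1 x u v) /\
         deriv_Rplus (fun t => F x u t) v (f2 x u v))
    (A2_cont1 : {within closure Omega `*` [set t : R | 0 <= t],
       continuous (fun z : 'rV[R]_N * R => g1 z.1 z.2)})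
    (A2_cont2 : {within closure Omega `*` [set t : R | 0 <= t],
       continuous (fun z : 'rV[R]_N * R => g2 z.1 z.2)})
    (A2_ge01 : forall x u, closure Omega x -> 0 <= u -> 0 <= g1 x u)
    (A2_ge02 : forall x u, closure Omega x -> 0 <= u -> 0 <= g2 x u)
    (A2_q1 : p1 < q1 < sobolev_exponent (N := N) s1 p1)
    (A2_q2 : p2 < q2 < sobolev_exponent (N := N) s2 p2)
    (A2_C1 : 0 < Cg1) (A2_C2 : 0 < Cg2)
    (A2_growth1 : forall x u, Omega x -> 0 <= u ->
       `|g1 x u| <= Cg1 * (`|u| `^ (p1 - 1) + `|u| `^ (q1 - 1)))
    (A2_growth2 : forall x u, Omega x -> 0 <= u ->
       `|g2 x u| <= Cg2 * (`|u| `^ (p2 - 1) + `|u| `^ (q2 - 1)))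
    (A3_alpha1 : Num.max p1 p2 < alpha1) (A3_alpha2 : Num.max p1 p2 < alpha2)
    (A3_1 : forall x u, Omega x -> 0 < u ->
       0 < alpha1 * primitive g1 x u <= u * g1 x u)
    (A3_2 : forall x u, Omega x -> 0 < u ->
       0 < alpha2 * primitive g2 x u <= u * g2 x u)
    (A4_1 : (limsup0 Omega g1 p1 < lambda1 Omega s1 p1)%E)
    (A4_2 : (limsup0 Omega g2 p2 < lambda1 Omega s2 p2)%E)
    (A5_1 : forall x u u', Omega x -> 0 < u -> u < u' ->
       g1 x u / u `^ (p1 - 1) < g1 x u' / u' `^ (p1 - 1))
    (A5_2 : forall x u u', Omega x -> 0 < u -> u < u' ->
       g2 x u / u `^ (p2 - 1) < g2 x u' / u' `^ (p2 - 1))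
    (A6_q : 1 < q < Num.min (sobolev_exponent (N := N) s1 p1)
                            (sobolev_exponent (N := N) s2 p2))
    (A6_C3 : 0 < C3)
    (A6 : forall x u v, Omega x -> 0 <= u -> 0 <= v ->
       `|f1 x u v| + `|f2 x u v| <= C3 * (`|u| `^ (q - 1) + `|v| `^ (q - 1) + 1))
    (A7_beta1 : 1 < beta1 < Num.min alpha1 alpha2)
    (A7_beta2 : 1 < beta2 < Num.min alpha1 alpha2)
    (A7_C4 : 0 < C4) (A7_R : 0 < R0)
    (A7 : forall x u v, Omega x -> 0 <= u -> 0 <= v -> R0 <= `|u| + `|v| ->
       u * f1 x u v + v * f2 x u v <= C4 * (`|u| `^ beta1 + `|v| `^ beta2))
    (f1_axes : {ae lebesgue_rV R N, forall x, Omega x ->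
       forall u v, 0 <= u -> 0 <= v -> f1 x u 0 = 0 /\ f1 x 0 v = 0})
    (f2_axes : {ae lebesgue_rV R N, forall x, Omega x ->
       forall u v, 0 <= u -> 0 <= v -> f2 x u 0 = 0 /\ f2 x 0 v = 0}) :
  exists2 Lambda : R, 0 < Lambda &
    (forall lam, 0 < lam < Lambda ->
       exists a b c,
         [/\ system_solution Omega s1 s2 p1 p2 lam f1 f2 g1 g2 a,
             system_solution Omega s1 s2 p1 p2 lam f1 f2 g1 g2 b,
             system_solution Omega s1 s2 p1 p2 lam f1 f2 g1 g2 c &
             pairwise_distinct3 a b c]) /\
    (unique_positive_solution Omega s1 p1 g1 ->
     unique_positive_solution Omega s2 p2 g2 ->
     forall lam, 0 < lam < Lambda ->
       exists a b c,
         [/\ system_solution Omega s1 s2 p1 p2 lam f1 f2 g1 g2 a,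
             system_solution Omega s1 s2 p1 p2 lam f1 f2 g1 g2 b,
             system_solution Omega s1 s2 p1 p2 lam f1 f2 g1 g2 c,
             pairwise_distinct3 a b c &
             [/\ positive_ae Omega c.1, positive_ae Omega c.2 &
                 ~ eq_ae2 c (cst 0, cst 0)]]).
Proof.
case: Omega_smooth => neO oO _ bO _.
have [F [FC1 dF]] := A1; have /andP[q_gt1] := A6_q; rewrite lt_min => /andP[qS1 qS2].
have ad1 := admissible_max s1_01 p1_range A2_q1 qS1; have ad2 := admissible_max s2_01 p2_range A2_q2 qS2.
have /andP[p1_gt1 _] := p1_range; have /andP[p2_gt1 _] := p2_range.
have /andP[pq1 _] := A2_q1; have /andP[pq2 _] := A2_q2.
(* A single exponent per component serves both for its source and for the coupling, and stays
   subcritical. *)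
set r1 := Num.max q1 q in ad1; set r2 := Num.max q2 q in ad2.
have qr1 : q <= r1 by rewrite le_max lexx orbT.
have qr2 : q <= r2 by rewrite le_max lexx orbT.
have pr1 : p1 < r1 by rewrite lt_max pq1.
have pr2 : p2 < r2 by rewrite lt_max pq2.
have K10 : 0 <= 2 * Cg1 by rewrite mulr_ge0// ltW.
have K20 : 0 <= 2 * Cg2 by rewrite mulr_ge0// ltW.
have gr1 x u : Omega x -> 0 <= u -> `|g1 x u| <= 2 * Cg1 * (`|u| `^ (p1 - 1) + `|u| `^ (r1 - 1)).
  move=> Ox u0; apply: (growth_weaken p1_gt1 pq1 _ (ltW A2_C1) (A2_growth1 x u Ox u0)).
  by rewrite le_max lexx.
have gr2 x u : Omega x -> 0 <= u -> `|g2 x u| <= 2 * Cg2 * (`|u| `^ (p2 - 1) + `|u| `^ (r2 - 1)).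
  move=> Ox u0; apply: (growth_weaken p2_gt1 pq2 _ (ltW A2_C2) (A2_growth2 x u Ox u0)).
  by rewrite le_max lexx.
have [m1 _] := g1_cara; have [m2 _] := g2_cara.
have pa1 : p1 < alpha1 by move: A3_alpha1; rewrite gt_max => /andP[].
have pa2 : p2 < alpha2 by move: A3_alpha2; rewrite gt_max => /andP[].
have axes := @axes0 R N Omega oO f1 f2 F FC1 dF f1_axes f2_axes.
have nl := coupling_nonlinearity oO FC1 dF (ltW q_gt1) (ltW A6_C3) A6 f1_axes f2_axes qr1 qr2.
have C0 : 0 <= 4 * (10 * C3) by rewrite !mulr_ge0// ltW.
have [w1 [Xw1 nw1 crit1 gs1]] := ground_state_exists oO bO neO ad1 pr1 pa1 K10 m1 A2_cont1 g1_ge0 gr1 A3_1 A4_1 A5_1.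
have [w2 [Xw2 nw2 crit2 gs2]] := ground_state_exists oO bO neO ad2 pr2 pa2 K20 m2 A2_cont2 g2_ge0 gr2 A3_2 A4_2 A5_2.
have es1 := X0_energy_space oO bO ad1; have es2 := X0_energy_space oO bO ad2.
have w1n0 : ~ {ae lebesgue_rV R N, forall x, w1 x = 0}.
  by move=> /(fnorm_ae0 oO ad1 Xw1) H; move: nw1; rewrite H ltxx.
have w2n0 : ~ {ae lebesgue_rV R N, forall x, w2 x = 0}.
  by move=> /(fnorm_ae0 oO ad2 Xw2) H; move: nw2; rewrite H ltxx.
pose cr := critical Omega s1 p1 s2 p2 g1 g2 f1 f2.
have sol lam u v : cr lam u v -> system_solution Omega s1 s2 p1 p2 lam f1 f2 g1 g2 (pos_pair u v).
  exact: (critical_system oO bO ad1 ad2 pr1 pr2 K10 K20 m1 m2 A2_cont1 A2_cont2 g1_ge0 g2_ge0 gr1 gr2 axes C0 nl).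
have eqE lam u v u' v' : cr lam u v -> cr lam u' v' -> eq_ae2 (pos_pair u v) (pos_pair u' v') ->
    {ae lebesgue_rV R N, forall x, u x = u' x} /\ {ae lebesgue_rV R N, forall x, v x = v' x}.
  move=> c c' [e1 e2].
  have [/nonneg_pos_part a1 /nonneg_pos_part a2] := critical_ge0 oO bO ad1 ad2 pr1 pr2 gr1 gr2 axes C0 nl c.
  have [/nonneg_pos_part b1 /nonneg_pos_part b2] := critical_ge0 oO bO ad1 ad2 pr1 pr2 gr1 gr2 axes C0 nl c'.
  split.
    by apply: filterS3 a1 b1 e1 => x E E' /(_ Logic.I) /=; rewrite E E'.
  by apply: filterS3 a2 b2 e2 => x E E' /(_ Logic.I) /=; rewrite E E'.
have c0 lam : cr lam (cst 0) (cst 0) := critical00 oO bO ad1 ad2 pr1 pr2 gr1 gr2 axes lam.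
have c1 lam : cr lam w1 (cst 0) := critical_left oO bO ad2 pr2 gr2 axes lam Xw1 crit1.
have c2 lam : cr lam (cst 0) w2 := critical_right oO bO ad1 pr1 gr1 axes lam Xw2 crit2.
have sym0 (w : 'rV[R]_N -> R) : {ae lebesgue_rV R N, forall x, cst 0 x = w x} -> {ae lebesgue_rV R N, forall x, w x = 0}.
  by apply: filterS => x <-.
have part1 lam : exists a b c, [/\ system_solution Omega s1 s2 p1 p2 lam f1 f2 g1 g2 a,
    system_solution Omega s1 s2 p1 p2 lam f1 f2 g1 g2 b,
    system_solution Omega s1 s2 p1 p2 lam f1 f2 g1 g2 c & pairwise_distinct3 a b c].
  exists (pos_pair (cst 0) (cst 0)), (pos_pair w1 (cst 0)), (pos_pair (cst 0) w2).
  split; [exact: sol (c0 lam)|exact: sol (c1 lam)|exact: sol (c2 lam)|split].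
  - by move=> /(eqE _ _ _ _ _ (c0 lam) (c1 lam))[/sym0].
  - by move=> /(eqE _ _ _ _ _ (c0 lam) (c2 lam))[_ /sym0].
  - by move=> /(eqE _ _ _ _ _ (c1 lam) (c2 lam))[].
(* The threshold is chosen after deciding uniqueness. If it fails, the second claim is void and any
   threshold works, the three solutions of [part1] existing for every lambda. *)
have [[u1 u2]|nU] := pselect (unique_positive_solution Omega s1 p1 g1 /\ unique_positive_solution Omega s2 p2 g2);
  last first.
  exists 1; first exact: ltr01.
  by split=> [lam _|U1 U2 lam _]; [exact: part1|case: (nU (conj U1 U2))].
have [rad [rad0 rw1 rw2]] := below_both nw1 nw2.
have [u01 [Xu01 pu01 iso1]] := unique_isolated oO bO ad1 pr1 g1_ge0 gr1 Xw1 (ltW rad0) rw1 crit1 u1.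
have [u02 [Xu02 pu02 iso2]] := unique_isolated oO bO ad2 pr2 g2_ge0 gr2 Xw2 (ltW rad0) rw2 crit2 u2.
have mO := open_measurable_rV oO; have muO := lebesgue_bounded_lty oO bO.
have r10 := admissible_gt0 ad1; have r20 := admissible_gt0 ad2.
have [Lam Lam0 third] := third_critical_point mO es1 es2
  (source_compact oO bO ad1 pr1 K10 m1 A2_cont1 g1_ge0 gr1) (source_compact oO bO ad2 pr2 K20 m2 A2_cont2 g2_ge0 gr2)
  (gs1 rad rw1 iso1) (gs2 rad rw2 iso2) rad0 (nem_compact mO muO r10 r20 C0 nl).
exists Lam; first exact: Lam0.
split=> [lam _|_ _ lam lam_range]; first exact: part1.
have /andP[lam0 _] := lam_range; have [u [v [Xu Xv uv crit]]] := third lam lam_range.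
have c3 : cr lam u v by split; [exact: Xu|exact: Xv|exact: crit].
have n1 := es_ge0 es1 (fun x => u x - w1 x); have n2 := es_ge0 es2 (fun x => v x - w2 x).
have [nu nv] : fnorm s1 p1 (fun x => u x - w1 x) <= rad /\ fnorm s2 p2 (fun x => v x - w2 x) <= rad.
  exact (addr_le_both n1 n2 uv).
have un0 := near_neq0 oO bO ad1 Xu Xw1 rw1 nu; have vn0 := near_neq0 oO bO ad2 Xv Xw2 rw2 nv.
have [pu pv] := critical_positive oO bO ad1 ad2 pr1 pr2 g1_ge0 g2_ge0 gr1 gr2 f1_ge0 f2_ge0 axes C0 nl
  (ltW lam0) c3 un0 vn0 Xu01 pu01 Xu02 pu02.
have ppos (w : 'rV[R]_N -> R) : positive_ae Omega w -> positive_ae Omega (fun x => Num.max 0 (w x)).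
  by apply: filterS => x Hx Ox; rewrite lt_max (Hx Ox) orbT.
have pos00 : pos_pair (cst 0) (cst 0) = (cst 0, cst 0) :> ('rV[R]_N -> R) * ('rV[R]_N -> R).
  by congr (_, _); apply/funext => x; rewrite maxxx.
have ne0 : ~ eq_ae2 (pos_pair (cst 0) (cst 0)) (pos_pair u v).
  by move=> /(eqE _ _ _ _ _ (c0 lam) c3)[/sym0].
(* The positive pair joins (0, 0) and (w1, 0), from which its nontrivial second component separates
   it. *)
exists (pos_pair (cst 0) (cst 0)), (pos_pair w1 (cst 0)), (pos_pair u v).
split; [exact: sol (c0 lam)|exact: sol (c1 lam)|exact: sol c3|split|split].
- by move=> /(eqE _ _ _ _ _ (c0 lam) (c1 lam))[/sym0].
- exact: ne0.
- by move=> /(eqE _ _ _ _ _ (c1 lam) c3)[_ /sym0].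
- exact: ppos pu.
- exact: ppos pv.
- rewrite -pos00 => /(eqE _ _ _ _ _ c3 (c0 lam))[u_eq0 _]; exact: un0 u_eq0.
Qed.
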